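(* Exact-Tri and \#Exact-Tri are equivalent under truly subcubic fine-grained reductions: Exact-Tri on $n$-node graphs has an $O(n^{3-\varepsilon})$-time algorithm for some $\varepsilon>0$ iff \#Exact-Tri on $n$-node graphs has an $O(n^{3-\varepsilon'})$-time algorithm for some $\varepsilon'>0$.
   Context: Word-RAM model with $O(\log n)$-bit words; edge weights are $O(\log n)$-bit integers. Exact-Tri: given an edge-weighted $n$-node graph $G$ and a target $t$, decide whether $G$ contains a triangle whose edge weights sum to $t$. \#Exact-Tri: count the number of such triangles. *)

(* Defs.v *)
From Stdlib Require Import ZArith List Reals Arith.
Import ListNotations.
Open Scope Z_scope.

Definition memory := nat -> Z.

Definition upd (m : memory) (a : nat) (v : Z) : memory :=
  fun i => if Nat.eqb i a then v else m i.

(* Word size w bits: every computed value is reduced to the two's-complement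
   range [-2^(w-1), 2^(w-1)). *)
Definition wrap (w : nat) (z : Z) : Z :=
  let md := 2 ^ Z.of_nat w in ((z + md / 2) mod md) - md / 2.

(* Instructions; operands are (direct) cell addresses, jump targets are
   program positions.  Load/Store use indirect addressing. *)
Inductive instr : Type :=
| IConst (d : nat) (z : Z)
| IAdd (d a b : nat)
| ISub (d a b : nat)
| IMul (d a b : nat)
| IDiv (d a b : nat)                 (* floor division; x / 0 = 0 *)
| IMod (d a b : nat)
| IAnd (d a b : nat)
| IOr  (d a b : nat)
| IXor (d a b : nat)
| IShr (d a b : nat)
| ILt  (d a b : nat)
| IEq  (d a b : nat)
| ILoad (d a : nat)
| IStore (a s : nat)
| IJz (a : nat) (l : nat)
| IJmp (l : nat)
| IHalt.

Definition program := list instr.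

Definition binop (w : nat) (f : Z -> Z -> Z) (m : memory) (d a b : nat) : memory :=
  upd m d (wrap w (f (m a) (m b))).

Fixpoint exec (P : program) (w : nat) (fuel : nat) (pc : nat) (m : memory)
  : option memory :=
  match fuel with
  | O => None
  | S fuel' =>
    match nth_error P pc with
    | None => Some m
    | Some i =>
      match i with
      | IHalt => Some m
      | IConst d z => exec P w fuel' (S pc) (upd m d (wrap w z))
      | IAdd d a b => exec P w fuel' (S pc) (binop w Z.add m d a b)
      | ISub d a b => exec P w fuel' (S pc) (binop w Z.sub m d a b)
      | IMul d a b => exec P w fuel' (S pc) (binop w Z.mul m d a b)
      | IDiv d a b => exec P w fuel' (S pc) (binop w Z.div m d a b)
      | IMod d a b => exec P w fuel' (S pc) (binop w Z.modulo m d a b)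
      | IAnd d a b => exec P w fuel' (S pc) (binop w Z.land m d a b)
      | IOr d a b => exec P w fuel' (S pc) (binop w Z.lor m d a b)
      | IXor d a b => exec P w fuel' (S pc) (binop w Z.lxor m d a b)
      | IShr d a b => exec P w fuel' (S pc) (binop w Z.shiftr m d a b)
      | ILt d a b => exec P w fuel' (S pc)
                       (upd m d (if Z.ltb (m a) (m b) then 1 else 0))
      | IEq d a b => exec P w fuel' (S pc)
                       (upd m d (if Z.eqb (m a) (m b) then 1 else 0))
      | ILoad d a => exec P w fuel' (S pc) (upd m d (m (Z.to_nat (m a))))
      | IStore a s => exec P w fuel' (S pc) (upd m (Z.to_nat (m a)) (m s))
      | IJz a l => if Z.eqb (m a) 0 then exec P w fuel' l m
                   else exec P w fuel' (S pc) m
      | IJmp l => exec P w fuel' l m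
      end
    end
  end.

(* Word size Theta(log n): k * (floor(log2 n) + 1) bits, k a constant of the
   algorithm. *)
Definition word_size (k n : nat) : nat := (k * (Nat.log2 n + 1))%nat.

Record wgraph := WGraph {
  gn  : nat;                    (* nodes 0 .. gn-1 *)
  gadj : nat -> nat -> bool;
  gwt : nat -> nat -> Z
}.

Definition wf_graph (G : wgraph) : Prop :=
  (forall i j, (i < gn G)%nat -> (j < gn G)%nat ->
     gadj G i j = gadj G j i /\ gwt G i j = gwt G j i) /\
  (forall i, (i < gn G)%nat -> gadj G i i = false).

(* O(log n)-bit weights: all edge weights and the target bounded by n^c *)
Definition weights_bounded (c : nat) (G : wgraph) (t : Z) : Prop :=
  (forall i j, (i < gn G)%nat -> (j < gn G)%nat -> gadj G i j = true ->
     Z.abs (gwt G i j) <= Z.of_nat (gn G ^ c)) /\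
  Z.abs t <= Z.of_nat (gn G ^ c).

Definition is_exact_tri (G : wgraph) (t : Z) (i j k : nat) : Prop :=
  (i < j)%nat /\ (j < k)%nat /\ (k < gn G)%nat /\
  gadj G i j = true /\ gadj G j k = true /\ gadj G i k = true /\
  gwt G i j + gwt G j k + gwt G i k = t.

Definition is_exact_trib (G : wgraph) (t : Z) (x : nat * nat * nat) : bool :=
  let '(i, j, k) := x in
  Nat.ltb i j && Nat.ltb j k && Nat.ltb k (gn G) &&
  gadj G i j && gadj G j k && gadj G i k &&
  Z.eqb (gwt G i j + gwt G j k + gwt G i k) t.

Definition all_triples (n : nat) : list (nat * nat * nat) :=
  flat_map (fun i => flat_map (fun j => map (fun k => (i, j, k)) (seq 0 n))
                              (seq 0 n)) (seq 0 n).

Definition has_exact_tri (G : wgraph) (t : Z) : Prop :=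
  exists i j k, is_exact_tri G t i j k.

(* #Exact-Tri: number of triangles (as unordered vertex sets) of weight t *)
Definition count_exact_tri (G : wgraph) (t : Z) : nat :=
  length (filter (is_exact_trib G t) (all_triples (gn G))).

(* Input encoding: m[0] = n, m[1] = t, and for i, j < n,
   m[2 + 2(i n + j)] = 1 if {i,j} is an edge (else 0),
   m[3 + 2(i n + j)] = weight of {i,j} if it is an edge (else 0);
   all other cells are 0. *)
Definition input_mem (G : wgraph) (t : Z) : memory :=
  fun a =>
    let n := gn G in
    match a with
    | O => Z.of_nat n
    | S O => t
    | S (S b) =>
      let p := Nat.div b 2 in
      let i := Nat.div p n in
      let j := Nat.modulo p n in
      if Nat.ltb p (n * n) then
        if gadj G i j then (if Nat.even b then 1 else gwt G i j) else 0
      else 0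
    end.

Open Scope R_scope.

Definition ExactTri_truly_subcubic : Prop :=
  forall c : nat, exists eps : R, 0 < eps /\
  exists (k : nat) (P : program) (C : R),
    forall (G : wgraph) (t : Z), wf_graph G -> weights_bounded c G t ->
      exists (T : nat) (m : memory),
        exec P (word_size k (gn G)) T 0%nat (input_mem G t) = Some m /\
        INR T <= C * Rpower (INR (gn G)) (3 - eps) /\
        (m 0%nat <> 0%Z <-> has_exact_tri G t).

Definition CountExactTri_truly_subcubic : Prop :=
  forall c : nat, exists eps : R, 0 < eps /\
  exists (k : nat) (P : program) (C : R),
    forall (G : wgraph) (t : Z), wf_graph G -> weights_bounded c G t ->
      exists (T : nat) (m : memory),
        exec P (word_size k (gn G)) T 0%nat (input_mem G t) = Some m /\
        INR T <= C * Rpower (INR (gn G)) (3 - eps) /\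
        m 0%nat = Z.of_nat (count_exact_tri G t).

(* Main.v *)
Require Import Defs.
From Stdlib Require Import ZArith List Reals Lia Lra Arith Bool.
Import ListNotations.
Open Scope Z_scope.

(** A count decides existence.  Conversely, pad the graph to [N = B^q] nodes and cut them into blocks
    of [B]; for every pair [(i, j)] one counts the middle nodes [k] with
    [W_ik + W_kj + W_ij = t].  The blocks [K] of middle nodes are treated in turn.  The decision program
    is run on every tripartite graph [I, K, J] of [3B] nodes, from which the pairs already settled are
    removed; this costs [(N/B)^3 B^(3-eps)] in all.  If fewer than [M = N^2/B^3] block pairs [(I, J)]
    contain a solution, they are searched by brute force, in time [N^2].  Otherwise every [p] in [K] is a
    pivot, and the pairs [(i, j)] forming an exact triangle with [p] are settled by Fredman's trick:
    [W_ik + W_kj = t - W_ij] iff [W_ik - W_ip = W_pj - W_kj], so that the count of [(i, j)] is an entry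
    of an equality product.  Each such block settles [M] new pairs, hence there are at most [B^4] pivots.
    In an equality product, classes of fewer than [N/B^5] rows are enumerated, and the at most [B^5]
    others of each column are handled by [B^5] matrix products through a tensor power of Strassen's
    algorithm.

    The algorithm is written in a for-loop language whose arrays are cleared in constant time.  A
    stratification of its variables bounds all values polynomially, so that it compiles to words of
    [O(log n)] bits; the decision program is interpreted with its own word size. *)

(** * A for-loop language *)

(** The exponents follow from one budget. A block turns to pivots at most N^2/M = B^3 times, which
    makes B^4 pivots; to save a factor B in the end, an equality product may cost only about
    N^3/B^5. This dictates N/B^5 as the size from which a class is heavy, and the B^5 matrix
    products left per pivot may cost N^3/B^10 each. With Strassen's identity on B^a by B^a blocks, B
    = 2^e, there are 7^(ae) block products instead of 8^(ae), and the ratio reaches B^10 = 2^(10e)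
    once 7^a 2^10 <= 8^a; a = 52 is the least such exponent. Forming the combinations of blocks
    entry by entry costs 7^(ae) N^2, which is affordable since q = 3a + 10 puts B^(3a) below N.

    The decision program saves only about Y = B^(1/r) with 1/r <= eps. As Y^(rq) > n, the final
    saving is n^(1/(rq)).

    The small instances inherit weights up to n^c, too large for exponent c at their own size. But n
    < B^q with q constant, so the decision program for the exponent qc applies; the quantifier over
    all exponents in the assumption makes this possible. *)

Inductive op := OAdd | OSub | OMul | ODiv | OMod | OClamp | OAnd | OOr | OXor
  | OShr | OLt | OEq | OPair.

Definition zig (z : Z) : Z := if z <? 0 then - 2 * z - 1 else 2 * z.

(** Injective because, with [s] the sum of the two codes, the value lies between [s^2] and
    [s^2 + s], below the next square. It is polynomial and needs no division, so that a few
    instructions compute addresses with it. *)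
Definition pairZ (a b : Z) : Z := (zig a + zig b) * (zig a + zig b) + zig b.

Lemma zig_nonneg z : 0 <= zig z.
Proof. unfold zig. destruct (Z.ltb_spec z 0); lia. Qed.

Lemma zig_inj a b : zig a = zig b -> a = b.
Proof. unfold zig. destruct (Z.ltb_spec a 0), (Z.ltb_spec b 0); lia. Qed.

Lemma pairZ_nonneg a b : 0 <= pairZ a b.
Proof. unfold pairZ. pose proof (zig_nonneg a). pose proof (zig_nonneg b). nia. Qed.

Lemma pairZ_inj a b c d : pairZ a b = pairZ c d -> a = c /\ b = d.
Proof.
  unfold pairZ. pose proof (zig_nonneg a). pose proof (zig_nonneg b).
  pose proof (zig_nonneg c). pose proof (zig_nonneg d). intros E.
  assert (zig a + zig b = zig c + zig d) by nia.
  assert (zig b = zig d) by nia.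
  split; apply zig_inj; lia.
Qed.

Lemma pairZ_eqb a b c d : (pairZ a b =? pairZ c d) = ((a =? c) && (b =? d))%bool.
Proof.
  destruct (Z.eqb_spec (pairZ a b) (pairZ c d)) as [E|E].
  - apply pairZ_inj in E. destruct E; subst. now rewrite !Z.eqb_refl.
  - destruct (Z.eqb_spec a c), (Z.eqb_spec b d); try reflexivity. subst. easy.
Qed.

(* [OClamp] leaves [a] unchanged when [0 <= a <= b^2] and makes the bound visible in the syntax. *)
Definition opsem (o : op) (a b : Z) : Z :=
  match o with
  | OAdd => a + b | OSub => a - b | OMul => a * b | ODiv => a / b
  | OMod => a mod b | OClamp => a mod (b * b + 1)
  | OAnd => Z.land a b | OOr => Z.lor a b | OXor => Z.lxor a b
  | OShr => Z.shiftr a (Z.max 0 b)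
  | OLt => if a <? b then 1 else 0
  | OEq => if a =? b then 1 else 0
  | OPair => pairZ a b
  end.

Inductive expr :=
| Cst (z : Z)
| Get (a : nat) (e : expr)
| Bin (o : op) (e1 e2 : expr).

(* Array identifier, index, value; scalars live at index 0. *)
Definition state := nat -> Z -> Z.

Definition set (s : state) (a : nat) (z v : Z) : state :=
  fun b y => if (Nat.eqb b a && Z.eqb y z)%bool then v else s b y.

Definition clr (s : state) (a : nat) : state :=
  fun b y => if Nat.eqb b a then 0 else s b y.

Fixpoint eval (e : expr) (s : state) : Z :=
  match e with
  | Cst z => z
  | Get a e => s a (eval e s)
  | Bin o e1 e2 => opsem o (eval e1 s) (eval e2 s)
  end.

Inductive cmd :=
| Skip
| Put (a : nat) (e1 e2 : expr)
| Clear (a : nat)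
| Seq (c1 c2 : cmd)
| If (e : expr) (c1 c2 : cmd)
| For (a : nat) (e : expr) (c : cmd).

Fixpoint iter (f : Z -> state -> state) (n : nat) (s : state) : state :=
  match n with
  | O => s
  | S n' => f (Z.of_nat n') (iter f n' s)
  end.

Fixpoint sem (c : cmd) (s : state) : state :=
  match c with
  | Skip => s
  | Put a e1 e2 => set s a (eval e1 s) (eval e2 s)
  | Clear a => clr s a
  | Seq c1 c2 => sem c2 (sem c1 s)
  | If e c1 c2 => if eval e s =? 0 then sem c2 s else sem c1 s
  | For a e c => iter (fun i s => sem c (set s a 0 i)) (Z.to_nat (eval e s)) s
  end.

Fixpoint itcost (f : Z -> state -> state) (g : Z -> state -> Z) (n : nat) (s : state) : Z :=
  match n with
  | O => 0
  | S n' => itcost f g n' s + (1 + g (Z.of_nat n') (iter f n' s))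
  end.

(** Expressions are free: their size is a constant of the program and enters the factor [kap] of the
    compilation. Every command costs at least 1, so the cost also bounds the number of clearings. *)
Fixpoint cost (c : cmd) (s : state) : Z :=
  match c with
  | Skip => 1
  | Put a e1 e2 => 1
  | Clear a => 1
  | Seq c1 c2 => cost c1 s + cost c2 (sem c1 s)
  | If e c1 c2 => 1 + (if eval e s =? 0 then cost c2 s else cost c1 s)
  | For a e c => 1 + itcost (fun i s => sem c (set s a 0 i))
                            (fun i s => cost c (set s a 0 i)) (Z.to_nat (eval e s)) s
  end.

Lemma itcost_nonneg f g n s : (forall i s, 0 <= g i s) -> 0 <= itcost f g n s.
Proof. intros H. induction n; cbn [itcost]; [lia|]. specialize (H (Z.of_nat n) (iter f n s)). lia. Qed.

Lemma itcost_mono f g s k n : (forall i s, 0 <= g i s) -> (k <= n)%nat ->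
  itcost f g k s <= itcost f g n s.
Proof.
  intros H Hk. induction Hk as [|n Hk IH]; [lia|]. cbn [itcost].
  specialize (H (Z.of_nat n) (iter f n s)). lia.
Qed.

Lemma cost_pos c s : 1 <= cost c s.
Proof.
  revert s. induction c; intros s; cbn [cost]; try lia.
  - specialize (IHc1 s). specialize (IHc2 (sem c1 s)). lia.
  - specialize (IHc1 s). specialize (IHc2 s). destruct (eval e s =? 0); lia.
  - pose proof (itcost_nonneg (fun i s => sem c (set s a 0 i))
      (fun i s => cost c (set s a 0 i)) (Z.to_nat (eval e s)) s) as H.
    assert (0 <= itcost (fun i s => sem c (set s a 0 i))
      (fun i s => cost c (set s a 0 i)) (Z.to_nat (eval e s)) s); [|lia].
    apply H. intros i s'. specialize (IHc (set s' a 0 i)). lia.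
Qed.

(** * Compilation to the word RAM *)

(** Stated for every remaining fuel [f], so that runs compose by adding their times. *)
Definition runs (P : program) (w : nat) (pc : nat) (m : memory) (pc' : nat) (m' : memory)
  (t : nat) : Prop :=
  forall f, exec P w (t + f) pc m = exec P w f pc' m'.

Lemma runs_refl P w pc m : runs P w pc m pc m 0.
Proof. now intros f. Qed.

Lemma runs_trans P w pc1 m1 pc2 m2 pc3 m3 t1 t2 :
  runs P w pc1 m1 pc2 m2 t1 -> runs P w pc2 m2 pc3 m3 t2 ->
  runs P w pc1 m1 pc3 m3 (t1 + t2).
Proof. intros H1 H2 f. rewrite <- Nat.add_assoc, H1. apply H2. Qed.

Definition code_at (P : program) (pc : nat) (code : list instr) : Prop :=
  exists A C, P = A ++ code ++ C /\ length A = pc.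

Lemma code_at_app P pc c1 c2 :
  code_at P pc (c1 ++ c2) -> code_at P pc c1 /\ code_at P (pc + length c1) c2.
Proof.
  intros (A & C & -> & <-). split.
  - exists A, (c2 ++ C). now rewrite <- app_assoc.
  - exists (A ++ c1), C. rewrite length_app, <- !app_assoc. auto.
Qed.

Lemma code_at_cons P pc i c :
  code_at P pc (i :: c) -> nth_error P pc = Some i /\ code_at P (S pc) c.
Proof.
  intros (A & C & -> & <-). split.
  - rewrite nth_error_app2, Nat.sub_diag by lia. reflexivity.
  - exists (A ++ [i]), C. rewrite length_app, <- app_assoc. simpl. split; [auto|lia].
Qed.

Definition straight (i : instr) : bool :=
  match i with IJz _ _ | IJmp _ | IHalt => false | _ => true end.

Definition step1 (w : nat) (m : memory) (i : instr) : memory :=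
  match i with
  | IConst d z => upd m d (wrap w z)
  | IAdd d a b => binop w Z.add m d a b
  | ISub d a b => binop w Z.sub m d a b
  | IMul d a b => binop w Z.mul m d a b
  | IDiv d a b => binop w Z.div m d a b
  | IMod d a b => binop w Z.modulo m d a b
  | IAnd d a b => binop w Z.land m d a b
  | IOr d a b => binop w Z.lor m d a b
  | IXor d a b => binop w Z.lxor m d a b
  | IShr d a b => binop w Z.shiftr m d a b
  | ILt d a b => upd m d (if Z.ltb (m a) (m b) then 1 else 0)
  | IEq d a b => upd m d (if Z.eqb (m a) (m b) then 1 else 0)
  | ILoad d a => upd m d (m (Z.to_nat (m a)))
  | IStore a s => upd m (Z.to_nat (m a)) (m s)
  | _ => m
  end.

Definition sl (w : nat) (l : list instr) (m : memory) : memory :=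
  fold_left (step1 w) l m.

Lemma sl_app w l1 l2 m : sl w (l1 ++ l2) m = sl w l2 (sl w l1 m).
Proof. apply fold_left_app. Qed.

Lemma runs_sl P w l : forall pc m, code_at P pc l -> forallb straight l = true ->
  runs P w pc m (pc + length l) (sl w l m) (length l).
Proof.
  induction l as [|i l IH]; intros pc m H Hs.
  - rewrite Nat.add_0_r. apply runs_refl.
  - apply code_at_cons in H. destruct H as [H1 H2].
    cbn [forallb] in Hs. apply andb_true_iff in Hs. destruct Hs as [Hs1 Hs2].
    specialize (IH (S pc) (step1 w m i) H2 Hs2).
    replace (pc + length (i :: l))%nat with (S pc + length l)%nat by (simpl; lia).
    intros f. specialize (IH f). cbn [length Nat.add exec]. rewrite H1.
    destruct i; try discriminate Hs1; exact IH.
Qed.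

Lemma runs_jmp P w pc m l : nth_error P pc = Some (IJmp l) -> runs P w pc m l m 1.
Proof. intros H f. cbn [Nat.add exec]. now rewrite H. Qed.

Lemma runs_jz P w pc m a l : nth_error P pc = Some (IJz a l) ->
  runs P w pc m (if m a =? 0 then l else S pc) m 1.
Proof. intros H f. cbn [Nat.add exec]. rewrite H. now destruct (m a =? 0). Qed.

Lemma upd_same m a v : upd m a v a = v.
Proof. unfold upd. now rewrite Nat.eqb_refl. Qed.

Lemma upd_diff m a v b : b <> a -> upd m a v b = m b.
Proof. intros H. unfold upd. apply Nat.eqb_neq in H. now rewrite H. Qed.

Definition half (w : nat) : Z := 2 ^ (Z.of_nat w - 1).

Definition small (w : nat) (z : Z) : Prop := - half w <= z < half w.

Lemma wrap_small w z : (1 <= w)%nat -> small w z -> wrap w z = z.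
Proof.
  unfold small, half, wrap. intros Hw Hz.
  replace (2 ^ Z.of_nat w) with (2 * 2 ^ (Z.of_nat w - 1)).
  2:{ rewrite <- Z.pow_succ_r by lia. f_equal. lia. }
  set (h := 2 ^ (Z.of_nat w - 1)) in *.
  assert (0 < h) by (apply Z.pow_pos_nonneg; lia).
  rewrite (Z.mul_comm 2 h), Z.div_mul by lia.
  rewrite Z.mod_small; lia.
Qed.

Lemma small_abs w z : Z.abs z < half w -> small w z.
Proof. unfold small. lia. Qed.

(** A number fits into two's complement with [p + 1] bits exactly when a shift by [p] leaves only
    copies of its sign. Bitwise operations commute with shifts, which reduces [bitop_range] to the
    operands 0 and -1. *)
Lemma range_shiftr p z : 0 <= p ->
  (- 2 ^ p <= z < 2 ^ p) <-> (Z.shiftr z p = 0 \/ Z.shiftr z p = -1).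
Proof.
  intros Hp. rewrite Z.shiftr_div_pow2 by lia.
  assert (0 < 2 ^ p) by (apply Z.pow_pos_nonneg; lia).
  pose proof (Z.div_mod z (2 ^ p)). pose proof (Z.mod_pos_bound z (2 ^ p)).
  split; intros; nia.
Qed.

Lemma bitop_range (f : Z -> Z -> Z) p x y : 0 <= p ->
  f = Z.land \/ f = Z.lor \/ f = Z.lxor ->
  - 2 ^ p <= x < 2 ^ p -> - 2 ^ p <= y < 2 ^ p -> - 2 ^ p <= f x y < 2 ^ p.
Proof.
  intros Hp Hf. rewrite !range_shiftr by lia. intros Hx Hy.
  destruct Hf as [-> | [-> | ->]];
    [rewrite Z.shiftr_land | rewrite Z.shiftr_lor | rewrite Z.shiftr_lxor];
    destruct Hx as [-> | ->], Hy as [-> | ->]; cbn; auto.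
Qed.

Lemma bitop_abs (f : Z -> Z -> Z) U x y : 1 <= U ->
  f = Z.land \/ f = Z.lor \/ f = Z.lxor ->
  Z.abs x <= U -> Z.abs y <= U -> Z.abs (f x y) <= 2 * U.
Proof.
  intros HU Hf Hx Hy. pose proof (Z.log2_spec U ltac:(lia)) as [H1 H2].
  rewrite Z.pow_succ_r in H2 by apply Z.log2_nonneg.
  pose proof (Z.log2_nonneg U).
  pose proof (bitop_range f (Z.log2 U + 1) x y ltac:(lia) Hf) as HH.
  rewrite Z.pow_add_r in HH by lia. change (2 ^ 1) with 2 in HH. lia.
Qed.

Lemma div_abs x y : Z.abs (x / y) <= Z.abs x.
Proof.
  destruct (Z.eq_dec y 0) as [->|Hy]; [rewrite Zdiv_0_r; lia|].
  pose proof (Z.div_mod x y Hy).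
  destruct (Z.lt_trichotomy y 0) as [L|[L|L]]; [|lia|].
  - pose proof (Z.mod_neg_bound x y L). nia.
  - pose proof (Z.mod_pos_bound x y L). nia.
Qed.

Lemma mod_abs x y : Z.abs (x mod y) <= Z.max (Z.abs x) (Z.abs y).
Proof.
  destruct (Z.lt_trichotomy y 0) as [L|[->|L]].
  - pose proof (Z.mod_neg_bound x y L). lia.
  - rewrite Zmod_0_r. lia.
  - pose proof (Z.mod_pos_bound x y L). lia.
Qed.

(** This is why [OShr] replaces a negative amount by 0: a left shift would let values grow
    exponentially. *)
Lemma shiftr_abs x y : 0 <= y -> Z.abs (Z.shiftr x y) <= Z.abs x.
Proof. intros H. rewrite Z.shiftr_div_pow2 by lia. apply div_abs. Qed.

Lemma zig_abs z : 0 <= zig z <= 2 * Z.abs z + 1.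
Proof. unfold zig. destruct (Z.ltb_spec z 0); lia. Qed.

(** The pairing is the worst case: the codes are at most [3 * U], hence [36 * U^2 + 3 * U]. The
    constant is taken as 64 = 4^3 so that [V^3] absorbs it when [4 <= V]. *)
Lemma opsem_abs o x y U : 1 <= U -> Z.abs x <= U -> Z.abs y <= U ->
  Z.abs (opsem o x y) <= 64 * (U * U).
Proof.
  intros HU Hx Hy. destruct o; cbn [opsem].
  - nia.
  - nia.
  - nia.
  - pose proof (div_abs x y). nia.
  - pose proof (mod_abs x y). nia.
  - pose proof (Z.mod_pos_bound x (y * y + 1)). nia.
  - pose proof (bitop_abs Z.land U x y HU ltac:(auto) Hx Hy). nia.
  - pose proof (bitop_abs Z.lor U x y HU ltac:(auto) Hx Hy). nia.
  - pose proof (bitop_abs Z.lxor U x y HU ltac:(auto) Hx Hy). nia.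
  - pose proof (shiftr_abs x (Z.max 0 y) ltac:(lia)). nia.
  - destruct (x <? y); nia.
  - destruct (x =? y); nia.
  - unfold pairZ. pose proof (zig_abs x). pose proof (zig_abs y).
    assert (zig x <= 3 * U) by lia. assert (zig y <= 3 * U) by lia.
    assert (0 <= zig x + zig y <= 6 * U) by lia.
    assert ((zig x + zig y) * (zig x + zig y) <= (6 * U) * (6 * U)) by nia. nia.
Qed.

(** Branch-free: with [t] the truth value of [x < 0], the code is [x * (2 - 4 t) - t]. Expressions
    thus compile to straight-line code. *)
Definition zigc (d x t : nat) : list instr :=
  [IConst t 0; ILt t x t; IConst (t+1) 4; IMul (t+1) (t+1) t;
   IConst (t+2) 2; ISub (t+1) (t+2) (t+1); IMul (t+1) x (t+1); ISub d (t+1) t].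

Definition opc (o : op) (d x y t : nat) : list instr :=
  match o with
  | OAdd => [IAdd d x y]
  | OSub => [ISub d x y]
  | OMul => [IMul d x y]
  | ODiv => [IDiv d x y]
  | OMod => [IMod d x y]
  | OClamp => [IMul t y y; IConst (t+1) 1; IAdd t t (t+1); IMod d x t]
  | OAnd => [IAnd d x y]
  | OOr => [IOr d x y]
  | OXor => [IXor d x y]
  | OShr => [IConst t 0; ILt t t y; IMul t t y; IShr d x t]
  | OLt => [ILt d x y]
  | OEq => [IEq d x y]
  | OPair => zigc (t+3) x t ++ zigc (t+4) y t ++
      [IAdd t (t+3) (t+4); IMul t t t; IAdd d t (t+4)]
  end.

Ltac regs := repeat first
  [ rewrite upd_same | rewrite upd_diff by lia ].

Lemma half_ge w U : 1 <= U -> 64 * (U * U) < half w -> (1 <= w)%nat.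
Proof.
  intros HU H. destruct w; [|lia]. change (half 0) with 0 in H. nia.
Qed.

Lemma zigc_ok w d x t m U : 1 <= U -> Z.abs (m x) <= U -> 64 * (U * U) < half w ->
  (x < t)%nat -> (d >= t + 3)%nat ->
  sl w (zigc d x t) m d = zig (m x) /\
  (forall c, (c < t)%nat \/ (c >= t + 3)%nat -> c <> d -> sl w (zigc d x t) m c = m c).
Proof.
  intros HU Hx Hw Hxt Hd. pose proof (half_ge w U HU Hw) as Hw1.
  assert (W : forall z, Z.abs z <= 64 * (U * U) -> wrap w z = z).
  { intros z Hz. apply wrap_small; [lia|]. apply small_abs. lia. }
  cbn [sl zigc fold_left step1 binop]. unfold binop. split.
  - regs. rewrite (W 0), (W 4), (W 2) by nia.
    unfold zig. destruct (Z.ltb_spec (m x) 0).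
    + rewrite (W (4 * 1)) by nia. rewrite (W (2 - 4 * 1)) by nia.
      rewrite (W (m x * _)) by nia. rewrite W by nia. lia.
    + rewrite (W (4 * 0)) by nia. rewrite (W (2 - 4 * 0)) by nia.
      rewrite (W (m x * _)) by nia. rewrite W by nia. lia.
  - intros c Hc Hcd. now rewrite !upd_diff by lia.
Qed.

Lemma opc_ok w o d x y t m U : 1 <= U -> Z.abs (m x) <= U -> Z.abs (m y) <= U ->
  64 * (U * U) < half w -> (x < t)%nat -> (y < t)%nat -> (d < t)%nat ->
  sl w (opc o d x y t) m d = opsem o (m x) (m y) /\
  (forall c, (c < t)%nat \/ (c >= t + 5)%nat -> c <> d -> sl w (opc o d x y t) m c = m c).
Proof.
  intros HU Hx Hy Hw Hxt Hyt Hd. pose proof (half_ge w U HU Hw) as Hw1.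
  assert (W : forall z, Z.abs z <= 64 * (U * U) -> wrap w z = z).
  { intros z Hz. apply wrap_small; [lia|]. apply small_abs. lia. }
  pose proof (opsem_abs o (m x) (m y) U HU Hx Hy) as Ho.
  destruct o; cbn [opc sl fold_left step1]; unfold binop;
  try (split; [regs; first [now apply W | reflexivity] | intros; now rewrite !upd_diff by lia]).
  - split; [|intros; now rewrite !upd_diff by lia].
    regs. rewrite (W (m y * m y)), (W 1) by nia. rewrite (W (m y * m y + 1)) by nia. now apply W.
  - split; [|intros; now rewrite !upd_diff by lia].
    regs. rewrite (W 0) by nia. cbn [opsem] in Ho.
    replace (wrap w ((if 0 <? m y then 1 else 0) * m y)) with (Z.max 0 (m y)).
    + now apply W.
    + destruct (Z.ltb_spec 0 (m y)); rewrite W by nia; lia.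
  - fold (sl w (zigc (t+3) x t ++ zigc (t+4) y t ++
      [IAdd t (t+3) (t+4); IMul t t t; IAdd d t (t+4)]) m).
    rewrite !sl_app.
    destruct (zigc_ok w (t+3) x t m U) as [A1 A2]; try lia.
    set (m1 := sl w (zigc (t+3) x t) m) in *.
    destruct (zigc_ok w (t+4) y t m1 U) as [B1 B2]; try lia.
    { rewrite A2 by lia. lia. }
    set (m2 := sl w (zigc (t+4) y t) m1) in *.
    cbn [sl fold_left step1]. unfold binop.
    assert (E3 : m2 (t+3)%nat = zig (m x)) by (rewrite B2 by lia; exact A1).
    assert (E4 : m2 (t+4)%nat = zig (m y)) by (rewrite B1, A2 by lia; reflexivity).
    cbn [opsem] in *. pose proof (zig_abs (m x)). pose proof (zig_abs (m y)).
    split.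
    + regs. rewrite E3, E4. unfold pairZ in *.
      rewrite (W (zig (m x) + zig (m y))) by nia.
      rewrite (W ((zig (m x) + zig (m y)) * _)) by nia. now apply W.
    + intros c Hc Hcd. rewrite !upd_diff by lia. rewrite B2, A2 by lia. reflexivity.
Qed.

Lemma opc_straight o d x y t : forallb straight (opc o d x y t) = true.
Proof. destruct o; reflexivity. Qed.

(** The address encodes array, version and index. Arrays become sparse tables over all integers, and
    raising the version turns to cells never written before. *)
Definition adr (a r t : nat) : list instr :=
  opc OPair r (2 + a) r t ++ [IConst t (Z.of_nat a)] ++ opc OPair r t r (t + 1) ++ [IAdd r r 0%nat].

(* The machine keeps the heap base in cell 0, the input length in cell 1 and the version number of
   array [a], which [Clear a] increments, in cell [2 + a]; expressions are evaluated on a register stack below cell [R].  The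
   input cells below [R] have been moved up by [SH + R]. *)
Fixpoint ce (R r : nat) (e : expr) : list instr :=
  match e with
  | Cst z => [IConst r z]
  | Get O e => ce R r e ++
      [IMod r r 1%nat; IConst (r+1) (Z.of_nat R); ILt (r+1) r (r+1);
       IConst (r+2) (Z.of_nat R); IAdd (r+2) 1%nat (r+2); IMul (r+1) (r+1) (r+2);
       IAdd r r (r+1); ILoad r r]
  | Get a e => ce R r e ++ adr a r (r+1) ++ [ILoad r r]
  | Bin o e1 e2 => ce R r e1 ++ ce R (r+1) e2 ++ opc o r r (r+1) (r+2)
  end.

(** A loop keeps its counter in register [r] and its bound in [r + 1], out of reach of the body,
    which works from [r + 2] on. So the bound is evaluated once, and a body that overwrites the loop
    variable does not disturb the count, as in [sem]. *)
Fixpoint cc (R pc r : nat) (c : cmd) : list instr :=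
  match c with
  | Skip => []
  | Put a e1 e2 => ce R r e1 ++ ce R (r+1) e2 ++ adr a r (r+2) ++ [IStore r (r+1)]
  | Clear a => [IConst r 1; IAdd (2 + a) (2 + a) r]
  | Seq c1 c2 => let k1 := cc R pc r c1 in k1 ++ cc R (pc + length k1) r c2
  | If e c1 c2 =>
      let k0 := ce R r e in
      let k1 := cc R (pc + length k0 + 1) r c1 in
      let pc2 := (pc + length k0 + 1 + length k1 + 1)%nat in
      let k2 := cc R pc2 r c2 in
      k0 ++ [IJz r pc2] ++ k1 ++ [IJmp (pc2 + length k2)] ++ k2
  | For a e c =>
      let k0 := ce R (r+1) e ++ [IConst r 0] in
      let l := (pc + length k0)%nat in
      let k1 := [IConst (r+2) 0] ++ adr a (r+2) (r+3) ++ [IStore (r+2) r] in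
      let pcb := (l + 2 + length k1)%nat in
      let kb := cc R pcb (r+2) c in
      k0 ++ [ILt (r+2) r (r+1); IJz (r+2) (pcb + length kb + 3)] ++ k1 ++ kb ++
      [IConst (r+2) 1; IAdd r r (r+2); IJmp l]
  end.

Fixpoint edp (e : expr) : nat :=
  match e with
  | Cst _ => 1
  | Get _ e => Nat.max (edp e) 8
  | Bin _ e1 e2 => Nat.max (edp e1) (Nat.max (S (edp e2)) 8)
  end.

Fixpoint cdp (c : cmd) : nat :=
  match c with
  | Skip => 0
  | Put a e1 e2 => Nat.max (edp e1) (Nat.max (S (edp e2)) 9)
  | Clear _ => 1
  | Seq c1 c2 => Nat.max (cdp c1) (cdp c2)
  | If e c1 c2 => Nat.max (edp e) (Nat.max (cdp c1) (cdp c2))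
  | For a e c => Nat.max (S (edp e)) (Nat.max 10 (2 + cdp c))
  end.

(** An exponent: if all cells are at most [V >= 4], the value is at most [V ^ dg e]. A binary
    operation maps [d] to [2 * d + 3] because 64 is at most [V^3]. The address of a cell takes two
    nested pairings and one addition, hence [2 * (2 * d + 3) + 3 + 1 = 4 * d + 10]. *)
Fixpoint dg (e : expr) : nat :=
  match e with
  | Cst z => S (Z.to_nat (Z.log2 (Z.abs z)))
  | Get _ e => 4 * dg e + 10
  | Bin _ e1 e2 => 2 * Nat.max (dg e1) (dg e2) + 3
  end.

Fixpoint cdg (c : cmd) : nat :=
  match c with
  | Skip => 1
  | Put a e1 e2 => Nat.max (4 * dg e1 + 10) (dg e2)
  | Clear _ => 1
  | Seq c1 c2 => Nat.max (cdg c1) (cdg c2)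
  | If e c1 c2 => Nat.max (dg e) (Nat.max (cdg c1) (cdg c2))
  | For a e c => Nat.max (dg e) (Nat.max 14 (cdg c))
  end.

Fixpoint ewf (NA : nat) (e : expr) : bool :=
  match e with
  | Cst _ => true
  | Get a e => (a <? NA)%nat && ewf NA e
  | Bin _ e1 e2 => ewf NA e1 && ewf NA e2
  end.

Definition idok (NA a : nat) : bool := ((1 <=? a) && (a <? NA))%nat.

Fixpoint cwf (NA : nat) (c : cmd) : bool :=
  match c with
  | Skip => true
  | Put a e1 e2 => idok NA a && ewf NA e1 && ewf NA e2
  | Clear a => idok NA a
  | Seq c1 c2 => cwf NA c1 && cwf NA c2
  | If e c1 c2 => ewf NA e && cwf NA c1 && cwf NA c2
  | For a e c => idok NA a && ewf NA e && cwf NA c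
  end.

Lemma idok_spec NA a : idok NA a = true <-> (1 <= a < NA)%nat.
Proof. unfold idok. rewrite andb_true_iff, Nat.leb_le, Nat.ltb_lt. lia. Qed.

Fixpoint elen (e : expr) : nat :=
  match e with
  | Cst _ => 1
  | Get _ e => elen e + 41
  | Bin _ e1 e2 => elen e1 + elen e2 + 19
  end.

Fixpoint kap (c : cmd) : nat :=
  match c with
  | Skip => 1
  | Put a e1 e2 => elen e1 + elen e2 + 41
  | Clear _ => 2
  | Seq c1 c2 => kap c1 + kap c2
  | If e c1 c2 => elen e + 2 + kap c1 + kap c2
  | For a e c => elen e + 50 + kap c
  end.

Lemma adr_length a r t : length (adr a r t) = 40%nat.
Proof. reflexivity. Qed.

Lemma opc_length o d x y t : (length (opc o d x y t) <= 19)%nat.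
Proof. destruct o; cbn; lia. Qed.

Lemma ce_length R e : forall r, (length (ce R r e) <= elen e)%nat.
Proof.
  induction e; intros r; cbn [ce elen].
  - cbn; lia.
  - destruct a; rewrite ?length_app; specialize (IHe r).
    + cbn [length]. lia.
    + rewrite adr_length. cbn [length]. lia.
  - rewrite !length_app. pose proof (opc_length o r r (r+1) (r+2)).
    specialize (IHe1 r). specialize (IHe2 (r+1)%nat). lia.
Qed.

Lemma ce_straight R e : forall r, forallb straight (ce R r e) = true.
Proof.
  induction e; intros r; cbn [ce].
  - reflexivity.
  - destruct a; rewrite !forallb_app, IHe; reflexivity.
  - now rewrite !forallb_app, IHe1, IHe2, opc_straight.
Qed.

(** * Bounds on expressions by powers of the largest cell value *)

Section Powers.
Variable V : Z.
Hypothesis V4 : 4 <= V.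

Definition bnd (s : state) : Prop := forall a z, Z.abs (s a z) <= V.

Lemma Vpow_pos k : 0 < V ^ Z.of_nat k.
Proof. apply Z.pow_pos_nonneg; lia. Qed.

Lemma Vpow_le j k : (j <= k)%nat -> V ^ Z.of_nat j <= V ^ Z.of_nat k.
Proof. intros. apply Z.pow_le_mono_r; lia. Qed.

Lemma Vpow_ge1 k : (1 <= k)%nat -> V <= V ^ Z.of_nat k.
Proof. intros L. pose proof (Vpow_le 1 k L) as Q. now rewrite Z.pow_1_r in Q. Qed.

Lemma Vpow_op k : 64 * (V ^ Z.of_nat k * V ^ Z.of_nat k) <= V ^ Z.of_nat (2 * k + 3).
Proof.
  replace (Z.of_nat (2 * k + 3)) with (3 + (Z.of_nat k + Z.of_nat k)) by lia.
  rewrite !Z.pow_add_r by lia.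
  assert (64 <= V ^ 3) by (change 64 with (4 ^ 3); apply Z.pow_le_mono_l; lia).
  pose proof (Vpow_pos k). nia.
Qed.

Lemma dg_pos e : (1 <= dg e)%nat.
Proof. destruct e; cbn; lia. Qed.

Lemma cst_abs z : Z.abs z <= V ^ Z.of_nat (dg (Cst z)).
Proof.
  cbn [dg]. destruct (Z.eq_dec z 0) as [->|Hz].
  - pose proof (Vpow_pos (S (Z.to_nat (Z.log2 (Z.abs 0))))). lia.
  - pose proof (Z.log2_spec (Z.abs z) ltac:(lia)) as [_ H2].
    pose proof (Z.log2_nonneg (Z.abs z)).
    rewrite Nat2Z.inj_succ, Z2Nat.id by lia.
    assert (2 ^ Z.succ (Z.log2 (Z.abs z)) <= V ^ Z.succ (Z.log2 (Z.abs z)))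
      by (apply Z.pow_le_mono_l; lia). lia.
Qed.

Lemma eval_abs s e : bnd s -> Z.abs (eval e s) <= V ^ Z.of_nat (dg e).
Proof.
  intros B. induction e.
  - apply cst_abs.
  - cbn [eval]. pose proof (B a (eval e s)). pose proof (Vpow_ge1 (dg (Get a e)) ltac:(apply dg_pos)). lia.
  - cbn [eval dg].
    pose proof (Vpow_le (dg e1) (Nat.max (dg e1) (dg e2)) ltac:(lia)).
    pose proof (Vpow_le (dg e2) (Nat.max (dg e1) (dg e2)) ltac:(lia)).
    pose proof (opsem_abs o (eval e1 s) (eval e2 s) (V ^ Z.of_nat (Nat.max (dg e1) (dg e2)))
      ltac:(pose proof (Vpow_pos (Nat.max (dg e1) (dg e2))); lia) ltac:(lia) ltac:(lia)).
    pose proof (Vpow_op (Nat.max (dg e1) (dg e2))). lia.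
Qed.

End Powers.

(** * Correctness of the compiled code *)

Section Compile.
Variables (NA R : nat) (inp : nat -> Z) (SH : Z) (w : nat) (V : Z) (D : nat).
Hypothesis SH_pos : 2 <= SH.
Let H := SH + 2 * Z.of_nat R.
Hypothesis R_pos : (2 + NA <= R)%nat.
Hypothesis V4 : 4 <= V.
Hypothesis VH : H <= V.
Hypothesis D14 : (14 <= D)%nat.
Hypothesis VD : V ^ Z.of_nat D < half w.

Definition loc (a : nat) (v z : Z) : nat :=
  Z.to_nat (pairZ (Z.of_nat a) (pairZ v z) + H).

Lemma loc_ge a v z : (Z.to_nat H <= loc a v z)%nat.
Proof. clear SH_pos R_pos V4 VH D14 VD. unfold loc. pose proof (pairZ_nonneg (Z.of_nat a) (pairZ v z)). lia. Qed.

Lemma loc_inj a v z a' v' z' : loc a v z = loc a' v' z' -> a = a' /\ v = v' /\ z = z'.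
Proof.
  unfold loc. intros E.
  assert (H0 : 0 <= H) by (unfold H in *; lia).
  pose proof (pairZ_nonneg (Z.of_nat a) (pairZ v z)).
  pose proof (pairZ_nonneg (Z.of_nat a') (pairZ v' z')).
  assert (E' : pairZ (Z.of_nat a) (pairZ v z) = pairZ (Z.of_nat a') (pairZ v' z')) by lia.
  apply pairZ_inj in E'. destruct E' as [E1 E2]. apply pairZ_inj in E2. lia.
Qed.

(** [rep_new] is what makes clearing take constant time: the cells of all versions still to come are
    zero. Input indices are reduced modulo [SH], so that every read of array 0 hits a cell of the
    input. *)
Record rep (s : state) (m : memory) : Prop := Rep {
  rep_H : m 0%nat = H;
  rep_SH : m 1%nat = SH;
  rep_in : forall z, s 0%nat z = inp (Z.to_nat (z mod SH));
  rep_hi : forall x : nat, (R <= x)%nat -> Z.of_nat x < SH -> m x = inp x;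
  rep_lo : forall x : nat, (x < R)%nat -> m (Z.to_nat SH + R + x)%nat = inp x;
  rep_ver : forall a, (1 <= a < NA)%nat -> 0 <= m (2 + a)%nat;
  rep_arr : forall a z, (1 <= a < NA)%nat -> m (loc a (m (2 + a)%nat) z) = s a z;
  rep_new : forall a v z, (1 <= a < NA)%nat -> m (2 + a)%nat < v -> m (loc a v z) = 0
}.

Lemma rep_agree s m m' : rep s m ->
  (forall x, (x < 2 + NA)%nat \/ (R <= x)%nat -> m' x = m x) -> rep s m'.
Proof.
  intros [h1 h2 h3 h4 h5 h6 h7 h8] A.
  assert (HR : forall a v z, (R <= loc a v z)%nat).
  { intros. pose proof (loc_ge a v z). unfold H in *. lia. }
  constructor; intros; rewrite ?(A 0%nat), ?(A 1%nat) by lia; auto.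
  - rewrite A by lia. auto.
  - rewrite A by lia. auto.
  - rewrite A by lia. auto.
  - rewrite (A (2 + a)%nat) by lia. rewrite A by auto. auto.
  - rewrite (A (2 + a)%nat) in * by lia. rewrite A by auto. auto.
Qed.

Lemma small_pow z k : Z.abs z <= V ^ Z.of_nat k -> (k <= D)%nat -> Z.abs z < half w.
Proof. clear SH_pos R_pos VH D14 H. intros A B. pose proof (Vpow_le V V4 k D B). lia. Qed.

Lemma w_pos : (1 <= w)%nat.
Proof. clear SH_pos R_pos VH D14 H. destruct w; [|lia]. change (half 0) with 0 in VD. pose proof (Vpow_pos V V4 D). lia. Qed.

Lemma wrapD z k : Z.abs z <= V ^ Z.of_nat k -> (k <= D)%nat -> wrap w z = z.
Proof. clear SH_pos R_pos VH D14 H.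
  intros A B. apply wrap_small; [apply w_pos|]. apply small_abs. now apply (small_pow z k).
Qed.

Lemma wrapV z : Z.abs z <= 4 * V -> wrap w z = z.
Proof. clear SH_pos R_pos VH H.
  intros A. apply (wrapD z 2); [|lia]. change (Z.of_nat 2) with 2. rewrite Z.pow_2_r. nia.
Qed.

Lemma adr_ok a r t m d : (1 <= d)%nat -> (1 <= a < NA)%nat -> m 0%nat = H ->
  Z.abs (m (2 + a)%nat) <= V ->
  Z.abs (m r) <= V ^ Z.of_nat d -> (4 * d + 10 <= D)%nat -> (2 + NA <= r < t)%nat ->
  sl w (adr a r t) m r = pairZ (Z.of_nat a) (pairZ (m (2 + a)%nat) (m r)) + H /\
  (forall c, (c < t)%nat \/ (c >= t + 6)%nat -> c <> r -> sl w (adr a r t) m c = m c).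
Proof.
  intros Hd Ha HH Hv Hr HD Ht. unfold adr. rewrite !sl_app.
  pose proof (Vpow_ge1 V V4 d Hd) as V1. pose proof (Vpow_op V V4 d) as O1.
  pose proof (Vpow_op V V4 (2 * d + 3)) as O2.
  pose proof (Vpow_le V V4 (2 * (2 * d + 3) + 3) D ltac:(lia)) as O3.
  pose proof (Vpow_pos V V4 d) as P1. pose proof (Vpow_pos V V4 (2 * d + 3)) as P2.
  pose proof (Vpow_le V V4 (2 * d + 3) (2 * (2 * d + 3) + 3) ltac:(lia)) as O4.
  pose proof (Vpow_ge1 V V4 (2 * d + 3) ltac:(lia)) as V2.
  assert (HNA : Z.of_nat a <= V) by (unfold H in *; lia).
  destruct (opc_ok w OPair r (2+a) r t m (V ^ Z.of_nat d)) as [A1 A2]; try lia.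
  set (m1 := sl w (opc OPair r (2+a) r t) m) in *. cbn [opsem] in A1.
  assert (B1 : sl w [IConst t (Z.of_nat a)] m1 t = Z.of_nat a).
  { cbn. rewrite upd_same. apply wrapV. lia. }
  assert (B2 : forall c, c <> t -> sl w [IConst t (Z.of_nat a)] m1 c = m1 c).
  { intros c Hc. cbn. now rewrite upd_diff. }
  set (m2 := sl w [IConst t (Z.of_nat a)] m1) in *.
  pose proof (opsem_abs OPair (m (2+a)%nat) (m r) (V ^ Z.of_nat d) ltac:(lia) ltac:(lia) ltac:(lia)) as Q1.
  cbn [opsem] in Q1.
  assert (R1 : m2 r = pairZ (m (2+a)%nat) (m r)) by (rewrite B2 by lia; exact A1).
  destruct (opc_ok w OPair r t r (t+1) m2 (V ^ Z.of_nat (2*d+3))) as [C1 C2]; try lia.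
  set (m3 := sl w (opc OPair r t r (t+1)) m2) in *. cbn [opsem] in C1.
  rewrite R1, B1 in C1.
  pose proof (opsem_abs OPair (Z.of_nat a) (pairZ (m (2+a)%nat) (m r)) (V ^ Z.of_nat (2*d+3)) ltac:(lia) ltac:(lia) ltac:(lia)) as Q2.
  cbn [opsem] in Q2.
  assert (H0 : 0 <= H) by (unfold H in *; lia).
  cbn [sl fold_left step1]. unfold binop. split.
  - rewrite upd_same. rewrite C1. rewrite C2, B2, A2, HH by lia.
    apply (wrapD _ (S (2 * (2 * d + 3) + 3))); [|lia].
    rewrite Nat2Z.inj_succ, Z.pow_succ_r by lia.
    pose proof (Vpow_ge1 V V4 (2 * (2 * d + 3) + 3) ltac:(lia)) as X1.
    assert (X2 : 2 * V ^ Z.of_nat (2 * (2 * d + 3) + 3) <= V * V ^ Z.of_nat (2 * (2 * d + 3) + 3))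
      by (apply Z.mul_le_mono_nonneg_r; lia).
    lia.
  - intros c Hc Hcr. rewrite upd_diff by lia. rewrite C2, B2, A2 by lia. reflexivity.
Qed.

(** Version numbers are part of addresses and must stay small. Each clearing costs a unit, so the
    time [tau] spent so far bounds them. *)
Definition vers (tau : Z) (m : memory) : Prop :=
  forall a, (1 <= a < NA)%nat -> m (2 + a)%nat <= tau.

Lemma ce_ok s e tau : bnd V s -> tau <= V ->
  forall r m, rep s m -> vers tau m -> (2 + NA <= r)%nat -> (r + edp e <= R)%nat ->
  ewf NA e = true -> (dg e <= D)%nat ->
  sl w (ce R r e) m r = eval e s /\
  (forall c, (c < r)%nat \/ (R <= c)%nat -> sl w (ce R r e) m c = m c).
Proof.
  intros B Ht. induction e; intros r m Rp Vr Hr HR Wf Hd.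
  - cbn [ce sl fold_left step1 eval]. split.
    + rewrite upd_same. eapply wrapD; [apply (cst_abs V V4)|exact Hd].
    + intros c Hc. cbn [edp] in HR. now rewrite upd_diff by lia.
  - cbn [edp] in HR. cbn [dg] in Hd. cbn [ewf] in Wf. apply andb_true_iff in Wf.
    destruct Wf as [Wa We]. apply Nat.ltb_lt in Wa.
    destruct (IHe r m Rp Vr Hr ltac:(lia) We ltac:(lia)) as [I1 I2].
    assert (Rp1 : rep s (sl w (ce R r e) m)) by (apply (rep_agree s m); [exact Rp|intros; apply I2; lia]).
    pose proof (eval_abs V V4 s e B) as Ee. pose proof (dg_pos e) as Dp.
    destruct a as [|a].
    + set (k := [IMod r r 1%nat; IConst (r+1) (Z.of_nat R); ILt (r+1) r (r+1);
       IConst (r+2) (Z.of_nat R); IAdd (r+2) 1%nat (r+2); IMul (r+1) (r+1) (r+2);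
       IAdd r r (r+1)]).
      change (ce R r (Get 0 e)) with (ce R r e ++ k ++ [ILoad r r]).
      rewrite !sl_app. set (m1 := sl w (ce R r e) m) in *.
      pose proof (rep_SH _ _ Rp1) as S1.
      assert (Hm : 0 <= eval e s mod SH < SH) by (apply Z.mod_pos_bound; lia).
      assert (HV : SH + 2 * Z.of_nat R <= V) by exact VH.
      assert (A1 : sl w k m1 r = eval e s mod SH +
         (if eval e s mod SH <? Z.of_nat R then SH + Z.of_nat R else 0)).
      { subst k. cbn [sl fold_left step1]. unfold binop. regs. rewrite I1, S1.
        rewrite (wrapV (eval e s mod SH)) by lia.
        rewrite (wrapV (Z.of_nat R)) by lia. rewrite (wrapV (SH + Z.of_nat R)) by lia.
        destruct (Z.ltb_spec (eval e s mod SH) (Z.of_nat R)) as [L|L].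
        - rewrite (wrapV (1 * _)) by lia. rewrite wrapV by lia. lia.
        - rewrite (wrapV (0 * _)) by lia. rewrite wrapV by lia. lia. }
      assert (A2 : forall c, (c < r)%nat \/ (R <= c)%nat -> sl w k m1 c = m1 c).
      { intros c Hc. subst k. cbn [sl fold_left step1]. unfold binop. now rewrite !upd_diff by lia. }
      set (m2 := sl w k m1) in *. cbn [sl fold_left step1]. split.
      * rewrite upd_same, A1. cbn [eval]. rewrite (rep_in _ _ Rp1).
        destruct (Z.ltb_spec (eval e s mod SH) (Z.of_nat R)) as [L|L].
        -- replace (Z.to_nat (eval e s mod SH + (SH + Z.of_nat R)))
             with (Z.to_nat SH + R + Z.to_nat (eval e s mod SH))%nat by lia.
           rewrite A2 by lia. apply (rep_lo _ _ Rp1). lia.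
        -- rewrite Z.add_0_r. rewrite A2 by lia. apply (rep_hi _ _ Rp1); lia.
      * intros c Hc. rewrite upd_diff by lia. rewrite A2 by lia. apply I2. lia.
    + change (ce R r (Get (S a) e)) with (ce R r e ++ adr (S a) r (r+1) ++ [ILoad r r]).
      rewrite !sl_app. set (m1 := sl w (ce R r e) m) in *.
      assert (Vm : Z.abs (m1 (2 + S a)%nat) <= V).
      { pose proof (rep_ver _ _ Rp1 (S a) ltac:(lia)).
        assert (m1 (2 + S a)%nat <= tau) by (rewrite I2 by lia; apply Vr; lia). lia. }
      destruct (adr_ok (S a) r (r+1) m1 (dg e)) as [A1 A2]; try lia; try apply (rep_H _ _ Rp1); auto.
      set (m2 := sl w (adr (S a) r (r+1)) m1) in *.
      cbn [sl fold_left step1]. split.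
      * rewrite upd_same, A1, I1. fold (loc (S a) (m1 (2 + S a)%nat) (eval e s)).
        rewrite A2.
        -- apply (rep_arr _ _ Rp1). lia.
        -- pose proof (loc_ge (S a) (m1 (2 + S a)%nat) (eval e s)). unfold H in *. lia.
        -- pose proof (loc_ge (S a) (m1 (2 + S a)%nat) (eval e s)). unfold H in *. lia.
      * intros c Hc. rewrite upd_diff by lia. rewrite A2 by lia. apply I2. lia.
  - cbn [edp] in HR. cbn [dg] in Hd. cbn [ewf] in Wf. apply andb_true_iff in Wf.
    destruct Wf as [W1 W2].
    destruct (IHe1 r m Rp Vr Hr ltac:(lia) W1 ltac:(lia)) as [I1 I2].
    assert (Rp1 : rep s (sl w (ce R r e1) m)) by (apply (rep_agree s m); [exact Rp|intros; apply I2; lia]).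
    cbn [ce]. rewrite !sl_app. set (m1 := sl w (ce R r e1) m) in *.
    assert (Vr1 : vers tau m1) by (intros a Ha; rewrite I2 by lia; now apply Vr).
    destruct (IHe2 (r+1)%nat m1 Rp1 Vr1 ltac:(lia) ltac:(lia) W2 ltac:(lia)) as [J1 J2].
    set (m2 := sl w (ce R (r+1) e2) m1) in *.
    pose proof (Vpow_le V V4 (dg e1) (Nat.max (dg e1) (dg e2)) ltac:(lia)).
    pose proof (Vpow_le V V4 (dg e2) (Nat.max (dg e1) (dg e2)) ltac:(lia)).
    pose proof (eval_abs V V4 s e1 B). pose proof (eval_abs V V4 s e2 B).
    assert (Er : m2 r = eval e1 s) by (rewrite J2 by lia; exact I1).
    assert (Er1 : m2 (r+1)%nat = eval e2 s) by exact J1.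
    pose proof (Vpow_pos V V4 (Nat.max (dg e1) (dg e2))).
    pose proof (Vpow_op V V4 (Nat.max (dg e1) (dg e2))).
    pose proof (Vpow_le V V4 (2 * Nat.max (dg e1) (dg e2) + 3) D Hd).
    destruct (opc_ok w o r r (r+1) (r+2) m2 (V ^ Z.of_nat (Nat.max (dg e1) (dg e2)))) as [A1 A2];
      [lia|rewrite Er; lia|rewrite Er1; lia|lia|lia|lia|lia|].
    split.
    + rewrite A1, Er, J1. reflexivity.
    + intros c Hc. rewrite A2, J2, I2 by lia. reflexivity.
Qed.

Lemma store_ok s m a r t src d z v tau : rep s m -> vers tau m -> tau <= V ->
  (1 <= d)%nat -> (1 <= a < NA)%nat -> Z.abs z <= V ^ Z.of_nat d -> (4 * d + 10 <= D)%nat ->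
  (2 + NA <= r < t)%nat -> (t + 6 <= R)%nat -> (2 + NA <= src < t)%nat -> src <> r ->
  m r = z -> m src = v ->
  let m' := sl w (adr a r t ++ [IStore r src]) m in
  rep (set s a z v) m' /\ vers tau m' /\
  (forall c, (2 + NA <= c < t)%nat -> c <> r -> m' c = m c).
Proof.
  intros Rp Vr Ht Hd Ha Hz HD Hr HR Hs Hsr Er Es m'. subst m'. rewrite sl_app.
  destruct (adr_ok a r t m d) as [A1 A2]; try lia; try apply (rep_H _ _ Rp); auto.
  { pose proof (rep_ver _ _ Rp a Ha). specialize (Vr a Ha). lia. }
  set (m1 := sl w (adr a r t) m) in *.
  assert (Rp1 : rep s m1) by (apply (rep_agree s m); [exact Rp|intros; apply A2; lia]).
  cbn [sl fold_left step1]. rewrite A1, Er.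
  fold (loc a (m (2 + a)%nat) z). rewrite (A2 src), Es by lia.
  assert (L : forall a v z, (Z.to_nat SH + R + R <= loc a v z)%nat).
  { intros. pose proof (loc_ge a0 v0 z0). unfold H in *. lia. }
  assert (E2 : forall b, (1 <= b < NA)%nat -> m1 (2 + b)%nat = m (2 + b)%nat) by (intros; apply A2; lia).
  assert (U : forall c, (c < Z.to_nat SH + R + R)%nat -> upd m1 (loc a (m (2 + a)%nat) z) v c = m1 c).
  { intros c Hc. pose proof (L a (m (2 + a)%nat) z). apply upd_diff. lia. }
  destruct Rp1 as [h1 h2 h3 h4 h5 h6 h7 h8].
  split; [|split].
  - constructor.
    + rewrite U by lia. exact h1.
    + rewrite U by lia. exact h2.
    + intros y. unfold set. replace (Nat.eqb 0 a) with false by (symmetry; apply Nat.eqb_neq; lia). apply h3.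
    + intros x Hx1 Hx2. rewrite U by lia. now apply h4.
    + intros x Hx. rewrite U by lia. now apply h5.
    + intros b Hb. rewrite U by lia. now apply h6.
    + intros b y Hb. rewrite (U (2 + b)%nat) by lia. unfold set, upd.
      destruct (Nat.eqb_spec (loc b (m1 (2 + b)%nat) y) (loc a (m (2 + a)%nat) z)) as [E|E].
      * apply loc_inj in E. destruct E as (-> & _ & ->). now rewrite Nat.eqb_refl, Z.eqb_refl.
      * replace (Nat.eqb b a && (y =? z))%bool with false; [now apply h7|].
        symmetry. apply andb_false_iff.
        destruct (Nat.eqb_spec b a) as [->|]; [right|now left].
        apply Z.eqb_neq. intros ->. apply E. now rewrite E2.
    + intros b u y Hb. rewrite (U (2 + b)%nat) by lia. intros Hu.
      rewrite upd_diff; [now apply h8|]. intros E. apply loc_inj in E. destruct E as (-> & -> & _).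
      rewrite E2 in Hu by lia. lia.
  - intros b Hb. rewrite U by lia. rewrite E2 by lia. now apply Vr.
  - intros c Hc Hcr. rewrite U by lia. rewrite A2 by lia. reflexivity.
Qed.

(** Boundedness is asked of every state on the way, since the machine must not overflow at any
    moment. The stratification of the variables provides it later. *)
Fixpoint safe (c : cmd) (s : state) : Prop :=
  bnd V s /\
  match c with
  | Seq c1 c2 => safe c1 s /\ safe c2 (sem c1 s)
  | If e c1 c2 => if eval e s =? 0 then safe c2 s else safe c1 s
  | For a e c => forall i : nat, Z.of_nat i < eval e s ->
      let s' := iter (fun i s => sem c (set s a 0 i)) i s in
      bnd V s' /\ safe c (set s' a 0 (Z.of_nat i))
  | _ => True
  end.

Lemma safe_bnd c s : safe c s -> bnd V s.
Proof. destruct c; cbn [safe]; tauto. Qed.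

Variable P : program.

(** The budget [tau + cost c s <= V] controls the version numbers, which are invisible in the
    abstract state and therefore not covered by [safe]. *)
Lemma cc_ok c : forall pc r s m tau,
  code_at P pc (cc R pc r c) -> cwf NA c = true ->
  (2 + NA <= r)%nat -> (r + cdp c <= R)%nat -> (cdg c <= D)%nat ->
  rep s m -> vers tau m -> safe c s -> tau + cost c s <= V ->
  exists m' t, runs P w pc m (pc + length (cc R pc r c)) m' t /\
    rep (sem c s) m' /\ vers (tau + cost c s) m' /\
    (forall x, (2 + NA <= x < r)%nat -> m' x = m x) /\
    Z.of_nat t <= Z.of_nat (kap c) * cost c s.
Proof.
  induction c as [|a e1 e2|a|c1 IH1 c2 IH2|e c1 IH1 c2 IH2|a e c IH];
    intros pc r s m tau Hc Wf Hr HR HD Rp Vr Sf Ht.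
  - exists m, 0%nat. cbn [cc length sem cost kap]. rewrite Nat.add_0_r.
    split; [apply runs_refl|]. split; [exact Rp|]. split; [|split; [auto|lia]].
    intros a Ha. specialize (Vr a Ha). lia.
  - cbn [cwf] in Wf. rewrite !andb_true_iff, idok_spec in Wf. destruct Wf as [[Wa W1] W2].
    cbn [cdp] in HR. cbn [cdg] in HD. cbn [cost] in Ht. pose proof (safe_bnd _ _ Sf) as B.
    exists (sl w (cc R pc r (Put a e1 e2)) m), (length (cc R pc r (Put a e1 e2))).
    split.
    { apply runs_sl; [exact Hc|]. cbn [cc]. rewrite !forallb_app, !ce_straight. reflexivity. }
    cbn [cc] in *. rewrite !app_assoc, <- (app_assoc (ce R r e1 ++ _)), !sl_app.
    destruct (ce_ok s e1 tau B ltac:(lia) r m Rp Vr Hr ltac:(lia) W1 ltac:(lia)) as [I1 I2].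
    assert (Rp1 : rep s (sl w (ce R r e1) m)) by (apply (rep_agree s m); [exact Rp|intros; apply I2; lia]).
    set (m1 := sl w (ce R r e1) m) in *.
    assert (Vr1 : vers tau m1) by (intros b Hb; rewrite I2 by lia; now apply Vr).
    destruct (ce_ok s e2 tau B ltac:(lia) (r+1)%nat m1 Rp1 Vr1 ltac:(lia) ltac:(lia) W2 ltac:(lia)) as [J1 J2].
    assert (Rp2 : rep s (sl w (ce R (r+1) e2) m1)) by (apply (rep_agree s m1); [exact Rp1|intros; apply J2; lia]).
    set (m2 := sl w (ce R (r+1) e2) m1) in *.
    assert (Vr2 : vers tau m2) by (intros b Hb; rewrite J2 by lia; now apply Vr1).
    destruct (store_ok s m2 a r (r+2) (r+1) (dg e1) (eval e1 s) (eval e2 s) tau) as (K1 & K2 & K3);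
      auto; try lia.
    { apply dg_pos. }
    { now apply (eval_abs V V4). }
    { rewrite J2 by lia. exact I1. }
    rewrite sl_app in K1, K2, K3.
    split; [exact K1|]. split.
    { intros b Hb. specialize (K2 b Hb). cbn [cost]. lia. }
    split.
    { intros x Hx. rewrite K3, J2, I2 by lia. reflexivity. }
    rewrite !length_app, adr_length. cbn [kap cost length].
    pose proof (ce_length R e1 r). pose proof (ce_length R e2 (r+1)). lia.
  - cbn [cwf] in Wf. apply idok_spec in Wf. cbn [cdp] in HR. cbn [cost] in Ht.
    exists (sl w (cc R pc r (Clear a)) m), 2%nat.
    split; [apply (runs_sl P w (cc R pc r (Clear a))); [exact Hc|reflexivity]|].
    cbn [cc sl fold_left step1]. unfold binop. rewrite upd_same. rewrite (upd_diff _ _ _ (2+a)) by lia.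
    pose proof (rep_ver _ _ Rp a Wf) as V1. pose proof (Vr a Wf) as V2.
    rewrite (wrapV 1) by lia. rewrite wrapV by lia.
    set (m' := upd _ _ _).
    assert (M1 : m' (2 + a)%nat = m (2 + a)%nat + 1) by (subst m'; apply upd_same).
    assert (M2 : forall x, x <> (2 + a)%nat -> x <> r -> m' x = m x)
      by (intros; subst m'; now rewrite !upd_diff by lia).
    assert (L : forall a v z, (Z.to_nat SH + R + R <= loc a v z)%nat).
    { intros. pose proof (loc_ge a0 v z). unfold H in *. lia. }
    assert (ML : forall b v z, m' (loc b v z) = m (loc b v z)).
    { intros b v z. pose proof (L b v z). apply M2; lia. }
    destruct Rp as [h1 h2 h3 h4 h5 h6 h7 h8].
    split; [constructor|split; [|split]].
    + rewrite M2 by lia. exact h1.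
    + rewrite M2 by lia. exact h2.
    + intros y. cbn [sem]. unfold clr. replace (Nat.eqb 0 a) with false by (symmetry; apply Nat.eqb_neq; lia). apply h3.
    + intros x Hx1 Hx2. rewrite M2 by lia. now apply h4.
    + intros x Hx. rewrite M2 by lia. now apply h5.
    + intros b Hb. destruct (Nat.eq_dec b a) as [->|]; [rewrite M1; lia|].
      rewrite M2 by lia. now apply h6.
    + intros b y Hb. rewrite ML. cbn [sem]. unfold clr.
      destruct (Nat.eqb_spec b a) as [->|].
      * rewrite M1. apply h8; lia.
      * rewrite M2 by lia. now apply h7.
    + intros b v y Hb Hv. rewrite ML.
      destruct (Nat.eq_dec b a) as [->|].
      * rewrite M1 in Hv. apply h8; lia.
      * rewrite M2 in Hv by lia. now apply h8.
    + intros b Hb. cbn [cost]. destruct (Nat.eq_dec b a) as [->|]; [rewrite M1; lia|].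
      rewrite M2 by lia. specialize (Vr b Hb). lia.
    + intros x Hx. apply M2; lia.
    + cbn [kap cost]. lia.
  - cbn [cwf] in Wf. apply andb_true_iff in Wf. destruct Wf as [W1 W2].
    cbn [cdp] in HR. cbn [cdg] in HD. cbn [cost] in Ht. cbn [cc] in Hc.
    apply code_at_app in Hc. destruct Hc as [H1 H2]. destruct Sf as (B & S1 & S2).
    pose proof (cost_pos c1 s) as C1. pose proof (cost_pos c2 (sem c1 s)) as C2.
    destruct (IH1 pc r s m tau H1 W1 Hr ltac:(lia) ltac:(lia) Rp Vr S1 ltac:(lia))
      as (m1 & t1 & A1 & A2 & A3 & A4 & A5).
    destruct (IH2 _ r _ m1 _ H2 W2 Hr ltac:(lia) ltac:(lia) A2 A3 S2 ltac:(lia))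
      as (m2 & t2 & B1 & B2 & B3 & B4 & B5).
    exists m2, (t1 + t2)%nat. cbn [cc sem cost kap]. rewrite length_app, Nat.add_assoc.
    split; [eapply runs_trans; eassumption|]. split; [exact B2|]. split.
    { intros b Hb. specialize (B3 b Hb). lia. }
    split; [intros; rewrite B4, A4 by lia; reflexivity|]. nia.
  - cbn [cwf] in Wf. rewrite !andb_true_iff in Wf. destruct Wf as [[We W1] W2].
    cbn [cdp] in HR. cbn [cdg] in HD. cbn [cost] in Ht. cbn [cc] in *.
    destruct Sf as (B & S12).
    pose proof (cost_pos c1 s) as C1. pose proof (cost_pos c2 s) as C2.
    destruct (ce_ok s e tau B ltac:(destruct (eval e s =? 0); lia) r m Rp Vr Hr ltac:(lia) We ltac:(lia)) as [I1 I2].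
    assert (Rp1 : rep s (sl w (ce R r e) m)) by (apply (rep_agree s m); [exact Rp|intros; apply I2; lia]).
    set (k0 := ce R r e) in *. set (m1 := sl w k0 m) in *.
    assert (Vr1 : vers tau m1) by (intros b Hb; rewrite I2 by lia; now apply Vr).
    set (k1 := cc R (pc + length k0 + 1) r c1) in *.
    set (pc2 := (pc + length k0 + 1 + length k1 + 1)%nat) in *.
    set (k2 := cc R pc2 r c2) in *.
    apply code_at_app in Hc. destruct Hc as [H0 Hc].
    apply code_at_cons in Hc. destruct Hc as [Hj Hc].
    apply code_at_app in Hc. destruct Hc as [H1 Hc].
    apply code_at_cons in Hc. destruct Hc as [Hj2 H2].
    pose proof (runs_sl P w k0 pc m H0 (ce_straight R e r)) as R0. fold m1 in R0.
    pose proof (runs_jz P w _ m1 _ _ Hj) as R1. rewrite I1 in R1.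
    pose proof (ce_length R e r) as Le. fold k0 in Le.
    assert (EL : (pc + length (k0 ++ [IJz r pc2] ++ k1 ++ [IJmp (pc2 + length k2)] ++ k2) = pc2 + length k2)%nat).
    { rewrite !length_app. cbn [length]. subst pc2. lia. }
    cbn [sem cost kap]. rewrite EL.
    destruct (eval e s =? 0).
    + destruct (IH2 pc2 r s m1 tau) as (m2 & t2 & B1 & B2 & B3 & B4 & B5); auto; try lia.
      { fold k2. replace pc2 with (S (S (pc + length k0) + length k1)) by (subst pc2; lia). exact H2. }
      exists m2, (length k0 + 1 + t2)%nat.
      split; [eapply runs_trans; [eapply runs_trans; eassumption|exact B1]|].
      split; [exact B2|]. split; [intros b Hb; specialize (B3 b Hb); lia|].
      split; [intros; rewrite B4, I2 by lia; reflexivity|]. nia.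
    + destruct (IH1 (pc + length k0 + 1)%nat r s m1 tau) as (m2 & t2 & B1 & B2 & B3 & B4 & B5); auto; try lia.
      { fold k1. replace (pc + length k0 + 1)%nat with (S (pc + length k0)) by lia. exact H1. }
      fold k1 in B1.
      exists m2, (length k0 + 1 + t2 + 1)%nat.
      split.
      { eapply runs_trans; [eapply runs_trans; [eapply runs_trans; eassumption|]|].
        - replace (S (pc + length k0)) with (pc + length k0 + 1)%nat by lia. exact B1.
        - apply runs_jmp. replace (pc + length k0 + 1 + length k1)%nat with (S (pc + length k0) + length k1)%nat by lia. exact Hj2. }
      split; [exact B2|]. split; [intros b Hb; specialize (B3 b Hb); lia|].
      split; [intros; rewrite B4, I2 by lia; reflexivity|]. nia.
  - cbn [cwf] in Wf. rewrite !andb_true_iff, idok_spec in Wf. destruct Wf as [[Wa We] Wc].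
    cbn [cdp] in HR. cbn [cdg] in HD. cbn [cost] in Ht. cbn [cc] in *.
    destruct Sf as (B & Sf).
    set (F := fun i s => sem c (set s a 0 i)) in *.
    set (G := fun i s => cost c (set s a 0 i)) in *.
    assert (Gn : forall i s, 0 <= G i s) by (intros; unfold G; pose proof (cost_pos c (set s0 a 0 i)); lia).
    pose proof (itcost_nonneg F G (Z.to_nat (eval e s)) s Gn) as Cn.
    destruct (ce_ok s e tau B ltac:(lia) (r+1)%nat m Rp Vr ltac:(lia) ltac:(lia) We ltac:(lia)) as [I1 I2].
    set (ke := ce R (r+1) e) in *.
    set (k0 := ke ++ [IConst r 0]) in *.
    set (l := (pc + length k0)%nat) in *.
    set (k1 := [IConst (r+2) 0] ++ adr a (r+2) (r+3) ++ [IStore (r+2) r]) in *.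
    set (pcb := (l + 2 + length k1)%nat) in *.
    set (kb := cc R pcb (r+2) c) in *.
    assert (Lk1 : length k1 = 42%nat) by reflexivity.
    assert (EL : (pc + length (k0 ++ [ILt (r+2) r (r+1); IJz (r+2) (pcb + length kb + 3)] ++ k1 ++ kb ++ [IConst (r+2) 1; IAdd r r (r+2); IJmp l]) = pcb + length kb + 3)%nat).
    { rewrite !length_app. cbn [length]. subst pcb l. lia. }
    rewrite EL. clear EL.
    apply code_at_app in Hc. destruct Hc as [H0 Hc]. fold l in Hc.
    apply code_at_app in Hc. destruct Hc as [Ht1 Hc]. cbn [length] in Hc.
    apply code_at_app in Hc. destruct Hc as [H1 Hc]. fold pcb in Hc.
    apply code_at_app in Hc. destruct Hc as [Hb Hend].
    change [ILt (r + 2) r (r + 1); IJz (r + 2) (pcb + length kb + 3)] with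
      ([ILt (r + 2) r (r + 1)] ++ [IJz (r + 2) (pcb + length kb + 3)]) in Ht1.
    apply code_at_app in Ht1. destruct Ht1 as [Hlt Hjz]. cbn [length] in Hjz.
    apply code_at_cons in Hjz. destruct Hjz as [Hjz _].
    change [IConst (r + 2) 1; IAdd r r (r + 2); IJmp l] with
      ([IConst (r + 2) 1; IAdd r r (r + 2)] ++ [IJmp l]) in Hend.
    apply code_at_app in Hend. destruct Hend as [Hinc Hjmp]. cbn [length] in Hjmp.
    apply code_at_cons in Hjmp. destruct Hjmp as [Hjmp _].
    pose proof (runs_sl P w k0 pc m H0 ltac:(unfold k0, ke; now rewrite forallb_app, ce_straight)) as R0.
    fold l in R0.
    assert (M0 : exists m0, m0 = sl w k0 m /\ m0 r = 0 /\ m0 (r+1)%nat = eval e s /\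
       forall x, (x < r)%nat \/ (R <= x)%nat -> m0 x = m x).
    { exists (sl w k0 m). split; [reflexivity|]. unfold k0. rewrite sl_app.
      cbn [sl fold_left step1]. fold (sl w ke m). rewrite upd_same, (wrapV 0) by lia. split; [reflexivity|].
      split; [rewrite upd_diff by lia; exact I1|]. intros x Hx. rewrite upd_diff by lia. apply I2. lia. }
    destruct M0 as (m0 & E0 & M0r & M0r1 & M0x). rewrite <- E0 in R0. clear E0.
    assert (Rp0 : rep s m0) by (apply (rep_agree s m); [exact Rp|intros; apply M0x; lia]).
    assert (Vr0 : vers tau m0) by (intros b Hb'; rewrite M0x by lia; now apply Vr).
    set (n := Z.to_nat (eval e s)) in *.
    pose proof (eval_abs V V4 s e B) as Ee.
    assert (Loop : forall i : nat, (i <= n)%nat ->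
      exists mi t, runs P w l m0 l mi t /\ rep (iter F i s) mi /\ vers (tau + itcost F G i s) mi /\
        mi r = Z.of_nat i /\ mi (r+1)%nat = eval e s /\
        (forall x, (2 + NA <= x < r)%nat -> mi x = m x) /\
        Z.of_nat t <= Z.of_nat (48 + kap c) * itcost F G i s).
    { induction i as [|i IHi]; intros Hi.
      - exists m0, 0%nat. cbn [itcost iter]. split; [apply runs_refl|]. rewrite Z.add_0_r.
        repeat split; auto; try lia; try apply Rp0. intros; apply M0x; lia.
      - destruct (IHi ltac:(lia)) as (mi & t & A1 & A2 & A3 & A4 & A5 & A6 & A7).
        assert (Hin : Z.of_nat i < eval e s) by lia.
        destruct (Sf i Hin) as [Bi Si]. fold F in Bi, Si.
        assert (Mono : itcost F G (S i) s <= itcost F G n s) by (apply itcost_mono; auto).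
        pose proof (itcost_nonneg F G i s Gn) as Ci.
        cbn [itcost] in Mono. specialize (Gn (Z.of_nat i) (iter F i s)) as Gi.
        pose proof (runs_sl P w _ l mi Hlt eq_refl) as S1.
        set (ma := sl w [ILt (r + 2) r (r + 1)] mi) in *. cbn [length] in S1.
        assert (Ma : ma (r+2)%nat = 1).
        { subst ma. cbn. rewrite upd_same, A4, A5.
          replace (Z.of_nat i <? eval e s) with true by (symmetry; apply Z.ltb_lt; lia). reflexivity. }
        assert (Mx : forall x, x <> (r+2)%nat -> ma x = mi x).
        { intros x Hx. subst ma. cbn. now rewrite upd_diff. }
        pose proof (runs_jz P w _ ma _ _ Hjz) as S2. rewrite Ma in S2. cbn in S2.
        assert (Rpa : rep (iter F i s) ma) by (apply (rep_agree _ mi); [exact A2|intros; apply Mx; lia]).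
        set (mb := sl w [IConst (r+2) 0] ma).
        assert (Mb : mb (r+2)%nat = 0) by (subst mb; cbn; rewrite upd_same; apply wrapV; lia).
        assert (Mbx : forall x, x <> (r+2)%nat -> mb x = ma x) by (intros; subst mb; cbn; now rewrite upd_diff).
        assert (Rpb : rep (iter F i s) mb) by (apply (rep_agree _ ma); [exact Rpa|intros; apply Mbx; lia]).
        destruct (store_ok (iter F i s) mb a (r+2) (r+3) r 1 0 (Z.of_nat i) (tau + itcost F G i s)) as (K1 & K2 & K3);
          auto; try lia.
        { intros b Hb'. rewrite Mbx, Mx by lia. now apply A3. }
        { rewrite Mbx, Mx by lia. exact A4. }
        assert (S3 : runs P w (l+2) ma pcb (sl w k1 ma) 42).
        { unfold pcb. rewrite <- Lk1. rewrite Lk1 at 1. rewrite <- Lk1. apply runs_sl; [exact H1|reflexivity]. }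
        change (sl w (adr a (r + 2) (r + 3) ++ [IStore (r + 2) r]) mb) with (sl w k1 ma) in K1, K2, K3.
        set (mc := sl w k1 ma) in *.
        destruct (IH pcb (r+2)%nat (set (iter F i s) a 0 (Z.of_nat i)) mc (tau + itcost F G i s)) as (md & t2 & B1 & B2 & B3 & B4 & B5);
          auto; try lia.
        { change (cost c (set (iter F i s) a 0 (Z.of_nat i))) with (G (Z.of_nat i) (iter F i s)). lia. }
        fold kb in B1.
        pose proof (runs_sl P w _ _ md Hinc eq_refl) as S4. cbn [length] in S4.
        set (me := sl w [IConst (r + 2) 1; IAdd r r (r + 2)] md) in *.
        assert (Mdr : md r = Z.of_nat i) by (rewrite B4, K3, Mbx, Mx by lia; exact A4).
        assert (Mer : me r = Z.of_nat i + 1).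
        { subst me. cbn. unfold binop. rewrite upd_same. rewrite upd_same, upd_diff by lia.
          rewrite (wrapV 1) by lia. rewrite Mdr. apply (wrapD _ (dg e)); lia. }
        assert (Mex : forall x, x <> (r+2)%nat -> x <> r -> me x = md x).
        { intros x Hx Hx2. subst me. cbn. unfold binop. now rewrite !upd_diff by lia. }
        pose proof (runs_jmp P w _ me _ Hjmp) as S5.
        (* One test, one jump, 42 instructions that store the counter in the loop variable, the
           body, two instructions to increment and one jump back: 47 besides the body, below the 48
           of the invariant. *)
        exists me, (t + (1 + (1 + (42 + (t2 + (2 + 1))))))%nat.
        split.
        { eapply runs_trans; [exact A1|]. eapply runs_trans; [exact S1|].
          eapply runs_trans; [exact S2|].
          replace (S (l + 1)) with (l + 2)%nat by lia.
          eapply runs_trans; [exact S3|].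
          eapply runs_trans; [exact B1|]. eapply runs_trans; [exact S4|exact S5]. }
        cbn [iter itcost]. split.
        { apply (rep_agree _ md); [exact B2|]. intros; apply Mex; lia. }
        split.
        { intros b Hb'. rewrite Mex by lia. specialize (B3 b Hb').
          change (cost c (set (iter F i s) a 0 (Z.of_nat i))) with (G (Z.of_nat i) (iter F i s)) in B3. lia. }
        split; [lia|]. split.
        { rewrite Mex, B4, K3, Mbx, Mx by lia. exact A5. }
        split.
        { intros x Hx. rewrite Mex, B4, K3, Mbx, Mx by lia. now apply A6. }
        change (cost c (set (iter F i s) a 0 (Z.of_nat i))) with (G (Z.of_nat i) (iter F i s)) in B5.
        clear - A7 B5 Gi. nia. }
    destruct (Loop n ltac:(lia)) as (mi & t & A1 & A2 & A3 & A4 & A5 & A6 & A7).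
    pose proof (runs_sl P w _ l mi Hlt eq_refl) as S1.
    set (ma := sl w [ILt (r + 2) r (r + 1)] mi) in *. cbn [length] in S1.
    assert (Ma : ma (r+2)%nat = 0).
    { subst ma. cbn. rewrite upd_same, A4, A5.
      replace (Z.of_nat n <? eval e s) with false by (symmetry; apply Z.ltb_ge; lia). reflexivity. }
    assert (Mx : forall x, x <> (r+2)%nat -> ma x = mi x).
    { intros x Hx. subst ma. cbn. now rewrite upd_diff. }
    pose proof (runs_jz P w _ ma _ _ Hjz) as S2. rewrite Ma in S2. cbn in S2.
    exists ma, (length k0 + (t + (1 + 1)))%nat.
    split.
    { eapply runs_trans; [exact R0|]. eapply runs_trans; [exact A1|].
      eapply runs_trans; [exact S1|]. exact S2. }
    cbn [sem cost kap]. fold F. fold n. split.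
    { apply (rep_agree _ mi); [exact A2|]. intros; apply Mx; lia. }
    split.
    { intros b Hb'. rewrite Mx by lia. specialize (A3 b Hb'). fold G. lia. }
    split; [intros; rewrite Mx by lia; now apply A6|].
    fold G. unfold k0. rewrite length_app. cbn [length].
    pose proof (ce_length R e (r+1)) as Le. fold ke in Le. nia.
Qed.

End Compile.

(** * Polynomial bounds on the values of stratified programs *)

(* Arrays are stratified by [lev]; an array may be assigned an expression over strictly lower
   levels, incremented by such an expression, or copied from itself.  Comparisons have level 0 and a
   clamped expression has the level of its bound.  The values then stay polynomial in the running time. *)
Fixpoint elev (lev : nat -> nat) (e : expr) : nat :=
  match e with
  | Cst _ => 0
  | Get a _ => lev a
  | Bin o e1 e2 =>
      match o with
      | OLt | OEq => 0
      | OClamp => elev lev e2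
      | _ => Nat.max (elev lev e1) (elev lev e2)
      end
  end%nat.

Definition okput (lev : nat -> nat) (a : nat) (e : expr) : bool :=
  (1 <=? lev a)%nat &&
  ((elev lev e <? lev a)%nat ||
   match e with
   | Bin OAdd (Get b _) e' => (b =? a)%nat && (elev lev e' <? lev a)%nat
   | Get b _ => (b =? a)%nat
   | _ => false
   end).

Fixpoint wt (lev : nat -> nat) (c : cmd) : bool :=
  match c with
  | Skip | Clear _ => true
  | Put a _ e2 => okput lev a e2
  | Seq c1 c2 => wt lev c1 && wt lev c2
  | If _ c1 c2 => wt lev c1 && wt lev c2
  | For a e c => (elev lev e <? lev a)%nat && wt lev c
  end.

Section Levels.
Variables (lev : nat -> nat) (V0 T : Z) (D Lm : nat).
Hypothesis V04 : 4 <= V0.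
Hypothesis T0 : 0 <= T.
Hypothesis D1 : (1 <= D)%nat.
Hypothesis levm : forall a, (lev a <= Lm)%nat.

(** Bound for level [L] throughout a run of cost at most [T]: a variable of level [L + 1] only
    receives, or is increased by, values up to [K L ^ D], and it changes at most [T] times. *)
Fixpoint K (L : nat) : Z :=
  match L with
  | O => V0
  | S L => (T + 2) * K L ^ Z.of_nat D
  end.

Lemma K4 L : 4 <= K L.
Proof.
  induction L; cbn [K]; [lia|].
  pose proof (Vpow_ge1 (K L) IHL D D1). nia.
Qed.

Lemma K_step L : K L <= K (S L).
Proof.
  cbn [K]. pose proof (K4 L). pose proof (Vpow_ge1 (K L) (K4 L) D D1). nia.
Qed.

Lemma K_mono L L' : (L <= L')%nat -> K L <= K L'.
Proof. induction 1; [lia|]. pose proof (K_step m). lia. Qed.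

Lemma Kpow_le L d d' : (d <= d')%nat -> K L ^ Z.of_nat d <= K L ^ Z.of_nat d'.
Proof. apply Vpow_le. apply K4. Qed.

Lemma Kpow_mono L L' d : (L <= L')%nat -> K L ^ Z.of_nat d <= K L' ^ Z.of_nat d.
Proof. intros. apply Z.pow_le_mono_l. pose proof (K4 L). pose proof (K_mono L L'). lia. Qed.

(** The level of an index plays no part in the bound: whichever cell is read, the array's own level
    bounds it. This permits arrays addressed by very large values. *)
Lemma eval_lev s e : (forall a z, Z.abs (s a z) <= K (lev a)) ->
  Z.abs (eval e s) <= K (elev lev e) ^ Z.of_nat (dg e).
Proof.
  intros B. induction e.
  - apply cst_abs. apply K4.
  - cbn [eval elev]. pose proof (B a (eval e s)).
    pose proof (Vpow_ge1 (K (lev a)) (K4 _) (dg (Get a e)) (dg_pos _)). lia.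
  - cbn [dg eval].
    set (d := Nat.max (dg e1) (dg e2)).
    assert (Hcmp : forall L, 1 <= K L ^ Z.of_nat (2 * d + 3)).
    { intros L. pose proof (Vpow_pos (K L) (K4 L) (2 * d + 3)). lia. }
    assert (Gen : Z.abs (opsem o (eval e1 s) (eval e2 s)) <=
      K (Nat.max (elev lev e1) (elev lev e2)) ^ Z.of_nat (2 * d + 3)).
    { set (L := Nat.max (elev lev e1) (elev lev e2)).
      assert (H1 : Z.abs (eval e1 s) <= K L ^ Z.of_nat d).
      { apply (Z.le_trans _ _ _ IHe1), (Z.le_trans _ (K L ^ Z.of_nat (dg e1))); [apply Kpow_mono|apply Kpow_le]; lia. }
      assert (H2 : Z.abs (eval e2 s) <= K L ^ Z.of_nat d).
      { apply (Z.le_trans _ _ _ IHe2), (Z.le_trans _ (K L ^ Z.of_nat (dg e2))); [apply Kpow_mono|apply Kpow_le]; lia. }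
      pose proof (Zlt_le_succ _ _ (Vpow_pos (K L) (K4 L) d)) as H0.
      exact (Z.le_trans _ _ _ (opsem_abs o _ _ _ H0 H1 H2) (Vpow_op (K L) (K4 L) d)). }
    destruct o; cbn [elev]; try exact Gen; cbn [opsem].
    + set (L := elev lev e2) in *.
      pose proof (Kpow_le L (dg e2) d ltac:(lia)).
      pose proof (Vpow_pos (K L) (K4 L) d).
      pose proof (Vpow_op (K L) (K4 L) d).
      clear IHe1 Gen.
      set (x := eval e1 s) in *. set (y := eval e2 s) in *. set (U := K L ^ Z.of_nat d) in *.
      assert (Hy : Z.abs y <= U) by lia.
      assert (0 <= y * y) by apply Z.square_nonneg.
      pose proof (Z.mod_pos_bound x (y * y + 1) ltac:(lia)).
      assert (y * y <= U * U).
      { rewrite <- Z.abs_square. apply Z.mul_le_mono_nonneg; lia. }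
      rewrite Z.abs_eq by lia. lia.
    + destruct (_ <? _); specialize (Hcmp 0%nat); cbn [Z.abs]; lia.
    + destruct (_ =? _); specialize (Hcmp 0%nat); cbn [Z.abs]; lia.
Qed.

(** The bound grows with time, so that one increment, which costs one unit, takes it from [tau] to
    [tau + 1]. *)
Definition lbd (a : nat) (tau : Z) : Z :=
  match lev a with
  | O => V0
  | S L => (1 + tau) * K L ^ Z.of_nat D
  end.

Definition linv (tau : Z) (s : state) : Prop := forall a z, Z.abs (s a z) <= lbd a tau.

Lemma lbd_mono a t t' : t <= t' -> lbd a t <= lbd a t'.
Proof.
  unfold lbd. destruct (lev a); [lia|]. pose proof (Vpow_pos (K n) (K4 n) D). nia.
Qed.

Lemma linv_mono s t t' : t <= t' -> linv t s -> linv t' s.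
Proof. intros H I a z. specialize (I a z). pose proof (lbd_mono a t t' H). lia. Qed.

Lemma linv_K s t : t <= T -> linv t s -> forall a z, Z.abs (s a z) <= K (lev a).
Proof.
  intros H I a z. specialize (I a z). unfold lbd in I. destruct (lev a); [exact I|].
  cbn [K]. pose proof (Vpow_pos (K n) (K4 n) D). nia.
Qed.

Lemma linv_bnd s t : t <= T -> linv t s -> bnd (K Lm) s.
Proof.
  intros H I a z. pose proof (linv_K s t H I a z). pose proof (K_mono _ _ (levm a)). lia.
Qed.

Lemma set_linv s a z v t : linv t s -> Z.abs v <= lbd a t -> linv t (set s a z v).
Proof.
  intros I Hv b y. unfold set. destruct (Nat.eqb_spec b a) as [->|]; [|apply I].
  destruct (y =? z); [exact Hv|apply I].
Qed.

Lemma eval_below s e a t : 0 <= t <= T -> linv t s -> (elev lev e < lev a)%nat -> (dg e <= D)%nat ->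
  Z.abs (eval e s) <= lbd a t /\ Z.abs (eval e s) + lbd a t <= lbd a (t + 1).
Proof.
  intros Ht I L Hd. pose proof (eval_lev s e (linv_K s t ltac:(lia) I)) as E.
  unfold lbd. destruct (lev a) as [|l]; [lia|].
  pose proof (Kpow_mono (elev lev e) l (dg e) ltac:(lia)).
  pose proof (Kpow_le l (dg e) D Hd). nia.
Qed.

Lemma wt_safe c : forall s t, wt lev c = true -> (cdg c <= D)%nat -> 0 <= t ->
  linv t s -> t + cost c s <= T ->
  safe (K Lm) c s /\ linv (t + cost c s) (sem c s).
Proof.
  induction c as [|a e1 e2|a|c1 IH1 c2 IH2|e c1 IH1 c2 IH2|a e c IH];
    intros s t W HD Ht I Hc; pose proof (linv_bnd s t) as B;
    cbn [wt cdg cost sem safe] in *.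
  - split; [split; [apply B; auto; lia|exact Logic.I]|]. apply (linv_mono s t); [lia|auto].
  - split; [split; [apply B; auto; lia|exact Logic.I]|].
    unfold okput in W. apply andb_true_iff in W. destruct W as [La W]. apply Nat.leb_le in La.
    apply set_linv; [apply (linv_mono s t); [lia|auto]|].
    apply orb_true_iff in W. destruct W as [W|W].
    + apply Nat.ltb_lt in W. pose proof (eval_below s e2 a t ltac:(lia) I W ltac:(lia)).
      pose proof (lbd_mono a t (t+1)). lia.
    + destruct e2 as [|b e'|o e' e'']; try discriminate W.
      * apply Nat.eqb_eq in W. subst b. cbn [eval]. pose proof (I a (eval e' s)).
        pose proof (lbd_mono a t (t+1)). lia.
      * destruct o; try discriminate W. destruct e' as [|b i|]; try discriminate W.
        apply andb_true_iff in W. destruct W as [W1 W2].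
        apply Nat.eqb_eq in W1. subst b. apply Nat.ltb_lt in W2.
        cbn [eval opsem]. pose proof (I a (eval i s)).
        cbn [dg] in HD. pose proof (eval_below s e'' a t ltac:(lia) I W2 ltac:(lia)). lia.
  - split; [split; [apply B; auto; lia|exact Logic.I]|].
    intros b z. unfold clr. pose proof (I b z). pose proof (lbd_mono b t (t+1)).
    destruct (Nat.eqb b a); cbn [Z.abs]; lia.
  - apply andb_true_iff in W. destruct W as [W1 W2].
    pose proof (cost_pos c1 s). pose proof (cost_pos c2 (sem c1 s)).
    destruct (IH1 s t W1 ltac:(lia) Ht I ltac:(lia)) as [A1 A2].
    destruct (IH2 (sem c1 s) (t + cost c1 s) W2 ltac:(lia) ltac:(lia) A2 ltac:(lia)) as [B1 B2].
    split; [split; [apply B; auto; lia|now split]|]. now rewrite Z.add_assoc.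
  - apply andb_true_iff in W. destruct W as [W1 W2].
    pose proof (cost_pos c1 s). pose proof (cost_pos c2 s).
    destruct (eval e s =? 0).
    + destruct (IH2 s t W2 ltac:(lia) Ht I ltac:(lia)) as [A1 A2].
      split; [split; [apply B; auto; lia|exact A1]|]. apply (linv_mono _ (t + cost c2 s)); [lia|auto].
    + destruct (IH1 s t W1 ltac:(lia) Ht I ltac:(lia)) as [A1 A2].
      split; [split; [apply B; auto; lia|exact A1]|]. apply (linv_mono _ (t + cost c1 s)); [lia|auto].
  - apply andb_true_iff in W. destruct W as [W1 W2]. apply Nat.ltb_lt in W1.
    set (F := fun i s => sem c (set s a 0 i)) in *.
    set (G := fun i s => cost c (set s a 0 i)) in *.
    assert (Gn : forall i s, 0 <= G i s) by (intros; unfold G; pose proof (cost_pos c (set s0 a 0 i)); lia).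
    set (n := Z.to_nat (eval e s)) in *.
    assert (Cn : forall k, 0 <= itcost F G k s) by (intros; now apply itcost_nonneg).
    assert (Mono : forall k, (k <= n)%nat -> itcost F G k s <= itcost F G n s).
    { intros k Hk. now apply itcost_mono. }
    destruct (eval_below s e a t ltac:(specialize (Cn n); lia) I W1 ltac:(lia)) as [Ee _].
    assert (Main : forall k, (k <= n)%nat -> linv (t + itcost F G k s) (iter F k s) /\
      forall i, (i < k)%nat -> bnd (K Lm) (iter F i s) /\ safe (K Lm) c (set (iter F i s) a 0 (Z.of_nat i))).
    { induction k as [|k IHk]; intros Hk.
      - cbn [itcost iter]. rewrite Z.add_0_r. split; [exact I|lia].
      - destruct (IHk ltac:(lia)) as [I1 S1].
        pose proof (Mono (S k) Hk) as Mk. cbn [itcost] in Mk. specialize (Cn k) as Ck.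
        specialize (Gn (Z.of_nat k) (iter F k s)) as Gk.
        assert (I2 : linv (t + itcost F G k s) (set (iter F k s) a 0 (Z.of_nat k))).
        { apply set_linv; [exact I1|]. pose proof (lbd_mono a t (t + itcost F G k s) ltac:(lia)).
          lia. }
        destruct (IH (set (iter F k s) a 0 (Z.of_nat k)) (t + itcost F G k s)) as [A1 A2]; auto; try lia.
        { change (cost c (set (iter F k s) a 0 (Z.of_nat k))) with (G (Z.of_nat k) (iter F k s)). lia. }
        split.
        + cbn [iter itcost].
          apply (linv_mono _ (t + itcost F G k s + G (Z.of_nat k) (iter F k s))); [lia|exact A2].
        + intros i Hi. destruct (Nat.eq_dec i k) as [->|]; [|apply S1; lia].
          split; [|exact A1]. apply (linv_bnd _ (t + itcost F G k s)); [lia|exact I1]. }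
    destruct (Main n ltac:(lia)) as [M1 M2].
    split.
    + split; [apply B; auto; specialize (Cn n); lia|]. intros i Hi. apply M2. lia.
    + apply (linv_mono _ (t + itcost F G n s)); [lia|exact M1].
Qed.

End Levels.

Definition init (n : nat) (inp : memory) : state :=
  fun a z => if Nat.eqb a 0 then inp (Z.to_nat (z mod (2 * (Z.of_nat n * Z.of_nat n) + 2))) else 0.

(* Before anything else only cells 2 and 3 are free: they encode the absent loop at node 0. *)
Definition save (R d : nat) : list instr :=
  [IMul 2 0 0; IAdd 2 2 2; IConst 3 (Z.of_nat (2 + R + d)); IAdd 2 2 3; IStore 2 d]%nat.

Definition setup (NA R : nat) : list instr :=
  [IMul 2 0 0; IAdd 2 2 2; IConst 3 2; IAdd 1 2 3; IConst 3 (Z.of_nat (2 * R)); IAdd 0 1 3]%nat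
  ++ map (fun a => IConst (2 + a) 0) (seq 1 (NA - 1)).

Definition prologue (NA R : nat) : list instr :=
  flat_map (save R) ([0; 1] ++ seq 4 (R - 4))%nat ++ setup NA R.

(** * Moving the input out of the way of the registers *)

Lemma flat_map_straight {A} (f : A -> list instr) l :
  (forall x, forallb straight (f x) = true) -> forallb straight (flat_map f l) = true.
Proof. intros H. induction l; cbn; [reflexivity|]. now rewrite forallb_app, H. Qed.

Section Prologue.
Variables (NA R n w : nat) (inp : memory).
Let N2 := 2 * (Z.of_nat n * Z.of_nat n).
Let SH := N2 + 2.
Hypothesis R4 : (4 <= R)%nat.
Hypothesis RNA : (2 + NA <= R)%nat.
Hypothesis inp0 : inp 0%nat = Z.of_nat n.
Hypothesis inp2 : inp 2%nat = 0.
Hypothesis inp3 : inp 3%nat = 0.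
Hypothesis inpz : forall x, SH <= Z.of_nat x -> inp x = 0.
Hypothesis small_w : forall z, 0 <= z <= SH + 3 * Z.of_nat R -> wrap w z = z.

Lemma save_ok m d : (d < R)%nat -> m 0%nat = Z.of_nat n -> d <> 2%nat -> d <> 3%nat ->
  (forall x, x <> 2%nat -> x <> 3%nat ->
     sl w (save R d) m x = if Nat.eqb x (Z.to_nat SH + R + d) then m d else m x).
Proof.
  intros Hd H0 D2 D3 x X2 X3. unfold SH, N2 in *.
  cbn [save sl fold_left step1]. unfold binop.
  rewrite H0.
  repeat (rewrite upd_same || rewrite (upd_diff _ 3%nat _ 2%nat) by lia || rewrite (upd_diff _ 2%nat _ 3%nat) by lia).
  rewrite (small_w (Z.of_nat n * Z.of_nat n)) by nia.
  rewrite (small_w (Z.of_nat n * Z.of_nat n + _)) by nia.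
  rewrite (small_w (Z.of_nat (2 + R + d))) by nia.
  rewrite small_w by nia.
  replace (Z.to_nat (Z.of_nat n * Z.of_nat n + Z.of_nat n * Z.of_nat n + Z.of_nat (2 + R + d)))
    with (Z.to_nat (2 * (Z.of_nat n * Z.of_nat n) + 2) + R + d)%nat by nia.
  unfold upd at 1. destruct (Nat.eqb_spec x (Z.to_nat (2 * (Z.of_nat n * Z.of_nat n) + 2) + R + d)%nat);
    now rewrite !upd_diff by lia.
Qed.

(** The alternative premise of the second clause, a cell whose copy is already correct, carries a
    cell just saved through the rest of the list. *)
Lemma saves_ok l : forall m, m 0%nat = Z.of_nat n ->
  (forall d, In d l -> (d < R)%nat /\ d <> 2%nat /\ d <> 3%nat) ->
  (forall x, x <> 2%nat -> x <> 3%nat -> (x < Z.to_nat SH + R)%nat ->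
     sl w (flat_map (save R) l) m x = m x) /\
  (forall d, In d l \/ m (Z.to_nat SH + R + d)%nat = m d -> d <> 2%nat -> d <> 3%nat -> (d < R)%nat ->
     sl w (flat_map (save R) l) m (Z.to_nat SH + R + d)%nat = m d) /\
  (forall d, ~ In d l ->
     sl w (flat_map (save R) l) m (Z.to_nat SH + R + d)%nat = m (Z.to_nat SH + R + d)%nat).
Proof.
  assert (SHp : 2 <= SH) by (unfold SH, N2; nia).
  induction l as [|d l IH]; intros m H0 Hl.
  - cbn [flat_map sl fold_left]. split; [auto|]. split; [|auto]. intros d [[]|E] _ _ _; auto.
  - cbn [flat_map]. rewrite sl_app.
    destruct (Hl d (or_introl eq_refl)) as (L1 & L2 & L3).
    pose proof (save_ok m d L1 H0 L2 L3) as S.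
    set (m1 := sl w (save R d) m) in *.
    assert (S' : forall x, x <> 2%nat -> x <> 3%nat -> (x < Z.to_nat SH + R)%nat -> m1 x = m x).
    { intros x X2 X3 X. rewrite S by auto. destruct (Nat.eqb_spec x (Z.to_nat SH + R + d)); [lia|auto]. }
    destruct (IH m1) as (A1 & A2 & A3).
    { rewrite S' by lia. exact H0. }
    { intros x Hx. apply Hl. now right. }
    split; [|split].
    + intros x X2 X3 X. rewrite A1 by auto. auto.
    + intros x Hx X2 X3 XR. rewrite A2; auto; [apply S'; lia|].
      rewrite (S' x) by lia. rewrite S by lia.
      destruct (Nat.eqb_spec (Z.to_nat SH + R + x) (Z.to_nat SH + R + d)) as [E|E].
      * right. f_equal. lia.
      * destruct Hx as [[Hx|Hx]|Hx]; [lia|now left|now right].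
    + intros x Hx. rewrite A3 by (intros Q; apply Hx; now right).
      rewrite S by lia.
      destruct (Nat.eqb_spec (Z.to_nat SH + R + x) (Z.to_nat SH + R + d)) as [E|E]; [|reflexivity].
      exfalso. apply Hx. left. lia.
Qed.

Lemma consts_ok l : forall m x,
  sl w (map (fun a => IConst (2 + a) 0) l) m x = if existsb (fun a => Nat.eqb x (2 + a)) l then 0 else m x.
Proof.
  induction l as [|a l IH]; intros m x; [reflexivity|].
  change (sl w (map (fun a0 : nat => IConst (2 + a0) 0) l) (upd m (2 + a) (wrap w 0)) x =
    if existsb (fun a0 => Nat.eqb x (2 + a0)) (a :: l) then 0 else m x).
  rewrite IH. cbn [existsb]. rewrite small_w by (unfold SH, N2; nia). unfold upd.
  destruct (Nat.eqb x (2 + a)), (existsb (fun a0 => Nat.eqb x (2 + a0)) l); reflexivity.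
Qed.

Lemma prologue_ok : rep NA R inp SH (init n inp) (sl w (prologue NA R) inp) /\
  vers NA 0 (sl w (prologue NA R) inp).
Proof.
  assert (SHp : 2 <= SH) by (unfold SH, N2; nia).
  unfold prologue. rewrite sl_app.
  destruct (saves_ok ([0; 1] ++ seq 4 (R - 4))%nat inp inp0) as (A1 & A2 & A3).
  { intros d Hd. apply in_app_or in Hd. destruct Hd as [Hd|Hd].
    - cbn in Hd. lia.
    - apply in_seq in Hd. lia. }
  set (m1 := sl w (flat_map (save R) ([0; 1] ++ seq 4 (R - 4))%nat) inp) in *.
  unfold setup. rewrite sl_app.
  set (m2 := sl w [IMul 2 0 0; IAdd 2 2 2; IConst 3 2; IAdd 1 2 3; IConst 3 (Z.of_nat (2 * R)); IAdd 0 1 3]%nat m1).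
  assert (M2 : m2 0%nat = SH + 2 * Z.of_nat R /\ m2 1%nat = SH /\ forall x, (4 <= x)%nat -> m2 x = m1 x).
  { subst m2. cbn [sl fold_left step1]. unfold binop. rewrite (A1 0%nat), inp0 by lia.
    repeat (rewrite upd_same || rewrite upd_diff by lia).
    rewrite (small_w (Z.of_nat n * Z.of_nat n)) by (unfold SH, N2 in *; nia).
    rewrite (small_w (Z.of_nat n * Z.of_nat n + _)) by (unfold SH, N2 in *; nia).
    rewrite (small_w 2) by lia.
    rewrite (small_w (_ + 2)) by (unfold SH, N2 in *; nia).
    rewrite (small_w (Z.of_nat (2 * R))) by lia.
    rewrite small_w by (unfold SH, N2 in *; nia).
    split; [unfold SH, N2; lia|]. split; [unfold SH, N2; lia|].
    intros x Hx. now rewrite !upd_diff by lia. }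
  destruct M2 as (M20 & M21 & M2x).
  pose proof (consts_ok (seq 1 (NA - 1)) m2) as C.
  set (m3 := sl w (map _ _) m2) in *.
  assert (C1 : forall x, (x < 3)%nat \/ (2 + NA <= x)%nat -> m3 x = m2 x).
  { intros x Hx. rewrite C. destruct (existsb _ _) eqn:E; [|reflexivity].
    apply existsb_exists in E. destruct E as (a & Ha & Ex). apply in_seq in Ha. apply Nat.eqb_eq in Ex. lia. }
  assert (C2 : forall a, (1 <= a < NA)%nat -> m3 (2 + a)%nat = 0).
  { intros a Ha. rewrite C. destruct (existsb _ _) eqn:E; [reflexivity|].
    exfalso. assert (Q : existsb (fun b => Nat.eqb (2 + a) (2 + b)) (seq 1 (NA - 1)) = true).
    { apply existsb_exists. exists a. rewrite in_seq, Nat.eqb_refl. split; [lia|reflexivity]. }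
    congruence. }
  assert (Lz : forall a v z, m3 (loc R SH a v z) = 0).
  { intros a v z. pose proof (loc_ge R SH a v z) as L.
    replace (loc R SH a v z) with (Z.to_nat SH + R + (loc R SH a v z - (Z.to_nat SH + R)))%nat by lia.
    rewrite C1 by lia. rewrite M2x by lia. rewrite A3.
    - apply inpz. lia.
    - intros Q. apply in_app_or in Q. destruct Q as [Q|Q]; [cbn in Q; lia|]. apply in_seq in Q. lia. }
  split.
  - constructor.
    + rewrite C1 by lia. exact M20.
    + rewrite C1 by lia. exact M21.
    + intros z. reflexivity.
    + intros x X1 X2. rewrite C1, M2x, A1 by lia. reflexivity.
    + intros x X. rewrite C1, M2x by lia.
      (* Cells 2 and 3 are scratch and never copied. Their copies would lie beyond the input and
         still hold 0, which is the right value. *)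
      destruct (Nat.eq_dec x 2) as [->|N2'].
      { rewrite A3, inp2 by (cbn; rewrite in_seq; lia). apply inpz. lia. }
      destruct (Nat.eq_dec x 3) as [->|N3'].
      { rewrite A3, inp3 by (cbn; rewrite in_seq; lia). apply inpz. lia. }
      apply A2; auto. left. cbn. rewrite in_seq. lia.
    + intros a Ha. rewrite C2 by lia. lia.
    + intros a z Ha. rewrite Lz. unfold init. destruct a; [lia|reflexivity].
    + intros a v z Ha _. apply Lz.
  - intros a Ha. rewrite C2 by lia. lia.
Qed.

End Prologue.

(** * The choice of the word size *)

Fixpoint Kexp (a b D L : nat) : nat :=
  match L with
  | O => a
  | S L => b + 2 + D * Kexp a b D L
  end.

(** The tower of bounds has as many storeys as the program has levels, so a polynomial in [X]
    results, with an exponent that depends on the program alone. *)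
Lemma K_exp X a b D L : 2 <= X ->
  K (X ^ Z.of_nat a) (X ^ Z.of_nat b) D L <= X ^ Z.of_nat (Kexp a b D L).
Proof.
  intros HX. assert (P : forall k, 0 < X ^ Z.of_nat k) by (intros; apply Z.pow_pos_nonneg; lia).
  assert (Q : forall L, 0 <= K (X ^ Z.of_nat a) (X ^ Z.of_nat b) D L).
  { intros l. induction l; cbn [K]; [specialize (P a); lia|].
    pose proof (P b). assert (0 <= K (X ^ Z.of_nat a) (X ^ Z.of_nat b) D l ^ Z.of_nat D)
      by (apply Z.pow_nonneg; lia). nia. }
  induction L as [|L IH]; [cbn; lia|]. cbn [K Kexp].
  replace (Z.of_nat (b + 2 + D * Kexp a b D L)) with
    ((Z.of_nat b + 2) + Z.of_nat (Kexp a b D L) * Z.of_nat D) by nia.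
  rewrite Z.pow_add_r, Z.pow_mul_r, Z.pow_add_r by lia.
  pose proof (P b). specialize (Q L).
  assert (K (X ^ Z.of_nat a) (X ^ Z.of_nat b) D L ^ Z.of_nat D <= (X ^ Z.of_nat (Kexp a b D L)) ^ Z.of_nat D)
    by (apply Z.pow_le_mono_l; lia).
  assert (0 <= K (X ^ Z.of_nat a) (X ^ Z.of_nat b) D L ^ Z.of_nat D) by (apply Z.pow_nonneg; lia).
  apply Z.mul_le_mono_nonneg; try lia.
  rewrite Z.pow_2_r. assert (4 <= X * X) by nia.
  assert (X ^ Z.of_nat b * 4 <= X ^ Z.of_nat b * (X * X)) by (apply Z.mul_le_mono_nonneg_l; lia). lia.
Qed.

(** Chosen so that [2 ^ word_size k n] is exactly [width n ^ k]. *)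
Definition width (n : nat) : Z := 2 ^ (Z.of_nat (Nat.log2 n + 1)).

Lemma width_gt n : Z.of_nat n < width n.
Proof.
  unfold width. destruct n as [|n]; [cbn; lia|].
  pose proof (Nat.log2_spec (S n) ltac:(lia)) as [_ H].
  replace (Nat.log2 (S n) + 1)%nat with (S (Nat.log2 (S n))) by lia.
  apply inj_lt in H. rewrite Nat2Z.inj_pow in H. exact H.
Qed.

Lemma width_ge2 n : 2 <= width n.
Proof.
  unfold width. change 2 with (2 ^ 1) at 1. apply Z.pow_le_mono_r; lia.
Qed.

(** The factor [k] is fixed before [n]: a stratified program of polynomial cost on polynomially
    bounded input runs on words of O(log n) bits, at a constant number of instructions per unit of
    cost. *)
Theorem compile_ram (c : cmd) (lev : nat -> nat) (NA Lm out : nat) (a b : nat) :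
  cwf NA c = true -> wt lev c = true -> (forall x, lev x <= Lm)%nat -> (1 <= Lm)%nat -> lev 0%nat = 0%nat ->
  (1 <= out < NA)%nat ->
  exists (k : nat) (P : program) (kappa : Z), 0 <= kappa /\
  forall (n : nat) (inp : memory),
    inp 0%nat = Z.of_nat n -> inp 2%nat = 0 -> inp 3%nat = 0 ->
    (forall x, 2 * (Z.of_nat n * Z.of_nat n) + 2 <= Z.of_nat x -> inp x = 0) ->
    (forall x, Z.abs (inp x) <= width n ^ Z.of_nat a) ->
    cost c (init n inp) <= width n ^ Z.of_nat b ->
    exists (T : nat) (m : memory),
      exec P (word_size k n) T 0%nat inp = Some m /\
      Z.of_nat T <= kappa * cost c (init n inp) /\
      m 0%nat = sem c (init n inp) out 0.
Proof.
  intros Wf W HL L1 L0 Ho.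
  set (r := (2 + NA)%nat).
  set (R := (r + Nat.max (cdp c) 20)%nat).
  set (D := Nat.max 14 (cdg c)).
  (* Since [j < X^j], the surplus over [a] makes [X^a'] exceed [SH + 3 * R + 4], that is, the input
     length, the shifted registers and the constants of the prologue. *)
  set (a' := (a + 3 * R + 8)%nat).
  set (kk := Kexp a' b D Lm).
  (* [V^D] is at most [X ^ (kk * D)]. The two further factors [X >= 2] make [2 ^ w] at least four
     times that, hence [half w] at least twice. *)
  set (k := (kk * D + 2)%nat).
  set (pro := prologue NA R).
  set (cod := cc R (length pro) r c).
  set (epi := ce R r (Get out (Cst 0)) ++ [IConst (r+1) 0; IAdd 0 r (r+1)]%nat).
  set (P := pro ++ cod ++ epi).
  exists k, P, (Z.of_nat (length pro + kap c + length epi + 1)). split; [lia|].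
  intros n inp i0 i2 i3 iz ib ic.
  set (X := width n) in *. pose proof (width_ge2 n) as X2. fold X in X2.
  pose proof (width_gt n) as Xn. fold X in Xn.
  set (w := word_size k n).
  set (V0 := X ^ Z.of_nat a'). set (T := X ^ Z.of_nat b) in *.
  set (V := K V0 T D Lm).
  assert (PX : forall j, 0 < X ^ Z.of_nat j) by (intros; apply Z.pow_pos_nonneg; lia).
  assert (MX : forall i j, (i <= j)%nat -> X ^ Z.of_nat i <= X ^ Z.of_nat j)
    by (intros; apply Z.pow_le_mono_r; lia).
  assert (SX : forall j, X ^ Z.of_nat (S j) = X * X ^ Z.of_nat j)
    by (intros; rewrite Nat2Z.inj_succ, Z.pow_succ_r by lia; reflexivity).
  assert (LX : forall j, Z.of_nat j < X ^ Z.of_nat j).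
  { induction j; [cbn; lia|]. rewrite SX. pose proof (PX j). nia. }
  set (SH := 2 * (Z.of_nat n * Z.of_nat n) + 2).
  assert (V0b : SH + 3 * Z.of_nat R + 4 <= V0).
  { unfold V0, a'.
    replace (a + 3 * R + 8)%nat with (S (S (S (S (S (a + 3 * R + 3)))))) by lia.
    rewrite !SX. pose proof (LX (a + 3 * R + 3)%nat).
    set (Y := X ^ Z.of_nat (a + 3 * R + 3)) in *. unfold SH.
    assert (Y1 : 3 * Z.of_nat R + 1 <= Y) by lia. clearbody Y.
    clear - X2 Xn Y1.
    assert (A1 : Z.of_nat n * Z.of_nat n <= X * X) by nia.
    assert (A2 : 4 <= X * X) by nia.
    replace (X * (X * (X * (X * (X * Y))))) with ((X * X) * (X * X) * X * Y) by ring.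
    set (Q := X * X) in *. clearbody Q.
    assert (A3 : 4 * Q <= Q * Q) by nia.
    assert (A4 : 8 * Q <= Q * Q * X) by nia.
    set (M := Q * Q * X) in *. clearbody M.
    assert (M + Y - 1 <= M * Y) by nia. lia. }
  assert (SHp : 2 <= SH) by (unfold SH; nia).
  assert (V04 : 4 <= V0) by lia.
  assert (T0 : 0 <= T) by (pose proof (PX b); unfold T; lia).
  assert (D1 : (1 <= D)%nat) by lia.
  assert (VV0 : V0 <= V) by (apply (K_mono V0 T D V04 T0 D1 0 Lm); lia).
  assert (VT : T <= V).
  { pose proof (K_mono V0 T D V04 T0 D1 1 Lm L1) as Q. cbn [K] in Q.
    pose proof (Vpow_pos V0 V04 D). fold V in Q. nia. }
  assert (VD : V ^ Z.of_nat D < half w).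
  { pose proof (K_exp X a' b D Lm X2) as Q. fold V0 T V kk in Q.
    assert (V ^ Z.of_nat D <= (X ^ Z.of_nat kk) ^ Z.of_nat D) by (apply Z.pow_le_mono_l; lia).
    rewrite <- Z.pow_mul_r, <- Nat2Z.inj_mul in H by lia.
    assert (E : 2 ^ Z.of_nat w = X ^ Z.of_nat k).
    { unfold w, word_size, X, width. rewrite <- Z.pow_mul_r by lia. f_equal. lia. }
    assert (Hw : (1 <= w)%nat).
    { unfold w, word_size, k. nia. }
    assert (E2 : 2 ^ Z.of_nat w = 2 * half w).
    { unfold half. rewrite <- Z.pow_succ_r by lia. f_equal. lia. }
    unfold k in E. replace (kk * D + 2)%nat with (S (S (kk * D))) in E by lia.
    rewrite !SX in E. pose proof (PX (kk * D)%nat) as PY.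
    set (Y := X ^ Z.of_nat (kk * D)) in *.
    assert (4 * Y <= X * (X * Y)) by (clearbody Y; clear - X2 PY; assert (2 * Y <= X * Y) by nia; nia).
    lia. }
  assert (Wsm : forall z, 0 <= z <= SH + 3 * Z.of_nat R -> wrap w z = z).
  { intros z Hz. apply (wrapV w V D ltac:(lia) ltac:(lia) VD). lia. }
  destruct (prologue_ok NA R n w inp) as [Rp Vr]; auto; try (unfold R, r; lia).
  fold SH in Rp. fold pro in Rp, Vr.
  assert (Cpro : code_at P 0 pro) by (exists [], (cod ++ epi); auto).
  assert (Ccod : code_at P (length pro) cod) by (exists pro, epi; auto).
  assert (Cepi : code_at P (length pro + length cod) epi).
  { exists (pro ++ cod), []. rewrite length_app, app_nil_r, <- app_assoc. auto. }
  pose proof (runs_sl P w pro 0 inp Cpro) as R1. cbn [Nat.add] in R1.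
  assert (Sp : forallb straight pro = true).
  { unfold pro, prologue, setup. rewrite !forallb_app, flat_map_straight by reflexivity.
    cbn. induction (seq 1 (NA - 1)); auto. }
  specialize (R1 Sp). set (m1 := sl w pro inp) in *.
  assert (LI : linv lev V0 T D 0 (init n inp)).
  { intros x z. unfold lbd, init. destruct (Nat.eqb_spec x 0) as [->|Hx].
    - rewrite L0. pose proof (ib (Z.to_nat (z mod (2 * (Z.of_nat n * Z.of_nat n) + 2)))).
      pose proof (MX a a' ltac:(lia)). fold V0 in H0. lia.
    - cbn [Z.abs]. destruct (lev x); [lia|].
      assert (0 <= K V0 T D n0 ^ Z.of_nat D).
      { apply Z.pow_nonneg. pose proof (K4 V0 T D V04 T0 D1 n0). lia. } lia. }
  destruct (wt_safe lev V0 T D Lm V04 T0 D1 HL c (init n inp) 0 W ltac:(lia) ltac:(lia) LI ltac:(lia)) as [Sf LI2].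
  fold V in Sf.
  pose proof (cost_pos c (init n inp)) as Cp.
  destruct (cc_ok NA R inp SH w V D) with (P := P) (c := c) (pc := length pro) (r := r) (s := init n inp) (m := m1) (tau := 0)
    as (m2 & t2 & B1 & B2 & B3 & B4 & B5); auto; try (unfold R, r; lia); try lia.
  fold cod in B1.
  pose proof (linv_bnd lev V0 T D Lm V04 T0 D1 HL (sem c (init n inp)) (0 + cost c (init n inp)) ltac:(lia) LI2) as Bn. fold V in Bn.
  assert (Hr : forall r' m, rep NA R inp SH (sem c (init n inp)) m -> vers NA (0 + cost c (init n inp)) m -> r' = r ->
    sl w (ce R r' (Get out (Cst 0))) m r' = sem c (init n inp) out 0).
  { intros r' m Q1 Q2 ->.
    apply (ce_ok NA R inp SH w V D) with (s := sem c (init n inp)) (e := Get out (Cst 0)) (tau := 0 + cost c (init n inp));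
      auto; try (unfold R, r; cbn [edp]; lia); try lia.
    - cbn [ewf]. rewrite andb_true_r. apply Nat.ltb_lt. lia.
    - cbn [dg]. change (Z.to_nat (Z.log2 (Z.abs 0))) with 0%nat. lia. }
  specialize (Hr r m2 B2 B3 eq_refl).
  pose proof (runs_sl P w epi _ m2 Cepi) as R3.
  assert (Se : forallb straight epi = true) by (unfold epi; now rewrite forallb_app, ce_straight).
  specialize (R3 Se).
  exists (length pro + (t2 + (length epi + 1)))%nat, (sl w epi m2).
  split; [|split].
  - rewrite R1, B1, R3. cbn [exec].
    replace (nth_error P (length pro + length cod + length epi)) with (@None instr); [reflexivity|].
    symmetry. apply nth_error_None. unfold P. rewrite !length_app. lia.
  - nia.
  - unfold epi. rewrite sl_app. set (m3 := sl w (ce R r (Get out (Cst 0))) m2) in *.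
    cbn [sl fold_left step1]. unfold binop. rewrite upd_same.
    rewrite upd_same, upd_diff by lia. rewrite Hr.
    specialize (Bn out 0).
    rewrite (wrapV w V D ltac:(lia) ltac:(lia) VD 0) by lia.
    rewrite Z.add_0_r. apply (wrapV w V D ltac:(lia) ltac:(lia) VD). lia.
Qed.

(** * Finite sums *)

Fixpoint sumz (n : nat) (f : Z -> Z) : Z :=
  match n with
  | O => 0
  | S n => sumz n f + f (Z.of_nat n)
  end.

Definition zsum (n : Z) (f : Z -> Z) : Z := sumz (Z.to_nat n) f.

Lemma zsum_neg n f : n <= 0 -> zsum n f = 0.
Proof. intros H. unfold zsum. now replace (Z.to_nat n) with 0%nat by lia. Qed.

Lemma zsum_succ n f : 0 <= n -> zsum (n + 1) f = zsum n f + f n.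
Proof.
  intros H. unfold zsum. replace (Z.to_nat (n + 1)) with (S (Z.to_nat n)) by lia.
  cbn [sumz]. now rewrite Z2Nat.id.
Qed.

Lemma zsum_ind (P : Z -> Prop) : P 0 -> (forall n, 0 <= n -> P n -> P (n + 1)) -> forall n, 0 <= n -> P n.
Proof.
  intros H0 HS n Hn. rewrite <- (Z2Nat.id n Hn). induction (Z.to_nat n) as [|k IH]; [exact H0|].
  rewrite Nat2Z.inj_succ. apply HS; [lia|exact IH].
Qed.

Lemma zsum_ext n f g : (forall i, 0 <= i < n -> f i = g i) -> zsum n f = zsum n g.
Proof.
  destruct (Z.le_gt_cases n 0) as [L|L]; [intros; now rewrite !zsum_neg by lia|].
  revert n L. assert (G : forall n, 0 <= n -> (forall i, 0 <= i < n -> f i = g i) -> zsum n f = zsum n g).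
  { apply (zsum_ind (fun n => (forall i, 0 <= i < n -> f i = g i) -> zsum n f = zsum n g)).
    - intros. now rewrite !zsum_neg by lia.
    - intros n Hn IH H. rewrite !zsum_succ by lia. rewrite IH, H; [reflexivity|lia|intros; apply H; lia]. }
  intros n L. apply G. lia.
Qed.

Lemma zsum_zero n f : (forall i, 0 <= i < n -> f i = 0) -> zsum n f = 0.
Proof.
  intros H. rewrite (zsum_ext n f (fun _ => 0)) by exact H.
  destruct (Z.le_gt_cases n 0) as [L|L]; [now apply zsum_neg|].
  apply (zsum_ind (fun n => zsum n (fun _ => 0) = 0)); [reflexivity| |lia].
  intros m Hm IH. rewrite zsum_succ; lia.
Qed.

Lemma zsum_plus n f g : zsum n (fun i => f i + g i) = zsum n f + zsum n g.
Proof. unfold zsum. induction (Z.to_nat n); cbn [sumz]; lia. Qed.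

Lemma zsum_scale n c f : zsum n (fun i => c * f i) = c * zsum n f.
Proof. unfold zsum. induction (Z.to_nat n); cbn [sumz]; lia. Qed.

Lemma zsum_scale_r n c f : zsum n (fun i => f i * c) = zsum n f * c.
Proof. unfold zsum. induction (Z.to_nat n); cbn [sumz]; lia. Qed.

Lemma zsum_const n c : 0 <= n -> zsum n (fun _ => c) = n * c.
Proof. intros H. unfold zsum. rewrite <- (Z2Nat.id n H) at 2. induction (Z.to_nat n); cbn [sumz]; lia. Qed.

Lemma zsum_swap n m f : zsum n (fun i => zsum m (fun j => f i j)) = zsum m (fun j => zsum n (fun i => f i j)).
Proof.
  unfold zsum at 1. transitivity (zsum m (fun j => sumz (Z.to_nat n) (fun i => f i j))); [|reflexivity].
  induction (Z.to_nat n) as [|k IH]; cbn [sumz].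
  - symmetry. now apply zsum_zero.
  - now rewrite IH, <- zsum_plus.
Qed.

Lemma zsum_le n f g : (forall i, 0 <= i < n -> f i <= g i) -> zsum n f <= zsum n g.
Proof.
  destruct (Z.le_gt_cases n 0) as [L|L]; [intros; rewrite !zsum_neg by lia; lia|].
  revert n L. assert (G : forall n, 0 <= n -> (forall i, 0 <= i < n -> f i <= g i) -> zsum n f <= zsum n g).
  { apply (zsum_ind (fun n => (forall i, 0 <= i < n -> f i <= g i) -> zsum n f <= zsum n g)).
    - intros. rewrite !zsum_neg by lia. lia.
    - intros n Hn IH H. rewrite !zsum_succ by lia. specialize (IH ltac:(intros; apply H; lia)).
      specialize (H n ltac:(lia)). lia. }
  intros n L. apply G. lia.
Qed.

Lemma zsum_nonneg n f : (forall i, 0 <= i < n -> 0 <= f i) -> 0 <= zsum n f.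
Proof. intros H. rewrite <- (zsum_zero n (fun _ => 0)) by auto. now apply zsum_le. Qed.

Lemma zsum_delta n k f : 0 <= k < n -> zsum n (fun i => if i =? k then f i else 0) = f k.
Proof.
  intros H. assert (G : forall n, 0 <= n ->
    zsum n (fun i => if i =? k then f i else 0) = if (0 <=? k) && (k <? n) then f k else 0).
  { apply (zsum_ind (fun n => zsum n (fun i => if i =? k then f i else 0) = if (0 <=? k) && (k <? n) then f k else 0)).
    - rewrite zsum_neg by lia. destruct (Z.leb_spec 0 k), (Z.ltb_spec k 0); try lia; reflexivity.
    - intros m Hm IH. rewrite zsum_succ, IH by lia.
      destruct (Z.eqb_spec m k) as [E|E], (Z.leb_spec 0 k), (Z.ltb_spec k m), (Z.ltb_spec k (m + 1));
        cbn [andb]; try lia. now rewrite E. }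
  rewrite G by lia. destruct (Z.leb_spec 0 k), (Z.ltb_spec k n); try lia. reflexivity.
Qed.

Lemma zsum_delta_out n k f : ~ (0 <= k < n) -> zsum n (fun i => if i =? k then f i else 0) = 0.
Proof. intros H. apply zsum_zero. intros i Hi. destruct (Z.eqb_spec i k); [lia|reflexivity]. Qed.

Lemma zsum_app n m f : 0 <= n -> 0 <= m -> zsum (n + m) f = zsum n f + zsum m (fun i => f (n + i)).
Proof.
  intros Hn. revert m. apply (zsum_ind (fun m => zsum (n + m) f = zsum n f + zsum m (fun i => f (n + i)))).
  - rewrite Z.add_0_r, (zsum_neg 0) by lia. lia.
  - intros m Hm IH. rewrite Z.add_assoc, !zsum_succ by lia. lia.
Qed.

Lemma zsum_blocks a b f : 0 <= a -> 0 <= b ->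
  zsum (a * b) f = zsum a (fun i => zsum b (fun j => f (i * b + j))).
Proof.
  intros Ha Hb. revert a Ha.
  apply (zsum_ind (fun a => zsum (a * b) f = zsum a (fun i => zsum b (fun j => f (i * b + j))))).
  - reflexivity.
  - intros a Ha IH. rewrite zsum_succ by lia. rewrite <- IH.
    replace ((a + 1) * b) with (a * b + b) by ring. rewrite zsum_app by nia. reflexivity.
Qed.

Lemma zsum_pos_ex n f : 0 < zsum n f -> exists i, 0 <= i < n /\ 0 < f i.
Proof.
  unfold zsum. intros H. assert (G : exists i, (i < Z.to_nat n)%nat /\ 0 < f (Z.of_nat i)).
  { induction (Z.to_nat n) as [|k IH]; cbn [sumz] in H; [lia|].
    destruct (Z.lt_ge_cases 0 (f (Z.of_nat k))) as [L|L].
    - exists k. split; [lia|exact L].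
    - destruct IH as (i & Hi & Hf); [lia|]. exists i. split; [lia|exact Hf]. }
  destruct G as (i & Hi & Hf). exists (Z.of_nat i). split; [lia|exact Hf].
Qed.

Lemma zsum_ge_term n f k : (forall i, 0 <= i < n -> 0 <= f i) -> 0 <= k < n -> f k <= zsum n f.
Proof.
  intros H Hk. rewrite <- (zsum_delta n k f Hk). apply zsum_le.
  intros i Hi. specialize (H i Hi). destruct (i =? k); lia.
Qed.

(** * Frames, accumulation loops and cost rules *)

Definition mem (a : nat) (l : list nat) : bool := existsb (Nat.eqb a) l.

Lemma mem_In a l : mem a l = true <-> In a l.
Proof.
  unfold mem. rewrite existsb_exists. split.
  - intros (x & Hx & E). apply Nat.eqb_eq in E. now subst.
  - intros H. exists a. now rewrite Nat.eqb_refl.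
Qed.

Lemma mem_app a l1 l2 : mem a (l1 ++ l2) = mem a l1 || mem a l2.
Proof. apply existsb_app. Qed.

Fixpoint wr (c : cmd) : list nat :=
  match c with
  | Skip => []
  | Put a _ _ => [a]
  | Clear a => [a]
  | Seq c1 c2 => wr c1 ++ wr c2
  | If _ c1 c2 => wr c1 ++ wr c2
  | For a _ c => a :: wr c
  end.

Fixpoint rd (e : expr) : list nat :=
  match e with
  | Cst _ => []
  | Get a e => a :: rd e
  | Bin _ e1 e2 => rd e1 ++ rd e2
  end.

Lemma set_other s a z v b y : b <> a -> set s a z v b y = s b y.
Proof. intros H. unfold set. apply Nat.eqb_neq in H. now rewrite H. Qed.

Lemma sem_frame c : forall s b, mem b (wr c) = false -> forall y, sem c s b y = s b y.
Proof.
  induction c as [|a e1 e2|a|c1 IH1 c2 IH2|e c1 IH1 c2 IH2|a e c IH]; intros s b; cbn [wr sem].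
  - reflexivity.
  - cbn. rewrite orb_false_r. intros H y. apply set_other. now apply Nat.eqb_neq.
  - cbn. rewrite orb_false_r. intros H y. unfold clr. now rewrite H.
  - rewrite mem_app. intros H y. apply orb_false_iff in H. destruct H. now rewrite IH2, IH1.
  - rewrite mem_app. intros H y. apply orb_false_iff in H. destruct H.
    destruct (eval e s =? 0); auto.
  - cbn. intros H y. apply orb_false_iff in H. destruct H as [H1 H2]. apply Nat.eqb_neq in H1.
    induction (Z.to_nat (eval e s)) as [|n IHn]; cbn [iter]; [reflexivity|].
    rewrite IH by exact H2. rewrite set_other by exact H1. exact IHn.
Qed.

Lemma eval_agree e s s' : (forall b, mem b (rd e) = true -> forall y, s b y = s' b y) ->
  eval e s = eval e s'.
Proof.
  induction e as [z|a e IH|o e1 IH1 e2 IH2]; intros H; cbn [eval]; [reflexivity| |].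
  - rewrite IH.
    + apply H. cbn. now rewrite Nat.eqb_refl.
    + intros b Hb. apply H. cbn. rewrite orb_true_iff. now right.
  - rewrite IH1, IH2; [reflexivity| |]; intros b Hb; apply H; cbn [rd]; rewrite mem_app, Hb;
      [apply orb_true_r|reflexivity].
Qed.

Definition op_dec (x y : op) : {x = y} + {x <> y}.
Proof. decide equality. Defined.

Definition expr_dec (x y : expr) : {x = y} + {x <> y}.
Proof. decide equality; [apply Z.eq_dec|apply Nat.eq_dec|apply op_dec]. Defined.

Definition Acc (X : nat) (e1 e2 : expr) : cmd := Put X e1 (Bin OAdd (Get X e1) e2).

(** The arrays on which the added values depend. The old content of the cell that is increased does
    not count, and a loop binds its counter. *)
Fixpoint fr (c : cmd) : list nat :=
  match c with
  | Put a e1 (Bin OAdd _ e2) => rd e1 ++ rd e2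
  | Seq c1 c2 => fr c1 ++ fr c2
  | If e c1 c2 => rd e ++ fr c1 ++ fr c2
  | For a e c => rd e ++ filter (fun b => negb (b =? a)%nat) (fr c)
  | _ => []
  end.

Definition disj (l1 l2 : list nat) : bool := forallb (fun a => negb (mem a l2)) l1.

Lemma disj_spec l1 l2 a : disj l1 l2 = true -> mem a l2 = true -> mem a l1 = false.
Proof.
  unfold disj. intros H1 H2. destruct (mem a l1) eqn:E; [|reflexivity].
  apply mem_In in E. rewrite forallb_forall in H1. specialize (H1 a E).
  now rewrite H2 in H1.
Qed.

(* A nest of loops and tests whose only effect on the heap is to add to cells of [X] values that do
   not depend on [X]. *)
Fixpoint accform (X : nat) (c : cmd) : bool :=
  match c with
  | Skip => true
  | Put a e1 (Bin OAdd (Get b e1') e2) =>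
      (a =? X)%nat && (b =? X)%nat && (if expr_dec e1 e1' then true else false) &&
      negb (mem X (rd e1)) && negb (mem X (rd e2))
  | Seq c1 c2 => accform X c1 && accform X c2 && disj (wr c1) (fr c2)
  | If e c1 c2 => negb (mem X (rd e)) && accform X c1 && accform X c2
  | For a e c => accform X c && negb (a =? X)%nat && negb (mem X (rd e)) && negb (mem a (wr c)) &&
      disj (wr c) (filter (fun b => negb (b =? a)%nat) (fr c))
  | _ => false
  end.

(** The total that [c] adds to cell [z] of its accumulator. Loops turn into sums, so that loop nests
    are verified by rewriting sums instead of by invariants. *)
Fixpoint contr (c : cmd) (s : state) (z : Z) : Z :=
  match c with
  | Put _ e1 (Bin OAdd _ e2) => if eval e1 s =? z then eval e2 s else 0
  | Seq c1 c2 => contr c1 s z + contr c2 s z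
  | If e c1 c2 => if eval e s =? 0 then contr c2 s z else contr c1 s z
  | For a e c => zsum (eval e s) (fun i => contr c (set s a 0 i) z)
  | _ => 0
  end.

(** Besides [X], such a command writes only loop counters, and these live at index 0. Binding a
    counter thus hides only its cell 0, while its other cells are unchanged. *)
Lemma acc_frame0 X c : accform X c = true -> forall s b y, b <> X -> y <> 0 -> sem c s b y = s b y.
Proof.
  induction c as [|a e1 e2|a|c1 IH1 c2 IH2|e c1 IH1 c2 IH2|a e c IH]; intros A s b y Hb Hy;
    cbn [accform sem] in *; try discriminate A.
  - reflexivity.
  - destruct e2 as [| |[] [|b' e1'|] e2]; try discriminate A.
    rewrite !andb_true_iff, Nat.eqb_eq in A. destruct A as ((((-> & _) & _) & _) & _).
    now apply set_other.
  - rewrite !andb_true_iff in A. destruct A as ((A1 & A2) & _). now rewrite IH2, IH1.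
  - rewrite !andb_true_iff in A. destruct A as ((_ & A1) & A2). destruct (eval e s =? 0); auto.
  - rewrite !andb_true_iff in A. destruct A as ((((A & _) & _) & _) & _).
    induction (Z.to_nat (eval e s)) as [|n IHn]; cbn [iter]; [reflexivity|].
    rewrite IH by assumption. unfold set. apply Z.eqb_neq in Hy. now rewrite Hy, andb_false_r.
Qed.

Lemma contr_agree X c : accform X c = true -> forall s s' z,
  (forall b, mem b (fr c) = true -> forall y, s b y = s' b y) ->
  (forall b y, b <> X -> y <> 0 -> s b y = s' b y) ->
  contr c s z = contr c s' z.
Proof.
  induction c as [|a e1 e2|a|c1 IH1 c2 IH2|e c1 IH1 c2 IH2|a e c IH]; intros A s s' z H H0;
    cbn [contr fr accform] in *; try reflexivity.
  - destruct e2 as [| |[] e2' e2]; try reflexivity.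
    rewrite (eval_agree e1 s s'), (eval_agree e2 s s'); [reflexivity| |];
      intros b Hb; apply H; rewrite mem_app, Hb; [apply orb_true_r|reflexivity].
  - rewrite !andb_true_iff in A. destruct A as ((A1 & A2) & _).
    rewrite (IH1 A1 s s'), (IH2 A2 s s'); auto;
      intros b Hb; apply H; rewrite mem_app, Hb; [apply orb_true_r|reflexivity].
  - rewrite !andb_true_iff in A. destruct A as ((_ & A1) & A2).
    rewrite (eval_agree e s s').
    2:{ intros b Hb. apply H. now rewrite mem_app, Hb. }
    rewrite (IH1 A1 s s'), (IH2 A2 s s'); auto;
      intros b Hb; apply H; rewrite !mem_app, Hb, ?orb_true_r; reflexivity.
  - rewrite !andb_true_iff in A. destruct A as ((((A & A1) & _) & _) & _).
    apply negb_true_iff, Nat.eqb_neq in A1.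
    rewrite (eval_agree e s s').
    2:{ intros b Hb. apply H. now rewrite mem_app, Hb. }
    apply zsum_ext. intros i _. apply IH; [exact A| |].
    + intros b Hb y. unfold set.
      destruct (Nat.eqb_spec b a) as [->|Hba]; cbn [andb].
      * destruct (Z.eqb_spec y 0); [reflexivity|]. now apply H0.
      * apply H. rewrite mem_app, orb_true_iff. right. apply mem_In, filter_In.
        split; [now apply mem_In|]. now apply negb_true_iff, Nat.eqb_neq.
    + intros b y Hb Hy. unfold set. apply Z.eqb_neq in Hy as Hy'. rewrite Hy', andb_false_r. auto.
Qed.

Lemma acc_sem X c : accform X c = true -> forall s z, sem c s X z = s X z + contr c s z.
Proof.
  induction c as [|a e1 e2|a|c1 IH1 c2 IH2|e c1 IH1 c2 IH2|a e c IH]; intros A s z;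
    cbn [contr accform sem] in *; try discriminate A.
  - lia.
  - destruct e2 as [| |[] [|b' e1'|] e2]; try discriminate A.
    rewrite !andb_true_iff, !Nat.eqb_eq in A. destruct A as ((((-> & ->) & A) & _) & _).
    destruct (expr_dec e1 e1') as [<-|]; [|discriminate A].
    cbn [eval opsem]. unfold set. rewrite Nat.eqb_refl. cbn [andb].
    rewrite (Z.eqb_sym z). destruct (Z.eqb_spec (eval e1 s) z) as [<-|]; lia.
  - rewrite !andb_true_iff in A. destruct A as ((A1 & A2) & Dj).
    rewrite IH2, IH1 by assumption.
    rewrite (contr_agree X c2 A2 (sem c1 s) s); [lia| |].
    + intros b Hb y. apply sem_frame. eapply disj_spec; eassumption.
    + intros b y Hb Hy. now apply (acc_frame0 X).
  - rewrite !andb_true_iff in A. destruct A as ((_ & A1) & A2). destruct (eval e s =? 0); auto.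
  - pose proof A as A'. rewrite !andb_true_iff in A.
    destruct A as ((((A & A1) & _) & A3) & Dj). apply negb_true_iff in A1, A3.
    apply Nat.eqb_neq in A1. unfold zsum.
    set (F := fun i s => sem c (set s a 0 i)).
    assert (G : forall n, iter F n s X z = s X z + sumz n (fun i => contr c (set s a 0 i) z) /\ (forall b y, b <> a -> mem b (wr c) = false -> iter F n s b y = s b y) /\ (forall b y, b <> X -> y <> 0 -> iter F n s b y = s b y)).
    { induction n as [|n (I1 & I2 & I3)]; cbn [iter sumz].
      - split; [lia|]. split; auto.
      - split; [|split].
        + unfold F at 1. rewrite IH by exact A. rewrite set_other by auto. rewrite I1.
          rewrite (contr_agree X c A (set (iter F n s) a 0 (Z.of_nat n)) (set s a 0 (Z.of_nat n))); [lia| |].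
          * intros b Hb y. unfold set. destruct (Nat.eqb_spec b a) as [->|Hba]; cbn [andb].
            -- destruct (Z.eqb_spec y 0); [reflexivity|]. now apply I3.
            -- apply I2; [exact Hba|]. apply (disj_spec _ _ _ Dj). apply mem_In, filter_In.
               split; [now apply mem_In|]. now apply negb_true_iff, Nat.eqb_neq.
          * intros b y Hb Hy. unfold set. apply Z.eqb_neq in Hy as Hy'. rewrite Hy', andb_false_r. auto.
        + intros b y Hb Hw. unfold F at 1. rewrite sem_frame by exact Hw. now rewrite set_other, I2.
        + intros b y Hb Hy. unfold F at 1. rewrite (acc_frame0 X) by assumption.
          unfold set. apply Z.eqb_neq in Hy as Hy'. rewrite Hy', andb_false_r. auto. }
    apply G.
Qed.

(** The invariant sees the cost spent so far. The main loop needs this to charge pivots to newly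
    settled pairs instead of to iterations. *)
Lemma for_amort (I : Z -> state -> Z -> Prop) a e c s n :
  eval e s = n -> 0 <= n -> I 0 s 0 ->
  (forall i s' k, 0 <= i < n -> I i s' k ->
     I (i + 1) (sem c (set s' a 0 i)) (k + 1 + cost c (set s' a 0 i))) ->
  exists k, I n (sem (For a e c) s) k /\ cost (For a e c) s = 1 + k.
Proof.
  intros He Hn H0 HS. cbn [sem cost]. rewrite He.
  set (F := fun i s => sem c (set s a 0 i)). set (G := fun i s => cost c (set s a 0 i)).
  exists (itcost F G (Z.to_nat n) s). split; [|reflexivity].
  assert (Q : forall k, (k <= Z.to_nat n)%nat -> I (Z.of_nat k) (iter F k s) (itcost F G k s)).
  { induction k as [|k IH]; intros Hk; [exact H0|]. cbn [iter itcost].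
    replace (Z.of_nat (S k)) with (Z.of_nat k + 1) by lia.
    rewrite Z.add_assoc. apply HS; [lia|]. apply IH. lia. }
  specialize (Q (Z.to_nat n) ltac:(lia)). now rewrite Z2Nat.id in Q.
Qed.

Lemma for_rule (I : Z -> state -> Prop) a e c s n t :
  eval e s = n -> 0 <= n -> I 0 s ->
  (forall i s', 0 <= i < n -> I i s' ->
     I (i + 1) (sem c (set s' a 0 i)) /\ cost c (set s' a 0 i) <= t) ->
  I n (sem (For a e c) s) /\ cost (For a e c) s <= 1 + n * (1 + t).
Proof.
  intros He Hn H0 HS.
  destruct (for_amort (fun i s k => I i s /\ k <= i * (1 + t)) a e c s n) as (k & (A & B) & C); auto.
  - split; [exact H0|lia].
  - intros i s' k Hi [A B]. destruct (HS i s' Hi A) as [A' B']. split; [exact A'|lia].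
  - split; [exact A|lia].
Qed.

Definition agr (l : list nat) (s s' : state) : Prop :=
  forall b, mem b l = false -> forall y, s' b y = s b y.

Definition inclb (l1 l2 : list nat) : bool := forallb (fun a => mem a l2) l1.

Lemma inclb_spec l1 l2 b : inclb l1 l2 = true -> mem b l2 = false -> mem b l1 = false.
Proof.
  unfold inclb. intros H1 H2. destruct (mem b l1) eqn:E; [|reflexivity].
  apply mem_In in E. rewrite forallb_forall in H1. rewrite (H1 b E) in H2. discriminate.
Qed.

Lemma inclb_app l1 l2 l : inclb (l1 ++ l2) l = inclb l1 l && inclb l2 l.
Proof. apply forallb_app. Qed.

Lemma inclb_trans l1 l2 l3 : inclb l2 l3 = true -> inclb l1 l2 = true -> inclb l1 l3 = true.
Proof.
  unfold inclb. rewrite !forallb_forall. intros H1 H2 x Hx. apply H1, mem_In, H2, Hx.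
Qed.

(** The bound holds in every state that agrees with [s] outside [l]. Since loop bounds lie outside
    what a nest writes, the cost of a whole nest can be read off its initial state without following
    the states inside. *)
Definition cle (l : list nat) (c : cmd) (s : state) (t : Z) : Prop :=
  forall s', agr l s s' -> cost c s' <= t.

Lemma agr_refl l s : agr l s s.
Proof. now intros b _ y. Qed.

Lemma agr_sem l c s s' : inclb (wr c) l = true -> agr l s s' -> agr l s (sem c s').
Proof. intros W A b Hb y. rewrite sem_frame; [now apply A|]. now apply (inclb_spec _ l). Qed.

Lemma agr_set l s s' a z v : mem a l = true -> agr l s s' -> agr l s (set s' a z v).
Proof. intros W A b Hb y. rewrite set_other; [now apply A|]. intros ->. congruence. Qed.

Lemma eval_agr l e s s' : disj l (rd e) = true -> agr l s s' -> eval e s' = eval e s.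
Proof. intros Dj A. apply eval_agree. intros b Hb y. apply A. eapply disj_spec; eassumption. Qed.

Lemma cle_put l a e1 e2 s : cle l (Put a e1 e2) s 1.
Proof. intros s' _. cbn. lia. Qed.

Lemma cle_skip l s : cle l Skip s 1.
Proof. intros s' _. cbn. lia. Qed.

Lemma cle_clear l a s : cle l (Clear a) s 1.
Proof. intros s' _. cbn. lia. Qed.

Lemma cle_seq l c1 c2 s t1 t2 : inclb (wr c1) l = true -> cle l c1 s t1 -> cle l c2 s t2 ->
  cle l (Seq c1 c2) s (t1 + t2).
Proof.
  intros W H1 H2 s' A. cbn [cost]. pose proof (H1 s' A).
  pose proof (H2 (sem c1 s') (agr_sem l c1 s s' W A)). lia.
Qed.

Lemma cle_if l e c1 c2 s t1 t2 : cle l c1 s t1 -> cle l c2 s t2 ->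
  cle l (If e c1 c2) s (t1 + t2).
Proof.
  intros H1 H2 s' A. cbn [cost]. pose proof (H1 s' A). pose proof (H2 s' A).
  pose proof (cost_pos c1 s'). pose proof (cost_pos c2 s').
  destruct (eval e s' =? 0); lia.
Qed.

(** [1 + n * (1 + t)] is at most [3 * (n * t)] for positive [n] and [t]. The multiplicative form
    makes the bounds of nested loops multiply. *)
Lemma cle_for l a e c s n t : mem a l = true -> inclb (wr c) l = true -> disj l (rd e) = true ->
  eval e s <= n -> cle l c s t -> 1 <= n -> 1 <= t -> cle l (For a e c) s (3 * (n * t)).
Proof.
  intros Ha W Dj He H Hn Ht s' A.
  assert (Ev : eval e s' = eval e s) by (now apply (eval_agr l)).
  destruct (Z.le_gt_cases (eval e s) 0) as [L|L].
  - cbn [cost]. rewrite Ev. replace (Z.to_nat (eval e s)) with 0%nat by lia. cbn [itcost]. nia.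
  - destruct (for_rule (fun _ s0 => agr l s s0) a e c s' (eval e s) t) as [_ Q]; auto; [lia| |].
    + intros i s0 Hi A0. assert (A1 : agr l s (set s0 a 0 i)) by now apply agr_set.
      split; [now apply agr_sem|]. now apply H.
    + assert (eval e s * (1 + t) <= n * (1 + t)) by nia. nia.
Qed.

Lemma cle_weaken l c s t t' : t <= t' -> cle l c s t -> cle l c s t'.
Proof. intros L H s' A. specialize (H s' A). lia. Qed.

Lemma cle_cost l c s t : cle l c s t -> cost c s <= t.
Proof. intros H. apply H. apply agr_refl. Qed.

(** * Strassen's identity and its tensor powers *)

(* The coefficients of Strassen's algorithm, each stored (plus one) in two bits: factor [kp] (left,
   right, output), product [r], block row [x], block column [y]. *)
Definition strassen_code : Z := 126541751838454204562060007679087166539852026389910.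

Definition coef (kp r x y : Z) : Z :=
  Z.shiftr strassen_code (Z.max 0 (2 * (kp * 28 + r * 4 + x * 2 + y))) mod 4 - 1.

(** The tensor power multiplies the coefficients digit by digit, in base 7 for the product and in
    base 2 for row and column. *)
Fixpoint tcoef (d : nat) (kp r x y : Z) : Z :=
  match d with
  | O => 1
  | S d => tcoef d kp (r / 7) (x / 2) (y / 2) * coef kp (r mod 7) (x mod 2) (y mod 2)
  end.

Definition dlt (a b : Z) : Z := if a =? b then 1 else 0.

Lemma coef_abs kp r x y : 0 <= kp < 3 -> 0 <= r < 7 -> 0 <= x < 2 -> 0 <= y < 2 ->
  Z.abs (coef kp r x y) <= 1.
Proof.
  intros Hk Hr Hx Hy.
  assert (G : forallb (fun kp => forallb (fun r => forallb (fun x => forallb (fun y =>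
     Z.abs (coef kp r x y) <=? 1) [0;1]) [0;1]) [0;1;2;3;4;5;6]) [0;1;2] = true)
    by (vm_compute; reflexivity).
  rewrite forallb_forall in G. specialize (G kp ltac:(cbn; lia)).
  rewrite forallb_forall in G. specialize (G r ltac:(cbn; lia)).
  rewrite forallb_forall in G. specialize (G x ltac:(cbn; lia)).
  rewrite forallb_forall in G. specialize (G y ltac:(cbn; lia)). now apply Z.leb_le.
Qed.

Lemma tcoef_abs d : forall kp r x y, 0 <= kp < 3 -> Z.abs (tcoef d kp r x y) <= 1.
Proof.
  induction d as [|d IH]; intros kp r x y Hk; cbn [tcoef]; [cbn; lia|].
  specialize (IH kp (r / 7) (x / 2) (y / 2) Hk).
  pose proof (coef_abs kp (r mod 7) (x mod 2) (y mod 2) Hk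
    ltac:(apply Z.mod_pos_bound; lia) ltac:(apply Z.mod_pos_bound; lia) ltac:(apply Z.mod_pos_bound; lia)).
  rewrite Z.abs_mul. nia.
Qed.

(** The Brent equations: they say that the seven products compute the multiplication of 2 by 2
    matrices. There are 64 cases, checked by evaluation. *)
Lemma strassen x y y' z x' z' : 0 <= x < 2 -> 0 <= y < 2 -> 0 <= y' < 2 -> 0 <= z < 2 ->
  0 <= x' < 2 -> 0 <= z' < 2 ->
  zsum 7 (fun r => coef 0 r x y * coef 1 r y' z * coef 2 r x' z') = dlt x x' * (dlt y y' * dlt z z').
Proof.
  intros H1 H2 H3 H4 H5 H6.
  assert (G : forallb (fun x => forallb (fun y => forallb (fun y' => forallb (fun z =>
     forallb (fun x' => forallb (fun z' =>
      zsum 7 (fun r => coef 0 r x y * coef 1 r y' z * coef 2 r x' z') =? dlt x x' * (dlt y y' * dlt z z'))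
      [0;1]) [0;1]) [0;1]) [0;1]) [0;1]) [0;1] = true)
    by (vm_compute; reflexivity).
  rewrite forallb_forall in G. specialize (G x ltac:(cbn; lia)).
  rewrite forallb_forall in G. specialize (G y ltac:(cbn; lia)).
  rewrite forallb_forall in G. specialize (G y' ltac:(cbn; lia)).
  rewrite forallb_forall in G. specialize (G z ltac:(cbn; lia)).
  rewrite forallb_forall in G. specialize (G x' ltac:(cbn; lia)).
  rewrite forallb_forall in G. specialize (G z' ltac:(cbn; lia)). now apply Z.eqb_eq.
Qed.

Lemma dlt_split a b : dlt a b = dlt (a / 2) (b / 2) * dlt (a mod 2) (b mod 2).
Proof.
  unfold dlt. pose proof (Z.div_mod a 2). pose proof (Z.div_mod b 2).
  destruct (Z.eqb_spec a b), (Z.eqb_spec (a / 2) (b / 2)), (Z.eqb_spec (a mod 2) (b mod 2)); subst; lia.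
Qed.

(** Both sides of the Brent equations are multiplicative in the digits. Writing [r = 7 i + j] splits
    off the last digit of every index. *)
Lemma tensor d : forall x y y' z x' z', 0 <= x < 2 ^ Z.of_nat d -> 0 <= y < 2 ^ Z.of_nat d ->
  0 <= y' < 2 ^ Z.of_nat d -> 0 <= z < 2 ^ Z.of_nat d -> 0 <= x' < 2 ^ Z.of_nat d ->
  0 <= z' < 2 ^ Z.of_nat d ->
  zsum (7 ^ Z.of_nat d) (fun r => tcoef d 0 r x y * tcoef d 1 r y' z * tcoef d 2 r x' z') =
  dlt x x' * (dlt y y' * dlt z z').
Proof.
  induction d as [|d IH]; intros x y y' z x' z' H1 H2 H3 H4 H5 H6.
  - change (2 ^ Z.of_nat 0) with 1 in *.
    replace x with 0 by lia. replace y with 0 by lia. replace y' with 0 by lia.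
    replace z with 0 by lia. replace x' with 0 by lia. replace z' with 0 by lia. reflexivity.
  - rewrite Nat2Z.inj_succ, Z.pow_succ_r in * by lia. rewrite (Z.mul_comm 7).
    rewrite zsum_blocks by (try apply Z.pow_nonneg; lia).
    assert (Hd : forall a, 0 <= a < 2 * 2 ^ Z.of_nat d -> 0 <= a / 2 < 2 ^ Z.of_nat d).
    { intros a Ha. split; [apply Z.div_pos; lia|]. apply Z.div_lt_upper_bound; lia. }
    assert (Hm : forall a, 0 <= a mod 2 < 2) by (intros; apply Z.mod_pos_bound; lia).
    erewrite zsum_ext.
    2:{ intros i Hi. erewrite zsum_ext.
        2:{ intros j Hj. cbn [tcoef].
            replace ((i * 7 + j) / 7) with i by (rewrite Z.div_add_l, Z.div_small; lia).
            replace ((i * 7 + j) mod 7) with j.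
            2:{ rewrite Z.add_comm, Z.mod_add, Z.mod_small; lia. }
            instantiate (1 := fun j => (tcoef d 0 i (x/2) (y/2) * tcoef d 1 i (y'/2) (z/2) * tcoef d 2 i (x'/2) (z'/2)) *
              (coef 0 j (x mod 2) (y mod 2) * coef 1 j (y' mod 2) (z mod 2) * coef 2 j (x' mod 2) (z' mod 2))).
            cbv beta. ring. }
        rewrite zsum_scale, strassen by auto. reflexivity. }
    rewrite zsum_scale_r, IH by auto.
    rewrite (dlt_split x x'), (dlt_split y y'), (dlt_split z z'). ring.
Qed.

Lemma zsum_prod n m f g : zsum n f * zsum m g = zsum n (fun i => zsum m (fun j => f i * g j)).
Proof.
  rewrite <- zsum_scale_r. apply zsum_ext. intros i _. now rewrite zsum_scale.
Qed.

Lemma zsum_dlt n k f : 0 <= k < n -> zsum n (fun i => f i * dlt i k) = f k.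
Proof.
  intros H. rewrite <- (zsum_delta n k f H). apply zsum_ext. intros i _. unfold dlt.
  destruct (i =? k); lia.
Qed.

Lemma tensor_mm d (a b : Z -> Z -> Z) x z : 0 <= x < 2 ^ Z.of_nat d -> 0 <= z < 2 ^ Z.of_nat d ->
  let Z2 := 2 ^ Z.of_nat d in
  zsum (7 ^ Z.of_nat d) (fun r => tcoef d 2 r x z *
    (zsum Z2 (fun x' => zsum Z2 (fun y => tcoef d 0 r x' y * a x' y)) *
     zsum Z2 (fun y => zsum Z2 (fun z' => tcoef d 1 r y z' * b y z')))) =
  zsum Z2 (fun y => a x y * b y z).
Proof.
  intros Hx Hz Z2. fold Z2 in Hx, Hz.
  transitivity (zsum (7 ^ Z.of_nat d) (fun r => zsum Z2 (fun x' => zsum Z2 (fun y => zsum Z2 (fun y' =>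
     zsum Z2 (fun z' => (a x' y * b y' z') *
       (tcoef d 0 r x' y * tcoef d 1 r y' z' * tcoef d 2 r x z))))))).
  { apply zsum_ext. intros r _. rewrite zsum_prod, <- zsum_scale. apply zsum_ext. intros x' _.
    transitivity (tcoef d 2 r x z * (zsum Z2 (fun y => tcoef d 0 r x' y * a x' y) *
      zsum Z2 (fun y => zsum Z2 (fun z' => tcoef d 1 r y z' * b y z')))).
    { f_equal. now rewrite zsum_scale. }
    rewrite zsum_prod, <- zsum_scale. apply zsum_ext. intros y _.
    rewrite <- zsum_scale. apply zsum_ext. intros y' _.
    rewrite <- !zsum_scale. apply zsum_ext. intros z' _. ring. }
  rewrite zsum_swap.
  transitivity (zsum Z2 (fun x' => zsum Z2 (fun y => zsum Z2 (fun y' => zsum Z2 (fun z' =>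
     (a x' y * b y' z') * (dlt x' x * (dlt y y' * dlt z' z))))))).
  { apply zsum_ext. intros x' Hx'. rewrite zsum_swap. apply zsum_ext. intros y Hy.
    rewrite zsum_swap. apply zsum_ext. intros y' Hy'. rewrite zsum_swap. apply zsum_ext. intros z' Hz'.
    rewrite zsum_scale. rewrite tensor by assumption. reflexivity. }
  transitivity (zsum Z2 (fun x' => zsum Z2 (fun y => a x' y * b y z) * dlt x' x)).
  { apply zsum_ext. intros x' Hx'. rewrite <- zsum_scale_r. apply zsum_ext. intros y Hy.
    transitivity (zsum Z2 (fun y' => (a x' y * b y' z * dlt x' x) * dlt y' y)).
    - apply zsum_ext. intros y' Hy'.
      rewrite <- (zsum_dlt Z2 z (fun z' => a x' y * b y' z' * dlt x' x * dlt y' y)) by exact Hz.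
      apply zsum_ext. intros z' _. replace (dlt y y') with (dlt y' y); [ring|].
      unfold dlt. now rewrite Z.eqb_sym.
    - now rewrite (zsum_dlt Z2 y (fun y' => a x' y * b y' z * dlt x' x)). }
  now rewrite (zsum_dlt Z2 x (fun x' => zsum Z2 (fun y => a x' y * b y z))).
Qed.

(** [u], [v], [w] are positions inside blocks. For fixed positions the identity is [tensor_mm] for
    matrices with one entry per block; the sum over [v] makes the seven-fold products ordinary
    products of blocks. *)
Lemma block_mm d bs (A B : Z -> Z -> Z) x z u w :
  let Z2 := 2 ^ Z.of_nat d in
  0 <= x < Z2 -> 0 <= z < Z2 -> 0 <= bs ->
  zsum (7 ^ Z.of_nat d) (fun r => tcoef d 2 r x z *
    zsum bs (fun v =>
     zsum Z2 (fun x' => zsum Z2 (fun y => tcoef d 0 r x' y * A (x' * bs + u) (y * bs + v))) *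
     zsum Z2 (fun y => zsum Z2 (fun z' => tcoef d 1 r y z' * B (y * bs + v) (z' * bs + w))))) =
  zsum (Z2 * bs) (fun k => A (x * bs + u) k * B k (z * bs + w)).
Proof.
  intros Z2 Hx Hz Hb.
  rewrite zsum_blocks by (try apply Z.pow_nonneg; lia). rewrite (zsum_swap Z2).
  erewrite zsum_ext. 2:{ intros r _. rewrite <- zsum_scale. reflexivity. }
  rewrite zsum_swap. apply zsum_ext. intros v _.
  exact (tensor_mm d (fun x' y => A (x' * bs + u) (y * bs + v)) (fun y z' => B (y * bs + v) (z' * bs + w)) x z Hx Hz).
Qed.

(** * The counting program *)

(* Prefixes: [v] for scalars, [a] for arrays, [l] for loop counters.  Array 0 is the input.  [N = B^q]
   nodes in [NB] blocks, [B = 2^E], [S7 = 7^E]; [M] open block pairs call for pivots; [Th] rows make a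
   class heavy, [R5] of them per column.  Matrices are cut into [Z * Z] blocks of size [b], which takes
   [Q7] products with the coefficients [T1].  The oracle runs for [TM] steps on words of [WP] bits,
   [MD = 2^WP].  [E], [W] are the graph (edges from low to high), [H] the settled pairs, [C] their
   counts so far, [LI], [LJ] the list of open block pairs. *)
Notation vB := 1%nat (only parsing).
Notation vE := 2%nat (only parsing).
Notation vS7 := 3%nat (only parsing).
Notation vN := 4%nat (only parsing).
Notation vY := 5%nat (only parsing).
Notation vM := 6%nat (only parsing).
Notation vTh := 7%nat (only parsing).
Notation vR5 := 8%nat (only parsing).
Notation vZ := 9%nat (only parsing).
Notation vb := 10%nat (only parsing).
Notation vNB := 11%nat (only parsing).
Notation vQ7 := 12%nat (only parsing).
Notation vL := 13%nat (only parsing).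
Notation vMD := 14%nat (only parsing).
Notation vWP := 15%nat (only parsing).
Notation vTM := 16%nat (only parsing).
Notation aE := 17%nat (only parsing).
Notation aW := 18%nat (only parsing).
Notation aT1 := 19%nat (only parsing).
Notation aT2 := 20%nat (only parsing).
Notation aH := 21%nat (only parsing).
Notation aC := 22%nat (only parsing).
Notation aPM := 23%nat (only parsing).
Notation vPC := 24%nat (only parsing).
Notation vCP := 25%nat (only parsing).
Notation vHLT := 26%nat (only parsing).
Notation aLI := 27%nat (only parsing).
Notation aLJ := 28%nat (only parsing).
Notation vcnt := 29%nat (only parsing).
Notation aCnt := 30%nat (only parsing).
Notation aMem := 31%nat (only parsing).
Notation aId := 32%nat (only parsing).
Notation aNh := 33%nat (only parsing).
Notation aA := 34%nat (only parsing).
Notation aBm := 35%nat (only parsing).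
Notation aD := 36%nat (only parsing).
Notation aAh := 37%nat (only parsing).
Notation aBh := 38%nat (only parsing).
Notation aPm := 39%nat (only parsing).
Notation vOut := 40%nat (only parsing).
Notation li := 41%nat (only parsing).
Notation lj := 42%nat (only parsing).
Notation lk := 43%nat (only parsing).
Notation lx := 44%nat (only parsing).
Notation ly := 45%nat (only parsing).
Notation lu := 46%nat (only parsing).
Notation lv := 47%nat (only parsing).
Notation lw := 48%nat (only parsing).
Notation lr := 49%nat (only parsing).
Notation lh := 50%nat (only parsing).
Notation vp := 51%nat (only parsing).
Notation lK := 52%nat (only parsing).
Notation lI := 53%nat (only parsing).
Notation lJ := 54%nat (only parsing).
Notation lkp := 55%nat (only parsing).
Notation ld := 56%nat (only parsing).
Notation lst := 57%nat (only parsing).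
Notation aBB := 58%nat (only parsing).
Notation lpw := 59%nat (only parsing).

Definition nids : nat := 60.

(** Two dependencies of an array on itself are cut by clamps: [aT1], of level 1, is recomputed from
    [aT2], of level 5, and the simulated memory [aPM] receives only self-copies, truth values,
    reduced words and the encoded instance. Loop counters, at level 4, are above every loop bound;
    the largest of these is [vTM], at level 3. *)
Definition levels : list nat :=
  [0; 1;1;1; 2;2;2;2;2;2;2;2;2;2;2;2;3; 1;1; 1;5; 1;5; 5; 1;2;1; 5;5;1; 1;5;2;1; 1;1;4;2;2;3; 6;
   4;4;4;4;4;4;4;4;4;4; 5; 4;4;4;4;4;4; 5; 4]%nat.

Definition lev (a : nat) : nat := nth a levels 1%nat.

Declare Scope prog_scope.
Delimit Scope prog_scope with P.
Notation "e1 + e2" := (Bin OAdd e1 e2) : prog_scope.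
Notation "e1 - e2" := (Bin OSub e1 e2) : prog_scope.
Notation "e1 * e2" := (Bin OMul e1 e2) : prog_scope.
Notation "e1 / e2" := (Bin ODiv e1 e2) : prog_scope.
Notation "e1 'mod' e2" := (Bin OMod e1 e2) : prog_scope.
Notation "e1 < e2" := (Bin OLt e1 e2) : prog_scope.
Notation "e1 == e2" := (Bin OEq e1 e2) (at level 70) : prog_scope.
Notation "<< e1 ; e2 >>" := (Bin OPair e1 e2) (e1 at level 69) : prog_scope.
Notation "c1 ;; c2" := (Seq c1 c2) (at level 100, right associativity) : prog_scope.
Bind Scope prog_scope with expr cmd.

Definition V (a : nat) : expr := Get a (Cst 0).
Arguments V a /.
Definition Ix (a : nat) (e1 e2 : expr) : expr := Get a (Bin OPair e1 e2).
Arguments Ix a e1 e2 /.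

Fixpoint epow (e : expr) (k : nat) : expr :=
  match k with
  | O => Cst 1
  | S k => Bin OMul e (epow e k)
  end.

Definition en : expr := Get 0%nat (Cst 0).
Definition et : expr := Get 0%nat (Cst 1).
Arguments en /.
Arguments et /.

Local Open Scope prog_scope.

(* [Xval i k] and [Yval k j] are the two sides [W_ik - W_ip] and [W_pj - W_kj] of Fredman's trick
   for the pivot [p]. *)
Definition Xok : expr := Ix aE (V li) (V lk) * Ix aE (V li) (V vp).
Definition Xval : expr := Ix aW (V li) (V lk) - Ix aW (V li) (V vp).
Definition Yok : expr := Ix aE (V lk) (V lj) * Ix aE (V vp) (V lj).
Definition Yval : expr := Ix aW (V vp) (V lj) - Ix aW (V lk) (V lj).
Arguments Xok /.
Arguments Xval /.
Arguments Yok /.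
Arguments Yval /.

(** The cells are addressed by the value itself, so that sparse memory serves as a perfect hash
    table for the classes of equal values in column [k]. *)
Definition c_classes : cmd :=
  For lk (V vN) (For li (V vN) (If Xok
    (Put aMem (<< V lk; << Xval; Ix aCnt (V lk) Xval >> >>) (V li) ;;
     Put aCnt (<< V lk; Xval >>) (Ix aCnt (V lk) Xval + Cst 1))
    Skip)).

(** Identifiers start at 1, so that the cleared value 0 marks a light class, including the empty
    one. *)
Definition c_ids : cmd :=
  For lk (V vN) (For li (V vN) (If
    (Xok * (Cst 1 - (Ix aCnt (V lk) Xval < V vTh)) * (Ix aId (V lk) Xval == Cst 0))
    (Put aNh (V lk) (Get aNh (V lk) + Cst 1) ;;
     Put aId (<< V lk; Xval >>) (Get aNh (V lk)))
    Skip)).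

Definition c_heavyA : cmd :=
  For lk (V vN) (For li (V vN) (If Xok
    (Acc aA (<< Ix aId (V lk) Xval; << V li; V lk >> >>) (Cst 1)) Skip)).

Definition c_heavyB : cmd :=
  For lk (V vN) (For lj (V vN) (If Yok
    (Acc aBm (<< Ix aId (V lk) Yval; << V lk; V lj >> >>) (Cst 1)) Skip)).

(** A class with identifier 0 has fewer than [Th] rows. Enumerating one for each of the [N^2]
    entries of the right side costs [N^2 * Th]. *)
Definition c_light : cmd :=
  For lk (V vN) (For lj (V vN) (If (Yok * (Ix aId (V lk) Yval == Cst 0))
    (For lx (Ix aCnt (V lk) Yval)
      (Acc aD (<< Ix aMem (V lk) (<< Yval; V lx >>); V lj >>) (Cst 1)))
    Skip)).

Definition tix (kp r x y : expr) : expr := << kp; << r; << x; y >> >> >>.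
Arguments tix kp r x y /.

(** The combinations are formed directly from the coefficients of the tensor power, without
    recursion. This takes [Q7 * N^2] steps, more than a recursive scheme would, but [Q7 * R5^2 <= N]
    keeps it within the budget. *)
Definition c_mmA : cmd :=
  For lr (V vQ7) (For lu (V vb) (For lv (V vb) (For lx (V vZ) (For ly (V vZ)
    (Acc aAh (<< V lr; << V lu; V lv >> >>)
      (Get aT1 (tix (Cst 0) (V lr) (V lx) (V ly)) *
       Get aA (<< V lh + Cst 1; << V lx * V vb + V lu; V ly * V vb + V lv >> >>))))))).

Definition c_mmB : cmd :=
  For lr (V vQ7) (For lu (V vb) (For lv (V vb) (For lx (V vZ) (For ly (V vZ)
    (Acc aBh (<< V lr; << V lu; V lv >> >>)
      (Get aT1 (tix (Cst 1) (V lr) (V lx) (V ly)) *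
       Get aBm (<< V lh + Cst 1; << V lx * V vb + V lu; V ly * V vb + V lv >> >>))))))).

Definition c_mmP : cmd :=
  For lr (V vQ7) (For lu (V vb) (For lw (V vb) (For lv (V vb)
    (Acc aPm (<< V lr; << V lu; V lw >> >>)
      (Get aAh (<< V lr; << V lu; V lv >> >>) * Get aBh (<< V lr; << V lv; V lw >> >>)))))).

Definition c_mmD : cmd :=
  For lr (V vQ7) (For lx (V vZ) (For lu (V vb) (For ly (V vZ) (For lw (V vb)
    (Acc aD (<< V lx * V vb + V lu; V ly * V vb + V lw >>)
      (Get aT1 (tix (Cst 2) (V lr) (V lx) (V ly)) * Get aPm (<< V lr; << V lu; V lw >> >>))))))).

Definition c_mm : cmd :=
  Clear aAh ;; Clear aBh ;; Clear aPm ;; c_mmA ;; c_mmB ;; c_mmP ;; c_mmD.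

Definition c_eqprod : cmd :=
  Clear aCnt ;; Clear aMem ;; Clear aId ;; Clear aNh ;; Clear aA ;; Clear aBm ;; Clear aD ;;
  c_classes ;; c_ids ;; c_heavyA ;; c_heavyB ;; c_light ;;
  For lh (V vR5) c_mm.

(* Node [u] of the oracle instance is node [vx u] of the graph; the three parts of [B] nodes are
   copies of the blocks [I], [K], [J]. *)
Definition vx (u : expr) : expr := Get aBB (u / V vB) * V vB + u mod V vB.
(** The difference 2 of the part numbers singles out edges between the copies of [I] and [J]. For a
    settled pair only this edge disappears: its end points may still serve as end points of open
    pairs, or in the middle. *)
Definition eg (u v : expr) : expr :=
  Ix aE (vx u) (vx v) * (Cst 1 - Ix aH (vx u) (vx v) * ((v / V vB - u / V vB) == Cst 2)).
Definition e3B : expr := Cst 3 * V vB.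
Arguments vx u /.
Arguments eg u v /.
Arguments e3B /.

Definition c_edge (u v : expr) : cmd :=
  Acc aPM (Cst 2 + Cst 2 * (V lu * e3B + V lv)) (eg u v) ;;
  Acc aPM (Cst 3 + Cst 2 * (V lu * e3B + V lv)) (eg u v * Ix aW (vx u) (vx v)).

Definition c_fill : cmd :=
  Acc aPM (Cst 0) e3B ;; Acc aPM (Cst 1) et ;;
  For lu e3B (For lv e3B (If (V lu / V vB < V lv / V vB) (c_edge (V lu) (V lv))
    (If (V lv / V vB < V lu / V vB) (c_edge (V lv) (V lu)) Skip))).

(** The residue is below [2^w], so the clamp changes nothing. It gives the result the level of
    [vMD], whereas the bare residue would have the level of the simulated memory itself. *)
Definition ewrap (x : expr) : expr :=
  Bin OClamp ((x + V vMD / Cst 2) mod V vMD) (V vMD) - V vMD / Cst 2.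
Arguments ewrap x /.

Definition pm (a : nat) : expr := Get aPM (Cst (Z.of_nat a)).
Arguments pm a /.

(** Arithmetic form of [Z.to_nat]: a negative address means cell 0. *)
Definition eaddr (x : expr) : expr := x * (Cst 0 < x).
Arguments eaddr x /.

(** The halting flag is raised before each dispatch and lowered by every instruction that continues.
    It stays up after [IHalt] and also when the program counter has left the program. *)
Definition nextpc (i : nat) : cmd := Put vPC (Cst 0) (Cst (Z.of_nat i + 1)%Z) ;; Put vHLT (Cst 0) (Cst 0).

Definition c_bin (o : op) (d a b : nat) : cmd :=
  Put aPM (Cst (Z.of_nat d)) (ewrap (Bin o (pm a) (pm b))).

Definition c_instr (i : nat) (ins : instr) : cmd :=
  match ins with
  | IHalt => Skip
  | IConst d z => Put aPM (Cst (Z.of_nat d)) (ewrap (Cst z)) ;; nextpc i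
  | IAdd d a b => c_bin OAdd d a b ;; nextpc i
  | ISub d a b => c_bin OSub d a b ;; nextpc i
  | IMul d a b => c_bin OMul d a b ;; nextpc i
  | IDiv d a b => c_bin ODiv d a b ;; nextpc i
  | IMod d a b => c_bin OMod d a b ;; nextpc i
  | IAnd d a b => c_bin OAnd d a b ;; nextpc i
  | IOr d a b => c_bin OOr d a b ;; nextpc i
  | IXor d a b => c_bin OXor d a b ;; nextpc i
  | IShr d a b =>
      (* A shift by a negative amount [-s] is a multiplication by [2^s], which vanishes modulo
         [2^w] when [s > w]. *)
      If (pm b < Cst 0)
        (Put aPM (Cst (Z.of_nat d)) (ewrap (pm a * ((Cst 0 - pm b < V vWP + Cst 1) *
           Bin OShr (V vMD) (V vWP + pm b)))))
        (c_bin OShr d a b) ;; nextpc i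
  | ILt d a b => Put aPM (Cst (Z.of_nat d)) (pm a < pm b) ;; nextpc i
  | IEq d a b => Put aPM (Cst (Z.of_nat d)) (pm a == pm b) ;; nextpc i
  | ILoad d a => Put aPM (Cst (Z.of_nat d)) (Get aPM (eaddr (pm a))) ;; nextpc i
  | IStore a s => Put aPM (eaddr (pm a)) (pm s) ;; nextpc i
  | IJz a l => If (pm a) (nextpc i)
      (Put vPC (Cst 0) (Cst (Z.of_nat l)) ;; Put vHLT (Cst 0) (Cst 0))
  | IJmp l => Put vPC (Cst 0) (Cst (Z.of_nat l)) ;; Put vHLT (Cst 0) (Cst 0)
  end.

(** The comparison is with [vCP], a copy of the program counter: an executed instruction changes
    [vPC], and no later entry may fire on the new value. *)
Fixpoint c_dispatch (i : nat) (P0 : program) : cmd :=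
  match P0 with
  | [] => Skip
  | ins :: P0 => If (V vCP == Cst (Z.of_nat i)) (c_instr i ins) Skip ;; c_dispatch (S i) P0
  end.

Definition c_step (P0 : program) : cmd :=
  If (V vHLT == Cst 0)
    (Put vCP (Cst 0) (V vPC) ;; Put vHLT (Cst 0) (Cst 1) ;; c_dispatch 0 P0) Skip.

Definition c_oracle (P0 : program) : cmd :=
  Put aBB (Cst 0) (V lI) ;; Put aBB (Cst 1) (V lK) ;; Put aBB (Cst 2) (V lJ) ;;
  Clear aPM ;; c_fill ;;
  Put vPC (Cst 0) (Cst 0) ;; Put vHLT (Cst 0) (Cst 0) ;;
  For lst (V vTM) (c_step P0).

Definition c_scan (P0 : program) : cmd :=
  Put vcnt (Cst 0) (Cst 0) ;;
  For lI (V vNB) (For lJ (V vNB)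
    (c_oracle P0 ;;
     If (Get aPM (Cst 0))
       (Put aLI (V vcnt) (V lI) ;; Put aLJ (V vcnt) (V lJ) ;; Put vcnt (Cst 0) (V vcnt + Cst 1))
       Skip)).

Definition tri (i k j : expr) : expr :=
  Ix aE i k * Ix aE k j * Ix aE i j * ((Ix aW i k + Ix aW k j + Ix aW i j) == et).
Arguments tri i k j /.

Definition c_brute : cmd :=
  For lx (V vcnt) (For lu (V vB) (For lv (V vB) (For lw (V vB)
    (If (tri (Get aLI (V lx) * V vB + V lu) (V lK * V vB + V lw) (Get aLJ (V lx) * V vB + V lv) *
         (Cst 1 - Ix aH (Get aLI (V lx) * V vB + V lu) (Get aLJ (V lx) * V vB + V lv)))
      (Acc aC (<< Get aLI (V lx) * V vB + V lu; Get aLJ (V lx) * V vB + V lv >>) (Cst 1)) Skip)))).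

(** The count is overwritten, not increased: the equality product ranges over all middle nodes and
    thus includes what earlier blocks contributed. *)
Definition c_settle : cmd :=
  For li (V vN) (For lj (V vN) (If (tri (V li) (V vp) (V lj))
    (Put aC (<< V li; V lj >>) (Ix aD (V li) (V lj)) ;; Put aH (<< V li; V lj >>) (Cst 1)) Skip)).

Definition c_pivot : cmd :=
  For lpw (V vB) (Put vp (Cst 0) (V lK * V vB + V lpw) ;; c_eqprod ;; c_settle).

Definition c_main (P0 : program) : cmd :=
  For lK (V vNB) (c_scan P0 ;; If (V vcnt < V vM) c_brute c_pivot).

Definition c_total : cmd :=
  For li (V vN) (For lj (V vN) (Acc vOut (Cst 0) (Ix aE (V li) (V lj) * Ix aC (V li) (V lj)))).

Definition ecoef (kp r x y : expr) : expr :=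
  Bin OShr (Cst strassen_code) (Cst 2 * (kp * Cst 28 + r * Cst 4 + x * Cst 2 + y)) mod Cst 4 - Cst 1.
Arguments ecoef kp r x y /.

Definition c_all4 (c : cmd) : cmd :=
  For lkp (Cst 3) (For lr (V vQ7) (For lx (V vZ) (For ly (V vZ) c))).
Arguments c_all4 c /.

Definition et4 : expr := tix (V lkp) (V lr) (V lx) (V ly).
Arguments et4 /.

Definition c_t0 : cmd := c_all4 (Acc aT1 et4 (Cst 1)).
Definition c_t1 : cmd := c_all4 (Acc aT2 et4
  (Get aT1 (tix (V lkp) (V lr / Cst 7) (V lx / Cst 2) (V ly / Cst 2)) *
   ecoef (V lkp) (V lr mod Cst 7) (V lx mod Cst 2) (V ly mod Cst 2))).
(** Coefficients lie between -1 and 1. Shifted by 2 they are below 5, so the clamp by [2 * 2 + 1]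
    copies them exactly while giving [aT1] a level independent of its former content. *)
Definition c_t2 : cmd := c_all4 (Acc aT1 et4 (Bin OClamp (Get aT2 et4 + Cst 2) (Cst 2) - Cst 2)).

Definition c_tables : cmd :=
  c_t0 ;; For ld (V vL) (Clear aT2 ;; c_t1 ;; Clear aT1 ;; c_t2).

(** Orienting the edges makes every triangle appear once, with its middle node numbered between the
    two others. *)
Definition c_edges : cmd :=
  For li en (For lj en (If (V li < V lj)
    (Acc aE (<< V li; V lj >>) (Get 0%nat (Cst 2 + Cst 2 * (V li * en + V lj)))) Skip)).

Definition c_weights : cmd :=
  For li en (For lj en
    (Acc aW (<< V li; V lj >>) (Get 0%nat (Cst 3 + Cst 2 * (V li * en + V lj))))).

(* [B] becomes the least power [2^e] with [B^q > n], and [S7] becomes [7^e]. *)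
Definition c_rootB (q : nat) : cmd :=
  Put vB (Cst 0) (Cst 1) ;; Put vE (Cst 0) (Cst 0) ;; Put vS7 (Cst 0) (Cst 1) ;;
  For li (en + Cst 1) (If (en < epow (V vB) q) Skip
    (Put vB (Cst 0) (Bin OClamp (Cst 2 * V vB) (Cst 2 * en + Cst 2)) ;;
     Put vE (Cst 0) (V vE + Cst 1) ;;
     Put vS7 (Cst 0) (Bin OClamp (Cst 7 * V vS7) (Cst 8 * (en * en) + Cst 8)))).

(** [Y] is an integer stand-in for the saving [B^eps] of the decision program: the least power of 2
    with [Y^r > B]. The number of steps to simulate has to be computed, and [B^3 / Y] is easier than
    a real power. *)
Definition c_rootY (r : nat) : cmd :=
  Put vY (Cst 0) (Cst 1) ;;
  For li (V vB + Cst 1) (If (V vB < epow (V vY) r) Skip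
    (Put vY (Cst 0) (Bin OClamp (Cst 2 * V vY) (Cst 2 * V vB + Cst 2)))).

(** An instance of [3 * 2^e] nodes has word size [k * (e + 2)], whence [vWP] and [vMD]. The last
    summand of [vTM] makes up for the rounding in the division. *)
Definition c_consts (q a k : nat) (C1 : Z) : cmd :=
  Put vN (Cst 0) (epow (V vB) q) ;;
  Put vM (Cst 0) (epow (V vB) (2 * q - 3)) ;;
  Put vTh (Cst 0) (epow (V vB) (q - 5)) ;;
  Put vR5 (Cst 0) (epow (V vB) 5) ;;
  Put vZ (Cst 0) (epow (V vB) a) ;;
  Put vb (Cst 0) (epow (V vB) (q - a)) ;;
  Put vNB (Cst 0) (epow (V vB) (q - 1)) ;;
  Put vQ7 (Cst 0) (epow (V vS7) a) ;;
  Put vL (Cst 0) (Cst (Z.of_nat a) * V vE) ;;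
  Put vMD (Cst 0) (epow (Cst 4 * V vB) k) ;;
  Put vWP (Cst 0) (Cst (Z.of_nat k) * (V vE + Cst 2)) ;;
  Put vTM (Cst 0) (Cst C1 * (V vB * V vB * V vB / V vY + Cst 1)).

Definition c_count (q a r k : nat) (C1 : Z) (P0 : program) : cmd :=
  c_rootB q ;; c_rootY r ;; c_consts q a k C1 ;; c_edges ;; c_weights ;; c_tables ;;
  c_main P0 ;; c_total.

Local Close Scope prog_scope.

Lemma epow_ewf NA e k : ewf NA e = true -> ewf NA (epow e k) = true.
Proof. intros H. induction k; cbn [epow ewf]; [reflexivity|]. now rewrite H. Qed.

Lemma epow_elev e k : (elev lev (epow e k) <= elev lev e)%nat.
Proof. induction k; cbn [epow elev]; lia. Qed.

Lemma epow_eval e k s : eval (epow e k) s = eval e s ^ Z.of_nat k.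
Proof.
  induction k; cbn [epow eval opsem]; [reflexivity|].
  rewrite IHk, Nat2Z.inj_succ, Z.pow_succ_r by lia. reflexivity.
Qed.

Lemma dispatch_cwf P0 : forall i, cwf nids (c_dispatch i P0) = true.
Proof.
  induction P0 as [|ins P0 IH]; intros i; [reflexivity|].
  cbn [c_dispatch cwf]. rewrite IH. destruct ins; reflexivity.
Qed.

Lemma dispatch_wt P0 : forall i, wt lev (c_dispatch i P0) = true.
Proof.
  induction P0 as [|ins P0 IH]; intros i; [reflexivity|].
  cbn [c_dispatch wt]. rewrite IH. destruct ins; reflexivity.
Qed.

Lemma count_cwf q a r k C1 P0 : cwf nids (c_count q a r k C1 P0) = true.
Proof.
  unfold c_count, c_main, c_scan, c_oracle, c_step, c_rootB, c_rootY, c_consts. cbn [cwf ewf V].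
  rewrite dispatch_cwf, !epow_ewf by reflexivity. reflexivity.
Qed.

Lemma okput_pow a b k : (elev lev b < lev a)%nat -> okput lev a (epow b k) = true.
Proof.
  intros H. unfold okput. pose proof (epow_elev b k).
  assert (E : (elev lev (epow b k) <? lev a)%nat = true) by (apply Nat.ltb_lt; lia).
  rewrite E. cbn [orb]. rewrite andb_true_r. apply Nat.leb_le. lia.
Qed.

Lemma count_wt q a r k C1 P0 : wt lev (c_count q a r k C1 P0) = true.
Proof.
  unfold c_count, c_main, c_scan, c_oracle, c_step, c_rootB, c_rootY, c_consts. cbn [wt V].
  rewrite dispatch_wt, !okput_pow by (cbn; lia). reflexivity.
Qed.

Lemma lev_le x : (lev x <= 6)%nat.
Proof.
  destruct (Nat.lt_ge_cases x 60) as [L|L].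
  - assert (G : forallb (fun x => (lev x <=? 6)%nat) (seq 0 60) = true) by reflexivity.
    rewrite forallb_forall in G. apply Nat.leb_le, G, in_seq. lia.
  - unfold lev. rewrite nth_overflow; [lia|exact L].
Qed.

(** * Correctness of the equality product *)

Lemma set_same s a z v : set s a z v a z = v.
Proof. unfold set. now rewrite Nat.eqb_refl, Z.eqb_refl. Qed.

Lemma set_diff s a z v b y : b <> a \/ y <> z -> set s a z v b y = s b y.
Proof.
  intros H. unfold set. destruct (Nat.eqb_spec b a), (Z.eqb_spec y z); cbn [andb]; tauto.
Qed.

Lemma zsum_if n (c : bool) f : zsum n (fun i => if c then f i else 0) = if c then zsum n f else 0.
Proof. destruct c; [reflexivity|]. now apply zsum_zero. Qed.

(** Reads one cell from the sum that a loop nest contributes: the pairing is injective, so a single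
    term survives. *)
Lemma hit2 n m i0 j0 f : 0 <= i0 < n -> 0 <= j0 < m ->
  zsum n (fun i => zsum m (fun j => if pairZ i j =? pairZ i0 j0 then f i j else 0)) = f i0 j0.
Proof.
  intros Hi Hj. erewrite zsum_ext.
  2:{ intros i _. erewrite zsum_ext.
      2:{ intros j _. rewrite pairZ_eqb.
          instantiate (1 := fun j => if i =? i0 then (if j =? j0 then f i j else 0) else 0).
          cbv beta. now destruct (i =? i0), (j =? j0). }
      rewrite zsum_if, zsum_delta by exact Hj. reflexivity. }
  now rewrite (zsum_delta n i0 (fun i => f i j0)).
Qed.

Lemma hit3 n m l i0 j0 k0 f : 0 <= i0 < n -> 0 <= j0 < m -> 0 <= k0 < l ->
  zsum n (fun i => zsum m (fun j => zsum l (fun k =>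
    if pairZ i (pairZ j k) =? pairZ i0 (pairZ j0 k0) then f i j k else 0))) = f i0 j0 k0.
Proof.
  intros Hi Hj Hk. erewrite zsum_ext.
  2:{ intros i _. erewrite zsum_ext.
      2:{ intros j _. erewrite zsum_ext.
          2:{ intros k _. rewrite pairZ_eqb.
              instantiate (1 := fun k => if i =? i0 then (if pairZ j k =? pairZ j0 k0 then f i j k else 0) else 0).
              cbv beta. now destruct (i =? i0), (pairZ j k =? pairZ j0 k0). }
          rewrite zsum_if. reflexivity. }
      rewrite zsum_if, hit2 by assumption. reflexivity. }
  now rewrite (zsum_delta n i0 (fun i => f i j0 k0)).
Qed.

Lemma hit4 n m l o i0 j0 k0 l0 f : 0 <= i0 < n -> 0 <= j0 < m -> 0 <= k0 < l -> 0 <= l0 < o ->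
  zsum n (fun i => zsum m (fun j => zsum l (fun k => zsum o (fun q =>
    if pairZ i (pairZ j (pairZ k q)) =? pairZ i0 (pairZ j0 (pairZ k0 l0)) then f i j k q else 0)))) = f i0 j0 k0 l0.
Proof.
  intros Hi Hj Hk Hl. erewrite zsum_ext.
  2:{ intros i _. erewrite zsum_ext.
      2:{ intros j _. erewrite zsum_ext.
          2:{ intros k _. erewrite zsum_ext.
              2:{ intros q _. rewrite pairZ_eqb.
              instantiate (1 := fun q => if i =? i0 then (if pairZ j (pairZ k q) =? pairZ j0 (pairZ k0 l0) then f i j k q else 0) else 0).
              cbv beta. now destruct (i =? i0), (pairZ j (pairZ k q) =? pairZ j0 (pairZ k0 l0)). }
              rewrite zsum_if. reflexivity. }
          rewrite zsum_if. reflexivity. }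
      rewrite zsum_if, hit3 by assumption. reflexivity. }
  now rewrite (zsum_delta n i0 (fun i => f i j0 k0 l0)).
Qed.

Lemma hit_block a b i f : 0 <= a -> 0 < b -> 0 <= i < a * b ->
  zsum a (fun x => zsum b (fun u => if x * b + u =? i then f x u else 0)) = f (i / b) (i mod b).
Proof.
  intros Ha Hb Hi.
  rewrite <- (zsum_delta (a * b) i (fun j => f (j / b) (j mod b)) Hi).
  rewrite zsum_blocks by lia. apply zsum_ext. intros x _. apply zsum_ext. intros u Hu.
  replace ((x * b + u) / b) with x by (rewrite Z.div_add_l, Z.div_small; lia).
  replace ((x * b + u) mod b) with u by (rewrite Z.add_comm, Z.mod_add, Z.mod_small; lia).
  reflexivity.
Qed.

Ltac evs := cbn [contr eval opsem V Ix tix Xok Xval Yok Yval]; unfold set; cbn [Nat.eqb andb Z.eqb].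

Ltac clfor Hn := eapply cle_for; [reflexivity|reflexivity|reflexivity|
  cbn [eval V]; rewrite Hn; apply Z.le_refl| | try lia | try lia].

Section EqProd.
Variables (N Th R5 bs : Z) (d : nat) (E W : Z -> Z -> Z) (p : Z).
Let Z2 := 2 ^ Z.of_nat d.
Let Q7 := 7 ^ Z.of_nat d.
Hypothesis N_blocks : N = Z2 * bs.
Hypothesis N_heavy : N = Th * R5.
Hypothesis Th_pos : 1 <= Th.
Hypothesis R5_pos : 1 <= R5.
Hypothesis bs_pos : 1 <= bs.
Hypothesis E01 : forall i j, E i j = 0 \/ E i j = 1.

Lemma Z2_pos : 1 <= Z2.
Proof. unfold Z2. pose proof (Z.pow_pos_nonneg 2 (Z.of_nat d)). lia. Qed.

Lemma Q7_pos : 1 <= Q7.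
Proof. unfold Q7. pose proof (Z.pow_pos_nonneg 7 (Z.of_nat d)). lia. Qed.

Lemma N_pos : 1 <= N.
Proof. nia. Qed.

Record penv (s : state) : Prop := Penv {
  penv_N : s vN 0 = N;
  penv_Th : s vTh 0 = Th;
  penv_R5 : s vR5 0 = R5;
  penv_Z : s vZ 0 = Z2;
  penv_b : s vb 0 = bs;
  penv_Q7 : s vQ7 0 = Q7;
  penv_E : forall i j, s aE (pairZ i j) = E i j;
  penv_W : forall i j, s aW (pairZ i j) = W i j;
  penv_T : forall kp r x y, 0 <= kp < 3 -> 0 <= r < Q7 -> 0 <= x < Z2 -> 0 <= y < Z2 ->
    s aT1 (pairZ kp (pairZ r (pairZ x y))) = tcoef d kp r x y;
  penv_p : s vp 0 = p
}.

Lemma penv_agr l s s' : disj l [vN; vTh; vR5; vZ; vb; vQ7; aE; aW; aT1; vp] = true ->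
  agr l s s' -> penv s -> penv s'.
Proof.
  intros Dj A [h1 h2 h3 h4 h5 h6 h7 h8 h9 h10].
  assert (G : forall b, mem b [vN; vTh; vR5; vZ; vb; vQ7; aE; aW; aT1; vp] = true -> forall y, s' b y = s b y).
  { intros b Hb. apply A. eapply disj_spec; eassumption. }
  constructor; intros; rewrite G by reflexivity; auto.
Qed.

Definition xok i k := E i k * E i p.
Definition xv i k := W i k - W i p.
Definition yok k j := E k j * E p j.
Definition yv k j := W p j - W k j.

Lemma yok01 k j : yok k j = 0 \/ yok k j = 1.
Proof. unfold yok. destruct (E01 k j) as [-> | ->], (E01 p j) as [-> | ->]; auto. Qed.

Lemma Xok_eval s i k : penv s -> s li 0 = i -> s lk 0 = k -> eval Xok s = xok i k.
Proof. intros Pe <- <-. cbn [Xok eval opsem V Ix]. rewrite !(penv_E _ Pe), (penv_p _ Pe). reflexivity. Qed.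

Lemma Xval_eval s i k : penv s -> s li 0 = i -> s lk 0 = k -> eval Xval s = xv i k.
Proof. intros Pe <- <-. cbn [Xval eval opsem V Ix]. rewrite !(penv_W _ Pe), (penv_p _ Pe). reflexivity. Qed.

Lemma Yval_eval s k j : penv s -> s lj 0 = j -> s lk 0 = k -> eval Yval s = yv k j.
Proof. intros Pe <- <-. cbn [Yval eval opsem V Ix]. rewrite !(penv_W _ Pe), (penv_p _ Pe). reflexivity. Qed.

Definition incls (v k : Z) (f : Z -> Z) (i : Z) : Z :=
  if xok i k =? 0 then 0 else if xv i k =? v then f i else 0.

(* Rows already inserted in column [k] when the loops stand at column [k0], row [i0]. *)
Definition lim (k0 i0 k : Z) : Z := if k <? k0 then N else if k =? k0 then i0 else 0.

(** The member list is specified through the sums of all functions over it, that is, as a multiset;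
    the order of insertion never matters. The constant 1 yields its length and an indicator yields
    membership. *)
Definition clsinv (k0 i0 : Z) (s : state) : Prop := forall k v, 0 <= k ->
  0 <= s aCnt (pairZ k v) /\
  forall f, zsum (s aCnt (pairZ k v)) (fun x => f (s aMem (pairZ k (pairZ v x)))) =
     zsum (lim k0 i0 k) (incls v k f).

Lemma classes_ok s : penv s -> (forall z, s aCnt z = 0) ->
  clsinv N 0 (sem c_classes s) /\ cost c_classes s <= 1 + N * (1 + (1 + N * (1 + 3))).
Proof.
  intros Pe H0. pose proof N_pos as Np. unfold c_classes.
  set (l := [lk; li; aMem; aCnt]).
  destruct (for_rule (fun k0 s' => agr l s s' /\ clsinv k0 0 s') lk (V vN)
    (For li (V vN) (If Xok
    (Seq (Put aMem (Bin OPair (V lk) (Bin OPair Xval (Ix aCnt (V lk) Xval))) (V li))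
     (Put aCnt (Bin OPair (V lk) Xval) (Bin OAdd (Ix aCnt (V lk) Xval) (Cst 1))))
    Skip)) s N (1 + N * (1 + 3))) as [[_ R1] R2].
  - cbn. apply Pe.
  - lia.
  - split; [apply agr_refl|]. intros k v Hk. rewrite H0. split; [lia|]. intros f.
    rewrite zsum_neg by lia. unfold lim. destruct (Z.ltb_spec k 0); [lia|].
    destruct (k =? 0); rewrite zsum_neg by lia; reflexivity.
  - intros k0 s1 Hk0 [A1 I1].
    assert (A1' : agr l s (set s1 lk 0 k0)) by (apply agr_set; [reflexivity|exact A1]).
    destruct (for_rule (fun i0 s' => agr l s s' /\ s' lk 0 = k0 /\ clsinv k0 i0 s') li (V vN)
     (If Xok
    (Seq (Put aMem (Bin OPair (V lk) (Bin OPair Xval (Ix aCnt (V lk) Xval))) (V li))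
     (Put aCnt (Bin OPair (V lk) Xval) (Bin OAdd (Ix aCnt (V lk) Xval) (Cst 1))))
    Skip) (set s1 lk 0 k0) N 3) as [(B1 & B2 & B3) C1].
    + apply (penv_agr l s _ eq_refl A1' Pe).
    + lia.
    + split; [exact A1'|]. split; [apply set_same|].
      intros k v Hk. rewrite !set_other by discriminate. destruct (I1 k v Hk) as [J1 J2]. split; [exact J1|].
      intros f. rewrite <- J2. apply zsum_ext. intros x _. now rewrite set_other by discriminate.
    + intros i0 s2 Hi0 (A2 & K2 & I2).
      set (s3 := set s2 li 0 i0).
      assert (A3 : agr l s s3) by (apply agr_set; [reflexivity|exact A2]).
      pose proof (penv_agr l s s3 eq_refl A3 Pe) as Pe3.
      assert (L3 : s3 lk 0 = k0) by (unfold s3; rewrite set_other by discriminate; exact K2).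
      assert (L3' : s3 li 0 = i0) by apply set_same.
      pose proof (Xok_eval s3 i0 k0 Pe3 L3' L3) as Ex. pose proof (Xval_eval s3 i0 k0 Pe3 L3' L3) as Ev.
      assert (I3 : clsinv k0 i0 s3).
      { intros k v Hk. unfold s3. rewrite !set_other by discriminate. destruct (I2 k v Hk) as [J1 J2]. split; [exact J1|].
        intros f. rewrite <- J2. apply zsum_ext. intros x _. now rewrite set_other by discriminate. }
      assert (LimS : forall k f v, 0 <= k -> zsum (lim k0 (i0 + 1) k) (incls v k f) =
         zsum (lim k0 i0 k) (incls v k f) + if k =? k0 then incls v k f i0 else 0).
      { intros k f v Hk. unfold lim. destruct (Z.ltb_spec k k0), (Z.eqb_spec k k0); try lia.
        rewrite zsum_succ by lia. reflexivity. }
      cbn [cost sem]. rewrite Ex. destruct (Z.eqb_spec (xok i0 k0) 0) as [X0|X0].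
      * split; [|lia]. split; [exact A3|]. split; [exact L3|].
        intros k v Hk. destruct (I3 k v Hk) as [J1 J2]. split; [exact J1|]. intros f.
        rewrite LimS, J2 by lia. destruct (Z.eqb_spec k k0) as [->|]; [|lia].
        unfold incls. rewrite X0. cbn. lia.
      * split; [|lia].
        set (s4 := set s3 aMem _ _). set (s5 := set s4 aCnt _ _).
        assert (Ex4 : eval Xval s4 = xv i0 k0).
        { rewrite <- Ev. apply eval_agree. intros b Hb y. unfold s4. apply set_other. intros ->. discriminate Hb. }
        assert (E5 : s5 = set s4 aCnt (pairZ k0 (xv i0 k0)) (s3 aCnt (pairZ k0 (xv i0 k0)) + 1)).
        { unfold s5. cbn [eval opsem V Ix]. rewrite Ex4.
          change (s4 aCnt) with (s3 aCnt). change (s4 lk 0) with (s3 lk 0). now rewrite L3. }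
        set (c0 := s3 aCnt (pairZ k0 (xv i0 k0))) in *.
        assert (E4 : s4 = set s3 aMem (pairZ k0 (pairZ (xv i0 k0) c0)) i0).
        { unfold s4. cbn [eval opsem V Ix]. rewrite Ev, L3, L3'. reflexivity. }
        split.
        { rewrite E5, E4. apply agr_set; [reflexivity|]. apply agr_set; [reflexivity|exact A3]. }
        split.
        { rewrite E5, E4. rewrite !set_other by discriminate. exact L3. }
        intros k v Hk. rewrite E5, E4. destruct (I3 k v Hk) as [J1 J2].
        destruct (Z.eq_dec k k0) as [->|Nk].
        -- destruct (Z.eq_dec v (xv i0 k0)) as [->|Nv].
           ++ rewrite set_same. fold c0 in J1, J2. split; [lia|]. intros f.
              rewrite zsum_succ by lia. rewrite LimS, <- J2, Z.eqb_refl by lia.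
              f_equal.
              ** apply zsum_ext. intros x Hx. rewrite set_other by discriminate.
                 rewrite set_diff; [reflexivity|]. right. intros Q. apply pairZ_inj in Q. destruct Q as [_ Q].
                 apply pairZ_inj in Q. lia.
              ** rewrite set_other by discriminate. rewrite set_same. unfold incls.
                 apply Z.eqb_neq in X0. now rewrite X0, Z.eqb_refl.
           ++ rewrite set_diff, set_other; [|discriminate|right; intros Q; apply pairZ_inj in Q; lia].
              split; [exact J1|]. intros f. rewrite LimS, <- J2, Z.eqb_refl by lia.
              unfold incls. replace (xv i0 k0 =? v) with false by (symmetry; apply Z.eqb_neq; lia).
              destruct (xok i0 k0 =? 0).
              all: rewrite Z.add_0_r; apply zsum_ext; intros x Hx; rewrite set_other by discriminate;
                rewrite set_diff; [reflexivity|]; right; intros Q; apply pairZ_inj in Q; destruct Q as [_ Q];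
                apply pairZ_inj in Q; lia.
        -- rewrite set_diff, set_other; [|discriminate|right; intros Q; apply pairZ_inj in Q; lia].
           split; [exact J1|]. intros f. rewrite LimS, <- J2 by lia.
           replace (k =? k0) with false by (symmetry; apply Z.eqb_neq; lia).
           rewrite Z.add_0_r. apply zsum_ext. intros x Hx. rewrite set_other by discriminate.
           rewrite set_diff; [reflexivity|]. right. intros Q. apply pairZ_inj in Q. lia.
    + split; [split; [exact B1|]|exact C1].
      intros k v Hk. destruct (B3 k v Hk) as [J1 J2]. split; [exact J1|]. intros f. rewrite J2.
      f_equal. unfold lim. destruct (Z.ltb_spec k k0), (Z.eqb_spec k k0), (Z.ltb_spec k (k0 + 1)), (Z.eqb_spec k (k0 + 1)); lia.
  - split; [exact R1|exact R2].
Qed.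

Definition cntf (k v : Z) : Z := zsum N (incls v k (fun _ => 1)).

Lemma clsinv_cnt s k v : clsinv N 0 s -> 0 <= k < N -> s aCnt (pairZ k v) = cntf k v.
Proof.
  intros H Hk. destruct (H k v ltac:(lia)) as [J1 J2]. specialize (J2 (fun _ => 1)). cbv beta in J2.
  rewrite zsum_const in J2 by exact J1. unfold lim in J2.
  destruct (Z.ltb_spec k N); [|lia]. unfold cntf. lia.
Qed.

Lemma cntf_ex k v : 1 <= cntf k v -> exists i, 0 <= i < N /\ xok i k <> 0 /\ xv i k = v.
Proof.
  intros H. destruct (zsum_pos_ex N (incls v k (fun _ => 1))) as (i & Hi & Hp); [fold (cntf k v); lia|].
  unfold incls in Hp. exists i. split; [exact Hi|].
  destruct (Z.eqb_spec (xok i k) 0); [lia|]. destruct (Z.eqb_spec (xv i k) v); [auto|lia].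
Qed.

(** In column [k] the nonzero identifiers biject heavy values with [1, ..., aNh k]. That every
    number is taken serves to bound how many there are; the last clause, for the rows visited so
    far, makes sure that no heavy value of a row is missed. *)
Definition idinv (k0 i0 : Z) (s : state) : Prop := forall k, 0 <= k < N ->
  (forall v, 0 <= s aId (pairZ k v) <= s aNh k) /\
  (forall v v', s aId (pairZ k v) = s aId (pairZ k v') -> s aId (pairZ k v) <> 0 -> v = v') /\
  (forall v, s aId (pairZ k v) <> 0 -> Th <= cntf k v) /\
  (forall h, 1 <= h <= s aNh k -> exists v, s aId (pairZ k v) = h) /\
  (forall i, 0 <= i < lim k0 i0 k -> xok i k <> 0 -> Th <= cntf k (xv i k) ->
     s aId (pairZ k (xv i k)) <> 0).

Lemma idinv_ext k0 i0 k1 i1 s s' : (forall y, s' aId y = s aId y) -> (forall y, s' aNh y = s aNh y) ->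
  (forall k, lim k1 i1 k <= lim k0 i0 k) -> idinv k0 i0 s -> idinv k1 i1 s'.
Proof.
  intros H1 H2 H3 I k Hk. destruct (I k Hk) as (J1 & J2 & J3 & J4 & J5).
  repeat split; intros; rewrite ?H1, ?H2 in *; try (now apply J1); eauto.
  - destruct (J4 h H) as [v Hv]. exists v. now rewrite H1.
  - apply J5; auto. specialize (H3 k). lia.
Qed.

Lemma ids_ok s : penv s -> clsinv N 0 s ->
  (forall z, s aId z = 0) -> (forall z, s aNh z = 0) ->
  idinv N 0 (sem c_ids s) /\ cost c_ids s <= 1 + N * (1 + (1 + N * (1 + 3))).
Proof.
  intros Pe Hc Hi0 Hn0. pose proof N_pos as Np. unfold c_ids.
  set (l := [lk; li; aNh; aId]).
  match goal with |- context [sem (For lk (V vN) (For li (V vN) ?c)) s] => set (body := c) end.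
  assert (Wl : inclb (wr body) l = true) by reflexivity.
  destruct (for_rule (fun k0 s' => agr l s s' /\ idinv k0 0 s') lk (V vN)
    (For li (V vN) body) s N (1 + N * (1 + 3))) as [[_ R1] R2].
  - cbn. apply Pe.
  - lia.
  - split; [apply agr_refl|]. intros k Hk.
    repeat split; intros; rewrite ?Hi0, ?Hn0 in *; try lia.
    exfalso. unfold lim in H. destruct (Z.ltb_spec k 0); [lia|]. destruct (k =? 0); lia.
  - intros k0 s1 Hk0 [A1 I1].
    assert (A1' : agr l s (set s1 lk 0 k0)) by (apply agr_set; [reflexivity|exact A1]).
    destruct (for_rule (fun i0 s' => agr l s s' /\ s' lk 0 = k0 /\ idinv k0 i0 s') li (V vN)
       body (set s1 lk 0 k0) N 3) as [(B1 & B2 & B3) C1].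
    + apply (penv_agr l s _ eq_refl A1' Pe).
    + lia.
    + split; [exact A1'|]. split; [apply set_same|].
      apply (idinv_ext k0 0 k0 0 s1); auto; try (intros; now rewrite set_other by discriminate); lia.
    + intros i0 s2 Hi (A2 & K2 & I2).
      set (s3 := set s2 li 0 i0).
      assert (A3 : agr l s s3) by (apply agr_set; [reflexivity|exact A2]).
      pose proof (penv_agr l s s3 eq_refl A3 Pe) as Pe3.
      assert (L3 : s3 lk 0 = k0) by (unfold s3; rewrite set_other by discriminate; exact K2).
      assert (L3' : s3 li 0 = i0) by apply set_same.
      pose proof (Xok_eval s3 i0 k0 Pe3 L3' L3) as Ex. pose proof (Xval_eval s3 i0 k0 Pe3 L3' L3) as Ev.
      set (v0 := xv i0 k0) in *.
      assert (I3 : idinv k0 i0 s3).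
      { apply (idinv_ext k0 i0 k0 i0 s2); auto; try (intros; unfold s3; now rewrite set_other by discriminate). lia. }
      assert (Cn : s3 aCnt (pairZ k0 v0) = cntf k0 v0).
      { rewrite A3 by reflexivity. apply clsinv_cnt; [exact Hc|lia]. }
      unfold body. cbn [cost sem].
      match goal with |- context [eval ?e s3] =>
        assert (Ec : (eval e s3 =? 0) = false -> xok i0 k0 <> 0 /\ Th <= cntf k0 v0 /\ s3 aId (pairZ k0 v0) = 0);
        [|assert (Ec' : (eval e s3 =? 0) = true -> xok i0 k0 <> 0 -> Th <= cntf k0 v0 -> s3 aId (pairZ k0 v0) <> 0)] end.
      { cbn [Xok Xval eval opsem V Ix] in Ex, Ev |- *. rewrite Z.eqb_neq.
        rewrite Ex, Ev, L3, Cn, (penv_Th _ Pe3).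
        destruct (Z.ltb_spec (cntf k0 v0) Th), (Z.eqb_spec (s3 aId (pairZ k0 v0)) 0); intros; nia. }
      { cbn [Xok Xval eval opsem V Ix] in Ex, Ev |- *. rewrite Z.eqb_eq.
        rewrite Ex, Ev, L3, Cn, (penv_Th _ Pe3).
        destruct (Z.ltb_spec (cntf k0 v0) Th), (Z.eqb_spec (s3 aId (pairZ k0 v0)) 0); intros; nia. }
      match goal with |- context [eval ?e s3 =? 0] => destruct (eval e s3 =? 0) end.
      * clear Ec. specialize (Ec' eq_refl). split; [|lia]. split; [exact A3|]. split; [exact L3|].
        intros k Hk. destruct (I3 k Hk) as (J1 & J2 & J3 & J4 & J5).
        split; [exact J1|]. split; [exact J2|]. split; [exact J3|]. split; [exact J4|].
        intros i Hi' Hx Hth.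
        destruct (Z.eq_dec k k0) as [->|Nk].
        -- destruct (Z.eq_dec i i0) as [->|Ni]; [now apply Ec'|]. apply J5; auto.
           unfold lim in *. rewrite Z.ltb_irrefl, Z.eqb_refl in *. lia.
        -- apply J5; auto. unfold lim in *. replace (k =? k0) with false in * by (symmetry; apply Z.eqb_neq; lia).
           exact Hi'.
      * clear Ec'. destruct (Ec eq_refl) as (X0 & Hth & Id0). clear Ec. split; [|lia].
        set (s4 := set s3 aNh _ _). set (s5 := set s4 aId _ _).
        assert (E4 : s4 = set s3 aNh k0 (s3 aNh k0 + 1)).
        { unfold s4. cbn [eval opsem V Ix]. now rewrite L3. }
        assert (Ev4 : eval Xval s4 = v0).
        { rewrite <- Ev. apply eval_agree. intros b Hb y. unfold s4. apply set_other. intros ->. discriminate Hb. }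
        assert (E5 : s5 = set s4 aId (pairZ k0 v0) (s3 aNh k0 + 1)).
        { unfold s5. cbn [eval opsem V]. rewrite Ev4. change (s4 lk 0) with (s3 lk 0). rewrite L3.
          f_equal. rewrite E4. apply set_same. }
        split.
        { rewrite E5, E4. apply agr_set; [reflexivity|]. apply agr_set; [reflexivity|exact A3]. }
        split.
        { rewrite E5, E4. rewrite !set_other by discriminate. exact L3. }
        assert (Nh5 : forall y, s5 aNh y = if y =? k0 then s3 aNh k0 + 1 else s3 aNh y).
        { intros y. rewrite E5, E4. rewrite set_other by discriminate.
          destruct (Z.eqb_spec y k0) as [->|]; [apply set_same|]. apply set_diff. now right. }
        assert (Id5 : forall k v, s5 aId (pairZ k v) = if (k =? k0) && (v =? v0) then s3 aNh k0 + 1 else s3 aId (pairZ k v)).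
        { intros k v. rewrite E5. destruct (Z.eqb_spec k k0) as [->|Nk]; cbn [andb].
          - destruct (Z.eqb_spec v v0) as [->|Nv]; [apply set_same|].
            rewrite set_diff by (right; intros Q; apply pairZ_inj in Q; tauto).
            rewrite E4. now rewrite set_other by discriminate.
          - rewrite set_diff by (right; intros Q; apply pairZ_inj in Q; tauto).
            rewrite E4. now rewrite set_other by discriminate. }
        intros k Hk. destruct (I3 k Hk) as (J1 & J2 & J3 & J4 & J5).
        destruct (Z.eqb_spec k k0) as [->|Nk].
        -- split; [|split; [|split; [|split]]].
           ++ intros v. rewrite Id5, Nh5, Z.eqb_refl. cbn [andb]. specialize (J1 v). pose proof (J1).
              destruct (I3 k0 Hk) as (J1' & _). pose proof (J1' v0). destruct (v =? v0); lia.
           ++ intros v v'. rewrite !Id5, !Z.eqb_refl. cbn [andb].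
              pose proof (J1 v). pose proof (J1 v').
              destruct (Z.eqb_spec v v0), (Z.eqb_spec v' v0); intros Q1 Q2; try lia. now apply J2.
           ++ intros v. rewrite Id5, Z.eqb_refl. cbn [andb]. destruct (Z.eqb_spec v v0) as [->|]; auto.
           ++ intros h Hh. rewrite Nh5, Z.eqb_refl in Hh.
              destruct (Z.eq_dec h (s3 aNh k0 + 1)) as [->|Nh].
              ** exists v0. now rewrite Id5, !Z.eqb_refl.
              ** destruct (J4 h ltac:(lia)) as [v Hv]. exists v. rewrite Id5, Z.eqb_refl. cbn [andb].
                 destruct (Z.eqb_spec v v0) as [->|]; [lia|exact Hv].
           ++ intros i Hi' Hx Ht. rewrite Id5, Z.eqb_refl. cbn [andb]. pose proof (J1 v0).
              destruct (Z.eqb_spec (xv i k0) v0) as [|Nv]; [lia|].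
              apply J5; auto. unfold lim in *. rewrite Z.ltb_irrefl, Z.eqb_refl in *.
              destruct (Z.eq_dec i i0) as [->|]; [|lia]. exfalso. apply Nv. reflexivity.
        -- apply Z.eqb_neq in Nk as Nk'.
           split; [|split; [|split; [|split]]]; intros; rewrite ?Id5, ?Nh5, ?Nk' in *; cbn [andb] in *; auto.
           ++ destruct (J4 h H) as [v Hv]. exists v. now rewrite Id5, Nk'.
           ++ apply J5; auto. unfold lim in *. rewrite Nk' in *. exact H.
    + split; [split; [exact B1|]|exact C1].
      apply (idinv_ext k0 N (k0+1) 0 (sem (For li (V vN) body) (set s1 lk 0 k0))); auto.
      intros k. unfold lim. destruct (Z.ltb_spec k k0), (Z.eqb_spec k k0), (Z.ltb_spec k (k0 + 1)), (Z.eqb_spec k (k0 + 1)); lia.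
  - split; [exact R1|exact R2].
Qed.

(* Each heavy class of column [k] takes [Th] of its [N] rows, whence at most [R5] of them. *)
Lemma ids_bound s k : idinv N 0 s -> 0 <= k < N -> s aNh k <= R5.
Proof.
  intros I Hk. destruct (I k Hk) as (J1 & J2 & J3 & J4 & J5).
  pose proof (J1 0) as Hn. set (h := s aNh k) in *.
  assert (H1 : h * Th <= zsum h (fun g => zsum N (fun i => if xok i k =? 0 then 0 else
     if s aId (pairZ k (xv i k)) =? g + 1 then 1 else 0))).
  { rewrite <- zsum_const by lia. apply zsum_le. intros g Hg.
    destruct (J4 (g + 1) ltac:(lia)) as [v Hv]. specialize (J3 v ltac:(lia)).
    apply (Z.le_trans _ (cntf k v)); [exact J3|]. apply zsum_le. intros i Hi. unfold incls.
    destruct (xok i k =? 0); [lia|]. destruct (Z.eqb_spec (xv i k) v) as [->|].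
    - rewrite Hv, Z.eqb_refl. lia.
    - destruct (_ =? _); lia. }
  rewrite zsum_swap in H1.
  assert (H2 : zsum N (fun i => zsum h (fun g => if xok i k =? 0 then 0 else
     if s aId (pairZ k (xv i k)) =? g + 1 then 1 else 0)) <= zsum N (fun _ => 1)).
  { apply zsum_le. intros i Hi. destruct (xok i k =? 0).
    { rewrite zsum_zero by auto. lia. }
    erewrite zsum_ext.
    2:{ intros g Hg. instantiate (1 := fun g => if g =? s aId (pairZ k (xv i k)) - 1 then 1 else 0).
        cbv beta. destruct (Z.eqb_spec (s aId (pairZ k (xv i k))) (g + 1)), (Z.eqb_spec g (s aId (pairZ k (xv i k)) - 1)); lia. }
    destruct (Z.lt_ge_cases 0 (s aId (pairZ k (xv i k)))) as [L|L].
    - rewrite (zsum_delta h _ (fun _ => 1)); [lia|]. pose proof (J1 (xv i k)). lia.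
    - rewrite (zsum_delta_out h _ (fun _ => 1)); lia. }
  pose proof N_pos. rewrite zsum_const in H2 by lia. nia.
Qed.

Lemma heavyA_ok s h i k : penv s -> (forall z, s aA z = 0) -> 0 <= i < N -> 0 <= k < N ->
  sem c_heavyA s aA (pairZ h (pairZ i k)) =
  if xok i k =? 0 then 0 else if s aId (pairZ k (xv i k)) =? h then 1 else 0.
Proof.
  intros Pe H0 Hi Hk. rewrite (acc_sem aA) by reflexivity. rewrite H0. unfold c_heavyA, Acc. evs.
  rewrite (penv_N _ Pe), (penv_p _ Pe), Z.add_0_l.
  transitivity (zsum N (fun k' => zsum N (fun i' => if pairZ k' i' =? pairZ k i then
    (if xok i' k' =? 0 then 0 else if s aId (pairZ k' (xv i' k')) =? h then 1 else 0) else 0))).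
  - apply zsum_ext. intros k' _. apply zsum_ext. intros i' _.
    rewrite !(penv_E _ Pe), !(penv_W _ Pe). fold (xok i' k') (xv i' k').
    rewrite !pairZ_eqb, (andb_comm (k' =? k)).
    destruct (xok i' k' =? 0), (i' =? i), (k' =? k), (s aId (pairZ k' (xv i' k')) =? h); reflexivity.
  - now rewrite (hit2 N N k i (fun k' i' => if xok i' k' =? 0 then 0 else if s aId (pairZ k' (xv i' k')) =? h then 1 else 0)).
Qed.

Lemma heavyB_ok s h k j : penv s -> (forall z, s aBm z = 0) -> 0 <= k < N -> 0 <= j < N ->
  sem c_heavyB s aBm (pairZ h (pairZ k j)) =
  if yok k j =? 0 then 0 else if s aId (pairZ k (yv k j)) =? h then 1 else 0.
Proof.
  intros Pe H0 Hk Hj. rewrite (acc_sem aBm) by reflexivity. rewrite H0. unfold c_heavyB, Acc. evs.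
  rewrite (penv_N _ Pe), (penv_p _ Pe), Z.add_0_l.
  transitivity (zsum N (fun k' => zsum N (fun j' => if pairZ k' j' =? pairZ k j then
    (if yok k' j' =? 0 then 0 else if s aId (pairZ k' (yv k' j')) =? h then 1 else 0) else 0))).
  - apply zsum_ext. intros k' _. apply zsum_ext. intros j' _.
    rewrite !(penv_E _ Pe), !(penv_W _ Pe). fold (yok k' j') (yv k' j').
    rewrite !pairZ_eqb.
    destruct (yok k' j' =? 0), (j' =? j), (k' =? k), (s aId (pairZ k' (yv k' j')) =? h); reflexivity.
  - now rewrite (hit2 N N k j (fun k' j' => if yok k' j' =? 0 then 0 else if s aId (pairZ k' (yv k' j')) =? h then 1 else 0)).
Qed.

Lemma light_ok s i j : penv s -> clsinv N 0 s -> (forall z, s aD z = 0) -> 0 <= i < N -> 0 <= j < N ->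
  sem c_light s aD (pairZ i j) =
  zsum N (fun k => if yok k j =? 0 then 0 else if s aId (pairZ k (yv k j)) =? 0 then
     incls (yv k j) k (fun _ => 1) i else 0).
Proof.
  intros Pe Hc H0 Hi Hj. rewrite (acc_sem aD) by reflexivity. rewrite H0. unfold c_light, Acc. evs.
  rewrite (penv_N _ Pe), (penv_p _ Pe), Z.add_0_l.
  apply zsum_ext. intros k Hk.
  rewrite <- (zsum_delta N j (fun j => if yok k j =? 0 then 0 else if s aId (pairZ k (yv k j)) =? 0 then
     incls (yv k j) k (fun _ => 1) i else 0) Hj).
  apply zsum_ext. intros j' Hj'.
  rewrite !(penv_E _ Pe), !(penv_W _ Pe). fold (yok k j') (yv k j').
  destruct (yok01 k j') as [Y0|Y0]; rewrite Y0.
  { cbn. now destruct (j' =? j). }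
  destruct (Z.eqb_spec (s aId (pairZ k (yv k j'))) 0) as [I0|I0]; cbn [Z.mul Z.eqb Pos.mul].
  2:{ now destruct (j' =? j). }
  destruct (Hc k (yv k j') ltac:(lia)) as [_ J].
  (* The multiset specification is applied to the indicator of the cell [(i, j)]. *)
  specialize (J (fun m => if pairZ m j' =? pairZ i j then 1 else 0)). cbv beta in J. rewrite J.
  unfold lim. destruct (Z.ltb_spec k N); [|lia].
  destruct (Z.eqb_spec j' j) as [->|Nj].
  - transitivity (zsum N (fun i' => if i' =? i then incls (yv k j) k (fun _ => 1) i' else 0)).
    + apply zsum_ext. intros i' _. unfold incls. rewrite pairZ_eqb, Z.eqb_refl, andb_true_r.
      destruct (xok i' k =? 0), (i' =? i), (xv i' k =? yv k j); reflexivity.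
    + now rewrite (zsum_delta N i (incls (yv k j) k (fun _ => 1))).
  - apply zsum_zero. intros i' _. unfold incls. rewrite pairZ_eqb.
    apply Z.eqb_neq in Nj. rewrite Nj, andb_false_r. now destruct (xok i' k =? 0), (xv i' k =? yv k j').
Qed.

Lemma mm_ok s h i j : penv s -> s lh 0 = h -> 0 <= i < N -> 0 <= j < N ->
  sem c_mm s aD (pairZ i j) = s aD (pairZ i j) +
    zsum N (fun k => s aA (pairZ (h + 1) (pairZ i k)) * s aBm (pairZ (h + 1) (pairZ k j))).
Proof.
  intros Pe Hh Hi Hj. pose proof Z2_pos as Z2p. pose proof Q7_pos as Q7p.
  unfold c_mm. cbn [sem].
  set (s0 := clr (clr (clr s aAh) aBh) aPm).
  assert (Pe0 : penv s0).
  { apply (penv_agr [aAh; aBh; aPm] s); [reflexivity| |exact Pe].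
    intros b Hb y. unfold s0, clr. cbn in Hb. apply orb_false_iff in Hb. destruct Hb as [Q1 Hb].
    apply orb_false_iff in Hb. destruct Hb as [Q2 Hb]. apply orb_false_iff in Hb. destruct Hb as [Q3 _].
    now rewrite Q1, Q2, Q3. }
  set (s1 := sem c_mmA s0). set (s2 := sem c_mmB s1). set (s3 := sem c_mmP s2).
  assert (Pe1 : penv s1) by (apply (penv_agr (wr c_mmA) s0 s1 eq_refl); [intros b Hb y; now apply sem_frame|exact Pe0]).
  assert (Pe2 : penv s2) by (apply (penv_agr (wr c_mmB) s1 s2 eq_refl); [intros b Hb y; now apply sem_frame|exact Pe1]).
  assert (Pe3 : penv s3) by (apply (penv_agr (wr c_mmP) s2 s3 eq_refl); [intros b Hb y; now apply sem_frame|exact Pe2]).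
  set (A := fun i k => s aA (pairZ (h + 1) (pairZ i k))).
  set (Bf := fun k j => s aBm (pairZ (h + 1) (pairZ k j))).
  assert (HA : forall r u v, 0 <= r < Q7 -> 0 <= u < bs -> 0 <= v < bs ->
    s1 aAh (pairZ r (pairZ u v)) = zsum Z2 (fun x => zsum Z2 (fun y => tcoef d 0 r x y * A (x * bs + u) (y * bs + v)))).
  { intros r u v Hr Hu Hv. unfold s1. rewrite (acc_sem aAh) by reflexivity.
    change (s0 aAh (pairZ r (pairZ u v))) with 0. unfold c_mmA, Acc. evs.
    rewrite (penv_Q7 _ Pe0), (penv_b _ Pe0), (penv_Z _ Pe0), Z.add_0_l.
    rewrite <- (hit3 Q7 bs bs r u v (fun r u v => zsum Z2 (fun x => zsum Z2 (fun y => tcoef d 0 r x y * A (x * bs + u) (y * bs + v))))) by assumption.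
    apply zsum_ext. intros r' Hr'. apply zsum_ext. intros u' _. apply zsum_ext. intros v' _.
    rewrite <- zsum_if. apply zsum_ext. intros x Hx. rewrite <- zsum_if. apply zsum_ext. intros y Hy.
    rewrite (penv_T _ Pe0) by lia. change (s0 lh 0) with (s lh 0). rewrite Hh. reflexivity. }
  assert (HB : forall r u v, 0 <= r < Q7 -> 0 <= u < bs -> 0 <= v < bs ->
    s2 aBh (pairZ r (pairZ u v)) = zsum Z2 (fun x => zsum Z2 (fun y => tcoef d 1 r x y * Bf (x * bs + u) (y * bs + v)))).
  { intros r u v Hr Hu Hv. unfold s2. rewrite (acc_sem aBh) by reflexivity.
    unfold s1 at 1. rewrite sem_frame by reflexivity.
    change (s0 aBh (pairZ r (pairZ u v))) with 0. unfold c_mmB, Acc. evs.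
    rewrite (penv_Q7 _ Pe1), (penv_b _ Pe1), (penv_Z _ Pe1), Z.add_0_l.
    rewrite <- (hit3 Q7 bs bs r u v (fun r u v => zsum Z2 (fun x => zsum Z2 (fun y => tcoef d 1 r x y * Bf (x * bs + u) (y * bs + v))))) by assumption.
    apply zsum_ext. intros r' Hr'. apply zsum_ext. intros u' _. apply zsum_ext. intros v' _.
    rewrite <- zsum_if. apply zsum_ext. intros x Hx. rewrite <- zsum_if. apply zsum_ext. intros y Hy.
    rewrite (penv_T _ Pe1) by lia. unfold s1. rewrite !sem_frame by reflexivity.
    change (s0 lh 0) with (s lh 0). rewrite Hh. reflexivity. }
  assert (HP : forall r u w, 0 <= r < Q7 -> 0 <= u < bs -> 0 <= w < bs ->
    s3 aPm (pairZ r (pairZ u w)) = zsum bs (fun v => s1 aAh (pairZ r (pairZ u v)) * s2 aBh (pairZ r (pairZ v w)))).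
  { intros r u w Hr Hu Hw. unfold s3. rewrite (acc_sem aPm) by reflexivity.
    unfold s2 at 1. rewrite sem_frame by reflexivity. unfold s1 at 1. rewrite sem_frame by reflexivity.
    change (s0 aPm (pairZ r (pairZ u w))) with 0. unfold c_mmP, Acc. evs.
    rewrite (penv_Q7 _ Pe2), (penv_b _ Pe2), Z.add_0_l.
    rewrite <- (hit3 Q7 bs bs r u w (fun r u w => zsum bs (fun v => s1 aAh (pairZ r (pairZ u v)) * s2 aBh (pairZ r (pairZ v w))))) by assumption.
    apply zsum_ext. intros r' Hr'. apply zsum_ext. intros u' _. apply zsum_ext. intros v' _.
    rewrite <- zsum_if. apply zsum_ext. intros v Hv.
    replace (s2 aAh (pairZ r' (pairZ u' v))) with (s1 aAh (pairZ r' (pairZ u' v))); [reflexivity|].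
    symmetry. unfold s2. now apply sem_frame. }
  rewrite (acc_sem aD) by reflexivity.
  f_equal.
  { unfold s3. rewrite sem_frame by reflexivity. unfold s2. rewrite sem_frame by reflexivity.
    unfold s1. now rewrite sem_frame by reflexivity. }
  unfold c_mmD, Acc. evs. rewrite (penv_Q7 _ Pe3), (penv_b _ Pe3), (penv_Z _ Pe3).
  assert (Di : 0 <= i / bs < Z2) by (split; [apply Z.div_pos; lia|apply Z.div_lt_upper_bound; lia]).
  assert (Dj : 0 <= j / bs < Z2) by (split; [apply Z.div_pos; lia|apply Z.div_lt_upper_bound; lia]).
  assert (Mi : 0 <= i mod bs < bs) by (apply Z.mod_pos_bound; lia).
  assert (Mj : 0 <= j mod bs < bs) by (apply Z.mod_pos_bound; lia).
  transitivity (zsum Q7 (fun r => tcoef d 2 r (i / bs) (j / bs) * s3 aPm (pairZ r (pairZ (i mod bs) (j mod bs))))).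
  - apply zsum_ext. intros r Hr.
    rewrite <- (hit_block Z2 bs i (fun x u => tcoef d 2 r x (j / bs) * s3 aPm (pairZ r (pairZ u (j mod bs))))) by lia.
    apply zsum_ext. intros x Hx. apply zsum_ext. intros u Hu.
    rewrite <- (hit_block Z2 bs j (fun z w => tcoef d 2 r x z * s3 aPm (pairZ r (pairZ u w)))) by lia.
    rewrite <- zsum_if. apply zsum_ext. intros z Hz. rewrite <- zsum_if. apply zsum_ext. intros w _.
    rewrite (penv_T _ Pe3) by lia. rewrite pairZ_eqb. now destruct (x * bs + u =? i), (z * bs + w =? j).
  - rewrite N_blocks. fold A Bf.
    pose proof (block_mm d bs A Bf (i / bs) (j / bs) (i mod bs) (j mod bs) Di Dj ltac:(lia)) as BM.
    assert (Ei : i / bs * bs + i mod bs = i) by (pose proof (Z.div_mod i bs); lia).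
    assert (Ej : j / bs * bs + j mod bs = j) by (pose proof (Z.div_mod j bs); lia).
    rewrite Ei, Ej in BM. fold Z2 in BM.
    change (zsum (Z2 * bs) (fun k => s aA (pairZ (h + 1) (pairZ i k)) * s aBm (pairZ (h + 1) (pairZ k j))))
      with (zsum (Z2 * bs) (fun k => A i k * Bf k j)).
    rewrite <- BM.
    apply zsum_ext. intros r Hr. rewrite HP by assumption. f_equal.
    apply zsum_ext. intros v Hv. rewrite HA, HB by assumption. reflexivity.
Qed.

Lemma clsinv_ext s s' : (forall y, s' aCnt y = s aCnt y) -> (forall y, s' aMem y = s aMem y) ->
  clsinv N 0 s -> clsinv N 0 s'.
Proof.
  intros H1 H2 H k v Hk. destruct (H k v Hk) as [J1 J2]. rewrite H1. split; [exact J1|].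
  intros f. rewrite <- J2. apply zsum_ext. intros x _. now rewrite H2.
Qed.

(** A class of [Th >= 1] members has a member row, and the pass over the rows gave its value an
    identifier. *)
Lemma id_light s k v : idinv N 0 s -> 0 <= k < N -> s aId (pairZ k v) = 0 -> cntf k v < Th.
Proof.
  intros I Hk Hv. destruct (I k Hk) as (_ & _ & _ & _ & J5).
  destruct (Z.lt_ge_cases (cntf k v) Th) as [L|L]; [exact L|].
  destruct (cntf_ex k v ltac:(lia)) as (i & Hi & Hx & <-).
  exfalso. apply (J5 i); auto. unfold lim. destruct (Z.ltb_spec k N); lia.
Qed.

Lemma light_cost s : penv s -> clsinv N 0 s -> idinv N 0 s ->
  cost c_light s <= 1 + N * (1 + (1 + N * (1 + (2 + 3 * Th)))).
Proof.
  intros Pe Hc Hi. pose proof N_pos as Np. unfold c_light.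
  match goal with |- context [For lk (V vN) (For lj (V vN) ?c)] => set (body := c) end.
  set (l := [lk; lj; lx; aD]).
  destruct (for_rule (fun _ s' => agr l s s') lk (V vN) (For lj (V vN) body) s N
    (1 + N * (1 + (2 + 3 * Th)))) as [_ R2]; [apply Pe|lia|apply agr_refl| |exact R2].
  intros k s1 Hk A1.
  assert (A1' : agr l s (set s1 lk 0 k)) by (apply agr_set; [reflexivity|exact A1]).
  destruct (for_rule (fun _ s' => agr l s s' /\ s' lk 0 = k) lj (V vN) body (set s1 lk 0 k) N
    (2 + 3 * Th)) as [[R1 _] R3];
    [apply (penv_agr l s _ eq_refl A1' Pe)|lia|split; [exact A1'|apply set_same]| |now split].
  intros j s2 Hj [A2 K2]. set (s3 := set s2 lj 0 j).
  assert (A3 : agr l s s3) by (apply agr_set; [reflexivity|exact A2]).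
  assert (K3 : s3 lk 0 = k) by (unfold s3; rewrite set_other by discriminate; exact K2).
  assert (J3 : s3 lj 0 = j) by apply set_same.
  pose proof (penv_agr l s s3 eq_refl A3 Pe) as Pe3.
  split; [split|].
  - apply agr_sem; [reflexivity|exact A3].
  - rewrite sem_frame by reflexivity. exact K3.
  - unfold body. cbn [cost].
    match goal with |- 1 + (if ?e then _ else ?b) <= _ => destruct e eqn:Q; [lia|] end.
    pose proof (Yval_eval s3 k j Pe3 J3 K3) as Ev.
    assert (I0 : s3 aId (pairZ k (yv k j)) = 0).
    { cbn [eval opsem V Ix] in Q. rewrite Ev in Q. rewrite K3 in Q.
      destruct (Z.eqb_spec (s3 aId (pairZ k (yv k j))) 0) as [|Nz]; [assumption|].
      rewrite Z.mul_0_r in Q. discriminate Q. }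
    rewrite (A3 aId) in I0 by reflexivity.
    assert (Cn : eval (Ix aCnt (V lk) Yval) s3 < Th).
    { cbn [eval opsem V Ix]. rewrite Ev, K3, (A3 aCnt) by reflexivity. rewrite clsinv_cnt by (auto; lia).
      now apply (id_light s). }
    enough (L : cost (For lx (Ix aCnt (V lk) Yval)
      (Acc aD (Bin OPair (Ix aMem (V lk) (Bin OPair Yval (V lx))) (V lj)) (Cst 1))) s3 <= 3 * (Th * 1)).
    { unfold cost in L; fold cost in L. cbn [cost] in L. lia. }
    apply (cle_cost [lx; aD]). apply cle_for; try reflexivity; try lia. apply cle_put.
Qed.

(** Five nested loops cost a factor 3^5 = 243, in each of the three nests that handle coefficients;
    the four loops of the block products cost 3^4 = 81. *)
Lemma mm_cost s : penv s ->
  cle (wr c_mm) c_mm s (740 * (Q7 * (N * N)) + 82 * (Q7 * (bs * bs * bs))).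
Proof.
  intros Pe. pose proof Z2_pos as Z2p. pose proof Q7_pos as Q7p. pose proof N_pos as Np.
  unfold c_mm.
  eapply cle_weaken.
  2:{ eapply cle_seq; [reflexivity|apply cle_clear|]. eapply cle_seq; [reflexivity|apply cle_clear|].
      eapply cle_seq; [reflexivity|apply cle_clear|].
      eapply cle_seq; [reflexivity| |eapply cle_seq; [reflexivity| |eapply cle_seq; [reflexivity| |]]].
      - unfold c_mmA. clfor (penv_Q7 _ Pe). clfor (penv_b _ Pe). clfor (penv_b _ Pe).
        clfor (penv_Z _ Pe). clfor (penv_Z _ Pe). apply cle_put. all: nia.
      - unfold c_mmB. clfor (penv_Q7 _ Pe). clfor (penv_b _ Pe). clfor (penv_b _ Pe).
        clfor (penv_Z _ Pe). clfor (penv_Z _ Pe). apply cle_put. all: nia.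
      - unfold c_mmP. clfor (penv_Q7 _ Pe). clfor (penv_b _ Pe). clfor (penv_b _ Pe).
        clfor (penv_b _ Pe). apply cle_put. all: nia.
      - unfold c_mmD. clfor (penv_Q7 _ Pe). clfor (penv_Z _ Pe). clfor (penv_b _ Pe).
        clfor (penv_Z _ Pe). clfor (penv_b _ Pe). apply cle_put. all: nia. }
  assert (1 <= Q7 * (N * N)) by nia.
  assert (1 <= Q7 * (bs * bs * bs)) by nia.
  replace (3 * (Q7 * (3 * (bs * (3 * (bs * (3 * (Z2 * (3 * (Z2 * 1))))))))))
    with (243 * (Q7 * (N * N))) by (rewrite N_blocks; ring).
  replace (3 * (Q7 * (3 * (Z2 * (3 * (bs * (3 * (Z2 * (3 * (bs * 1))))))))))
    with (243 * (Q7 * (N * N))) by (rewrite N_blocks; ring).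
  replace (3 * (Q7 * (3 * (bs * (3 * (bs * (3 * (bs * 1))))))))
    with (81 * (Q7 * (bs * bs * bs))) by ring.
  lia.
Qed.

Definition eqcnt (i j : Z) : Z := zsum N (fun k =>
  if xok i k =? 0 then 0 else if yok k j =? 0 then 0 else if xv i k =? yv k j then 1 else 0).

Definition eqcost : Z :=
  100 * (N * N * Th) + R5 * (2300 * (Q7 * (N * N)) + 300 * (Q7 * (bs * bs * bs))).

(** A middle node [k] with equal sides is counted exactly once: by enumeration if the common value
    has identifier 0, otherwise in the matrix product of its identifier. With unequal sides the
    identifiers differ or are both 0, and nothing is counted. *)
Lemma eqprod_ok s : penv s ->
  (forall i j, 0 <= i < N -> 0 <= j < N -> sem c_eqprod s aD (pairZ i j) = eqcnt i j) /\
  cost c_eqprod s <= eqcost.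
Proof.
  intros Pe. pose proof N_pos as Np. pose proof Q7_pos as Q7p.
  unfold c_eqprod. cbn [sem cost].
  match goal with |- context [clr ?x aD] => set (s0 := clr x aD) end.
  assert (Pe0 : penv s0).
  { apply (penv_agr [aCnt; aMem; aId; aNh; aA; aBm; aD] s); [reflexivity| |exact Pe].
    intros b Hb y. unfold s0, clr. cbn in Hb. rewrite !orb_false_iff in Hb.
    destruct Hb as (Q1 & Q2 & Q3 & Q4 & Q5 & Q6 & Q7' & _).
    now rewrite Q1, Q2, Q3, Q4, Q5, Q6, Q7'. }
  destruct (classes_ok s0 Pe0) as [Cl1 Co1]; [reflexivity|].
  set (s1 := sem c_classes s0) in *.
  assert (F1 : agr (wr c_classes) s0 s1) by (intros b Hb y; now apply sem_frame).
  pose proof (penv_agr (wr c_classes) s0 s1 eq_refl F1 Pe0) as Pe1.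
  destruct (ids_ok s1 Pe1 Cl1) as [Id2 Co2].
  { intros z. rewrite F1 by reflexivity. reflexivity. }
  { intros z. rewrite F1 by reflexivity. reflexivity. }
  set (s2 := sem c_ids s1) in *.
  assert (F2 : agr (wr c_ids) s1 s2) by (intros b Hb y; now apply sem_frame).
  pose proof (penv_agr (wr c_ids) s1 s2 eq_refl F2 Pe1) as Pe2.
  set (s3 := sem c_heavyA s2).
  assert (F3 : agr (wr c_heavyA) s2 s3) by (intros b Hb y; now apply sem_frame).
  pose proof (penv_agr (wr c_heavyA) s2 s3 eq_refl F3 Pe2) as Pe3.
  set (s4 := sem c_heavyB s3).
  assert (F4 : agr (wr c_heavyB) s3 s4) by (intros b Hb y; now apply sem_frame).
  pose proof (penv_agr (wr c_heavyB) s3 s4 eq_refl F4 Pe3) as Pe4.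
  set (s5 := sem c_light s4).
  assert (F5 : agr (wr c_light) s4 s5) by (intros b Hb y; now apply sem_frame).
  pose proof (penv_agr (wr c_light) s4 s5 eq_refl F5 Pe4) as Pe5.
  assert (Cl4 : clsinv N 0 s4).
  { apply (clsinv_ext s1); [| |exact Cl1]; intros y; now rewrite F4, F3, F2 by reflexivity. }
  assert (Id4 : idinv N 0 s4).
  { apply (idinv_ext N 0 N 0 s2); [| |intros; lia|exact Id2]; intros y; now rewrite F4, F3 by reflexivity. }
  pose proof (light_cost s4 Pe4 Cl4 Id4) as Co5.
  assert (Co3 : cost c_heavyA s2 <= 3 * (N * (3 * (N * (1 + 1))))).
  { apply (cle_cost (wr c_heavyA)). unfold c_heavyA. clfor (penv_N _ Pe2). clfor (penv_N _ Pe2).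
    apply cle_if; [apply cle_put|apply cle_skip]. }
  assert (Co4 : cost c_heavyB s3 <= 3 * (N * (3 * (N * (1 + 1))))).
  { apply (cle_cost (wr c_heavyB)). unfold c_heavyB. clfor (penv_N _ Pe3). clfor (penv_N _ Pe3).
    apply cle_if; [apply cle_put|apply cle_skip]. }
  set (mmc := 740 * (Q7 * (N * N)) + 82 * (Q7 * (bs * bs * bs))).
  destruct (for_rule (fun h s' => agr (lh :: wr c_mm) s5 s' /\ forall i j, 0 <= i < N -> 0 <= j < N ->
     s' aD (pairZ i j) = s5 aD (pairZ i j) + zsum h (fun h => zsum N (fun k =>
       s5 aA (pairZ (h + 1) (pairZ i k)) * s5 aBm (pairZ (h + 1) (pairZ k j)))))
     lh (V vR5) c_mm s5 R5 mmc) as [[_ Dd] Co6].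
  - apply Pe5.
  - lia.
  - split; [apply agr_refl|]. intros. rewrite zsum_neg; lia.
  - intros h s' Hh [A I].
    assert (A' : agr (lh :: wr c_mm) s5 (set s' lh 0 h)) by (apply agr_set; [reflexivity|exact A]).
    pose proof (penv_agr (lh :: wr c_mm) s5 _ eq_refl A' Pe5) as Pe'.
    split.
    + split; [apply agr_sem; [reflexivity|exact A']|].
      intros i j Hi Hj. rewrite (mm_ok _ h) by (auto using set_same).
      rewrite set_other by discriminate. rewrite I, zsum_succ by lia. rewrite <- Z.add_assoc. f_equal. f_equal.
      apply zsum_ext. intros k _. now rewrite !(A' aA), !(A' aBm) by reflexivity.
    + apply (cle_cost (wr c_mm)). now apply mm_cost.
  - split.
    + intros i j Hi Hj. unfold s5 in Dd. change (sem (For lh (V vR5) c_mm) s5) with (sem (For lh (V vR5) c_mm) (sem c_light s4)).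
      transitivity (sem c_light s4 aD (pairZ i j) + zsum R5 (fun h => zsum N (fun k =>
         s5 aA (pairZ (h + 1) (pairZ i k)) * s5 aBm (pairZ (h + 1) (pairZ k j))))); [now apply Dd|].
      rewrite light_ok; auto.
      2:{ intros z. rewrite F4, F3, F2, F1 by reflexivity. reflexivity. }
      rewrite zsum_swap, <- zsum_plus. unfold eqcnt. apply zsum_ext. intros k Hk.
      erewrite (zsum_ext R5).
      2:{ intros h Hh. rewrite (F5 aA), (F4 aA), (F5 aBm) by reflexivity.
          unfold s3 at 1. rewrite heavyA_ok; auto; [|intros z; now rewrite F2, F1 by reflexivity].
          unfold s4 at 1. rewrite heavyB_ok; auto; [|intros z; now rewrite F3, F2, F1 by reflexivity].
          rewrite (F3 aId) by reflexivity. reflexivity. }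
      rewrite (F4 aId), (F3 aId) by reflexivity. unfold incls.
      destruct (Id2 k Hk) as (J1 & J2 & J3 & J4 & J5).
      pose proof (ids_bound s2 k Id2 Hk) as Jb.
      destruct (xok i k =? 0).
      { rewrite zsum_zero by (intros; lia). destruct (yok k j =? 0), (s2 aId (pairZ k (yv k j)) =? 0); lia. }
      destruct (yok k j =? 0).
      { rewrite zsum_zero by (intros; lia). lia. }
      set (b := s2 aId (pairZ k (yv k j))) in *. set (a := s2 aId (pairZ k (xv i k))) in *.
      pose proof (J1 (xv i k)) as Ha. pose proof (J1 (yv k j)) as Hb. fold a in Ha. fold b in Hb.
      (* The loop counts from 0, identifiers from 1. By [ids_bound] the index [b - 1] lies within
         the loop as soon as [b] is nonzero. *)
      assert (S : zsum R5 (fun h => (if a =? h + 1 then 1 else 0) * (if b =? h + 1 then 1 else 0)) =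
        if (a =? b) && negb (b =? 0) then 1 else 0).
      { transitivity (zsum R5 (fun h => if h =? b - 1 then (if a =? b then 1 else 0) else 0)).
        - apply zsum_ext. intros h _.
          destruct (Z.eqb_spec a (h + 1)), (Z.eqb_spec b (h + 1)), (Z.eqb_spec h (b - 1)), (Z.eqb_spec a b); lia.
        - destruct (Z.eqb_spec b 0) as [B0|B0].
          + rewrite (zsum_delta_out R5 (b - 1) (fun _ => if a =? b then 1 else 0)) by lia.
            now rewrite andb_false_r.
          + rewrite (zsum_delta R5 (b - 1) (fun _ => if a =? b then 1 else 0)) by lia.
            now rewrite andb_true_r. }
      rewrite S. destruct (Z.eqb_spec b 0) as [B0|B0]; cbn [negb].
      { rewrite andb_false_r. lia. }
      rewrite andb_true_r. destruct (Z.eqb_spec a b) as [Eab|Eab], (Z.eqb_spec (xv i k) (yv k j)) as [Ev|Ev]; try lia.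
      * exfalso. apply Ev. apply J2; fold a; [exact Eab|lia].
      * exfalso. apply Eab. unfold a, b. now rewrite Ev.
    + unfold eqcost. fold mmc in Co6.
      assert (1 <= N * N) by nia. assert (N <= N * N) by nia. assert (N * N <= N * N * Th) by nia.
      assert (1 <= Q7 * (N * N)) by nia. assert (1 <= Q7 * (bs * bs * bs)) by nia.
      assert (R5 <= R5 * (Q7 * (N * N))) by nia.
      unfold mmc in Co6.
      assert (X1 : 1 + N * (1 + (1 + N * (1 + 3))) <= 7 * (N * N)) by nia.
      assert (X2 : 1 + N * (1 + (1 + N * (1 + (2 + 3 * Th)))) <= 9 * (N * N * Th)) by nia.
      assert (X3 : 1 + R5 * (1 + (740 * (Q7 * (N * N)) + 82 * (Q7 * (bs * bs * bs)))) <= 1 + R5 * (2300 * (Q7 * (N * N)) + 300 * (Q7 * (bs * bs * bs)))) by nia.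
      cbn [cost] in Co6. fold s5. lia.
Qed.

End EqProd.

(** * Simulating the decision program *)

Lemma wrap_mod w x y : x mod 2 ^ Z.of_nat w = y mod 2 ^ Z.of_nat w -> wrap w x = wrap w y.
Proof.
  intros H. unfold wrap. f_equal. rewrite (Zplus_mod x), (Zplus_mod y). now rewrite H.
Qed.

Definition prep (s : state) (pc : nat) (m : memory) : Prop :=
  (forall a : nat, s aPM (Z.of_nat a) = m a) /\ s vPC 0 = Z.of_nat pc.

Definition menv (w : nat) (s : state) : Prop := s vMD 0 = 2 ^ Z.of_nat w /\ s vWP 0 = Z.of_nat w.

Lemma ewrap_eval w s x : menv w s -> eval (ewrap x) s = wrap w (eval x s).
Proof.
  intros [H1 _]. cbn [ewrap eval opsem V]. rewrite H1. unfold wrap.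
  set (md := 2 ^ Z.of_nat w). assert (0 < md) by (apply Z.pow_pos_nonneg; lia).
  pose proof (Z.mod_pos_bound (eval x s + md / 2) md ltac:(lia)).
  rewrite (Z.mod_small (_ mod md)) by nia. reflexivity.
Qed.

Lemma shl_wrap w x b : b < 0 ->
  wrap w (x * ((if 0 - b <? Z.of_nat w + 1 then 1 else 0) * Z.shiftr (2 ^ Z.of_nat w) (Z.max 0 (Z.of_nat w + b)))) =
  wrap w (Z.shiftr x b).
Proof.
  intros Hb. replace (Z.shiftr x b) with (x * 2 ^ (- b)).
  2:{ replace b with (- - b) at 2 by lia. rewrite Z.shiftr_opp_r, Z.shiftl_mul_pow2 by lia. reflexivity. }
  destruct (Z.ltb_spec (0 - b) (Z.of_nat w + 1)) as [L|L].
  - f_equal. rewrite Z.mul_1_l, Z.shiftr_div_pow2 by lia. f_equal.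
    rewrite Z.max_r by lia. rewrite <- Z.pow_sub_r by lia. f_equal. lia.
  - apply wrap_mod. rewrite Z.mul_0_l, Z.mul_0_r.
    replace (- b) with (Z.of_nat w + (- b - Z.of_nat w)) by lia.
    rewrite Z.pow_add_r by lia.
    rewrite (Z.mul_comm (2 ^ Z.of_nat w)), Z.mul_assoc, Z.mod_mul, Z.mod_0_l; try reflexivity;
      apply Z.pow_nonzero; lia.
Qed.

Lemma prep_set s pc m d v : prep s pc m ->
  (forall a : nat, set s aPM (Z.of_nat d) v aPM (Z.of_nat a) = upd m d v a).
Proof.
  intros [H _] a. unfold set, upd. rewrite Nat.eqb_refl. cbn [andb].
  destruct (Nat.eqb_spec a d) as [->|Na]; [now rewrite Z.eqb_refl|].
  destruct (Z.eqb_spec (Z.of_nat a) (Z.of_nat d)); [lia|apply H].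
Qed.

Definition next (w : nat) (pc : nat) (m : memory) (ins : instr) : option (nat * memory) :=
  match ins with
  | IHalt => None
  | IJz a l => Some (if m a =? 0 then l else S pc, m)
  | IJmp l => Some (l, m)
  | _ => Some (S pc, step1 w m ins)
  end.

Lemma exec_next P w f pc m : exec P w (S f) pc m =
  match nth_error P pc with
  | None => Some m
  | Some ins => match next w pc m ins with
                | None => Some m
                | Some (pc', m') => exec P w f pc' m'
                end
  end.
Proof.
  cbn [exec]. destruct (nth_error P pc) as [ins|]; [|reflexivity].
  destruct ins; try reflexivity. cbn [next]. now destruct (m a =? 0).
Qed.

Lemma eaddr_nat (x : Z) : x * (if 0 <? x then 1 else 0) = Z.of_nat (Z.to_nat x).
Proof. destruct (Z.ltb_spec 0 x); lia. Qed.

Lemma sem_put_cst a z e s : sem (Put a (Cst z) e) s = set s a z (eval e s).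
Proof. reflexivity. Qed.

Lemma sem_seq c1 c2 s : sem (Seq c1 c2) s = sem c2 (sem c1 s).
Proof. reflexivity. Qed.

Lemma cost_seq c1 c2 s : cost (Seq c1 c2) s = cost c1 s + cost c2 (sem c1 s).
Proof. reflexivity. Qed.

Lemma sem_if e c1 c2 s : sem (If e c1 c2) s = if eval e s =? 0 then sem c2 s else sem c1 s.
Proof. reflexivity. Qed.

Lemma instr_ok w s pc m ins : menv w s -> prep s pc m -> s vHLT 0 = 1 ->
  match next w pc m ins with
  | None => sem (c_instr pc ins) s = s
  | Some (pc', m') => prep (sem (c_instr pc ins) s) pc' m' /\ sem (c_instr pc ins) s vHLT 0 = 0
  end.
Proof.
  intros Me Pr Hh. pose proof Pr as [Pm Ppc].
  assert (NX : forall s' m', (forall a : nat, s' aPM (Z.of_nat a) = m' a) ->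
    prep (sem (nextpc pc) s') (S pc) m' /\ sem (nextpc pc) s' vHLT 0 = 0).
  { intros s' m' H. unfold nextpc. cbn [sem eval]. split; [split|].
    - intros a. rewrite !set_other by discriminate. apply H.
    - rewrite set_other by discriminate. rewrite set_same. lia.
    - apply set_same. }
  destruct ins as [d z|d a b|d a b|d a b|d a b|d a b|d a b|d a b|d a b|d a b|d a b|d a b|d a|a s0|a l|l|];
    cbn [next step1]; cbn [c_instr]; try (reflexivity);
    try (rewrite !sem_seq; apply NX; unfold c_bin; intros c; rewrite sem_put_cst, (prep_set s pc m) by exact Pr;
         unfold binop; f_equal; rewrite ?(ewrap_eval w) by exact Me; cbn [eval opsem pm]; rewrite ?Pm; reflexivity).
  - rewrite !sem_seq. apply NX. intros c. rewrite sem_if.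
    replace (eval (pm b < Cst 0)%P s) with (if m b <? 0 then 1 else 0) by (cbn [eval opsem pm]; now rewrite Pm).
    destruct (Z.ltb_spec (m b) 0) as [L|L]; cbn [Z.eqb].
    + rewrite sem_put_cst, (prep_set s pc m) by exact Pr. unfold binop. f_equal.
      rewrite (ewrap_eval w) by exact Me. cbn [eval opsem pm V]. rewrite !Pm. destruct Me as [-> ->].
      now apply shl_wrap.
    + unfold c_bin. rewrite sem_put_cst, (prep_set s pc m) by exact Pr.
      unfold binop. f_equal. rewrite (ewrap_eval w) by exact Me. cbn [eval opsem pm]. rewrite !Pm.
      now rewrite Z.max_r by lia.
  - rewrite !sem_seq. apply NX. intros c. rewrite sem_put_cst, (prep_set s pc m) by exact Pr. f_equal.
    cbn [eval opsem pm eaddr]. rewrite !Pm, eaddr_nat. apply Pm.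
  - rewrite !sem_seq. apply NX. intros c. cbn [sem]. cbn [eval opsem pm eaddr]. rewrite !Pm, eaddr_nat.
    now rewrite (prep_set s pc m) by exact Pr.
  - cbn [sem]. cbn [eval pm]. rewrite Pm. destruct (m a =? 0).
    + cbn [sem eval]. split; [split|].
      * intros c. rewrite !set_other by discriminate. apply Pm.
      * rewrite set_other by discriminate. apply set_same.
      * apply set_same.
    + now apply NX.
  - cbn [sem eval]. split; [split|].
    + intros c. rewrite !set_other by discriminate. apply Pm.
    + rewrite set_other by discriminate. apply set_same.
    + apply set_same.
Qed.

Lemma instr_wr i ins : inclb (wr (c_instr i ins)) [aPM; vPC; vHLT] = true.
Proof. destruct ins; reflexivity. Qed.

Lemma dispatch_wr P0 : forall i, inclb (wr (c_dispatch i P0)) [aPM; vPC; vHLT] = true.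
Proof.
  induction P0 as [|ins P0 IH]; intros i; [reflexivity|]. cbn [c_dispatch wr].
  now rewrite !inclb_app, IH, instr_wr.
Qed.

Lemma dispatch_miss P0 : forall i c s, s vCP 0 = Z.of_nat c -> (c < i)%nat \/ (i + length P0 <= c)%nat ->
  sem (c_dispatch i P0) s = s.
Proof.
  induction P0 as [|ins P0 IH]; intros i c s Hc Hi; [reflexivity|].
  cbn [c_dispatch sem eval opsem V length] in *. rewrite Hc.
  destruct (Z.eqb_spec (Z.of_nat c) (Z.of_nat i)); [lia|]. cbn. apply (IH _ c); [exact Hc|lia].
Qed.

Lemma dispatch_hit P0 : forall i c ins s, s vCP 0 = Z.of_nat c -> (i <= c)%nat ->
  nth_error P0 (c - i) = Some ins -> sem (c_dispatch i P0) s = sem (c_instr c ins) s.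
Proof.
  induction P0 as [|ins' P0 IH]; intros i c ins s Hc Hi Hn; [now destruct (c - i)%nat|].
  cbn [c_dispatch sem eval opsem V]. rewrite Hc.
  destruct (Z.eqb_spec (Z.of_nat c) (Z.of_nat i)) as [E|E].
  - assert (c = i) by lia. subst i. rewrite Nat.sub_diag in Hn. injection Hn as ->.
    cbn [Z.eqb]. apply (dispatch_miss _ _ c); [|lia].
    rewrite sem_frame; [exact Hc|]. apply (inclb_spec _ [aPM; vPC; vHLT]); [apply instr_wr|reflexivity].
  - cbn [Z.eqb]. apply IH; [exact Hc|lia|]. replace (c - i)%nat with (S (c - S i)) in Hn by lia. exact Hn.
Qed.

Lemma instr_cost i ins s : cost (c_instr i ins) s <= 6.
Proof.
  destruct ins; cbn [c_instr cost c_bin nextpc]; try lia; unfold nextpc, c_bin; cbn [cost];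
    try destruct (_ =? _); cbn [cost]; lia.
Qed.

Lemma dispatch_cost P0 : forall i s, cost (c_dispatch i P0) s <= 1 + 7 * Z.of_nat (length P0).
Proof.
  induction P0 as [|ins P0 IH]; intros i s; [cbn; lia|]. cbn [c_dispatch cost length].
  match goal with |- context [cost (c_dispatch (S i) P0) ?x] => pose proof (IH (S i) x) end.
  pose proof (instr_cost i ins s). destruct (_ =? 0); lia.
Qed.

Definition steplen (P0 : program) : Z := 5 + 7 * Z.of_nat (length P0).

Lemma step_cost P0 s : cost (c_step P0) s <= steplen P0.
Proof.
  unfold c_step, steplen. cbn [cost].
  match goal with |- context [cost (c_dispatch 0 P0) ?x] => pose proof (dispatch_cost P0 0 x) end.
  destruct (_ =? 0); lia.
Qed.

Lemma step_wr P0 : inclb (wr (c_step P0)) [aPM; vPC; vHLT; vCP] = true.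
Proof.
  unfold c_step. cbn [wr]. rewrite !inclb_app.
  now rewrite (inclb_trans (wr (c_dispatch 0 P0)) [aPM; vPC; vHLT]) by (reflexivity || apply dispatch_wr).
Qed.

(** The rounds after the halt change nothing in the simulated memory, so an upper bound on the
    running time suffices. *)
Lemma interp_ok P0 w s T m m' TM : menv w s -> prep s 0 m -> s vHLT 0 = 0 -> s vTM 0 = TM ->
  exec P0 w T 0 m = Some m' -> Z.of_nat T <= TM ->
  (forall a : nat, sem (For lst (V vTM) (c_step P0)) s aPM (Z.of_nat a) = m' a) /\
  cost (For lst (V vTM) (c_step P0)) s <= 1 + TM * (1 + steplen P0).
Proof.
  intros Me Pr Hh Ht Ex HT.
  destruct (for_rule (fun i s' => menv w s' /\
     ((s' vHLT 0 = 0 /\ exists pc m1, prep s' pc m1 /\ exec P0 w (T - Z.to_nat i) pc m1 = Some m') \/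
      (s' vHLT 0 = 1 /\ forall a : nat, s' aPM (Z.of_nat a) = m' a)))
     lst (V vTM) (c_step P0) s TM (steplen P0)) as [[_ [(_ & pc & m1 & _ & Q)|[_ Q]]] Co].
  - exact Ht.
  - lia.
  - split; [exact Me|]. left. split; [exact Hh|]. exists 0%nat, m. split; [exact Pr|].
    now rewrite Nat.sub_0_r.
  - intros i s1 Hi [Me1 St]. split; [|apply step_cost].
    assert (Me2 : menv w (set s1 lst 0 i)).
    { destruct Me1 as [M1 M2]. split; rewrite set_other by discriminate; assumption. }
    split.
    { destruct Me2 as [M1 M2]. split; (rewrite sem_frame; [assumption|]);
        (apply (inclb_spec _ [aPM; vPC; vHLT; vCP]); [apply step_wr|reflexivity]). }
    unfold c_step. cbn [sem]. cbn [eval opsem V]. rewrite (set_other _ _ _ _ vHLT) by discriminate.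
    destruct St as [(H0 & pc & m1 & Pr1 & Ex1)|[H1 Q]].
    + rewrite H0. cbn [Z.eqb].
      destruct (T - Z.to_nat i)%nat as [|f] eqn:Ef; [discriminate Ex1|].
      replace (T - Z.to_nat (i + 1))%nat with f by lia.
      rewrite exec_next in Ex1.
      set (s2 := set (set s1 lst 0 i) vCP 0 _). set (s3 := set s2 vHLT 0 1).
      assert (Me3 : menv w s3).
      { destruct Me2 as [M1 M2]. split; unfold s3, s2; rewrite !set_other by discriminate; assumption. }
      assert (Pr3 : prep s3 pc m1).
      { destruct Pr1 as [P1 P2]. split; [intros a|]; unfold s3, s2; rewrite !set_other by discriminate; auto. }
      assert (C3 : s3 vCP 0 = Z.of_nat pc).
      { unfold s3, s2. rewrite set_other by discriminate. rewrite set_same, set_other by discriminate. apply Pr1. }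
      assert (H3 : s3 vHLT 0 = 1) by apply set_same.
      destruct (nth_error P0 pc) as [ins|] eqn:En.
      * rewrite (dispatch_hit P0 0 pc ins) by (auto; try lia; now rewrite Nat.sub_0_r).
        pose proof (instr_ok w s3 pc m1 ins Me3 Pr3 H3) as IO.
        destruct (next w pc m1 ins) as [[pc' m1']|].
        -- left. destruct IO as [IO1 IO2]. split; [exact IO2|]. now exists pc', m1'.
        -- right. rewrite IO. injection Ex1 as <-. split; [exact H3|apply Pr3].
      * rewrite (dispatch_miss P0 0 pc) by (auto; right; now apply nth_error_None).
        right. injection Ex1 as <-. split; [exact H3|apply Pr3].
    + rewrite H1. cbn [Z.eqb]. right. split; [now rewrite set_other by discriminate|].
      intros a. rewrite set_other by discriminate. apply Q.
  (* After [TM >= T] rounds a program that still ran would have no fuel left, against the assumption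
     that it delivers [m']. *)
  - exfalso. replace (T - Z.to_nat TM)%nat with 0%nat in Q by lia. discriminate Q.
  - split; [exact Q|exact Co].
Qed.

Section Oracle.
Variables (B t TM Wb : Z) (wp : nat) (P0 : program) (E W : Z -> Z -> Z).
Hypothesis B_pos : 1 <= B.
Hypothesis E01 : forall i j, E i j = 0 \/ E i j = 1.
Hypothesis Wbd : forall i j, E i j = 1 -> Z.abs (W i j) <= Wb.
Hypothesis orc : forall G, wf_graph G -> gn G = Z.to_nat (3 * B) ->
  (forall i j, (i < gn G)%nat -> (j < gn G)%nat -> gadj G i j = true -> Z.abs (gwt G i j) <= Wb) ->
  exists T m, exec P0 wp T 0 (input_mem G t) = Some m /\ Z.of_nat T <= TM /\
    (m 0%nat <> 0 <-> has_exact_tri G t).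

Record oenv (Hf : Z -> Z -> Z) (s : state) : Prop := Oenv {
  oenv_B : s vB 0 = B;
  oenv_t : s 0%nat 1 = t;
  oenv_TM : s vTM 0 = TM;
  oenv_m : menv wp s;
  oenv_E : forall i j, s aE (pairZ i j) = E i j;
  oenv_W : forall i j, s aW (pairZ i j) = W i j;
  oenv_H : forall i j, s aH (pairZ i j) = Hf i j
}.

Lemma oenv_agr l Hf s s' : disj l [vB; 0%nat; vTM; vMD; vWP; aE; aW; aH] = true ->
  agr l s s' -> oenv Hf s -> oenv Hf s'.
Proof.
  intros Dj A [h1 h2 h3 [h4 h4'] h5 h6 h7].
  assert (G : forall b, mem b [vB; 0%nat; vTM; vMD; vWP; aE; aW; aH] = true -> forall y, s' b y = s b y).
  { intros b Hb. apply A. eapply disj_spec; eassumption. }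
  constructor; [| | |split| | |]; intros; rewrite G by reflexivity; auto.
Qed.

Section Instance.
Variables (Hf : Z -> Z -> Z) (I K J : Z).
Hypothesis H01 : forall i j, Hf i j = 0 \/ Hf i j = 1.

Definition base (q : Z) : Z := if q =? 0 then I else if q =? 1 then K else J.
Definition vxf (u : Z) : Z := base (u / B) * B + u mod B.
Definition egf (u v : Z) : Z :=
  E (vxf u) (vxf v) * (1 - Hf (vxf u) (vxf v) * (if v / B - u / B =? 2 then 1 else 0)).
(** [E] is oriented while the decision problem wants undirected graphs: both orders look the edge up
    from the lower part to the higher one, and there are no edges within a part. *)
Definition adjf (u v : Z) : Z :=
  if u / B <? v / B then egf u v else if v / B <? u / B then egf v u else 0.
Definition wtf (u v : Z) : Z :=
  if u / B <? v / B then W (vxf u) (vxf v) else if v / B <? u / B then W (vxf v) (vxf u) else 0.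

Definition inst : wgraph := WGraph (Z.to_nat (3 * B))
  (fun u v => adjf (Z.of_nat u) (Z.of_nat v) =? 1) (fun u v => wtf (Z.of_nat u) (Z.of_nat v)).

Lemma egf01 u v : egf u v = 0 \/ egf u v = 1.
Proof.
  unfold egf. destruct (E01 (vxf u) (vxf v)) as [-> | ->], (H01 (vxf u) (vxf v)) as [-> | ->],
    (v / B - u / B =? 2); auto.
Qed.

Lemma adjf_sym u v : adjf u v = adjf v u.
Proof. unfold adjf. destruct (Z.ltb_spec (u / B) (v / B)), (Z.ltb_spec (v / B) (u / B)); lia. Qed.

Lemma adjf01 u v : adjf u v = 0 \/ adjf u v = 1.
Proof. unfold adjf. destruct (_ <? _); [apply egf01|]. destruct (_ <? _); [apply egf01|auto]. Qed.

Lemma inst_wf : wf_graph inst.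
Proof.
  split.
  - intros i j Hi Hj. cbn. rewrite adjf_sym. split; [reflexivity|].
    unfold wtf. destruct (Z.ltb_spec (Z.of_nat i / B) (Z.of_nat j / B)), (Z.ltb_spec (Z.of_nat j / B) (Z.of_nat i / B)); lia.
  - intros i Hi. cbn. unfold adjf. now rewrite Z.ltb_irrefl.
Qed.

Lemma inst_bound i j : gadj inst i j = true -> Z.abs (gwt inst i j) <= Wb.
Proof.
  cbn. rewrite Z.eqb_eq. unfold adjf, wtf.
  assert (G : forall u v, egf u v = 1 -> Z.abs (W (vxf u) (vxf v)) <= Wb).
  { intros u v H. apply Wbd. unfold egf in H. destruct (E01 (vxf u) (vxf v)) as [Q|Q]; [rewrite Q in H; lia|exact Q]. }
  destruct (_ <? _); [apply G|]. destruct (_ <? _); [apply G|lia].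
Qed.

Lemma fill_contr s z : oenv Hf s -> s aBB 0 = I -> s aBB 1 = K -> s aBB 2 = J ->
  contr c_fill s z = (if 0 =? z then 3 * B else 0) + ((if 1 =? z then t else 0) +
    zsum (3 * B) (fun u => zsum (3 * B) (fun v =>
      (if 2 + 2 * (u * (3 * B) + v) =? z then adjf u v else 0) +
      (if 3 + 2 * (u * (3 * B) + v) =? z then adjf u v * wtf u v else 0)))).
Proof.
  intros Oe B0 B1 B2. unfold c_fill, c_edge, Acc. cbn [contr eval opsem V Ix vx eg e3B et].
  unfold set. cbn [Nat.eqb andb Z.eqb].
  rewrite (oenv_B _ _ Oe), (oenv_t _ _ Oe). f_equal. f_equal.
  assert (Bs : forall u, 0 <= u < 3 * B -> s aBB (u / B) * B + u mod B = vxf u).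
  { intros u Hu. unfold vxf, base. assert (0 <= u / B < 3) by (split; [apply Z.div_pos; lia|apply Z.div_lt_upper_bound; lia]).
    destruct (Z.eqb_spec (u / B) 0) as [->|]; [now rewrite B0|].
    destruct (Z.eqb_spec (u / B) 1) as [->|]; [now rewrite B1|].
    replace (u / B) with 2 by lia. now rewrite B2. }
  apply zsum_ext. intros u Hu. apply zsum_ext. intros v Hv.
  rewrite !Bs by assumption. rewrite !(oenv_E _ _ Oe), !(oenv_W _ _ Oe), !(oenv_H _ _ Oe).
  unfold adjf, wtf. fold (egf u v) (egf v u).
  destruct (u / B <? v / B); cbn [Z.eqb]; [reflexivity|].
  destruct (v / B <? u / B); cbn [Z.eqb]; [reflexivity|].
  now destruct (_ =? z), (_ =? z).
Qed.

Lemma fill_ok s : oenv Hf s -> s aBB 0 = I -> s aBB 1 = K -> s aBB 2 = J -> (forall z, s aPM z = 0) ->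
  forall a : nat, sem c_fill s aPM (Z.of_nat a) = input_mem inst t a.
Proof.
  intros Oe B0 B1 B2 H0 a. rewrite (acc_sem aPM) by reflexivity. rewrite H0, fill_contr by assumption.
  rewrite Z.add_0_l. set (n := 3 * B).
  assert (Hn : Z.of_nat (Z.to_nat n) = n) by (unfold n; lia).
  destruct a as [|[|b]].
  - cbn [Z.of_nat Z.eqb input_mem inst gn]. rewrite zsum_zero; [fold n; lia|].
    intros u Hu. apply zsum_zero. intros v Hv.
    destruct (Z.eqb_spec (2 + 2 * (u * n + v)) 0), (Z.eqb_spec (3 + 2 * (u * n + v)) 0); nia.
  - change (Z.of_nat 1) with 1. cbn [Z.eqb input_mem]. rewrite zsum_zero; [cbn; lia|].
    intros u Hu. apply zsum_zero. intros v Hv.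
    destruct (Z.eqb_spec (2 + 2 * (u * n + v)) 1), (Z.eqb_spec (3 + 2 * (u * n + v)) 1); nia.
  - replace (0 =? Z.of_nat (S (S b))) with false by (symmetry; apply Z.eqb_neq; lia).
    replace (1 =? Z.of_nat (S (S b))) with false by (symmetry; apply Z.eqb_neq; lia).
    rewrite !Z.add_0_l. cbn [input_mem].
    change (gn inst) with (Z.to_nat n).
    set (p := (b / 2)%nat). set (pz := Z.of_nat p).
    assert (Hb : Z.of_nat b = 2 * pz + (if Nat.even b then 0 else 1)).
    { unfold pz, p. pose proof (Nat.div_mod_eq b 2) as Q. pose proof (Nat.mod_upper_bound b 2 ltac:(lia)).
      destruct (Nat.even b) eqn:Ev.
      - apply Nat.even_spec in Ev. destruct Ev as [q Hq]. assert (b mod 2 = 0)%nat by lia. lia.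
      - assert (Od : Nat.odd b = true) by (unfold Nat.odd; now rewrite Ev).
        apply Nat.odd_spec in Od. destruct Od as [q Hq]. lia. }
    set (val := fun u v => if Nat.even b then adjf u v else adjf u v * wtf u v).
    transitivity (zsum n (fun u => zsum n (fun v => if u * n + v =? pz then val u v else 0))).
    { apply zsum_ext. intros u Hu. apply zsum_ext. intros v Hv. unfold val.
      destruct (Nat.even b).
      - destruct (Z.eqb_spec (2 + 2 * (u * n + v)) (Z.of_nat (S (S b)))), (Z.eqb_spec (3 + 2 * (u * n + v)) (Z.of_nat (S (S b)))),
          (Z.eqb_spec (u * n + v) pz); lia.
      - destruct (Z.eqb_spec (2 + 2 * (u * n + v)) (Z.of_nat (S (S b)))), (Z.eqb_spec (3 + 2 * (u * n + v)) (Z.of_nat (S (S b)))),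
          (Z.eqb_spec (u * n + v) pz); lia. }
    destruct (Nat.ltb_spec p (Z.to_nat n * Z.to_nat n)) as [L|L].
    + assert (Lz : 0 <= pz < n * n) by (unfold pz; nia).
      rewrite hit_block by (unfold n in *; lia).
      cbn [inst gadj gwt]. rewrite !Nat2Z.inj_div, !Nat2Z.inj_mod, Hn. fold pz.
      unfold val. destruct (adjf01 (pz / n) (pz mod n)) as [Q|Q]; rewrite Q; cbn [Z.eqb Pos.eqb].
      * now destruct (Nat.even b).
      * destruct (Nat.even b); lia.
    + apply zsum_zero. intros u Hu. apply zsum_zero. intros v Hv.
      destruct (Z.eqb_spec (u * n + v) pz) as [Q|Q]; [|reflexivity].
      exfalso. assert (Z.of_nat (Z.to_nat n * Z.to_nat n) <= pz) by (unfold pz; lia).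
      rewrite Nat2Z.inj_mul, Hn in H. nia.
Qed.

Definition trif (i k j : Z) : Z :=
  E i k * E k j * E i j * (if W i k + W k j + W i j =? t then 1 else 0).

Lemma trif01 i k j : trif i k j = 0 \/ trif i k j = 1.
Proof.
  unfold trif. destruct (E01 i k) as [-> | ->], (E01 k j) as [-> | ->], (E01 i j) as [-> | ->], (_ =? t); auto.
Qed.

Definition openb : Prop := exists u w v, 0 <= u < B /\ 0 <= w < B /\ 0 <= v < B /\
  trif (I * B + u) (K * B + w) (J * B + v) = 1 /\ Hf (I * B + u) (J * B + v) = 0.

(** Edges join distinct parts only. An increasing triple of adjacent nodes therefore has exactly one
    node in each of the three parts, in the order [I], [K], [J]. *)
Lemma inst_tri : has_exact_tri inst t <-> openb.
Proof.
  assert (D : forall q u, 0 <= u < B -> (q * B + u) / B = q) by (intros; rewrite Z.div_add_l, Z.div_small; lia).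
  assert (M : forall q u, 0 <= u < B -> (q * B + u) mod B = u)
    by (intros; rewrite Z.add_comm, Z.mod_add, Z.mod_small; lia).
  split.
  - intros (x & y & z & H1 & H2 & H3 & A1 & A2 & A3 & S). cbn [inst gn gadj gwt] in *.
    apply Z.eqb_eq in A1, A2, A3.
    set (X := Z.of_nat x) in *. set (Y := Z.of_nat y) in *. set (Q := Z.of_nat z) in *.
    assert (L1 : X / B <= Y / B) by (apply Z.div_le_mono; lia).
    assert (L2 : Y / B <= Q / B) by (apply Z.div_le_mono; lia).
    assert (L3 : Q / B < 3) by (apply Z.div_lt_upper_bound; lia).
    assert (L0 : 0 <= X / B) by (apply Z.div_pos; lia).
    unfold adjf, wtf in *.
    destruct (Z.ltb_spec (X / B) (Y / B)) as [l1|l1]; [|destruct (Z.ltb_spec (Y / B) (X / B)); lia].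
    destruct (Z.ltb_spec (Y / B) (Q / B)) as [l2|l2]; [|destruct (Z.ltb_spec (Q / B) (Y / B)); lia].
    destruct (Z.ltb_spec (X / B) (Q / B)) as [l3|l3]; [|lia].
    assert (X / B = 0) by lia. assert (Y / B = 1) by lia. assert (Q / B = 2) by lia.
    unfold egf, vxf in *. rewrite H, H0, H4 in *.
    change (base 1) with K in *. change (base 2) with J in *. change (base 0) with I in *.
    exists (X mod B), (Y mod B), (Q mod B).
    split; [apply Z.mod_pos_bound; lia|]. split; [apply Z.mod_pos_bound; lia|]. split; [apply Z.mod_pos_bound; lia|].
    unfold trif.
    replace (2 - 0 =? 2) with true in A3 by reflexivity. replace (1 - 0 =? 2) with false in A1 by reflexivity.
    replace (2 - 1 =? 2) with false in A2 by reflexivity.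
    destruct (E01 (I * B + X mod B) (K * B + Y mod B)) as [e1|e1]; [rewrite e1 in A1; lia|].
    destruct (E01 (K * B + Y mod B) (J * B + Q mod B)) as [e2|e2]; [rewrite e2 in A2; lia|].
    destruct (E01 (I * B + X mod B) (J * B + Q mod B)) as [e3|e3]; [rewrite e3 in A3; lia|].
    rewrite e1, e2, e3. rewrite e3 in A3. split; [|lia].
    destruct (Z.eqb_spec (W (I * B + X mod B) (K * B + Y mod B) + W (K * B + Y mod B) (J * B + Q mod B) + W (I * B + X mod B) (J * B + Q mod B)) t); lia.
  - intros (u & w & v & Hu & Hw & Hv & Ht & Hh).
    assert (Du : u / B = 0) by (apply Z.div_small; lia).
    assert (Mu : u mod B = u) by (apply Z.mod_small; lia).
    pose proof (D 1 w Hw) as Dw. pose proof (M 1 w Hw) as Mw.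
    pose proof (D 2 v Hv) as Dv. pose proof (M 2 v Hv) as Mv.
    exists (Z.to_nat u), (Z.to_nat (1 * B + w)), (Z.to_nat (2 * B + v)).
    unfold is_exact_tri. cbn [inst gn gadj gwt]. rewrite !Z2Nat.id by lia.
    unfold trif in Ht.
    destruct (E01 (I * B + u) (K * B + w)) as [e1|e1]; [rewrite e1 in Ht; lia|].
    destruct (E01 (K * B + w) (J * B + v)) as [e2|e2]; [rewrite e2 in Ht; lia|].
    destruct (E01 (I * B + u) (J * B + v)) as [e3|e3]; [rewrite e3 in Ht; lia|].
    rewrite e1, e2, e3 in Ht.
    destruct (Z.eqb_spec (W (I * B + u) (K * B + w) + W (K * B + w) (J * B + v) + W (I * B + u) (J * B + v)) t) as [S|S]; [|lia].
    unfold adjf, wtf, egf, vxf. rewrite Du, Dw, Dv, Mu, Mw, Mv.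
    change (base 0) with I. change (base 1) with K. change (base 2) with J.
    cbn [Z.ltb Z.compare Pos.compare Pos.compare_cont].
    change (1 - 0 =? 2) with false. change (2 - 1 =? 2) with false. change (2 - 0 =? 2) with true.
    cbv iota. rewrite e1, e2, e3, Hh.
    repeat split; try lia; try reflexivity.
Qed.

(** 405 = 9 * 9 * 5: two loops of length [3 * B], each with the factor 3 of [cle_for], around a body
    of cost 5 that writes the instance. *)
Definition orcost : Z := 20 + 405 * (B * B) + TM * (1 + steplen P0).

Lemma oracle_ok s : oenv Hf s -> s lI 0 = I -> s lK 0 = K -> s lJ 0 = J ->
  (sem (c_oracle P0) s aPM 0 <> 0 <-> openb) /\ cost (c_oracle P0) s <= orcost.
Proof.
  intros Oe HI HK HJ. unfold c_oracle. rewrite !sem_seq.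
  set (s1 := sem (Clear aPM) _).
  assert (A1 : agr [aBB; aPM] s s1).
  { unfold s1. cbn [sem]. intros b Hb y. unfold clr. cbn in Hb. rewrite !orb_false_iff in Hb.
    destruct Hb as (Q1 & Q2 & _). rewrite Q2. apply Nat.eqb_neq in Q1. now rewrite !set_other by exact Q1. }
  pose proof (oenv_agr [aBB; aPM] Hf s s1 eq_refl A1 Oe) as Oe1.
  assert (F0 : s1 aBB 0 = I /\ s1 aBB 1 = K /\ s1 aBB 2 = J).
  { unfold s1. cbn [sem eval V]. unfold clr, set. cbn. auto. }
  destruct F0 as (F0 & F1 & F2).
  pose proof (fill_ok s1 Oe1 F0 F1 F2 (fun z => eq_refl)) as Fi.
  set (s2 := sem c_fill s1) in *.
  assert (A2 : agr (wr c_fill) s1 s2) by (intros b Hb y; now apply sem_frame).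
  pose proof (oenv_agr (wr c_fill) Hf s1 s2 eq_refl A2 Oe1) as Oe2.
  set (s4 := sem (Put vHLT (Cst 0) (Cst 0)) (sem (Put vPC (Cst 0) (Cst 0)) s2)).
  assert (A4 : agr [vPC; vHLT] s2 s4).
  { apply agr_set; [reflexivity|]. apply agr_set; [reflexivity|]. apply agr_refl. }
  pose proof (oenv_agr [vPC; vHLT] Hf s2 s4 eq_refl A4 Oe2) as Oe4.
  destruct (orc inst inst_wf eq_refl) as (T & m & Ex & HT & Hm).
  { intros i j _ _. apply inst_bound. }
  destruct (interp_ok P0 wp s4 T (input_mem inst t) m TM) as [R1 R2]; auto.
  - apply Oe4.
  - split; [intros a; rewrite A4 by reflexivity; apply Fi|].
    unfold s4. cbn [sem eval]. rewrite set_other by discriminate. apply set_same.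
  - apply Oe4.
  - specialize (R1 0%nat). change (Z.of_nat 0) with 0 in R1. rewrite R1. split.
    + rewrite Hm. apply inst_tri.
    + assert (Cf : cost c_fill s1 <= 2 + 3 * (3 * B * (3 * (3 * B * (2 + (2 + 1)))))).
      { apply (cle_cost (wr c_fill)). unfold c_fill. eapply cle_weaken.
        2:{ eapply cle_seq; [reflexivity|apply cle_put|]. eapply cle_seq; [reflexivity|apply cle_put|].
            eapply cle_for; [reflexivity|reflexivity|reflexivity|cbn [eval opsem V e3B]; rewrite (oenv_B _ _ Oe1); apply Z.le_refl| |lia|].
            eapply cle_for; [reflexivity|reflexivity|reflexivity|cbn [eval opsem V e3B]; rewrite (oenv_B _ _ Oe1); apply Z.le_refl| |lia|].
            apply cle_if; [|apply cle_if; [|apply cle_skip]]; (unfold c_edge; eapply cle_seq; [reflexivity|apply cle_put|apply cle_put]).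
            all: lia. }
        lia. }
      unfold orcost. cbn [cost] in R2 |- *. fold s1.
      change (sem c_fill s1) with s2.
      fold s4. lia.
Qed.

End Instance.
End Oracle.

(** * The main loop *)

Section Main.
Variables (B NB N M Th R5 bs t TM Wb : Z) (d wp : nat) (P0 : program) (E W : Z -> Z -> Z).
Let Z2 := 2 ^ Z.of_nat d.
Let Q7 := 7 ^ Z.of_nat d.
Hypothesis B_pos : 1 <= B.
Hypothesis M_pos : 1 <= M.
Hypothesis N_NB : N = NB * B.
Hypothesis N_blocks : N = Z2 * bs.
Hypothesis N_heavy : N = Th * R5.
Hypothesis Th_pos : 1 <= Th.
Hypothesis R5_pos : 1 <= R5.
Hypothesis bs_pos : 1 <= bs.
Hypothesis E01 : forall i j, E i j = 0 \/ E i j = 1.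
Hypothesis Wbd : forall i j, E i j = 1 -> Z.abs (W i j) <= Wb.
Hypothesis orc : forall G, wf_graph G -> gn G = Z.to_nat (3 * B) ->
  (forall i j, (i < gn G)%nat -> (j < gn G)%nat -> gadj G i j = true -> Z.abs (gwt G i j) <= Wb) ->
  exists T m, exec P0 wp T 0 (input_mem G t) = Some m /\ Z.of_nat T <= TM /\
    (m 0%nat <> 0 <-> has_exact_tri G t).

Record senv (s : state) : Prop := Senv {
  senv_N : s vN 0 = N;
  senv_B : s vB 0 = B;
  senv_NB : s vNB 0 = NB;
  senv_M : s vM 0 = M;
  senv_Th : s vTh 0 = Th;
  senv_R5 : s vR5 0 = R5;
  senv_Z : s vZ 0 = Z2;
  senv_b : s vb 0 = bs;
  senv_Q7 : s vQ7 0 = Q7;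
  senv_TM : s vTM 0 = TM;
  senv_m : menv wp s;
  senv_t : s 0%nat 1 = t;
  senv_E : forall i j, s aE (pairZ i j) = E i j;
  senv_W : forall i j, s aW (pairZ i j) = W i j;
  senv_T : forall kp r x y, 0 <= kp < 3 -> 0 <= r < Q7 -> 0 <= x < Z2 -> 0 <= y < Z2 ->
    s aT1 (pairZ kp (pairZ r (pairZ x y))) = tcoef d kp r x y
}.

Definition sids : list nat :=
  [vN; vB; vNB; vM; vTh; vR5; vZ; vb; vQ7; vTM; vMD; vWP; 0%nat; aE; aW; aT1].

Lemma senv_agr l s s' : disj l sids = true -> agr l s s' -> senv s -> senv s'.
Proof.
  intros Dj A [h1 h2 h3 h4 h5 h6 h7 h8 h9 h10 [h11 h11'] h12 h13 h14 h15].
  assert (G : forall b, mem b sids = true -> forall y, s' b y = s b y).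
  { intros b Hb. apply A. eapply disj_spec; eassumption. }
  constructor; try (split); intros; rewrite G by reflexivity; auto.
Qed.

Lemma senv_oenv s : senv s -> oenv B t TM wp E W (fun i j => s aH (pairZ i j)) s.
Proof. intros [h1 h2 h3 h4 h5 h6 h7 h8 h9 h10 h11 h12 h13 h14 h15]. now constructor. Qed.

Lemma senv_penv s p : senv s -> s vp 0 = p -> penv N Th R5 bs d E W p s.
Proof. intros [h1 h2 h3 h4 h5 h6 h7 h8 h9 h10 h11 h12 h13 h14 h15] Hp. now constructor. Qed.

Let tr := trif t E W.

Lemma tr01 i k j : tr i k j = 0 \/ tr i k j = 1.
Proof. now apply trif01. Qed.

Definition full (i j : Z) : Z := zsum N (fun k => tr i k j).

(* Fredman's trick: for a pair settled by the pivot [p], the test [W_ik + W_kj = t - W_ij] reads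
   [W_ik - W_ip = W_pj - W_kj]. *)
Lemma fredman p i j : tr i p j = 1 -> eqcnt N E W p i j = full i j.
Proof.
  intros H. unfold eqcnt, full. apply zsum_ext. intros k _.
  unfold tr, trif in *. unfold xok, yok, xv, yv.
  destruct (E01 i p) as [e1|e1]; [rewrite e1 in H; lia|].
  destruct (E01 p j) as [e2|e2]; [rewrite e2 in H; lia|].
  destruct (E01 i j) as [e3|e3]; [rewrite e3 in H; lia|].
  rewrite e1, e2, e3 in *.
  destruct (Z.eqb_spec (W i p + W p j + W i j) t) as [Q|Q]; [|lia].
  destruct (E01 i k) as [-> | ->], (E01 k j) as [-> | ->]; cbn [Z.mul Z.eqb Pos.mul]; try reflexivity.
  destruct (Z.eqb_spec (W i k - W i p) (W p j - W k j)), (Z.eqb_spec (W i k + W k j + W i j) t); lia.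
Qed.

Lemma N_ge1 : 1 <= N.
Proof. nia. Qed.

Section Block.
Variables (K : Z) (Hf : Z -> Z -> Z).
Hypothesis H01 : forall i j, Hf i j = 0 \/ Hf i j = 1.

(** A count instead of an existence statement: it can be tested in [sel], and it dominates what
    brute force would add for the pair of blocks. *)
Definition openz (I J : Z) : Z := zsum B (fun u => zsum B (fun v => zsum B (fun w =>
  tr (I * B + u) (K * B + w) (J * B + v) * (1 - Hf (I * B + u) (J * B + v))))).

Lemma term01 i k j : 0 <= tr i k j * (1 - Hf i j).
Proof. destruct (tr01 i k j) as [-> | ->], (H01 i j) as [-> | ->]; lia. Qed.

Lemma openz_spec I J : openz I J <> 0 <-> openb B t E W Hf I K J.
Proof.
  assert (P3 : forall u v, 0 <= zsum B (fun w => tr (I * B + u) (K * B + w) (J * B + v) * (1 - Hf (I * B + u) (J * B + v)))).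
  { intros. apply zsum_nonneg. intros. apply term01. }
  assert (P2 : forall u, 0 <= zsum B (fun v => zsum B (fun w => tr (I * B + u) (K * B + w) (J * B + v) * (1 - Hf (I * B + u) (J * B + v))))).
  { intros. apply zsum_nonneg. auto. }
  assert (P1 : 0 <= openz I J) by (apply zsum_nonneg; auto).
  split.
  - intros H. destruct (zsum_pos_ex B (fun u => zsum B (fun v => zsum B (fun w => tr (I * B + u) (K * B + w) (J * B + v) * (1 - Hf (I * B + u) (J * B + v))))))
      as (u & Hu & H1); [fold (openz I J); lia|].
    apply zsum_pos_ex in H1. destruct H1 as (v & Hv & H2).
    apply zsum_pos_ex in H2. destruct H2 as (w & Hw & H3).
    exists u, w, v. fold tr.
    destruct (tr01 (I * B + u) (K * B + w) (J * B + v)) as [Q|Q], (H01 (I * B + u) (J * B + v)) as [Q'|Q'];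
      rewrite Q, Q' in H3; lia.
  - intros (u & w & v & Hu & Hw & Hv & Q & Q'). fold tr in Q.
    pose proof (zsum_ge_term B (fun u => zsum B (fun v => zsum B (fun w => tr (I * B + u) (K * B + w) (J * B + v) * (1 - Hf (I * B + u) (J * B + v))))) u ltac:(intros; apply P2) Hu) as G1.
    pose proof (zsum_ge_term B (fun v => zsum B (fun w => tr (I * B + u) (K * B + w) (J * B + v) * (1 - Hf (I * B + u) (J * B + v)))) v ltac:(intros; apply P3) Hv) as G2.
    pose proof (zsum_ge_term B (fun w => tr (I * B + u) (K * B + w) (J * B + v) * (1 - Hf (I * B + u) (J * B + v))) w ltac:(intros; apply term01) Hw) as G3.
    cbv beta in *.
    assert (T1 : tr (I * B + u) (K * B + w) (J * B + v) * (1 - Hf (I * B + u) (J * B + v)) = 1)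
      by (rewrite Q, Q'; reflexivity).
    rewrite T1 in G3. fold (openz I J) in G1. lia.
Qed.

Definition sel (f : Z -> Z -> Z) (I J : Z) : Z := if openz I J =? 0 then 0 else f I J.

(** As for the classes, the list of open block pairs is known only through sums over it. The
    constant 1 gives its length. *)
Definition listed (s : state) (f : Z -> Z -> Z) : Z :=
  zsum (s vcnt 0) (fun x => f (s aLI x) (s aLJ x)).

Definition ocost : Z := orcost B TM P0.

Lemma oracle_wr : inclb (wr (c_oracle P0)) [aBB; aPM; vPC; vHLT; vCP; lst; lu; lv] = true.
Proof.
  unfold c_oracle. cbn [wr]. rewrite !inclb_app. change (lst :: wr (c_step P0)) with ([lst] ++ wr (c_step P0)).
  rewrite inclb_app.
  now rewrite (inclb_trans (wr (c_step P0)) [aPM; vPC; vHLT; vCP]) by (reflexivity || apply step_wr).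
Qed.

Definition scan_ids : list nat := [vcnt; lI; lJ; aLI; aLJ; aBB; aPM; vPC; vHLT; vCP; lst; lu; lv].

Lemma scan_body_wr : inclb (wr (Seq (c_oracle P0) (If (Get aPM (Cst 0))
       (Seq (Put aLI (V vcnt) (V lI)) (Seq (Put aLJ (V vcnt) (V lJ)) (Put vcnt (Cst 0) (Bin OAdd (V vcnt) (Cst 1)))))
       Skip))) scan_ids = true.
Proof.
  cbn [wr]. rewrite inclb_app.
  now rewrite (inclb_trans (wr (c_oracle P0)) [aBB; aPM; vPC; vHLT; vCP; lst; lu; lv]) by (reflexivity || apply oracle_wr).
Qed.

Lemma scan_ok s : senv s -> (forall i j, s aH (pairZ i j) = Hf i j) -> s lK 0 = K ->
  let s' := sem (c_scan P0) s in
  agr scan_ids s s' /\ 0 <= s' vcnt 0 /\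
  (forall f, listed s' f = zsum NB (fun I => zsum NB (fun J => sel f I J))) /\
  cost (c_scan P0) s <= 2 + NB * (1 + (1 + NB * (1 + (ocost + 4)))).
Proof.
  intros Se Hh HK. unfold c_scan. rewrite sem_seq, cost_seq. change (cost (Put vcnt (Cst 0) (Cst 0)) s) with 1.
  set (s0 := sem (Put vcnt (Cst 0) (Cst 0)) s).
  match goal with |- context [For lI (V vNB) (For lJ (V vNB) ?c)] => set (body := c) end.
  assert (A0 : agr scan_ids s s0) by (apply agr_set; [reflexivity|apply agr_refl]).
  destruct (for_rule (fun I0 s' => agr scan_ids s s' /\ 0 <= s' vcnt 0 /\
     forall f, listed s' f = zsum I0 (fun I => zsum NB (fun J => sel f I J)))
     lI (V vNB) (For lJ (V vNB) body) s0 NB (1 + NB * (1 + (ocost + 4)))) as [(R1 & R2 & R3) R4].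
  - apply (senv_agr scan_ids s s0 eq_refl A0 Se).
  - lia.
  - split; [exact A0|]. split; [unfold s0; cbn; lia|]. intros f. unfold listed, s0. cbn. reflexivity.
  - intros I s1 HI (A1 & C1 & L1).
    assert (A1' : agr scan_ids s (set s1 lI 0 I)) by (apply agr_set; [reflexivity|exact A1]).
    destruct (for_rule (fun J0 s' => agr scan_ids s s' /\ 0 <= s' vcnt 0 /\ s' lI 0 = I /\
       forall f, listed s' f = zsum I (fun I => zsum NB (fun J => sel f I J)) + zsum J0 (fun J => sel f I J))
      lJ (V vNB) body (set s1 lI 0 I) NB (ocost + 4)) as [(Q1 & Q2 & _ & Q3) Q4].
    + apply (senv_agr scan_ids s _ eq_refl A1' Se).
    + lia.
    + split; [exact A1'|]. split; [rewrite set_other by discriminate; exact C1|]. split; [apply set_same|].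
      intros f. rewrite (zsum_neg 0) by lia. rewrite Z.add_0_r, <- L1. reflexivity.
    + intros J s2 HJ (A2 & C2 & I2 & L2).
      set (s3 := set s2 lJ 0 J).
      assert (A3 : agr scan_ids s s3) by (apply agr_set; [reflexivity|exact A2]).
      pose proof (senv_agr scan_ids s s3 eq_refl A3 Se) as Se3.
      assert (Oe3 : oenv B t TM wp E W Hf s3).
      { destruct (senv_oenv s3 Se3) as [k1 k2 k3 k4 k5 k6 k7]. constructor; auto.
        intros i j. rewrite A3 by reflexivity. apply Hh. }
      destruct (oracle_ok B t TM Wb wp P0 E W B_pos E01 Wbd orc Hf I K J H01 s3 Oe3) as [O1 O2].
      { unfold s3. rewrite set_other by discriminate. exact I2. }
      { rewrite A3 by reflexivity. exact HK. }
      { apply set_same. }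
      unfold body. rewrite !sem_seq. cbn [cost]. fold ocost in O2.
      set (s4 := sem (c_oracle P0) s3) in *.
      assert (F4 : forall b, mem b [aBB; aPM; vPC; vHLT; vCP; lst; lu; lv] = false -> forall y, s4 b y = s3 b y).
      { intros b Hb y. apply sem_frame. apply (inclb_spec _ [aBB; aPM; vPC; vHLT; vCP; lst; lu; lv]); [apply oracle_wr|exact Hb]. }
      rewrite <- openz_spec in O1.
      assert (A5 : agr scan_ids s (sem body s3)) by (apply agr_sem; [apply scan_body_wr|exact A3]).
      unfold body in A5. rewrite sem_seq in A5. fold s4 in A5.
      rewrite sem_if in *. cbn [eval] in *.
      assert (L4 : forall f, listed s4 f = listed s2 f).
      { intros f. unfold listed. rewrite F4 by reflexivity. change (s3 vcnt 0) with (s2 vcnt 0).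
        apply zsum_ext. intros x _. now rewrite !F4 by reflexivity. }
      destruct (Z.eqb_spec (s4 aPM 0) 0) as [Z0|Z0].
      * assert (Op : openz I J = 0) by (destruct (Z.eq_dec (openz I J) 0); tauto).
        split; [|cbn [cost]; lia]. cbn [sem] in *. split; [exact A5|].
        split; [rewrite F4 by reflexivity; exact C2|].
        split; [rewrite F4 by reflexivity; exact I2|].
        intros f. rewrite L4, L2, zsum_succ by lia. assert (Sl : sel f I J = 0) by (unfold sel; now rewrite Op). rewrite Sl. lia.
      * apply O1 in Z0. split; [|cbn [cost]; lia]. split; [exact A5|].
        set (c := s2 vcnt 0) in *.
        assert (Cc : s4 vcnt 0 = c) by (rewrite F4 by reflexivity; reflexivity).
        assert (Ci : s4 lI 0 = I) by (rewrite F4 by reflexivity; exact I2).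
        assert (Cj : s4 lJ 0 = J) by (rewrite F4 by reflexivity; apply set_same).
        assert (Es : sem (Seq (Put aLI (V vcnt) (V lI)) (Seq (Put aLJ (V vcnt) (V lJ)) (Put vcnt (Cst 0) (Bin OAdd (V vcnt) (Cst 1))))) s4
           = set (set (set s4 aLI c I) aLJ c J) vcnt 0 (c + 1)).
        { cbn [sem eval opsem V]. rewrite Cc, Ci.
          change (set s4 aLI c I vcnt 0) with (s4 vcnt 0). change (set s4 aLI c I lJ 0) with (s4 lJ 0).
          rewrite Cc, Cj. change (set (set s4 aLI c I) aLJ c J vcnt 0) with (s4 vcnt 0). now rewrite Cc. }
        rewrite Es. clear Es.
        split; [rewrite set_same; lia|].
        split; [rewrite !set_other by discriminate; exact Ci|].
        intros f. unfold listed. rewrite set_same.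
        rewrite zsum_succ by lia. rewrite (zsum_succ J) by lia. rewrite Z.add_assoc. f_equal.
        -- rewrite <- L2, <- L4. unfold listed. rewrite Cc. apply zsum_ext. intros x Hx.
           rewrite !(set_other _ vcnt) by discriminate. rewrite (set_other _ aLJ) by discriminate.
           rewrite !set_diff by (right; lia || left; discriminate).
           reflexivity.
        -- rewrite !(set_other _ vcnt) by discriminate. rewrite (set_other _ aLJ) by discriminate.
           rewrite !set_same. unfold sel. apply Z.eqb_neq in Z0. now rewrite Z0.
    + split; [|exact Q4]. split; [exact Q1|]. split; [exact Q2|].
      intros f. rewrite Q3, zsum_succ by lia. reflexivity.
  - split; [exact R1|]. split; [exact R2|]. split; [exact R3|]. lia.
Qed.

(** A block pair that is not listed contributes at most [openz = 0], so the sum over the list may be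
    extended to all block pairs. There the entry [(i, j)] singles out one pair of blocks and one
    position in each. *)
Lemma brute_ok s i j : senv s -> (forall i j, s aH (pairZ i j) = Hf i j) -> s lK 0 = K ->
  (forall f, listed s f = zsum NB (fun I => zsum NB (fun J => sel f I J))) ->
  0 <= i < N -> 0 <= j < N ->
  sem c_brute s aC (pairZ i j) = s aC (pairZ i j) + (1 - Hf i j) * zsum B (fun w => tr i (K * B + w) j).
Proof.
  intros Se Hh HK Hl Hi Hj. rewrite (acc_sem aC) by reflexivity. f_equal.
  set (G := fun I J u v => if pairZ (I * B + u) (J * B + v) =? pairZ i j then
     zsum B (fun w => tr (I * B + u) (K * B + w) (J * B + v) * (1 - Hf (I * B + u) (J * B + v))) else 0).
  set (F := fun I J => zsum B (fun u => zsum B (fun v => G I J u v))).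
  transitivity (listed s F).
  { unfold c_brute, Acc, listed. cbn [contr eval opsem V Ix tri et]. unfold set. cbn [Nat.eqb andb Z.eqb].
    apply zsum_ext. intros x _. unfold F, G. rewrite (senv_B _ Se), HK, (senv_t _ Se).
    apply zsum_ext. intros u _. apply zsum_ext. intros v _.
    rewrite <- zsum_if. apply zsum_ext. intros w _.
    rewrite !(senv_E _ Se), !(senv_W _ Se), !Hh.
    set (a := s aLI x * B + u). set (b := s aLJ x * B + v). set (k := K * B + w).
    change (E a k * E k b * E a b * (if W a k + W k b + W a b =? t then 1 else 0)) with (tr a k b).
    destruct (tr01 a k b) as [-> | ->], (H01 a b) as [-> | ->], (pairZ a b =? pairZ i j); reflexivity. }
  rewrite Hl.
  transitivity (zsum NB (fun I => zsum NB (fun J => F I J))).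
  { apply zsum_ext. intros I _. apply zsum_ext. intros J _. unfold sel.
    destruct (Z.eqb_spec (openz I J) 0) as [Z0|Z0]; [|reflexivity].
    assert (T : forall u v, 0 <= G I J u v <= zsum B (fun w => tr (I * B + u) (K * B + w) (J * B + v) * (1 - Hf (I * B + u) (J * B + v)))).
    { intros u v. assert (0 <= zsum B (fun w => tr (I * B + u) (K * B + w) (J * B + v) * (1 - Hf (I * B + u) (J * B + v))))
        by (apply zsum_nonneg; intros; apply term01).
      unfold G. destruct (_ =? _); lia. }
    assert (0 <= F I J) by (apply zsum_nonneg; intros; apply zsum_nonneg; intros; apply T).
    assert (F I J <= openz I J) by (apply zsum_le; intros; apply zsum_le; intros; apply T). lia. }
  transitivity (zsum NB (fun I => zsum B (fun u => if I * B + u =? i then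
     zsum NB (fun J => zsum B (fun v => if J * B + v =? j then
       zsum B (fun w => tr (I * B + u) (K * B + w) (J * B + v) * (1 - Hf (I * B + u) (J * B + v))) else 0)) else 0))).
  { apply zsum_ext. intros I _. unfold F. rewrite zsum_swap. apply zsum_ext. intros u _.
    rewrite <- zsum_if. apply zsum_ext. intros J _. rewrite <- zsum_if. apply zsum_ext. intros v _.
    unfold G. rewrite pairZ_eqb. now destruct (I * B + u =? i), (J * B + v =? j). }
  rewrite hit_block by lia. rewrite hit_block by lia.
  replace (i / B * B + i mod B) with i by (pose proof (Z.div_mod i B); lia).
  replace (j / B * B + j mod B) with j by (pose proof (Z.div_mod j B); lia).
  rewrite zsum_scale_r. ring.
Qed.

Lemma brute_cost s : senv s -> s vcnt 0 < M -> cost c_brute s <= 162 * (M * (B * B * B)).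
Proof.
  intros Se Hc. apply (cle_cost (wr c_brute)). unfold c_brute. eapply cle_weaken.
  2:{ eapply cle_for; [reflexivity|reflexivity|reflexivity|cbn [eval V]; apply Z.lt_le_incl; exact Hc| |lia|].
      clfor (senv_B _ Se). clfor (senv_B _ Se). clfor (senv_B _ Se).
      apply cle_if; [apply cle_put|apply cle_skip]. all: nia. }
  lia.
Qed.

End Block.

Definition done (i0 j0 i j : Z) : bool :=
  (0 <=? i) && (0 <=? j) && (j <? N) && ((i <? i0) || ((i =? i0) && (j <? j0))).

Definition settled (p i0 j0 : Z) (s s' : state) : Prop := forall i j,
  s' aH (pairZ i j) = (if done i0 j0 i j && (tr i p j =? 1) then 1 else s aH (pairZ i j)) /\
  s' aC (pairZ i j) = (if done i0 j0 i j && (tr i p j =? 1) then s aD (pairZ i j) else s aC (pairZ i j)).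

Lemma settled_ext p i0 j0 i1 j1 s s1 s2 : settled p i0 j0 s s1 ->
  (forall y, s2 aH y = s1 aH y) -> (forall y, s2 aC y = s1 aC y) ->
  (forall i j, done i1 j1 i j = done i0 j0 i j) -> settled p i1 j1 s s2.
Proof.
  intros H H1 H2 H3 i j. rewrite H1, H2, H3. apply H.
Qed.

Lemma settle_ok s p : senv s -> s vp 0 = p -> 0 <= p ->
  settled p N 0 s (sem c_settle s) /\ cost c_settle s <= 1 + N * (1 + (1 + N * (1 + 3))).
Proof.
  intros Se Hp Hp0. pose proof N_ge1 as Np. unfold c_settle.
  match goal with |- context [For li (V vN) (For lj (V vN) ?c)] => set (body := c) end.
  set (l := [li; lj; aC; aH]).
  destruct (for_rule (fun i0 s' => agr l s s' /\ settled p i0 0 s s') li (V vN) (For lj (V vN) body) s N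
    (1 + N * (1 + 3))) as [[_ R1] R2].
  - apply Se.
  - lia.
  - split; [apply agr_refl|]. intros i j. unfold done.
    destruct (Z.leb_spec 0 i), (Z.leb_spec 0 j), (Z.ltb_spec j N), (Z.ltb_spec i 0), (Z.eqb_spec i 0), (Z.ltb_spec j 0);
      cbn [andb orb]; try lia; auto.
  - intros i0 s1 Hi0 [A1 S1].
    assert (A1' : agr l s (set s1 li 0 i0)) by (apply agr_set; [reflexivity|exact A1]).
    destruct (for_rule (fun j0 s' => agr l s s' /\ s' li 0 = i0 /\ settled p i0 j0 s s') lj (V vN) body (set s1 li 0 i0) N 3)
      as [(B1 & _ & B3) B4].
    + apply (senv_agr l s _ eq_refl A1' Se).
    + lia.
    + split; [exact A1'|]. split; [apply set_same|].
      apply (settled_ext p i0 0 i0 0 s s1); auto.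
    + intros j0 s2 Hj0 (A2 & I2 & S2).
      set (s3 := set s2 lj 0 j0).
      assert (A3 : agr l s s3) by (apply agr_set; [reflexivity|exact A2]).
      pose proof (senv_agr l s s3 eq_refl A3 Se) as Se3.
      assert (I3 : s3 li 0 = i0) by (unfold s3; rewrite set_other by discriminate; exact I2).
      assert (J3 : s3 lj 0 = j0) by apply set_same.
      assert (P3 : s3 vp 0 = p) by (rewrite A3 by reflexivity; exact Hp).
      assert (D3 : forall y, s3 aD y = s aD y) by (intros; now rewrite A3 by reflexivity).
      assert (S3 : settled p i0 j0 s s3) by (apply (settled_ext p i0 j0 i0 j0 s s2); auto).
      assert (Ed : forall i j, done i0 (j0 + 1) i j = done i0 j0 i j || ((i =? i0) && (j =? j0))).
      { intros i j. unfold done.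
        destruct (Z.leb_spec 0 i), (Z.leb_spec 0 j), (Z.ltb_spec j N), (Z.ltb_spec i i0), (Z.eqb_spec i i0),
          (Z.ltb_spec j j0), (Z.ltb_spec j (j0 + 1)), (Z.eqb_spec j j0); cbn [andb orb]; try lia; auto. }
      assert (Et : eval (tri (V li) (V vp) (V lj)) s3 = tr i0 p j0).
      { cbn [tri et eval opsem V Ix]. rewrite I3, J3, P3, !(senv_E _ Se3), !(senv_W _ Se3), (senv_t _ Se3). reflexivity. }
      unfold body. rewrite sem_if. cbn [cost]. rewrite Et.
      destruct (tr01 i0 p j0) as [T0|T0]; rewrite T0; cbn [Z.eqb].
      * split; [|lia]. cbn [sem]. split; [exact A3|]. split; [exact I3|].
        intros i j. rewrite Ed. destruct (S3 i j) as [Q1 Q2].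
        destruct (Z.eqb_spec i i0) as [->|], (Z.eqb_spec j j0) as [->|]; cbn [andb]; rewrite ?orb_false_r; auto.
        rewrite T0 in *. rewrite !andb_false_r in *. auto.
      * split; [|lia].
        assert (Es : sem (Seq (Put aC (Bin OPair (V li) (V lj)) (Ix aD (V li) (V lj))) (Put aH (Bin OPair (V li) (V lj)) (Cst 1))) s3
          = set (set s3 aC (pairZ i0 j0) (s aD (pairZ i0 j0))) aH (pairZ i0 j0) 1).
        { cbn [sem eval opsem V Ix].
          change (set s3 aC (pairZ (s3 li 0) (s3 lj 0)) (s3 aD (pairZ (s3 li 0) (s3 lj 0))) li 0) with (s3 li 0).
          change (set s3 aC (pairZ (s3 li 0) (s3 lj 0)) (s3 aD (pairZ (s3 li 0) (s3 lj 0))) lj 0) with (s3 lj 0).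
          now rewrite I3, J3, D3. }
        rewrite Es. split; [apply agr_set; [reflexivity|apply agr_set; [reflexivity|exact A3]]|].
        split; [rewrite !set_other by discriminate; exact I3|].
        intros i j. rewrite Ed. destruct (S3 i j) as [Q1 Q2].
        destruct ((i =? i0) && (j =? j0)) eqn:Eq.
        -- apply andb_true_iff in Eq. destruct Eq as [Eq1 Eq2]. apply Z.eqb_eq in Eq1, Eq2. subst i j.
           rewrite orb_true_r, T0. cbn [andb Z.eqb Pos.eqb]. split.
           ++ apply set_same.
           ++ rewrite set_other by discriminate. apply set_same.
        -- rewrite orb_false_r.
           assert (Ne : pairZ i j <> pairZ i0 j0).
           { intros Q. apply pairZ_inj in Q. destruct Q as [-> ->]. now rewrite !Z.eqb_refl in Eq. }
           split.
           ++ rewrite set_diff by (right; exact Ne). rewrite set_other by discriminate. exact Q1.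
           ++ rewrite set_other by discriminate. rewrite set_diff by (right; exact Ne). exact Q2.
    + split; [split; [exact B1|]|exact B4].
      apply (settled_ext p i0 N (i0 + 1) 0 s _ _ B3); auto.
      intros i j. unfold done.
      destruct (Z.leb_spec 0 i), (Z.leb_spec 0 j), (Z.ltb_spec j N), (Z.ltb_spec i i0), (Z.eqb_spec i i0),
          (Z.ltb_spec i (i0 + 1)), (Z.eqb_spec i (i0 + 1)), (Z.ltb_spec j 0); cbn [andb orb]; try lia; auto.
  - split; [exact R1|exact R2].
Qed.

Definition pids : list nat := wr c_pivot.

Definition ecost : Z := eqcost N Th R5 bs d.

Definition pivcost : Z := 1 + B * (1 + (1 + (ecost + (1 + N * (1 + (1 + N * (1 + 3))))))).

(** Compares the state after [w] pivots of block [K] with the state [s] before the block. A pair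
    left unsettled has no exact triangle through the pivots so far; after the last pivot it has none
    through the block, and its count is right without change. *)
Record pivinv (K w : Z) (s s' : state) : Prop := Pivinv {
  piv_H01 : forall i j, s' aH (pairZ i j) = 0 \/ s' aH (pairZ i j) = 1;
  piv_keep : forall i j, s aH (pairZ i j) = 1 -> s' aH (pairZ i j) = 1;
  piv_full : forall i j, 0 <= i < N -> 0 <= j < N -> s' aH (pairZ i j) = 1 -> s' aC (pairZ i j) = full i j;
  piv_none : forall i j, 0 <= i < N -> 0 <= j < N -> s' aH (pairZ i j) = 0 ->
    s' aC (pairZ i j) = s aC (pairZ i j) /\ forall w', 0 <= w' < w -> tr i (K * B + w') j = 0
}.

Lemma pivot_ok s K : senv s -> s lK 0 = K -> 0 <= K ->
  (forall i j, s aH (pairZ i j) = 0 \/ s aH (pairZ i j) = 1) ->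
  (forall i j, 0 <= i < N -> 0 <= j < N -> s aH (pairZ i j) = 1 -> s aC (pairZ i j) = full i j) ->
  pivinv K B s (sem c_pivot s) /\ cost c_pivot s <= pivcost.
Proof.
  intros Se HK HK0 H01 Hfu. unfold c_pivot.
  match goal with |- context [For lpw (V vB) ?c] => set (body := c) end.
  destruct (for_rule (fun w s' => agr pids s s' /\ pivinv K w s s') lpw (V vB) body s B
    (1 + (ecost + (1 + N * (1 + (1 + N * (1 + 3))))))) as [[_ R1] R2].
  - apply Se.
  - lia.
  - split; [apply agr_refl|]. constructor; auto. intros i j _ _ _. split; [reflexivity|lia].
  - intros w s1 Hw [A1 I1].
    set (s2 := set s1 lpw 0 w). set (p := K * B + w).
    assert (A2 : agr pids s s2) by (apply agr_set; [reflexivity|exact A1]).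
    pose proof (senv_agr pids s s2 eq_refl A2 Se) as Se2.
    unfold body. rewrite !sem_seq, !cost_seq.
    assert (E3 : sem (Put vp (Cst 0) (Bin OAdd (Bin OMul (V lK) (V vB)) (V lpw))) s2 = set s2 vp 0 p).
    { cbn [sem eval opsem V]. rewrite (A2 lK), HK, (senv_B _ Se2) by reflexivity.
      change (s2 lpw 0) with w. reflexivity. }
    rewrite E3. set (s3 := set s2 vp 0 p).
    assert (A3 : agr pids s s3) by (apply agr_set; [reflexivity|exact A2]).
    pose proof (senv_agr pids s s3 eq_refl A3 Se) as Se3.
    destruct (eqprod_ok N Th R5 bs d E W p N_blocks N_heavy Th_pos R5_pos bs_pos E01 s3) as [D4 C4].
    { apply senv_penv; [exact Se3|apply set_same]. }
    set (s4 := sem c_eqprod s3) in *.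
    assert (F4 : agr (wr c_eqprod) s3 s4) by (intros b Hb y; now apply sem_frame).
    assert (A4 : agr pids s s4) by (apply agr_sem; [reflexivity|exact A3]).
    pose proof (senv_agr pids s s4 eq_refl A4 Se) as Se4.
    destruct (settle_ok s4 p Se4) as [S5 C5].
    { rewrite F4 by reflexivity. apply set_same. }
    { unfold p. nia. }
    set (s5 := sem c_settle s4) in *.
    assert (A5 : agr pids s s5) by (apply agr_sem; [reflexivity|exact A4]).
    assert (EH : forall y, s4 aH y = s1 aH y) by (intros; rewrite F4 by reflexivity; reflexivity).
    assert (EC : forall y, s4 aC y = s1 aC y) by (intros; rewrite F4 by reflexivity; reflexivity).
    split.
    + split; [exact A5|]. destruct I1 as [k1 k2 k3 k4]. constructor.
      * intros i j. destruct (S5 i j) as [-> _]. rewrite EH. destruct (_ && _); auto.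
      * intros i j Q. destruct (S5 i j) as [-> _]. rewrite EH, k2 by exact Q. now destruct (_ && _).
      * intros i j Hi Hj. destruct (S5 i j) as [-> ->]. rewrite EH, EC.
        destruct (done N 0 i j && (tr i p j =? 1)) eqn:Q.
        -- intros _. apply andb_true_iff in Q. destruct Q as [_ Q]. apply Z.eqb_eq in Q.
           rewrite D4 by assumption. now apply fredman.
        -- now apply k3.
      * intros i j Hi Hj. destruct (S5 i j) as [-> ->]. rewrite EH, EC.
        destruct (done N 0 i j && (tr i p j =? 1)) eqn:Q; [lia|].
        intros H0. destruct (k4 i j Hi Hj H0) as [k5 k6]. split; [exact k5|].
        intros w' Hw'. destruct (Z.eq_dec w' w) as [->|]; [|apply k6; lia].
        assert (Dn : done N 0 i j = true).
        { unfold done. destruct (Z.leb_spec 0 i), (Z.leb_spec 0 j), (Z.ltb_spec j N), (Z.ltb_spec i N); cbn; try lia; auto. }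
        rewrite Dn in Q. cbn [andb] in Q. apply Z.eqb_neq in Q. fold p. destruct (tr01 i p j); tauto.
    + fold ecost in C4. cbn [cost]. lia.
  - split; [exact R1|]. unfold pivcost. exact R2.
Qed.

(* Every open block pair contains a newly settled pair. *)
Lemma pivot_gain s s' K : 0 <= K ->
  (forall i j, s aH (pairZ i j) = 0 \/ s aH (pairZ i j) = 1) -> pivinv K B s s' ->
  zsum NB (fun I => zsum NB (fun J => sel K (fun i j => s aH (pairZ i j)) (fun _ _ => 1) I J)) +
  zsum N (fun i => zsum N (fun j => s aH (pairZ i j))) <= zsum N (fun i => zsum N (fun j => s' aH (pairZ i j))).
Proof.
  intros HK H01 [k1 k2 k3 k4].
  assert (Bl : forall f : Z -> Z -> Z, zsum N (fun i => zsum N (fun j => f i j)) =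
    zsum NB (fun I => zsum NB (fun J => zsum B (fun u => zsum B (fun v => f (I * B + u) (J * B + v)))))).
  { intros f. rewrite N_NB, zsum_blocks by lia. apply zsum_ext. intros I _.
    rewrite (zsum_swap NB B). apply zsum_ext. intros u _. now rewrite zsum_blocks by lia. }
  rewrite !Bl. rewrite <- zsum_plus. apply zsum_le. intros I HI. rewrite <- zsum_plus. apply zsum_le. intros J HJ.
  assert (Mo : forall i j, s aH (pairZ i j) <= s' aH (pairZ i j)).
  { intros i j. destruct (H01 i j) as [Q|Q]; [destruct (k1 i j); lia|]. rewrite Q, k2; lia. }
  assert (Df : zsum B (fun u => zsum B (fun v => s' aH (pairZ (I * B + u) (J * B + v)))) =
    zsum B (fun u => zsum B (fun v => s aH (pairZ (I * B + u) (J * B + v)))) +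
    zsum B (fun u => zsum B (fun v => s' aH (pairZ (I * B + u) (J * B + v)) - s aH (pairZ (I * B + u) (J * B + v))))).
  { rewrite <- zsum_plus. apply zsum_ext. intros u _. rewrite <- zsum_plus. apply zsum_ext. intros v _. lia. }
  rewrite Df. clear Df.
  assert (P2 : forall u, 0 <= zsum B (fun v => s' aH (pairZ (I * B + u) (J * B + v)) - s aH (pairZ (I * B + u) (J * B + v)))).
  { intros u. apply zsum_nonneg. intros v _. specialize (Mo (I * B + u) (J * B + v)). lia. }
  assert (P1 : 0 <= zsum B (fun u => zsum B (fun v => s' aH (pairZ (I * B + u) (J * B + v)) - s aH (pairZ (I * B + u) (J * B + v)))))
    by (apply zsum_nonneg; auto).
  unfold sel. destruct (Z.eqb_spec (openz K (fun i j => s aH (pairZ i j)) I J) 0) as [Z0|Z0]; [lia|].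
  apply openz_spec in Z0; [|exact H01]. destruct Z0 as (u & w & v & Hu & Hw & Hv & Q & Q'). fold tr in Q.
  pose proof (zsum_ge_term B (fun u => zsum B (fun v => s' aH (pairZ (I * B + u) (J * B + v)) - s aH (pairZ (I * B + u) (J * B + v)))) u ltac:(intros; apply P2) Hu) as G1.
  pose proof (zsum_ge_term B (fun v => s' aH (pairZ (I * B + u) (J * B + v)) - s aH (pairZ (I * B + u) (J * B + v))) v
    ltac:(intros v' _; cbv beta; specialize (Mo (I * B + u) (J * B + v')); lia) Hv) as G2.
  cbv beta in *.
  assert (H1 : s' aH (pairZ (I * B + u) (J * B + v)) = 1).
  { destruct (k1 (I * B + u) (J * B + v)) as [R|R]; [|exact R]. exfalso.
    destruct (k4 (I * B + u) (J * B + v)) as [_ R2]; [nia|nia|exact R|]. specialize (R2 w Hw). lia. }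
  rewrite H1, Q' in G2. lia.
Qed.

Definition mids : list nat := lK :: scan_ids ++ wr c_brute ++ wr c_pivot.

Definition blkcost : Z :=
  2 + NB * (1 + (1 + NB * (1 + (ocost + 4)))) + (1 + 162 * (M * (B * B * B))).

Lemma main_wr : inclb (wr (Seq (c_scan P0) (If (Bin OLt (V vcnt) (V vM)) c_brute c_pivot))) mids = true.
Proof.
  change (inclb ((vcnt :: lI :: lJ :: wr (Seq (c_oracle P0) (If (Get aPM (Cst 0))
       (Seq (Put aLI (V vcnt) (V lI)) (Seq (Put aLJ (V vcnt) (V lJ)) (Put vcnt (Cst 0) (Bin OAdd (V vcnt) (Cst 1)))))
       Skip))) ++ (wr c_brute ++ wr c_pivot)) mids = true).
  rewrite inclb_app. apply andb_true_intro. split; [|reflexivity].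
  apply (inclb_trans _ scan_ids); [reflexivity|]. exact scan_body_wr.
Qed.

(** Before block [K], settled pairs hold their final count and the others count the middle nodes of
    earlier blocks. The number [hs] of settled pairs is the potential: each pivot round raises it by
    at least [M], and it never exceeds [N^2]. *)
Lemma main_ok s : senv s -> (forall z, s aH z = 0) -> (forall z, s aC z = 0) ->
  agr mids s (sem (c_main P0) s) /\
  (forall i j, 0 <= i < N -> 0 <= j < N -> sem (c_main P0) s aC (pairZ i j) = full i j) /\
  exists piv, 0 <= piv /\ piv * M <= N * N /\
    cost (c_main P0) s <= 1 + NB * (1 + blkcost) + piv * pivcost.
Proof.
  intros Se H0 C0. pose proof N_ge1 as Np. unfold c_main.
  match goal with |- context [For lK (V vNB) ?c] => set (body := c) end.
  set (hs := fun s : state => zsum N (fun i => zsum N (fun j => s aH (pairZ i j)))).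
  (* The bound is nonnegative because it bounds an actual run. *)
  assert (BP : 0 <= pivcost).
  { pose proof (cost_pos c_pivot s).
    destruct (pivot_ok (set s lK 0 0) 0) as [_ Q]; try lia.
    - apply (senv_agr [lK] s); [reflexivity| |exact Se]. apply agr_set; [reflexivity|apply agr_refl].
    - apply set_same.
    - intros. left. rewrite set_other by discriminate. apply H0.
    - intros i j _ _. rewrite set_other by discriminate. rewrite H0. lia.
    - pose proof (cost_pos c_pivot (set s lK 0 0)). lia. }
  destruct (for_amort (fun K s' k => agr mids s s' /\
     (forall i j, s' aH (pairZ i j) = 0 \/ s' aH (pairZ i j) = 1) /\
     (forall i j, 0 <= i < N -> 0 <= j < N -> s' aH (pairZ i j) = 1 -> s' aC (pairZ i j) = full i j) /\
     (forall i j, 0 <= i < N -> 0 <= j < N -> s' aH (pairZ i j) = 0 ->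
        s' aC (pairZ i j) = zsum (K * B) (fun k => tr i k j)) /\
     exists piv, 0 <= piv /\ piv * M <= hs s' /\ k <= K * (1 + blkcost) + piv * pivcost)
     lK (V vNB) body s NB) as (k & (A & H01 & Hf1 & Hf0 & piv & Hp0 & Hp1 & Hk) & Ck).
  - apply Se.
  - lia.
  - split; [apply agr_refl|]. split; [intros; left; apply H0|].
    split; [intros i j _ _; rewrite H0; lia|].
    split; [intros i j _ _ _; rewrite C0; reflexivity|].
    exists 0. split; [lia|]. split; [|lia].
    unfold hs. apply zsum_nonneg. intros i _. apply zsum_nonneg. intros j _. rewrite H0. lia.
  - intros K s1 k HK (A1 & I1 & I2 & I3 & piv & Hp0 & Hp1 & Hk).
    set (s2 := set s1 lK 0 K).
    assert (A2 : agr mids s s2) by (apply agr_set; [reflexivity|exact A1]).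
    pose proof (senv_agr mids s s2 eq_refl A2 Se) as Se2.
    assert (Am : agr mids s (sem body s2)) by (apply agr_sem; [apply main_wr|exact A2]).
    set (Hf := fun i j => s1 aH (pairZ i j)).
    destruct (scan_ok K Hf I1 s2 Se2) as (F3 & Cn & Ls & Cs); [reflexivity|apply set_same|].
    set (s3 := sem (c_scan P0) s2) in *.
    pose proof (senv_agr scan_ids s2 s3 eq_refl F3 Se2) as Se3.
    assert (H3 : forall i j, s3 aH (pairZ i j) = Hf i j) by (intros; rewrite F3 by reflexivity; reflexivity).
    assert (C3 : forall y, s3 aC y = s1 aC y) by (intros; rewrite F3 by reflexivity; reflexivity).
    assert (K3 : s3 lK 0 = K) by (rewrite F3 by reflexivity; apply set_same).
    split; [exact Am|]. clear Am.
    assert (Ev : eval (Bin OLt (V vcnt) (V vM)) s3 = if s3 vcnt 0 <? M then 1 else 0).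
    { cbn [eval opsem V]. now rewrite (senv_M _ Se3). }
    unfold body. rewrite sem_seq, cost_seq, sem_if. fold s3.
    replace (cost (If (Bin OLt (V vcnt) (V vM)) c_brute c_pivot) s3) with
      (1 + (if (if s3 vcnt 0 <? M then 1 else 0) =? 0 then cost c_pivot s3 else cost c_brute s3))
      by (now rewrite <- Ev).
    rewrite Ev.
    assert (Zs : forall i j, zsum ((K + 1) * B) (fun k => tr i k j) =
       zsum (K * B) (fun k => tr i k j) + zsum B (fun w => tr i (K * B + w) j)).
    { intros i j. rewrite Z.mul_add_distr_r, Z.mul_1_l, zsum_app by nia. reflexivity. }
    unfold blkcost in *. set (bru := 162 * (M * (B * B * B))) in *.
    assert (Bru : 0 <= bru) by (unfold bru; nia).
    destruct (Z.ltb_spec (s3 vcnt 0) M) as [L|L]; cbn [Z.eqb].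
    + pose proof (brute_cost s3 Se3 L) as Cb. fold bru in Cb.
      assert (Hb : forall y, sem c_brute s3 aH y = s1 aH y).
      { intros y. rewrite sem_frame by reflexivity. rewrite F3 by reflexivity. reflexivity. }
      assert (Cbr : forall i j, 0 <= i < N -> 0 <= j < N -> sem c_brute s3 aC (pairZ i j) =
         s1 aC (pairZ i j) + (1 - Hf i j) * zsum B (fun w => tr i (K * B + w) j)).
      { intros i j Hi Hj. rewrite (brute_ok K Hf I1) by auto. now rewrite C3. }
      split; [intros; rewrite Hb; apply I1|].
      split.
      { intros i j Hi Hj. rewrite Hb. intros Q. rewrite Cbr by assumption. unfold Hf. rewrite Q, I2 by assumption. lia. }
      split.
      { intros i j Hi Hj. rewrite Hb. intros Q. rewrite Cbr, Zs by assumption. unfold Hf. rewrite Q, I3 by assumption. lia. }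
      exists piv. split; [exact Hp0|]. split.
      { unfold hs in *. erewrite zsum_ext; [exact Hp1|]. intros i _. apply zsum_ext. intros j _. apply Hb. }
      lia.
    + destruct (pivot_ok s3 K Se3 K3 ltac:(lia)) as [Pi Cp].
      { intros i j. rewrite H3. apply I1. }
      { intros i j Hi Hj. rewrite H3, C3. now apply I2. }
      pose proof (pivot_gain s3 (sem c_pivot s3) K ltac:(lia)) as Ga.
      specialize (Ga ltac:(intros; rewrite H3; apply I1) Pi).
      destruct Pi as [p1 p2 p3 p4].
      split; [exact p1|]. split; [exact p3|]. split.
      { intros i j Hi Hj Q. destruct (p4 i j Hi Hj Q) as [q1 q2]. rewrite q1, C3, Zs.
        rewrite (zsum_zero B) by exact q2. rewrite Z.add_0_r. apply I3; auto.
        destruct (I1 i j) as [R|R]; [exact R|]. exfalso.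
        assert (sem c_pivot s3 aH (pairZ i j) = 1) by (apply p2; rewrite H3; exact R). lia. }
      exists (piv + 1). split; [lia|]. split.
      { assert (Hcnt : s3 vcnt 0 = zsum NB (fun I => zsum NB (fun J => sel K Hf (fun _ _ => 1) I J))).
        { rewrite <- Ls. unfold listed. rewrite zsum_const by lia. lia. }
        assert (Hg : zsum NB (fun I => zsum NB (fun J => sel K (fun i j => s3 aH (pairZ i j)) (fun _ _ => 1) I J)) =
           zsum NB (fun I => zsum NB (fun J => sel K Hf (fun _ _ => 1) I J))).
        { apply zsum_ext. intros I _. apply zsum_ext. intros J _. unfold sel.
          replace (openz K (fun i j => s3 aH (pairZ i j)) I J) with (openz K Hf I J); [reflexivity|].
          unfold openz. apply zsum_ext. intros u _. apply zsum_ext. intros v _. apply zsum_ext. intros w _.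
          now rewrite H3. }
        assert (Hs : hs s1 = zsum N (fun i => zsum N (fun j => s3 aH (pairZ i j)))).
        { unfold hs. apply zsum_ext. intros i _. apply zsum_ext. intros j _. now rewrite H3. }
        unfold hs at 1. nia. }
      nia.
  - split; [exact A|]. split.
    + intros i j Hi Hj. destruct (H01 i j) as [Q|Q]; [|now apply Hf1].
      rewrite Hf0 by assumption. unfold full. now rewrite <- N_NB.
    + exists piv. split; [exact Hp0|]. split; [|lia].
      apply (Z.le_trans _ _ _ Hp1). unfold hs.
      apply (Z.le_trans _ (zsum N (fun _ => zsum N (fun _ => 1)))).
      * apply zsum_le. intros i _. apply zsum_le. intros j _. destruct (H01 i j); lia.
      * rewrite !zsum_const by lia. lia.
Qed.

Lemma total_ok s : senv s -> (forall z, s aH z = 0) -> (forall z, s aC z = 0) -> s vOut 0 = 0 ->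
  sem (Seq (c_main P0) c_total) s vOut 0 = zsum N (fun i => zsum N (fun j => full i j)) /\
  exists piv, 0 <= piv /\ piv * M <= N * N /\
    cost (Seq (c_main P0) c_total) s <= 1 + NB * (1 + blkcost) + piv * pivcost + 9 * (N * N).
Proof.
  intros Se H0 C0 O0. pose proof N_ge1 as Np.
  destruct (main_ok s Se H0 C0) as (A & Fu & piv & Hp0 & Hp1 & Hc).
  rewrite sem_seq, cost_seq. set (s1 := sem (c_main P0) s) in *.
  pose proof (senv_agr mids s s1 eq_refl A Se) as Se1. split.
  - rewrite (acc_sem vOut) by reflexivity. rewrite (A vOut), O0, Z.add_0_l by reflexivity.
    unfold c_total, Acc. cbn [contr eval opsem V Ix]. unfold set. cbn [Nat.eqb andb Z.eqb].
    rewrite (senv_N _ Se1). apply zsum_ext. intros i Hi. apply zsum_ext. intros j Hj.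
    rewrite (senv_E _ Se1), Fu by assumption. unfold full. rewrite <- zsum_scale. apply zsum_ext. intros k _.
    (* The count already contains the factor [E i j], which is idempotent. *)
    unfold tr, trif. destruct (E01 i j) as [-> | ->]; ring.
  - exists piv. split; [exact Hp0|]. split; [exact Hp1|].
    assert (Ct : cost c_total s1 <= 3 * (N * (3 * (N * 1)))).
    { apply (cle_cost (wr c_total)). unfold c_total. clfor (senv_N _ Se1). clfor (senv_N _ Se1). apply cle_put. }
    lia.
Qed.

End Main.

(** * Initialisation *)

Lemma pow_ge_base b q : 1 <= b -> (1 <= q)%nat -> b <= b ^ Z.of_nat q.
Proof. intros Hb Hq. rewrite <- (Z.pow_1_r b) at 1. apply Z.pow_le_mono_r; lia. Qed.

Lemma pow2_pos e : 1 <= 2 ^ Z.of_nat e.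
Proof. pose proof (Z.pow_pos_nonneg 2 (Z.of_nat e)). lia. Qed.

Lemma pow2_succ e : 2 ^ Z.of_nat (S e) = 2 * 2 ^ Z.of_nat e.
Proof. rewrite Nat2Z.inj_succ, Z.pow_succ_r by lia. reflexivity. Qed.

Lemma pow2_gt e : Z.of_nat e < 2 ^ Z.of_nat e.
Proof. induction e; [cbn; lia|]. rewrite pow2_succ. lia. Qed.

Lemma pow7_8 e : 7 ^ Z.of_nat e <= 2 ^ Z.of_nat e * (2 ^ Z.of_nat e * 2 ^ Z.of_nat e).
Proof.
  rewrite <- !Z.pow_mul_l. change (2 * (2 * 2)) with 8. apply Z.pow_le_mono_l. lia.
Qed.

(** Minimality is stated for the predecessor only. Halving the base loses a factor [2^q], so the
    power overshoots [x] by a constant factor. *)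
Definition rootexp (q : nat) (x : Z) (e : nat) : Prop :=
  x < (2 ^ Z.of_nat e) ^ Z.of_nat q /\
  (e = 0%nat \/ (2 ^ Z.of_nat (e - 1)) ^ Z.of_nat q <= x).

Lemma rootB_ok q s n : (1 <= q)%nat -> 0 <= n -> s 0%nat 0 = n ->
  let s' := sem (c_rootB q) s in
  agr [vB; vE; vS7; li] s s' /\ cost (c_rootB q) s <= 4 + (n + 1) * 5 /\
  exists e, s' vB 0 = 2 ^ Z.of_nat e /\ s' vE 0 = Z.of_nat e /\ s' vS7 0 = 7 ^ Z.of_nat e /\ rootexp q n e.
Proof.
  intros Hq Hn Hs. cbv zeta. unfold c_rootB. rewrite !sem_seq, !cost_seq.
  match goal with |- context [For li ?b ?c] => set (body := c); set (bd := b) end.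
  set (s0 := sem (Put vS7 (Cst 0) (Cst 1)) _).
  set (l := [vB; vE; vS7; li]).
  assert (A0 : agr l s s0) by (repeat (apply agr_set; [reflexivity|]); apply agr_refl).
  (* The search loop has no early exit, so the invariant allows that the exponent has been raised in
     every round. In the end [e < 2^e] shows that [n + 1] rounds were enough. *)
  destruct (for_rule (fun i s' => agr l s s' /\ exists e : nat, Z.of_nat e <= i /\
     s' vB 0 = 2 ^ Z.of_nat e /\ s' vE 0 = Z.of_nat e /\ s' vS7 0 = 7 ^ Z.of_nat e /\
     (e = 0%nat \/ (2 ^ Z.of_nat (e - 1)) ^ Z.of_nat q <= n) /\
     (n < (2 ^ Z.of_nat e) ^ Z.of_nat q \/ Z.of_nat e = i)) li bd body s0 (n + 1) 4)
    as [(A & e & E1 & E2 & E3 & E4 & E5 & E6) Co].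
  - unfold bd. cbn [eval opsem en]. rewrite A0, Hs by reflexivity. reflexivity.
  - lia.
  - split; [exact A0|]. exists 0%nat. repeat split; auto; lia.
  - intros i s1 Hi (A1 & e & E1 & E2 & E3 & E4 & E5 & E6).
    set (s2 := set s1 li 0 i).
    assert (A2 : agr l s s2) by (apply agr_set; [reflexivity|exact A1]).
    assert (N2 : s2 0%nat 0 = n) by (rewrite A2 by reflexivity; exact Hs).
    assert (Ev : eval (Bin OLt en (epow (V vB) q)) s2 = if n <? (2 ^ Z.of_nat e) ^ Z.of_nat q then 1 else 0).
    { cbn [eval opsem en]. rewrite epow_eval. cbn [eval V]. rewrite N2. change (s2 vB 0) with (s1 vB 0). now rewrite E2. }
    assert (Wb : inclb (wr body) l = true) by reflexivity.
    assert (Am : agr l s (sem body s2)) by (apply agr_sem; [exact Wb|exact A2]).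
    split.
    2:{ unfold body. cbn [cost]. destruct (_ =? 0); lia. }
    split; [exact Am|]. clear Am. unfold body. rewrite sem_if, Ev.
    destruct (Z.ltb_spec n ((2 ^ Z.of_nat e) ^ Z.of_nat q)) as [L|L]; cbn [Z.eqb].
    + exists e. cbn [sem]. repeat split; auto; lia.
    + destruct E6 as [E6|E6]; [lia|].
      pose proof (pow2_pos e) as P2. pose proof (pow_ge_base (2 ^ Z.of_nat e) q P2 Hq) as Pb.
      set (b := 2 ^ Z.of_nat e) in *.
      pose proof (pow7_8 e) as P7. fold b in P7. pose proof (Z.pow_pos_nonneg 7 (Z.of_nat e) ltac:(lia) ltac:(lia)) as P7p.
      set (c := 7 ^ Z.of_nat e) in *.
      (* [7^e <= 8^e = b^3 <= n^3], and this is far below the square of the bound used in the clamp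
         of [vS7]. *)
      assert (Cn : c <= n * (n * n)).
      { apply (Z.le_trans _ _ _ P7). apply Z.mul_le_mono_nonneg; try lia; try nia. }
      assert (Cl1 : (2 * b) mod ((2 * n + 2) * (2 * n + 2) + 1) = 2 * b) by (apply Z.mod_small; nia).
      assert (Cl2 : (7 * c) mod ((8 * (n * n) + 8) * (8 * (n * n) + 8) + 1) = 7 * c).
      { apply Z.mod_small. split; [lia|].
        assert (n * (n * n) <= (n * n) * (n * n)) by nia.
        set (m := n * n) in *. assert (1 <= m) by (unfold m; nia). nia. }
      exists (S e). rewrite !sem_seq.
      assert (Es : sem (Put vB (Cst 0) (Bin OClamp (Bin OMul (Cst 2) (V vB)) (Bin OAdd (Bin OMul (Cst 2) en) (Cst 2)))) s2 = set s2 vB 0 (2 * b)).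
      { rewrite sem_put_cst. f_equal. cbn [eval opsem V en]. rewrite N2. change (s2 vB 0) with (s1 vB 0). rewrite E2. exact Cl1. }
      rewrite Es. set (s3 := set s2 vB 0 (2 * b)).
      assert (Es' : sem (Put vE (Cst 0) (Bin OAdd (V vE) (Cst 1))) s3 = set s3 vE 0 (Z.of_nat e + 1)).
      { rewrite sem_put_cst. f_equal. cbn [eval opsem V]. change (s3 vE 0) with (s1 vE 0). now rewrite E3. }
      rewrite Es'. set (s4 := set s3 vE 0 (Z.of_nat e + 1)).
      assert (Es'' : sem (Put vS7 (Cst 0) (Bin OClamp (Bin OMul (Cst 7) (V vS7)) (Bin OAdd (Bin OMul (Cst 8) (Bin OMul en en)) (Cst 8)))) s4 = set s4 vS7 0 (7 * c)).
      { rewrite sem_put_cst. f_equal. cbn [eval opsem V en]. change (s4 0%nat 0) with (s2 0%nat 0). rewrite N2.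
        change (s4 vS7 0) with (s1 vS7 0). rewrite E4. exact Cl2. }
      rewrite Es''.
      split; [lia|]. split; [rewrite pow2_succ; reflexivity|]. split; [rewrite Nat2Z.inj_succ; reflexivity|].
      split; [rewrite Nat2Z.inj_succ, Z.pow_succ_r by lia; reflexivity|].
      split; [right; rewrite Nat.sub_succ, Nat.sub_0_r; exact L|]. right. lia.
  - split; [exact A|]. split.
    + cbn [cost]. change (1 + (n + 1) * (1 + 4)) with (1 + (n + 1) * 5) in Co. cbn [cost] in Co. fold s0. lia.
    + exists e. repeat split; auto. destruct E6 as [E6|E6]; [exact E6|].
      pose proof (pow2_gt e). pose proof (pow_ge_base (2 ^ Z.of_nat e) q (pow2_pos e) Hq). lia.
Qed.

Lemma rootY_ok r s B : (1 <= r)%nat -> 1 <= B -> s vB 0 = B ->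
  let s' := sem (c_rootY r) s in
  agr [vY; li] s s' /\ cost (c_rootY r) s <= 2 + (B + 1) * 3 /\
  exists y, s' vY 0 = 2 ^ Z.of_nat y /\ rootexp r B y.
Proof.
  intros Hr HB Hs. cbv zeta. unfold c_rootY. rewrite !sem_seq, !cost_seq.
  match goal with |- context [For li ?b ?c] => set (body := c); set (bd := b) end.
  set (s0 := sem (Put vY (Cst 0) (Cst 1)) s).
  set (l := [vY; li]).
  assert (A0 : agr l s s0) by (repeat (apply agr_set; [reflexivity|]); apply agr_refl).
  destruct (for_rule (fun i s' => agr l s s' /\ exists e : nat, Z.of_nat e <= i /\
     s' vY 0 = 2 ^ Z.of_nat e /\
     (e = 0%nat \/ (2 ^ Z.of_nat (e - 1)) ^ Z.of_nat r <= B) /\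
     (B < (2 ^ Z.of_nat e) ^ Z.of_nat r \/ Z.of_nat e = i)) li bd body s0 (B + 1) 2)
    as [(A & e & E1 & E2 & E5 & E6) Co].
  - unfold bd. cbn [eval opsem V]. rewrite A0, Hs by reflexivity. reflexivity.
  - lia.
  - split; [exact A0|]. exists 0%nat. repeat split; auto; lia.
  - intros i s1 Hi (A1 & e & E1 & E2 & E5 & E6).
    set (s2 := set s1 li 0 i).
    assert (A2 : agr l s s2) by (apply agr_set; [reflexivity|exact A1]).
    assert (N2 : s2 vB 0 = B) by (rewrite A2 by reflexivity; exact Hs).
    assert (Ev : eval (Bin OLt (V vB) (epow (V vY) r)) s2 = if B <? (2 ^ Z.of_nat e) ^ Z.of_nat r then 1 else 0).
    { cbn [eval opsem V]. rewrite epow_eval. cbn [eval V]. rewrite N2. change (s2 vY 0) with (s1 vY 0). now rewrite E2. }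
    assert (Am : agr l s (sem body s2)) by (apply agr_sem; [reflexivity|exact A2]).
    split.
    2:{ unfold body. cbn [cost]. destruct (_ =? 0); lia. }
    split; [exact Am|]. clear Am. unfold body. rewrite sem_if, Ev.
    destruct (Z.ltb_spec B ((2 ^ Z.of_nat e) ^ Z.of_nat r)) as [L|L]; cbn [Z.eqb].
    + exists e. cbn [sem]. repeat split; auto; lia.
    + destruct E6 as [E6|E6]; [lia|].
      pose proof (pow2_pos e) as P2. pose proof (pow_ge_base (2 ^ Z.of_nat e) r P2 Hr) as Pb.
      exists (S e). rewrite sem_put_cst. split; [lia|]. split.
      { rewrite set_same. cbn [eval opsem V]. rewrite N2. change (s2 vY 0) with (s1 vY 0). rewrite E2.
        rewrite pow2_succ. apply Z.mod_small. nia. }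
      split; [right; rewrite Nat.sub_succ, Nat.sub_0_r; exact L|]. right. lia.
  - split; [exact A|]. split.
    + cbn [cost] in *. fold s0. lia.
    + exists e. repeat split; auto. destruct E6 as [E6|E6]; [exact E6|].
      pose proof (pow2_gt e). pose proof (pow_ge_base (2 ^ Z.of_nat e) r (pow2_pos e) Hr). lia.
Qed.

Lemma params_ok q a k C1 s B S7 e Y : s vB 0 = B -> s vS7 0 = S7 -> s vE 0 = e -> s vY 0 = Y ->
  let s' := sem (c_consts q a k C1) s in
  cost (c_consts q a k C1) s = 12 /\
  s' vN 0 = B ^ Z.of_nat q /\ s' vM 0 = B ^ Z.of_nat (2 * q - 3) /\ s' vTh 0 = B ^ Z.of_nat (q - 5) /\
  s' vR5 0 = B ^ 5 /\ s' vZ 0 = B ^ Z.of_nat a /\ s' vb 0 = B ^ Z.of_nat (q - a) /\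
  s' vNB 0 = B ^ Z.of_nat (q - 1) /\ s' vQ7 0 = S7 ^ Z.of_nat a /\ s' vL 0 = Z.of_nat a * e /\
  s' vMD 0 = (4 * B) ^ Z.of_nat k /\ s' vWP 0 = Z.of_nat k * (e + 2) /\
  s' vTM 0 = C1 * (B * B * B / Y + 1).
Proof.
  intros HB HS He HY. cbv zeta. split; [reflexivity|].
  remember (sem (c_consts q a k C1) s) as s' eqn:E. unfold c_consts in E.
  do 11 (rewrite sem_seq, sem_put_cst, ?epow_eval in E; cbn [eval opsem V] in E;
    rewrite ?set_other in E by discriminate; rewrite ?HB, ?HS, ?He, ?HY in E).
  rewrite sem_put_cst in E. cbn [eval opsem V] in E.
  rewrite ?set_other in E by discriminate. rewrite ?HB, ?He, ?HY in E. rewrite E.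
  repeat split; repeat (rewrite set_same || rewrite set_other by discriminate); reflexivity.
Qed.

Section Tables.
Variables (d : nat).
Let Z2 := 2 ^ Z.of_nat d.
Let Q7 := 7 ^ Z.of_nat d.

Lemma t_all s c X : s vQ7 0 = Q7 -> s vZ 0 = Z2 -> accform X (c_all4 (Put X et4 (Bin OAdd (Get X et4) c))) = true ->
  forall kp r x y, 0 <= kp < 3 -> 0 <= r < Q7 -> 0 <= x < Z2 -> 0 <= y < Z2 ->
  sem (c_all4 (Acc X et4 c)) s X (pairZ kp (pairZ r (pairZ x y))) =
  s X (pairZ kp (pairZ r (pairZ x y))) + eval c (set (set (set (set s lkp 0 kp) lr 0 r) lx 0 x) ly 0 y).
Proof.
  intros HQ HZ Ha kp r x y H1 H2 H3 H4. unfold Acc. rewrite (acc_sem X _ Ha). f_equal.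
  cbn [c_all4 contr]. change (eval (Cst 3) s) with 3.
  rewrite <- (hit4 3 Q7 Z2 Z2 kp r x y (fun kp r x y => eval c (set (set (set (set s lkp 0 kp) lr 0 r) lx 0 x) ly 0 y))) by assumption.
  apply zsum_ext. intros kp' _.
  replace (eval (V vQ7) (set s lkp 0 kp')) with Q7 by (symmetry; exact HQ). apply zsum_ext. intros r' _.
  replace (eval (V vZ) (set (set s lkp 0 kp') lr 0 r')) with Z2 by (symmetry; exact HZ). apply zsum_ext. intros x' _.
  replace (eval (V vZ) (set (set (set s lkp 0 kp') lr 0 r') lx 0 x')) with Z2 by (symmetry; exact HZ). apply zsum_ext. intros y' _.
  reflexivity.
Qed.

(** The table of the [i]-th power is kept on the index range of the [d]-th. A round reads it at the
    shortened indices [r / 7], [x / 2], [y / 2], which stay in that range. *)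
Definition tok (s : state) (i : nat) : Prop :=
  forall kp r x y, 0 <= kp < 3 -> 0 <= r < Q7 -> 0 <= x < Z2 -> 0 <= y < Z2 ->
  s aT1 (pairZ kp (pairZ r (pairZ x y))) = tcoef i kp r x y.

Lemma t_cost l s X c : s vQ7 0 = Q7 -> s vZ 0 = Z2 -> inclb [X; lkp; lr; lx; ly] l = true ->
  mem vQ7 l = false -> mem vZ l = false ->
  cle l (c_all4 (Put X et4 c)) s (243 * (Q7 * (Z2 * Z2))).
Proof.
  intros HQ HZ Hl Hq Hz.
  assert (Q7p : 1 <= Q7) by (pose proof (Z.pow_pos_nonneg 7 (Z.of_nat d)); unfold Q7; lia).
  pose proof (pow2_pos d) as Z2p. fold Z2 in Z2p.
  assert (Dj : forall a, mem a l = false -> disj l [a] = true).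
  { intros a Ha. unfold disj. apply forallb_forall. intros x Hx. cbn. rewrite orb_false_r.
    apply negb_true_iff. apply Nat.eqb_neq. intros ->. apply mem_In in Hx. congruence. }
  assert (Il : forall a, mem a [X; lkp; lr; lx; ly] = true -> mem a l = true).
  { intros a Ha. unfold inclb in Hl. rewrite forallb_forall in Hl. apply Hl. now apply mem_In. }
  assert (IX : mem X l = true) by (apply Il; cbn; now rewrite Nat.eqb_refl).
  assert (Ikp : mem lkp l = true) by (apply Il; cbn; now rewrite !orb_true_r).
  assert (Ir : mem lr l = true) by (apply Il; cbn; now rewrite !orb_true_r).
  assert (Ix : mem lx l = true) by (apply Il; cbn; now rewrite !orb_true_r).
  assert (Iy : mem ly l = true) by (apply Il; cbn; now rewrite !orb_true_r).
  eapply cle_weaken.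
  2:{ unfold c_all4. eapply cle_for; [exact Ikp|unfold inclb; cbn [wr forallb]; now rewrite Ir, Ix, Iy, IX| |apply Z.le_refl| |cbn; lia|].
      { unfold disj. apply forallb_forall. reflexivity. }
      eapply cle_for; [exact Ir|unfold inclb; cbn [wr forallb]; now rewrite Ix, Iy, IX|now apply Dj|cbn [eval V]; rewrite HQ; apply Z.le_refl| |lia|].
      eapply cle_for; [exact Ix|unfold inclb; cbn [wr forallb]; now rewrite Iy, IX|now apply Dj|cbn [eval V]; rewrite HZ; apply Z.le_refl| |lia|].
      eapply cle_for; [exact Iy|unfold inclb; cbn [wr forallb]; now rewrite IX|now apply Dj|cbn [eval V]; rewrite HZ; apply Z.le_refl|apply cle_put|lia|].
      all: nia. }
  cbn [eval]. lia.
Qed.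

Lemma tables_ok s : s vQ7 0 = Q7 -> s vZ 0 = Z2 -> s vL 0 = Z.of_nat d -> (forall z, s aT1 z = 0) ->
  tok (sem c_tables s) d /\
  cost c_tables s <= (Z.of_nat d + 1) * (490 * (Q7 * (Z2 * Z2))).
Proof.
  intros HQ HZ HL H0.
  assert (Q7p : 1 <= Q7) by (pose proof (Z.pow_pos_nonneg 7 (Z.of_nat d)); unfold Q7; lia).
  pose proof (pow2_pos d) as Z2p. fold Z2 in Z2p.
  set (l := [aT1; aT2; lkp; lr; lx; ly; ld]).
  unfold c_tables. rewrite sem_seq, cost_seq.
  assert (C0 : cost c_t0 s <= 243 * (Q7 * (Z2 * Z2))) by (apply (cle_cost l); now apply t_cost).
  set (s0 := sem c_t0 s).
  assert (A0 : agr l s s0) by (apply agr_sem; [reflexivity|apply agr_refl]).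
  assert (T0 : tok s0 0).
  { intros kp r x y H1 H2 H3 H4. unfold s0, c_t0. rewrite t_all by (auto; reflexivity).
    rewrite H0. reflexivity. }
  match goal with |- context [For ld (V vL) ?c] => set (body := c) end.
  destruct (for_rule (fun i s' => agr l s s' /\ tok s' (Z.to_nat i)) ld (V vL) body s0 (Z.of_nat d)
     (2 + 486 * (Q7 * (Z2 * Z2)))) as [(_ & T) Co].
  - cbn [eval V]. rewrite A0 by reflexivity. exact HL.
  - lia.
  - split; [exact A0|exact T0].
  - intros i s1 Hi (A1 & T1). set (s2 := set s1 ld 0 i).
    assert (A2 : agr l s s2) by (apply agr_set; [reflexivity|exact A1]).
    split.
    2:{ apply (cle_cost l). unfold body. eapply cle_weaken.
        2:{ assert (Hq : s2 vQ7 0 = Q7) by (rewrite A2 by reflexivity; exact HQ).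
            assert (Hz : s2 vZ 0 = Z2) by (rewrite A2 by reflexivity; exact HZ).
            eapply cle_seq; [reflexivity|apply cle_clear|]. eapply cle_seq; [reflexivity|now apply t_cost|].
            eapply cle_seq; [reflexivity|apply cle_clear|]. now apply t_cost. }
        lia. }
    split; [apply agr_sem; [reflexivity|exact A2]|].
    unfold body. rewrite !sem_seq. set (s3 := sem (Clear aT2) s2).
    assert (A3 : agr l s s3) by (apply agr_sem; [reflexivity|exact A2]).
    set (s4 := sem c_t1 s3).
    assert (A4 : agr l s s4) by (apply agr_sem; [reflexivity|exact A3]).
    set (s5 := sem (Clear aT1) s4).
    assert (A5 : agr l s s5) by (apply agr_sem; [reflexivity|exact A4]).
    intros kp r x y H1 H2 H3 H4.
    assert (D7 : 0 <= r / 7 < Q7) by (split; [apply Z.div_pos; lia|apply Z.div_lt_upper_bound; lia]).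
    assert (Dx : 0 <= x / 2 < Z2) by (split; [apply Z.div_pos; lia|apply Z.div_lt_upper_bound; lia]).
    assert (Dy : 0 <= y / 2 < Z2) by (split; [apply Z.div_pos; lia|apply Z.div_lt_upper_bound; lia]).
    replace (Z.to_nat (i + 1)) with (S (Z.to_nat i)) by lia.
    assert (T4 : s4 aT2 (pairZ kp (pairZ r (pairZ x y))) = tcoef (S (Z.to_nat i)) kp r x y).
    { unfold s4, c_t1. rewrite t_all; try reflexivity; auto; try (rewrite A3 by reflexivity; auto).
      change (s3 aT2 (pairZ kp (pairZ r (pairZ x y)))) with 0.
      cbn [eval opsem V tix ecoef]. unfold set. cbn [Nat.eqb andb Z.eqb].
      change (s3 aT1) with (s1 aT1). rewrite T1 by assumption. cbn [tcoef]. unfold coef. ring. }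
    unfold c_t2. rewrite t_all; try reflexivity; auto; try (rewrite A5 by reflexivity; auto).
    change (s5 aT1 (pairZ kp (pairZ r (pairZ x y)))) with 0.
    assert (Ev : eval (Bin OSub (Bin OClamp (Bin OAdd (Get aT2 et4) (Cst 2)) (Cst 2)) (Cst 2))
       (set (set (set (set s5 lkp 0 kp) lr 0 r) lx 0 x) ly 0 y) =
       (s4 aT2 (pairZ kp (pairZ r (pairZ x y))) + 2) mod 5 - 2) by reflexivity.
    rewrite Ev, T4. pose proof (tcoef_abs (S (Z.to_nat i)) kp r x y H1).
    rewrite Z.mod_small by lia. lia.
  - rewrite Nat2Z.id in T. split; [exact T|].
    assert (1 <= Q7 * (Z2 * Z2)) by nia. set (X := Q7 * (Z2 * Z2)) in *. fold s0. nia.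
Qed.

End Tables.

(** * The number of exact triangles *)

Section Graph.
Variables (G : wgraph) (t : Z).
Let n := Z.of_nat (gn G).
Let inp := input_mem G t.

Definition Ef (i j : Z) : Z :=
  if (0 <=? i) && (i <? j) && (j <? n) then (if gadj G (Z.to_nat i) (Z.to_nat j) then 1 else 0) else 0.
Definition Wf (i j : Z) : Z :=
  if (0 <=? i) && (i <? n) && (0 <=? j) && (j <? n) then
    (if gadj G (Z.to_nat i) (Z.to_nat j) then gwt G (Z.to_nat i) (Z.to_nat j) else 0) else 0.

Lemma Ef01 i j : Ef i j = 0 \/ Ef i j = 1.
Proof. unfold Ef. destruct (_ && _); [|auto]. destruct (gadj _ _ _); auto. Qed.

Lemma inp_cell i j b : 0 <= i < n -> 0 <= j < n -> (b = 0 \/ b = 1) ->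
  inp (Z.to_nat (2 + b + 2 * (i * n + j))) =
  if gadj G (Z.to_nat i) (Z.to_nat j) then (if b =? 0 then 1 else gwt G (Z.to_nat i) (Z.to_nat j)) else 0.
Proof.
  intros Hi Hj Hb. set (p := (Z.to_nat i * gn G + Z.to_nat j)%nat).
  assert (Hp : Z.of_nat p = i * n + j) by (unfold p, n; nia).
  replace (Z.to_nat (2 + b + 2 * (i * n + j))) with (S (S (2 * p + Z.to_nat b)))%nat by lia.
  unfold inp. cbn [input_mem].
  assert (Db : ((2 * p + Z.to_nat b) / 2 = p)%nat).
  { rewrite Nat.mul_comm, Nat.div_add_l by lia. rewrite Nat.div_small by lia. lia. }
  assert (Eb : Nat.even (2 * p + Z.to_nat b) = (b =? 0)).
  { rewrite Nat.even_add, Nat.even_mul. destruct Hb as [-> | ->]; reflexivity. }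
  rewrite Db, Eb.
  assert (Dp : (p / gn G = Z.to_nat i)%nat).
  { unfold p. rewrite Nat.div_add_l by lia. rewrite Nat.div_small by lia. lia. }
  assert (Mp : (p mod gn G = Z.to_nat j)%nat).
  { unfold p. rewrite Nat.add_comm, Nat.Div0.mod_add, Nat.mod_small; lia. }
  rewrite Dp, Mp. destruct (Nat.ltb_spec p (gn G * gn G)) as [L|L]; [reflexivity|].
  exfalso. unfold p in L. nia.
Qed.

Definition inenv (s : state) : Prop := forall z, s 0%nat z = init (gn G) inp 0%nat z.

Lemma inenv_get s z : inenv s -> 0 <= z < 2 * (n * n) + 2 -> s 0%nat z = inp (Z.to_nat z).
Proof. intros H Hz. rewrite H. unfold init. cbn [Nat.eqb]. fold n. now rewrite Z.mod_small. Qed.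

Lemma inenv_n s : inenv s -> s 0%nat 0 = n.
Proof. intros H. rewrite inenv_get by (auto; nia). reflexivity. Qed.

Lemma inenv_t s : inenv s -> s 0%nat 1 = t.
Proof. intros H. rewrite inenv_get by (auto; nia). reflexivity. Qed.

Lemma edges_ok s N : inenv s -> (forall z, s aE z = 0) -> n <= N -> 1 <= N ->
  (forall i j, sem c_edges s aE (pairZ i j) = Ef i j) /\ cost c_edges s <= 18 * (N * N).
Proof.
  intros Hs H0 HN N1. pose proof (inenv_n s Hs) as Hn. split.
  - intros i j. rewrite (acc_sem aE) by reflexivity. rewrite H0, Z.add_0_l.
    unfold c_edges, Acc. cbn [contr eval opsem V Ix en]. unfold set. cbn [Nat.eqb andb Z.eqb]. rewrite Hn.
    set (f := fun i' j' => if i' <? j' then (if gadj G (Z.to_nat i') (Z.to_nat j') then 1 else 0) else 0).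
    transitivity (zsum n (fun i' => zsum n (fun j' => if pairZ i' j' =? pairZ i j then f i' j' else 0))).
    { apply zsum_ext. intros i' Hi'. apply zsum_ext. intros j' Hj'. unfold f.
      rewrite inenv_get by (auto; nia).
      change (2 + 2 * (i' * n + j')) with (2 + 0 + 2 * (i' * n + j')). rewrite (inp_cell i' j' 0) by auto.
      destruct (i' <? j'), (pairZ i' j' =? pairZ i j); reflexivity. }
    unfold Ef. destruct (Z.leb_spec 0 i) as [a1|a1], (Z.ltb_spec i j) as [a2|a2], (Z.ltb_spec j n) as [a3|a3]; cbn [andb].
    { rewrite hit2 by lia. unfold f. destruct (Z.ltb_spec i j); [reflexivity|lia]. }
    all: apply zsum_zero; intros i' Hi'; apply zsum_zero; intros j' Hj';
      rewrite pairZ_eqb; destruct (Z.eqb_spec i' i), (Z.eqb_spec j' j); cbn [andb]; try reflexivity; try lia;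
      unfold f; destruct (Z.ltb_spec i' j'); try reflexivity; lia.
  - apply (cle_cost (wr c_edges)). unfold c_edges. eapply cle_weaken.
    2:{ eapply cle_for; [reflexivity|reflexivity|reflexivity|cbn [eval en]; rewrite Hn; exact HN| |lia|].
        eapply cle_for; [reflexivity|reflexivity|reflexivity|cbn [eval en]; rewrite Hn; exact HN| |lia|].
        apply cle_if; [apply cle_put|apply cle_skip]. all: lia. }
    lia.
Qed.

Lemma weights_ok s N : inenv s -> (forall z, s aW z = 0) -> n <= N -> 1 <= N ->
  (forall i j, sem c_weights s aW (pairZ i j) = Wf i j) /\ cost c_weights s <= 9 * (N * N).
Proof.
  intros Hs H0 HN N1. pose proof (inenv_n s Hs) as Hn. split.
  - intros i j. rewrite (acc_sem aW) by reflexivity. rewrite H0, Z.add_0_l.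
    unfold c_weights, Acc. cbn [contr eval opsem V Ix en]. unfold set. cbn [Nat.eqb andb Z.eqb]. rewrite Hn.
    set (f := fun i' j' => if gadj G (Z.to_nat i') (Z.to_nat j') then gwt G (Z.to_nat i') (Z.to_nat j') else 0).
    transitivity (zsum n (fun i' => zsum n (fun j' => if pairZ i' j' =? pairZ i j then f i' j' else 0))).
    { apply zsum_ext. intros i' Hi'. apply zsum_ext. intros j' Hj'. unfold f.
      rewrite inenv_get by (auto; nia).
      change (3 + 2 * (i' * n + j')) with (2 + 1 + 2 * (i' * n + j')). rewrite (inp_cell i' j' 1) by auto. reflexivity. }
    unfold Wf. destruct (Z.leb_spec 0 i) as [a1|a1], (Z.ltb_spec i n) as [a2|a2], (Z.leb_spec 0 j) as [a3|a3], (Z.ltb_spec j n) as [a4|a4]; cbn [andb].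
    { now rewrite hit2 by lia. }
    all: apply zsum_zero; intros i' Hi'; apply zsum_zero; intros j' Hj';
      rewrite pairZ_eqb; destruct (Z.eqb_spec i' i), (Z.eqb_spec j' j); cbn [andb]; try reflexivity; lia.
  - apply (cle_cost (wr c_weights)). unfold c_weights. eapply cle_weaken.
    2:{ eapply cle_for; [reflexivity|reflexivity|reflexivity|cbn [eval en]; rewrite Hn; exact HN| |lia|].
        eapply cle_for; [reflexivity|reflexivity|reflexivity|cbn [eval en]; rewrite Hn; exact HN|apply cle_put|lia|].
        all: lia. }
    lia.
Qed.

Lemma filter_flat_map {A} (p : A -> bool) (f : nat -> list A) m :
  Z.of_nat (length (filter p (flat_map f (seq 0 m)))) =
  zsum (Z.of_nat m) (fun i => Z.of_nat (length (filter p (f (Z.to_nat i))))).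
Proof.
  unfold zsum. rewrite Nat2Z.id.
  induction m as [|m IH]; [reflexivity|]. rewrite seq_S, flat_map_app, filter_app, length_app.
  cbn [flat_map sumz Nat.add]. rewrite app_nil_r, Nat2Z.inj_add, IH, Nat2Z.id. reflexivity.
Qed.

Lemma filter_map_seq {A} (p : A -> bool) (f : nat -> A) m :
  Z.of_nat (length (filter p (map f (seq 0 m)))) =
  zsum (Z.of_nat m) (fun i => if p (f (Z.to_nat i)) then 1 else 0).
Proof.
  unfold zsum. rewrite Nat2Z.id.
  induction m as [|m IH]; [reflexivity|]. rewrite seq_S, map_app, filter_app, length_app.
  cbn [map sumz Nat.add filter]. rewrite Nat2Z.inj_add, IH, Nat2Z.id. destruct (p (f m)); reflexivity.
Qed.

Lemma zsum_extend m N f : 0 <= m <= N -> (forall i, m <= i -> f i = 0) -> zsum N f = zsum m f.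
Proof.
  intros Hm H. replace N with (m + (N - m)) by lia. rewrite zsum_app by lia.
  rewrite (zsum_zero (N - m)); [lia|]. intros i Hi. apply H. lia.
Qed.

Lemma tr_trib i k j : 0 <= i -> 0 <= k -> 0 <= j ->
  trif t Ef Wf i k j = if is_exact_trib G t (Z.to_nat i, Z.to_nat k, Z.to_nat j) then 1 else 0.
Proof.
  intros Hi Hk Hj. unfold trif, is_exact_trib.
  assert (L : forall x y, 0 <= x -> 0 <= y -> (Z.to_nat x <? Z.to_nat y)%nat = (x <? y)).
  { intros x y Hx Hy. destruct (Nat.ltb_spec (Z.to_nat x) (Z.to_nat y)), (Z.ltb_spec x y); lia. }
  assert (Ln : (Z.to_nat j <? gn G)%nat = (j <? n)).
  { unfold n. destruct (Nat.ltb_spec (Z.to_nat j) (gn G)), (Z.ltb_spec j (Z.of_nat (gn G))); lia. }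
  rewrite !L, Ln by assumption. unfold Ef.
  destruct (Z.ltb_spec i k) as [a1|a1]; [|rewrite andb_false_r; cbn [andb]; lia].
  destruct (Z.ltb_spec k j) as [a2|a2]; [|rewrite !andb_false_r; cbn [andb]; lia].
  destruct (Z.ltb_spec j n) as [a3|a3]; [|rewrite !andb_false_r; cbn [andb]; lia].
  assert (B0 : (0 <=? i) = true) by (apply Z.leb_le; lia).
  assert (B1 : (0 <=? k) = true) by (apply Z.leb_le; lia).
  assert (B2 : (0 <=? j) = true) by (apply Z.leb_le; lia).
  assert (B3 : (k <? n) = true) by (apply Z.ltb_lt; lia).
  assert (B4 : (i <? n) = true) by (apply Z.ltb_lt; lia).
  assert (B5 : (j <? n) = true) by (apply Z.ltb_lt; lia).
  assert (B6 : (i <? j) = true) by (apply Z.ltb_lt; lia).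
  unfold Wf. rewrite B0, B1, B2, B3, B4, B5, B6. cbn [andb].
  destruct (gadj G (Z.to_nat i) (Z.to_nat k)); [|reflexivity].
  destruct (gadj G (Z.to_nat k) (Z.to_nat j)); [|reflexivity].
  destruct (gadj G (Z.to_nat i) (Z.to_nat j)); [|reflexivity].
  cbn [andb]. destruct (_ =? t); reflexivity.
Qed.

Lemma tr_out i k j : n <= i \/ n <= k \/ n <= j -> trif t Ef Wf i k j = 0.
Proof.
  intros H. unfold trif, Ef.
  destruct (Z.ltb_spec i k); [|rewrite andb_false_r; cbn [andb]; lia].
  destruct (Z.ltb_spec k j); [|rewrite !andb_false_r; cbn [andb]; lia].
  destruct (Z.ltb_spec j n); [lia|]. rewrite !andb_false_r. lia.
Qed.

(** Nodes from [n] on are isolated. The specification lists triples with the middle node second,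
    whence the exchange of two sums. *)
Lemma count_sum N : n <= N ->
  zsum N (fun i => zsum N (fun j => full N t Ef Wf i j)) = Z.of_nat (count_exact_tri G t).
Proof.
  intros HN. unfold count_exact_tri, all_triples. rewrite filter_flat_map.
  assert (n0 : 0 <= n) by (unfold n; lia).
  unfold full.
  rewrite (zsum_extend n N).
  2:{ lia. }
  2:{ intros i Hi. apply zsum_zero. intros j _. apply zsum_zero. intros k _. apply tr_out. lia. }
  apply zsum_ext. intros i Hi. rewrite zsum_swap, filter_flat_map.
  rewrite (zsum_extend n N).
  2:{ lia. }
  2:{ intros k Hk. apply zsum_zero. intros j _. apply tr_out. lia. }
  apply zsum_ext. intros k Hk. rewrite filter_map_seq.
  rewrite (zsum_extend n N).
  2:{ lia. }
  2:{ intros j Hj. apply tr_out. lia. }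
  apply zsum_ext. intros j Hj. apply tr_trib; lia.
Qed.

End Graph.

(** * Arithmetic of the running time *)

Section Cost.
Variables (B NB N M Th R5 Z2 bs Q7 Y n C1 L : Z) (a d : Z).
Hypothesis B1 : 1 <= B.
Hypothesis NB1 : 1 <= NB.
Hypothesis M1 : 1 <= M.
Hypothesis Th1 : 1 <= Th.
Hypothesis Z21 : 1 <= Z2.
Hypothesis bs1 : 1 <= bs.
Hypothesis Q71 : 1 <= Q7.
Hypothesis Y1 : 1 <= Y <= 2 * B.
Hypothesis n0 : 0 <= n < N.
Hypothesis C10 : 0 <= C1.
Hypothesis L0 : 0 <= L.
Hypothesis a0 : 0 <= a.
Hypothesis d0 : 0 <= d <= a * B.
Hypothesis N_NB : N = NB * B.
Hypothesis N_blocks : N = Z2 * bs.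
Hypothesis R5_def : R5 = B * B * B * B * B.
Hypothesis N_heavy : N = Th * R5.
Hypothesis N_M : N * N = M * (B * B * B).
Hypothesis Q7_gain : Q7 * (R5 * R5) <= Z2 * Z2 * Z2.
Hypothesis Z2_N : Z2 * Z2 * Z2 * (R5 * R5) <= N.

Let N3 := N * N * N.

Lemma B_le_N : B <= N.
Proof. nia. Qed.

(** All parts except the oracle calls save a full factor [B]. As [Y <= 2 * B], the lemma [dbl]
    weakens this to the factor [Y] of the oracle. *)
Lemma part_setup : (4 + (n + 1) * 5 + (2 + (B + 1) * 3) + 12 + 18 * (N * N) + 9 * (N * N) + 1 + 9 * (N * N)) * B <= 80 * N3.
Proof.
  pose proof B_le_N. assert (N <= N * N) by nia.
  assert (X : 4 + (n + 1) * 5 + (2 + (B + 1) * 3) + 12 + 18 * (N * N) + 9 * (N * N) + 1 + 9 * (N * N) <= 80 * (N * N)) by lia.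
  unfold N3. set (S := 4 + (n + 1) * 5 + (2 + (B + 1) * 3) + 12 + 18 * (N * N) + 9 * (N * N) + 1 + 9 * (N * N)) in *.
  assert (0 <= S) by (unfold S; nia).
  apply (Z.le_trans _ (80 * (N * N) * N)); [|lia]. apply Z.mul_le_mono_nonneg; lia.
Qed.

Lemma R5_ge : 1 <= R5 /\ B <= R5 /\ B * B <= R5.
Proof.
  rewrite R5_def. assert (1 <= B * B) by nia. assert (B <= B * B) by nia.
  assert (B * B <= B * B * B * B).
  { assert (B * B * 1 <= B * B * (B * B)) by (apply Z.mul_le_mono_nonneg_l; lia). lia. }
  assert (B * B * B * B * 1 <= B * B * B * B * B) by (apply Z.mul_le_mono_nonneg_l; lia). lia.
Qed.

(** [d + 1] is at most [(a + 1) * B], so two factors [B] have to be paid for; [Q7 * B^2 <= N] and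
    [Z2^2 <= N] leave room for them within [N^2]. *)
Lemma part_tables : (d + 1) * (490 * (Q7 * (Z2 * Z2))) * B <= 490 * (a + 1) * N3.
Proof.
  destruct R5_ge as (r1 & r2 & r3). pose proof B_le_N as BN.
  assert (q1 : Q7 <= Z2 * Z2 * Z2).
  { assert (1 <= R5 * R5) by nia. assert (Q7 * 1 <= Q7 * (R5 * R5)) by (apply Z.mul_le_mono_nonneg_l; lia). lia. }
  assert (z3 : 1 <= Z2 * Z2 * Z2) by nia.
  assert (q2 : Q7 * (R5 * R5) <= N).
  { assert (Z2 * Z2 * Z2 * 1 <= Z2 * Z2 * Z2 * (R5 * R5)) by (apply Z.mul_le_mono_nonneg_l; nia). lia. }
  assert (q3 : Q7 * (B * B) <= N).
  { assert (Q7 * (B * B) <= Q7 * (R5 * R5)) by (apply Z.mul_le_mono_nonneg_l; nia). lia. }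
  assert (z2 : Z2 * Z2 <= N).
  { assert (Z2 * Z2 * 1 <= Z2 * Z2 * Z2) by (apply Z.mul_le_mono_nonneg_l; nia).
    assert (Z2 * Z2 * Z2 * 1 <= Z2 * Z2 * Z2 * (R5 * R5)) by (apply Z.mul_le_mono_nonneg_l; nia). lia. }
  assert (d1 : d + 1 <= (a + 1) * B) by nia.
  assert (s1 : (Q7 * (B * B)) * (Z2 * Z2) <= N * N) by (apply Z.mul_le_mono_nonneg; nia).
  assert (s2 : N * N <= N3) by (unfold N3; nia).
  assert (s3 : (d + 1) * (490 * (Q7 * (Z2 * Z2))) * B <= ((a + 1) * B) * (490 * (Q7 * (Z2 * Z2))) * B).
  { apply Z.mul_le_mono_nonneg_r; [lia|]. apply Z.mul_le_mono_nonneg_r; [nia|exact d1]. }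
  replace ((a + 1) * B * (490 * (Q7 * (Z2 * Z2))) * B) with (490 * (a + 1) * ((Q7 * (B * B)) * (Z2 * Z2))) in s3 by ring.
  apply (Z.le_trans _ _ _ s3). apply Z.mul_le_mono_nonneg_l; [clear - a0; lia|].
  exact (Z.le_trans _ _ _ s1 s2).
Qed.

Definition TMc : Z := C1 * (B * B * B / Y + 1).

Lemma part_oracle : NB * NB * NB * (TMc * L) * Y <= 3 * (C1 * L) * N3.
Proof.
  (* The added unit costs [Y], and [Y <= 2 * B <= 2 * B^3]. *)
  unfold TMc. assert (F : (B * B * B / Y + 1) * Y <= 3 * (B * B * B)).
  { pose proof (Z.mul_div_le (B * B * B) Y ltac:(lia)). assert (B <= B * B * B) by nia. lia. }
  replace (NB * NB * NB * (C1 * (B * B * B / Y + 1) * L) * Y) with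
    (NB * NB * NB * (C1 * L) * ((B * B * B / Y + 1) * Y)) by ring.
  replace (3 * (C1 * L) * N3) with (NB * NB * NB * (C1 * L) * (3 * (B * B * B))) by (unfold N3; rewrite N_NB; ring).
  apply Z.mul_le_mono_nonneg_l; [|exact F]. assert (0 <= C1 * L) by nia. assert (0 <= NB * NB * NB) by nia. nia.
Qed.

Lemma part_scan : NB * (1 + (2 + NB * (1 + (1 + NB * (1 + ((20 + 405 * (B * B)) + 4)))) + (1 + 162 * (M * (B * B * B))))) * B <= 700 * N3.
Proof.
  rewrite <- N_M. assert (b2 : 1 <= B * B) by nia.
  assert (e1 : 4 + 2 * NB + 25 * (NB * NB) + 405 * (NB * NB * (B * B)) <= 500 * (N * N)).
  { rewrite N_NB. assert (NB <= NB * NB) by nia. assert (1 <= NB * NB) by nia.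
    assert (NB * NB * 1 <= NB * NB * (B * B)) by (apply Z.mul_le_mono_nonneg_l; lia).
    replace (NB * B * (NB * B)) with (NB * NB * (B * B)) by ring. lia. }
  replace (NB * (1 + (2 + NB * (1 + (1 + NB * (1 + (20 + 405 * (B * B) + 4)))) + (1 + 162 * (N * N)))) * B)
    with (NB * B * ((4 + 2 * NB + 25 * (NB * NB) + 405 * (NB * NB * (B * B))) + 162 * (N * N))) by ring.
  rewrite <- N_NB. unfold N3. replace (700 * (N * N * N)) with (N * (700 * (N * N))) by ring.
  apply Z.mul_le_mono_nonneg_l; nia.
Qed.

Lemma z4 : Z2 * Z2 * Z2 <= Z2 * Z2 * Z2 * (R5 * R5).
Proof.
  destruct R5_ge as (r1 & r2 & r3).
  assert (1 * 1 <= R5 * R5) by (apply Z.mul_le_mono_nonneg; lia).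
  assert (Z2 * Z2 * Z2 * 1 <= Z2 * Z2 * Z2 * (R5 * R5)); [|lia].
  apply Z.mul_le_mono_nonneg_l; [repeat apply Z.mul_nonneg_nonneg; lia|lia].
Qed.

Lemma N3_nonneg : 0 <= N3.
Proof. unfold N3. repeat apply Z.mul_nonneg_nonneg; lia. Qed.

(** There are at most [B^3] rounds of [B] pivots, and one more [B] is to be saved, which makes a
    factor [B^5 = R5]. The light part becomes [N^2 * Th * R5 = N^3]. The heavy part has [R5^2 * Q7]
    in front of [N^2] and of [bs^3]; it is at most [Z2^3 <= N] for the first and at most
    [Z2^3 = (N / bs)^3] for the second. *)
Lemma part_pivot piv : 0 <= piv -> piv * M <= N * N ->
  piv * (1 + B * (1 + (1 + ((100 * (N * N * Th) + R5 * (2300 * (Q7 * (N * N)) + 300 * (Q7 * (bs * bs * bs)))) +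
     (1 + N * (1 + (1 + N * (1 + 3)))))))) * B <= 3000 * N3.
Proof.
  intros Hp0 Hp1. destruct R5_ge as (r1 & r2 & r3). pose proof B_le_N as BN.
  assert (Pb : piv <= B * B * B).
  { rewrite N_M in Hp1. rewrite (Z.mul_comm M) in Hp1. now apply Z.mul_le_mono_pos_r in Hp1; [|lia]. }
  set (ec := 100 * (N * N * Th) + R5 * (2300 * (Q7 * (N * N)) + 300 * (Q7 * (bs * bs * bs)))).
  assert (ec0 : 0 <= ec).
  { unfold ec. repeat (apply Z.add_nonneg_nonneg || apply Z.mul_nonneg_nonneg); lia. }
  assert (n2 : 1 <= N * N) by nia. assert (n3 : N <= N * N) by nia.
  assert (c1 : 1 + B * (1 + (1 + (ec + (1 + N * (1 + (1 + N * (1 + 3))))))) <= B * (ec + 11 * (N * N))).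
  { assert (i1 : 4 + ec + 2 * N + 4 * (N * N) <= ec + 11 * (N * N)) by lia.
    apply (Z.mul_le_mono_nonneg_l _ _ B) in i1; [|lia].
    replace (1 + B * (1 + (1 + (ec + (1 + N * (1 + (1 + N * (1 + 3)))))))) with
      (B * (4 + ec + 2 * N + 4 * (N * N)) + (1 - B)) by ring. lia. }
  set (pc := 1 + B * (1 + (1 + (ec + (1 + N * (1 + (1 + N * (1 + 3)))))))) in *.
  assert (pc0 : 0 <= pc).
  { unfold pc. assert (0 <= B * (1 + (1 + (ec + (1 + N * (1 + (1 + N * (1 + 3)))))))); [|lia].
    apply Z.mul_nonneg_nonneg; [lia|]. assert (0 <= N * (1 + (1 + N * (1 + 3)))) by (apply Z.mul_nonneg_nonneg; lia). lia. }
  assert (c2 : piv * pc * B <= (B * B * B) * (B * (ec + 11 * (N * N))) * B).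
  { apply Z.mul_le_mono_nonneg_r; [lia|]. apply Z.mul_le_mono_nonneg; lia. }
  replace (B * B * B * (B * (ec + 11 * (N * N))) * B) with (R5 * ec + 11 * (R5 * (N * N))) in c2 by (rewrite R5_def; ring).
  assert (RN : 1 * R5 <= Th * R5) by (apply Z.mul_le_mono_nonneg_r; lia). rewrite <- N_heavy, Z.mul_1_l in RN.
  assert (c3 : R5 * (N * N) <= N3)
    by (unfold N3; rewrite <- Z.mul_assoc; apply Z.mul_le_mono_nonneg_r; lia).
  assert (c4 : R5 * ec = 100 * N3 + (2300 * ((Q7 * (R5 * R5)) * (N * N)) + 300 * ((Q7 * (R5 * R5)) * (bs * bs * bs)))).
  { unfold ec, N3. replace (100 * (N * N * N)) with (100 * (N * N * (Th * R5))) by (rewrite <- N_heavy; ring). ring. }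
  assert (c5 : (Q7 * (R5 * R5)) * (N * N) <= N3).
  { unfold N3. replace (N * N * N) with (N * (N * N)) by ring. apply Z.mul_le_mono_nonneg_r; [lia|].
    pose proof z4. lia. }
  assert (c6 : (Q7 * (R5 * R5)) * (bs * bs * bs) <= N3).
  { unfold N3. rewrite N_blocks. replace (Z2 * bs * (Z2 * bs) * (Z2 * bs)) with ((Z2 * Z2 * Z2) * (bs * bs * bs)) by ring.
    apply Z.mul_le_mono_nonneg_r; [repeat apply Z.mul_nonneg_nonneg; lia|exact Q7_gain]. }
  pose proof N3_nonneg as n30. clear - c2 c3 c4 c5 c6 n30. lia.
Qed.

Lemma dbl x k : 0 <= x -> x * B <= k * N3 -> x * Y <= 2 * k * N3.
Proof.
  intros Hx Hk. assert (H : x * Y <= x * (2 * B)) by (apply Z.mul_le_mono_nonneg_l; lia).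
  clear - H Hk. lia.
Qed.

Definition Cc : Z := 2 * (80 + 490 * (a + 1) + 700 + 3000) + 3 * (C1 * L).

Lemma cost_arith piv T : 0 <= piv -> piv * M <= N * N ->
  T <= (4 + (n + 1) * 5) + ((2 + (B + 1) * 3) + (12 + (18 * (N * N) + (9 * (N * N) +
    ((d + 1) * (490 * (Q7 * (Z2 * Z2))) +
    (1 + NB * (1 + (2 + NB * (1 + (1 + NB * (1 + ((20 + 405 * (B * B) + TMc * L) + 4)))) + (1 + 162 * (M * (B * B * B)))))
     + piv * (1 + B * (1 + (1 + ((100 * (N * N * Th) + R5 * (2300 * (Q7 * (N * N)) + 300 * (Q7 * (bs * bs * bs)))) +
     (1 + N * (1 + (1 + N * (1 + 3)))))))) + 9 * (N * N))))))) ->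
  T * Y <= Cc * N3.
Proof.
  intros Hp0 Hp1 HT.
  pose proof part_setup as p1. pose proof part_tables as p2. pose proof part_oracle as p3.
  pose proof part_scan as p4. pose proof (part_pivot piv Hp0 Hp1) as p5.
  set (S1 := 4 + (n + 1) * 5 + (2 + (B + 1) * 3) + 12 + 18 * (N * N) + 9 * (N * N) + 1 + 9 * (N * N)) in *.
  set (S2 := (d + 1) * (490 * (Q7 * (Z2 * Z2)))) in *.
  set (S3 := NB * NB * NB * (TMc * L)) in *.
  set (S4 := NB * (1 + (2 + NB * (1 + (1 + NB * (1 + ((20 + 405 * (B * B)) + 4)))) + (1 + 162 * (M * (B * B * B)))))) in *.
  set (S5 := piv * _) in p5.
  assert (N0 : 0 <= N) by (clear - n0; lia).
  assert (NN : 0 <= N * N) by (apply Z.mul_nonneg_nonneg; exact N0).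
  assert (H1 : 0 <= S1) by (unfold S1; clear - NN n0 B1; lia).
  assert (H2 : 0 <= S2) by (unfold S2; clear - d0 Q71 Z21; repeat apply Z.mul_nonneg_nonneg; lia).
  assert (H4 : 0 <= S4).
  { unfold S4. rewrite <- N_M. clear - NB1 B1 NN. assert (0 <= B * B) by (apply Z.mul_nonneg_nonneg; lia).
    assert (0 <= NB * (1 + (20 + 405 * (B * B) + 4))) by (apply Z.mul_nonneg_nonneg; lia).
    assert (0 <= NB * (1 + (1 + NB * (1 + (20 + 405 * (B * B) + 4))))) by (apply Z.mul_nonneg_nonneg; lia).
    apply Z.mul_nonneg_nonneg; lia. }
  assert (H5 : 0 <= S5).
  { destruct R5_ge as (r1 & _). unfold S5. clear - Hp0 N0 r1 Th1 Q71 bs1 B1.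
    repeat (apply Z.add_nonneg_nonneg || apply Z.mul_nonneg_nonneg); lia. }
  apply dbl in p1; [|exact H1]. apply dbl in p2; [|exact H2]. apply dbl in p4; [|exact H4]. apply dbl in p5; [|exact H5].
  assert (HT2 : T <= S1 + S2 + S3 + S4 + S5).
  { replace (S1 + S2 + S3 + S4 + S5) with
     ((4 + (n + 1) * 5) + ((2 + (B + 1) * 3) + (12 + (18 * (N * N) + (9 * (N * N) +
    (S2 +
    (1 + NB * (1 + (2 + NB * (1 + (1 + NB * (1 + ((20 + 405 * (B * B) + TMc * L) + 4)))) + (1 + 162 * (M * (B * B * B)))))
     + S5 + 9 * (N * N)))))))); [exact HT|].
    unfold S1, S3, S4. ring. }
  assert (TY : T * Y <= (S1 + S2 + S3 + S4 + S5) * Y) by (apply Z.mul_le_mono_nonneg_r; [clear - Y1; lia|exact HT2]).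
  unfold Cc. clear - TY p1 p2 p3 p4 p5. clearbody S1 S2 S3 S4 S5 N3. lia.
Qed.

End Cost.

(** * The counting program as a whole *)

Lemma pow_split B x z q : q = (x + z)%nat -> B ^ Z.of_nat q = B ^ Z.of_nat x * B ^ Z.of_nat z.
Proof. intros ->. rewrite Nat2Z.inj_add, Z.pow_add_r by lia. reflexivity. Qed.

Lemma Wf_bound G t c i j : weights_bounded c G t -> Ef G i j = 1 -> Z.abs (Wf G i j) <= Z.of_nat (gn G ^ c).
Proof.
  intros [Gw _]. unfold Ef, Wf.
  destruct (Z.leb_spec 0 i), (Z.ltb_spec i j), (Z.ltb_spec j (Z.of_nat (gn G))); cbn [andb]; try lia.
  destruct (Z.ltb_spec i (Z.of_nat (gn G))), (Z.leb_spec 0 j); cbn [andb]; try lia.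
  destruct (gadj G (Z.to_nat i) (Z.to_nat j)) eqn:Ga; [|lia]. intros _. apply Gw; auto; lia.
Qed.

(** The [e]-th power of the hypothesis, because [B^10 = 1024^e] and [Z2^3 = (8^a)^e]. *)
Lemma strassen_gain a e : 7 ^ Z.of_nat a * 1024 <= 8 ^ Z.of_nat a ->
  let B := 2 ^ Z.of_nat e in let Z2 := B ^ Z.of_nat a in
  7 ^ Z.of_nat (a * e) * (B ^ 5 * B ^ 5) <= Z2 * Z2 * Z2.
Proof.
  intros Hg B Z2.
  assert (P : (7 ^ Z.of_nat a * 1024) ^ Z.of_nat e <= (8 ^ Z.of_nat a) ^ Z.of_nat e).
  { apply Z.pow_le_mono_l. split; [|exact Hg]. pose proof (Z.pow_pos_nonneg 7 (Z.of_nat a)). lia. }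
  rewrite Z.pow_mul_l in P.
  replace (7 ^ Z.of_nat (a * e)) with ((7 ^ Z.of_nat a) ^ Z.of_nat e)
    by (rewrite <- Z.pow_mul_r by lia; f_equal; lia).
  replace (B ^ 5 * B ^ 5) with (1024 ^ Z.of_nat e).
  2:{ unfold B. change 1024 with (2 ^ 10). rewrite <- !Z.pow_mul_r, <- Z.pow_add_r by lia. f_equal. lia. }
  replace (Z2 * Z2 * Z2) with ((8 ^ Z.of_nat a) ^ Z.of_nat e); [exact P|].
  unfold Z2, B. change 8 with (2 ^ 3). rewrite <- !Z.pow_mul_r, <- !Z.pow_add_r by lia. f_equal. lia.
Qed.

Section Count.
Variables (G : wgraph) (t : Z) (q a r k c : nat) (C1 : Z) (P0 : program).
Let n := Z.of_nat (gn G).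
Hypothesis Gwb : weights_bounded c G t.
Hypothesis a1 : (1 <= a)%nat.
Hypothesis q_def : q = (3 * a + 10)%nat.
Hypothesis r1 : (1 <= r)%nat.
Hypothesis a_gain : 7 ^ Z.of_nat a * 1024 <= 8 ^ Z.of_nat a.
Hypothesis C10 : 0 <= C1.
Hypothesis orc : forall e y, rootexp q n e -> rootexp r (2 ^ Z.of_nat e) y ->
  let B := 2 ^ Z.of_nat e in
  forall G', wf_graph G' -> gn G' = Z.to_nat (3 * B) ->
  (forall i j, (i < gn G')%nat -> (j < gn G')%nat -> gadj G' i j = true ->
     Z.abs (gwt G' i j) <= Z.of_nat (gn G ^ c)) ->
  exists T m, exec P0 (k * (e + 2)) T 0 (input_mem G' t) = Some m /\
    Z.of_nat T <= C1 * (B * B * B / 2 ^ Z.of_nat y + 1) /\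
    (m 0%nat <> 0 <-> has_exact_tri G' t).

Lemma rootexp_le x y : 1 <= x -> rootexp r x y -> 2 ^ Z.of_nat y <= 2 * x.
Proof.
  intros Hx [H1 [->|H2]]; [change (2 ^ Z.of_nat 0) with 1; lia|].
  destruct y as [|y]; [change (2 ^ Z.of_nat 0) with 1; lia|].
  rewrite Nat.sub_succ, Nat.sub_0_r in H2. rewrite pow2_succ.
  pose proof (pow_ge_base (2 ^ Z.of_nat y) r (pow2_pos y) r1). lia.
Qed.

Lemma count_ok : exists e y, rootexp q n e /\ rootexp r (2 ^ Z.of_nat e) y /\
  let s := init (gn G) (input_mem G t) in
  sem (c_count q a r k C1 P0) s vOut 0 = Z.of_nat (count_exact_tri G t) /\
  let N := (2 ^ Z.of_nat e) ^ Z.of_nat q in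
  cost (c_count q a r k C1 P0) s * 2 ^ Z.of_nat y <= Cc C1 (1 + steplen P0) (Z.of_nat a) * (N * N * N).
Proof.
  set (s := init (gn G) (input_mem G t)).
  assert (I0 : inenv G t s) by (intros z; reflexivity).
  unfold c_count. rewrite !sem_seq, !cost_seq.
  destruct (rootB_ok q s n) as (A1 & Co1 & e & Be & Ee & Se & Re); [lia|unfold n; lia|now apply (inenv_n G t)|].
  set (s1 := sem (c_rootB q) s) in *.
  set (B := 2 ^ Z.of_nat e) in *. pose proof (pow2_pos e) as B1. fold B in B1.
  destruct (rootY_ok r s1 B r1 B1 Be) as (A2 & Co2 & y & Ye & Ry).
  set (s2 := sem (c_rootY r) s1) in *.
  set (Y := 2 ^ Z.of_nat y) in *.
  assert (Y1 : 1 <= Y) by apply pow2_pos.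
  pose proof (rootexp_le B y B1 Ry) as Y2. fold Y in Y2.
  destruct (params_ok q a k C1 s2 B (7 ^ Z.of_nat e) (Z.of_nat e) Y) as (Co3 & v1 & v2 & v3 & v4 & v5 & v6 & v7 & v8 & v9 & v10 & v11 & v12).
  { rewrite A2 by reflexivity. exact Be. }
  { rewrite A2 by reflexivity. exact Se. }
  { rewrite A2 by reflexivity. exact Ee. }
  { exact Ye. }
  set (s3 := sem (c_consts q a k C1) s2) in *.
  assert (A3 : agr (wr (c_consts q a k C1)) s2 s3) by (intros b Hb z; now apply sem_frame).
  set (N := B ^ Z.of_nat q) in *.
  assert (PB : forall j : nat, 1 <= B ^ Z.of_nat j) by (intros; pose proof (Z.pow_pos_nonneg B (Z.of_nat j)); lia).
  assert (nN : n < N) by apply Re.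
  assert (I3 : inenv G t s3).
  { intros z. rewrite A3, A2, A1 by reflexivity. apply I0. }
  (* Arrays that the initialisation has not written yet are still zero, as the accumulation loops
     expect. *)
  assert (Zr : forall b z, mem b (wr (c_consts q a k C1) ++ [vY; li] ++ [vB; vE; vS7; li] ++ [0%nat]) = false -> s3 b z = 0).
  { intros b z Hb. rewrite !mem_app, !orb_false_iff in Hb. destruct Hb as (b1 & b2 & b3 & b4).
    rewrite A3, A2, A1 by assumption. unfold s, init. cbn in b4. rewrite orb_false_r in b4. now rewrite b4. }
  destruct (edges_ok G t s3 N I3) as [Eok Co4]; [intros; now apply Zr|fold n; lia|apply PB|].
  set (s4 := sem c_edges s3) in *.
  assert (A4 : agr (wr c_edges) s3 s4) by (intros b Hb z; now apply sem_frame).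
  assert (I4 : inenv G t s4) by (intros z; rewrite A4 by reflexivity; apply I3).
  destruct (weights_ok G t s4 N I4) as [Wok Co5]; [intros; rewrite A4 by reflexivity; now apply Zr|fold n; lia|apply PB|].
  set (s5 := sem c_weights s4) in *.
  assert (A5 : agr (wr c_weights) s4 s5) by (intros b Hb z; now apply sem_frame).
  set (d := (a * e)%nat).
  assert (Zd : 2 ^ Z.of_nat d = B ^ Z.of_nat a).
  { unfold B, d. rewrite <- Z.pow_mul_r by lia. f_equal. lia. }
  assert (Qd : 7 ^ Z.of_nat d = (7 ^ Z.of_nat e) ^ Z.of_nat a).
  { unfold d. rewrite <- Z.pow_mul_r by lia. f_equal. lia. }
  destruct (tables_ok d s5) as [Tok Co6].
  { rewrite A5, A4, v8, Qd by reflexivity. reflexivity. }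
  { rewrite A5, A4, v5, Zd by reflexivity. reflexivity. }
  { rewrite A5, A4, v9 by reflexivity. unfold d. lia. }
  { intros z. rewrite A5, A4 by reflexivity. now apply Zr. }
  set (s6 := sem c_tables s5) in *.
  assert (A6 : agr (wr c_tables) s5 s6) by (intros b Hb z; now apply sem_frame).
  assert (F6 : forall b z, mem b (wr c_tables ++ wr c_weights ++ wr c_edges) = false -> s6 b z = s3 b z).
  { intros b z Hb. rewrite !mem_app, !orb_false_iff in Hb. destruct Hb as (b1 & b2 & b3). now rewrite A6, A5, A4. }
  set (NB := B ^ Z.of_nat (q - 1)) in *. set (M := B ^ Z.of_nat (2 * q - 3)) in *.
  set (Th := B ^ Z.of_nat (q - 5)) in *. set (R5 := B ^ 5) in *. set (bs := B ^ Z.of_nat (q - a)) in *.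
  set (Z2 := B ^ Z.of_nat a) in *. set (Q7 := 7 ^ Z.of_nat d) in *.
  set (TM := C1 * (B * B * B / Y + 1)) in *.
  set (wp := (k * (e + 2))%nat).
  assert (Se6 : senv B NB N M Th R5 bs t TM d wp (Ef G) (Wf G) s6).
  { constructor.
    - now rewrite F6.
    - rewrite F6, A3, A2 by reflexivity. exact Be.
    - now rewrite F6.
    - now rewrite F6.
    - now rewrite F6.
    - now rewrite F6.
    - rewrite F6, v5 by reflexivity. now rewrite Zd.
    - now rewrite F6.
    - rewrite F6, v8 by reflexivity. symmetry. exact Qd.
    - now rewrite F6.
    - split.
      + rewrite F6, v10 by reflexivity. unfold wp, B.
        replace (4 * 2 ^ Z.of_nat e) with (2 ^ Z.of_nat (e + 2)).
        2:{ rewrite Nat2Z.inj_add, Z.pow_add_r by lia. change (2 ^ Z.of_nat 2) with 4. lia. }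
        rewrite <- Z.pow_mul_r by lia. f_equal. lia.
      + rewrite F6, v11 by reflexivity. unfold wp. lia.
    - rewrite F6 by reflexivity. now apply (inenv_t G).
    - intros i j. rewrite A6, A5 by reflexivity. apply Eok.
    - intros i j. rewrite A6 by reflexivity. apply Wok.
    - exact Tok. }
  assert (Q10 : (10 <= q)%nat) by (clear - q_def; lia).
  assert (R5d : R5 = B * B * B * B * B) by (unfold R5; clear; ring).
  assert (N_NB : N = NB * B).
  { unfold N, NB. rewrite (pow_split B (q - 1) 1) by (clear - Q10; lia). f_equal. apply Z.pow_1_r. }
  assert (N_bl : N = 2 ^ Z.of_nat d * bs).
  { rewrite Zd. unfold N, bs, Z2. apply pow_split. clear - q_def. lia. }
  assert (N_hv : N = Th * R5).
  { unfold N, Th, R5. apply (pow_split B (q - 5) 5). clear - Q10. lia. }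
  assert (N_M : N * N = M * (B * B * B)).
  { unfold N, M. rewrite <- (pow_split B q q _ eq_refl).
    rewrite (pow_split B (2 * q - 3) 3) by (clear - Q10; lia). f_equal.
    change (Z.of_nat 3) with 3. clear. ring. }
  assert (R5p : 1 <= R5) by (apply (PB 5%nat)).
  destruct (total_ok B NB N M Th R5 bs t TM (Z.of_nat (gn G ^ c)) d wp P0 (Ef G) (Wf G)) with (s := s6)
    as [Tot (piv & Hp0 & Hp1 & Co7)]; auto; try (apply PB).
  { apply Ef01. }
  { intros i j. exact (Wf_bound G t c i j Gwb). }
  { intros G' w1 w2 w3. apply (orc e y Re Ry G' w1 w2 w3). }
  { intros z. rewrite F6 by reflexivity. now apply Zr. }
  { intros z. rewrite F6 by reflexivity. now apply Zr. }
  { rewrite F6 by reflexivity. now apply Zr. }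
  exists e, y. split; [exact Re|]. split; [exact Ry|]. cbv zeta. split.
  - rewrite sem_seq in Tot. rewrite Tot. apply count_sum. fold n. lia.
  - fold B N Y. rewrite cost_seq in Co7.
    assert (G7 : Q7 * (R5 * R5) <= Z2 * Z2 * Z2) by exact (strassen_gain a e a_gain).
    assert (Q7p : 1 <= Q7) by (clear; unfold Q7; pose proof (Z.pow_pos_nonneg 7 (Z.of_nat d)); lia).
    assert (n0 : 0 <= n < N) by (split; [unfold n; clear; lia|exact nN]).
    assert (L0 : 0 <= 1 + steplen P0) by (unfold steplen; clear; lia).
    assert (d0 : 0 <= Z.of_nat d <= Z.of_nat a * B).
    { unfold d. pose proof (pow2_gt e) as H. fold B in H. clear - H. nia. }
    assert (ZN : Z2 * Z2 * Z2 * (R5 * R5) <= N).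
    { apply Z.eq_le_incl. unfold Z2, R5, N. change (B ^ 5) with (B ^ Z.of_nat 5).
      rewrite <- (pow_split B a a _ eq_refl), <- (pow_split B (a + a) a _ eq_refl),
        <- (pow_split B 5 5 _ eq_refl), <- (pow_split B _ _ _ eq_refl).
      f_equal. clear - q_def. lia. }
    assert (a0 : 0 <= Z.of_nat a) by (clear; lia).
    refine (cost_arith B NB N M Th R5 Z2 bs Q7 Y n C1 (1 + steplen P0) (Z.of_nat a) (Z.of_nat d)
      B1 (PB _) (PB _) (PB _) (PB _) (PB _) Q7p (conj Y1 Y2) n0 C10 L0 a0 d0 N_NB _ R5d N_hv N_M G7 ZN piv _ Hp0 Hp1 _).
    { rewrite <- Zd. exact N_bl. }
    unfold blkcost, ocost, orcost, pivcost, ecost, eqcost in Co7. unfold TMc. fold TM. fold Q7 in Co7, Co6.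
    rewrite Zd in Co6. fold Z2 in Co6. fold s1 s2 s3 s4 s5 s6.
    repeat match goal with |- ?x + _ <= _ + _ => apply Z.add_le_mono; [first [assumption | rewrite Co3; apply Z.le_refl] |] end.
    exact Co7.
Qed.

End Count.

(** * The equivalence *)

Lemma trib_spec G t i j k : is_exact_trib G t (i, j, k) = true <-> is_exact_tri G t i j k.
Proof.
  unfold is_exact_trib, is_exact_tri. rewrite !andb_true_iff, !Nat.ltb_lt, Z.eqb_eq. tauto.
Qed.

Lemma in_all_triples n i j k : (i < n)%nat -> (j < n)%nat -> (k < n)%nat -> In (i, j, k) (all_triples n).
Proof.
  intros Hi Hj Hk. apply in_flat_map. exists i. split; [apply in_seq; lia|].
  apply in_flat_map. exists j. split; [apply in_seq; lia|]. apply in_map_iff. exists k.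
  split; [reflexivity|apply in_seq; lia].
Qed.

Lemma count_pos G t : count_exact_tri G t <> 0%nat <-> has_exact_tri G t.
Proof.
  unfold count_exact_tri, has_exact_tri. split.
  - intros H. destruct (filter (is_exact_trib G t) (all_triples (gn G))) as [|[[i j] k] l] eqn:F; [easy|].
    assert (Hin : In (i, j, k) (filter (is_exact_trib G t) (all_triples (gn G)))) by (rewrite F; now left).
    apply filter_In in Hin. destruct Hin as [_ Hin]. apply trib_spec in Hin. now exists i, j, k.
  - intros (i & j & k & H) F. apply length_zero_iff_nil in F.
    assert (Hin : In (i, j, k) (filter (is_exact_trib G t) (all_triples (gn G)))).
    { apply filter_In. split; [|now apply trib_spec]. destruct H as (H1 & H2 & H3 & _). apply in_all_triples; lia. }
    now rewrite F in Hin.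
Qed.

Lemma count_to_exact : CountExactTri_truly_subcubic -> ExactTri_truly_subcubic.
Proof.
  intros H c. destruct (H c) as (eps & Heps & k & P & C & HP). exists eps. split; [exact Heps|].
  exists k, P, C. intros G t Wf Wb. destruct (HP G t Wf Wb) as (T & m & E & HT & Hm).
  exists T, m. split; [exact E|]. split; [exact HT|]. rewrite Hm, <- count_pos. lia.
Qed.

Open Scope R_scope.

Lemma Rpower_root (x : R) (m : nat) : 0 < x -> (1 <= m)%nat -> Rpower (x ^ m) (/ INR m) = x.
Proof.
  intros Hx Hm. rewrite <- Rpower_pow by exact Hx. rewrite Rpower_mult, Rinv_r, Rpower_1; [reflexivity|exact Hx|].
  apply not_0_INR. lia.
Qed.

(** [(3 B)^(3 - eps)] is at most [27 * B^3 / (3 B)^(1/r)], and [Y / 2] is at most [(3 B)^(1/r)];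
    hence 54 = 27 * 2. *)
Lemma oracle_time (B Y : Z) (r : nat) (eps : R) : (1 <= B)%Z -> (2 <= Y)%Z -> (1 <= r)%nat ->
  / INR r <= eps -> (IZR Y / 2) ^ r <= IZR B ->
  Rpower (3 * IZR B) (3 - eps) <= 54 * (IZR B * IZR B * IZR B / IZR Y).
Proof.
  intros HB HY Hr He Hy. apply IZR_le in HB, HY. set (b := IZR B) in *. set (y := IZR Y) in *.
  assert (H1 : Rpower (3 * b) (3 - eps) <= Rpower (3 * b) (3 + - / INR r)).
  { apply Rle_Rpower; lra. }
  rewrite Rpower_plus in H1.
  replace (Rpower (3 * b) 3) with ((3 * b) ^ 3) in H1.
  2:{ rewrite <- Rpower_pow by lra. f_equal. simpl. lra. }
  rewrite Rpower_Ropp in H1.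
  assert (H2 : y / 2 <= Rpower (3 * b) (/ INR r)).
  { rewrite <- (Rpower_root (y / 2) r) by (auto; lra). apply Rle_Rpower_l.
    - left. apply Rinv_0_lt_compat. apply lt_0_INR. lia.
    - split; [apply pow_lt; lra|lra]. }
  apply (Rle_trans _ _ _ H1).
  assert (H3 : / Rpower (3 * b) (/ INR r) <= / (y / 2)) by (apply Rinv_le_contravar; lra).
  assert (H4 : 0 <= (3 * b) ^ 3) by (apply pow_le; lra).
  apply (Rle_trans _ ((3 * b) ^ 3 * / (y / 2))); [now apply Rmult_le_compat_l|].
  right. field. lra.
Qed.

Lemma oracle_steps (B Y C1 : Z) (r T : nat) (eps C : R) : (1 <= B)%Z -> (2 <= Y)%Z -> (1 <= r)%nat ->
  / INR r <= eps -> (IZR Y / 2) ^ r <= IZR B -> (0 <= C1)%Z -> 54 * C <= IZR C1 ->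
  INR T <= C * Rpower (3 * IZR B) (3 - eps) ->
  (Z.of_nat T <= C1 * (B * B * B / Y + 1))%Z.
Proof.
  intros HB HY Hr He Hy HC1 HC HT. apply le_IZR. rewrite <- INR_IZR_INZ.
  pose proof (oracle_time B Y r eps HB HY Hr He Hy) as Ho.
  assert (Hfl : (B * B * B < Y * (B * B * B / Y + 1))%Z).
  { pose proof (Z.mul_succ_div_gt (B * B * B) Y ltac:(lia)). lia. }
  apply IZR_lt in Hfl. rewrite !mult_IZR, !plus_IZR in Hfl. rewrite mult_IZR, plus_IZR.
  set (F := IZR (B * B * B / Y)) in *. apply IZR_le in HB, HY, HC1.
  assert (Hq : IZR B * IZR B * IZR B / IZR Y <= F + 1).
  { apply Rmult_le_reg_l with (IZR Y); [lra|].
    replace (IZR Y * (IZR B * IZR B * IZR B / IZR Y)) with (IZR B * IZR B * IZR B) by (field; lra). lra. }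
  assert (Hpos : 0 < Rpower (3 * IZR B) (3 - eps)) by apply exp_pos.
  set (X := Rpower (3 * IZR B) (3 - eps)) in *.
  assert (H54 : X <= 54 * (F + 1)) by lra.
  (* The sign of [C] is unknown. If it is not positive, the time bound is nonpositive and the claim
     trivial. *)
  destruct (Rle_dec C 0) as [Cn|Cn].
  - assert (C * X <= 0) by nra. assert (0 <= F + 1) by nra. nra.
  - assert (C * X <= C * (54 * (F + 1))) by (apply Rmult_le_compat_l; lra).
    assert (0 <= F + 1) by lra. nra.
Qed.

(** [Y ^ (r * q) >= N > n] turns the saved factor [Y] into [n^(1/(rq))], and [N <= 2^q * max(1, n)]
    turns [N^3] into a constant multiple of [n^3]. *)
Lemma final_time (n N Y Tz K : Z) (q r : nat) : (0 <= K)%Z -> (0 <= n)%Z -> (1 <= Y)%Z -> (1 <= q)%nat -> (1 <= r)%nat ->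
  (n < N)%Z -> (N <= 2 ^ Z.of_nat q * Z.max 1 n)%Z -> (N <= Y ^ Z.of_nat (r * q))%Z ->
  (Tz * Y <= K * (N * N * N))%Z ->
  IZR Tz <= (IZR K * (2 ^ q) ^ 3) * Rpower (IZR n) (3 - / INR (r * q)).
Proof.
  intros HK Hn HY Hq Hr HnN HN HYN HT.
  set (m := Z.max 1 n) in *. set (x := / INR (r * q)).
  assert (Hx0 : 0 < x) by (apply Rinv_0_lt_compat, lt_0_INR; nia).
  assert (Em : Rpower (IZR n) (3 - x) = Rpower (IZR m) (3 - x)).
  (* On the empty graph [ln 0] takes the default value 0, so [Rpower 0] agrees with [Rpower 1]. *)
  { unfold m. destruct (Z.eq_dec n 0) as [->|Nz].
    - change (Z.max 1 0) with 1%Z. unfold Rpower. rewrite ln_1.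
      replace (ln 0) with 0; [reflexivity|]. unfold ln. destruct (Rlt_dec 0 0) as [Q|Q]; [destruct (Rlt_irrefl 0 Q)|reflexivity].
    - now rewrite Z.max_r by lia. }
  rewrite Em.
  assert (Hm : (1 <= m)%Z) by (unfold m; lia).
  assert (HmY : (m <= Y ^ Z.of_nat (r * q))%Z) by (unfold m; lia).
  assert (HmR : 1 <= IZR m) by (now apply IZR_le in Hm).
  assert (HYR : 1 <= IZR Y) by (now apply IZR_le in HY).
  assert (Hy : Rpower (IZR m) x <= IZR Y).
  { rewrite <- (Rpower_root (IZR Y) (r * q)) by (try lra; nia). fold x. apply Rle_Rpower_l; [lra|].
    split; [lra|]. rewrite pow_IZR. now apply IZR_le. }
  assert (HNR : IZR N <= 2 ^ q * IZR m).
  { apply IZR_le in HN. rewrite mult_IZR, <- pow_IZR in HN. exact HN. }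
  assert (HN1 : 0 <= IZR N) by (apply IZR_le; lia).
  assert (HKR : 0 <= IZR K) by (now apply IZR_le in HK).
  assert (P2 : 0 < 2 ^ q) by (apply pow_lt; lra).
  assert (N3 : IZR N * IZR N * IZR N <= (2 ^ q) ^ 3 * (IZR m) ^ 3).
  { rewrite <- Rpow_mult_distr. replace (IZR N * IZR N * IZR N) with (IZR N ^ 3) by ring.
    apply pow_incr. lra. }
  apply IZR_le in HT. rewrite !mult_IZR in HT.
  assert (Hp : Rpower (IZR m) (3 - x) = (IZR m) ^ 3 * / Rpower (IZR m) x).
  { unfold Rminus. rewrite Rpower_plus, Rpower_Ropp. f_equal. rewrite <- Rpower_pow by lra. f_equal. simpl. lra. }
  rewrite Hp. assert (Hr0 : 0 < Rpower (IZR m) x) by apply exp_pos.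
  set (z := Rpower (IZR m) x) in *.
  destruct (Rle_dec (IZR Tz) 0) as [Tn|Tn].
  - apply (Rle_trans _ _ _ Tn). apply Rmult_le_pos; [apply Rmult_le_pos; [lra|apply pow_le; lra]|].
    apply Rmult_le_pos; [apply pow_le; lra|left; now apply Rinv_0_lt_compat].
  - apply Rmult_le_reg_r with z; [exact Hr0|].
    replace (IZR K * (2 ^ q) ^ 3 * (IZR m ^ 3 * / z) * z) with (IZR K * ((2 ^ q) ^ 3 * IZR m ^ 3)) by (field; lra).
    apply (Rle_trans _ (IZR Tz * IZR Y)); [apply Rmult_le_compat_l; lra|].
    apply (Rle_trans _ _ _ HT). apply Rmult_le_compat_l; lra.
Qed.

Open Scope Z_scope.

(** [3 * 2^e] lies between [2^(e + 1)] and [2^(e + 2)], so the oracle instances have word size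
    [k * (e + 2)]. *)
Lemma log2_3pow e : Nat.log2 (Z.to_nat (3 * 2 ^ Z.of_nat e)) = (e + 1)%nat.
Proof.
  replace (Z.to_nat (3 * 2 ^ Z.of_nat e)) with (3 * 2 ^ e)%nat.
  2:{ rewrite Z2Nat.inj_mul by (try apply Z.pow_nonneg; lia). f_equal.
      rewrite <- (Nat2Z.id (2 ^ e)). f_equal. now rewrite Nat2Z.inj_pow. }
  apply Nat.log2_unique; [lia|]. rewrite <- Nat.add_succ_r, !Nat.pow_add_r. cbn [Nat.pow].
  pose proof (Nat.pow_nonzero 2 e ltac:(lia)). lia.
Qed.

Lemma rootexp_upper q n e : (1 <= q)%nat -> 0 <= n -> rootexp q n e ->
  (2 ^ Z.of_nat e) ^ Z.of_nat q <= 2 ^ Z.of_nat q * Z.max 1 n.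
Proof.
  intros Hq Hn [_ [->|H]].
  - change (2 ^ Z.of_nat 0) with 1. rewrite Z.pow_1_l by lia. pose proof (pow2_pos q). nia.
  - destruct e as [|e].
    + change (2 ^ Z.of_nat 0) with 1. rewrite Z.pow_1_l by lia. pose proof (pow2_pos q). nia.
    + rewrite Nat.sub_succ, Nat.sub_0_r in H. rewrite pow2_succ, Z.pow_mul_l.
      apply Z.mul_le_mono_nonneg_l; [pose proof (pow2_pos q); lia|lia].
Qed.

Lemma cube_le x y : 0 <= x -> x <= y -> x * x * x <= y * y * y.
Proof.
  intros Hx Hy. apply Z.mul_le_mono_nonneg; [nia|nia|exact Hx|exact Hy].
Qed.

Lemma scaled_le T x k c y m : 0 <= k -> 0 <= y -> T <= k * x -> x * y <= c * m -> T * y <= k * c * m.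
Proof.
  intros Hk Hy HT Hx. apply (Z.le_trans _ (k * x * y)); [now apply Z.mul_le_mono_nonneg_r|].
  rewrite <- !Z.mul_assoc. now apply Z.mul_le_mono_nonneg_l.
Qed.

Lemma input_bound G t c x : weights_bounded c G t ->
  Z.abs (input_mem G t x) <= width (gn G) ^ Z.of_nat (c + 1).
Proof.
  intros [Gw Gt]. set (X := width (gn G)). pose proof (width_ge2 (gn G)) as X2. pose proof (width_gt (gn G)) as Xn.
  fold X in X2, Xn.
  assert (Xc : Z.of_nat (gn G ^ c) <= X ^ Z.of_nat c).
  { rewrite Nat2Z.inj_pow. apply Z.pow_le_mono_l. lia. }
  assert (Xp : 1 <= X ^ Z.of_nat c) by (pose proof (Z.pow_pos_nonneg X (Z.of_nat c)); lia).
  assert (X1 : X ^ Z.of_nat (c + 1) = X ^ Z.of_nat c * X).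
  { rewrite Nat2Z.inj_add, Z.pow_add_r by lia. f_equal. apply Z.pow_1_r. }
  assert (XX : X ^ Z.of_nat c <= X ^ Z.of_nat (c + 1)) by nia.
  assert (XY : X <= X ^ Z.of_nat (c + 1)) by nia.
  destruct x as [|[|b]]; cbn [input_mem]; [lia|lia|].
  destruct (Nat.ltb_spec (b / 2) (gn G * gn G)) as [L|L]; [|cbn [Z.abs]; lia].
  assert (G0 : gn G <> 0%nat) by (intros Q; rewrite Q in L; lia).
  destruct (gadj G (b / 2 / gn G) ((b / 2) mod gn G)) eqn:Ga; [|cbn [Z.abs]; lia].
  destruct (Nat.even b); [cbn [Z.abs]; lia|].
  assert (Z.abs (gwt G (b / 2 / gn G) ((b / 2) mod gn G)) <= Z.of_nat (gn G ^ c)); [|lia].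
  apply Gw; [apply Nat.Div0.div_lt_upper_bound; lia|apply Nat.mod_upper_bound; exact G0|exact Ga].
Qed.

Lemma input_loop G t b : wf_graph G -> (b <= 1)%nat -> input_mem G t (2 + b)%nat = 0.
Proof.
  intros [_ W] Hb. cbn [Nat.add input_mem].
  replace (b / 2)%nat with 0%nat by (symmetry; apply Nat.div_small; lia).
  destruct (Nat.ltb_spec 0 (gn G * gn G)) as [L|L]; [|reflexivity].
  assert (gn G <> 0)%nat by (intros Q; rewrite Q in L; lia).
  rewrite Nat.Div0.div_0_l, Nat.Div0.mod_0_l. now rewrite W by lia.
Qed.

Lemma input_end G t x : 2 * (Z.of_nat (gn G) * Z.of_nat (gn G)) + 2 <= Z.of_nat x -> input_mem G t x = 0.
Proof.
  intros H. destruct x as [|[|b]]; [lia|lia|]. cbn [input_mem].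
  destruct (Nat.ltb_spec (b / 2) (gn G * gn G)) as [L|L]; [|reflexivity].
  exfalso. pose proof (Nat.div_mod_eq b 2). pose proof (Nat.mod_upper_bound b 2). lia.
Qed.

Lemma exact_to_count : ExactTri_truly_subcubic -> CountExactTri_truly_subcubic.
Proof.
  intros H c.
  (* 52 is the least [a] with [7^a * 2^10 <= 8^a]. The exponent [q] makes [Z2^3 * R5^2] equal to
     [N]. *)
  set (a := 52%nat). set (q := (3 * a + 10)%nat).
  (* Weights up to [n^c] are below [(B^q)^c], hence within the bound [(3 B)^(q c)] for an instance
     of [3 B] nodes. *)
  destruct (H (q * c)%nat) as (eps & Heps & k & P0 & C & HP). clear H.
  set (r := S (Z.to_nat (up (/ eps)))).
  assert (r1 : (1 <= r)%nat) by (unfold r; lia).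
  assert (Hr : (/ INR r <= eps)%R).
  { assert (0 < / eps)%R by (now apply Rinv_0_lt_compat).
    destruct (archimed (/ eps)) as [U _].
    assert (Up : 0 <= up (/ eps)) by (apply le_IZR; lra).
    assert (Rr : (/ eps <= INR r)%R).
    { unfold r. rewrite S_INR, INR_IZR_INZ, Z2Nat.id by exact Up. lra. }
    rewrite <- (Rinv_inv eps). apply Rinv_le_contravar; lra. }
  (* An integer above the constant 54 of [oracle_time] times [C]; the maximum with 0 keeps the
     number of simulated steps nonnegative. *)
  set (C1 := Z.max 0 (up (54 * C))).
  assert (C10 : 0 <= C1) by (unfold C1; lia).
  assert (HC1 : (54 * C <= IZR C1)%R).
  { destruct (archimed (54 * C)) as [U _].
    assert (IZR (up (54 * C)) <= IZR C1)%R by (apply IZR_le; unfold C1; lia). lra. }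
  set (CC := Cc C1 (1 + steplen P0) (Z.of_nat a)).
  assert (CC0 : 0 <= CC) by (unfold CC, Cc, steplen; nia).
  (* The cost is at most [CC * N^3]. With [X = width n >= 2], the constant is at most [X^CC] and
     [N <= 2^q * max(1, n)] is at most [X^(q + 1)]. *)
  set (b := (Z.to_nat CC + 3 * (q + 1))%nat).
  destruct (compile_ram (c_count q a r k C1 P0) lev nids 6 vOut (c + 1) b) as (k' & P & kappa & Kp & HC).
  { apply count_cwf. }
  { apply count_wt. }
  { apply lev_le. }
  { lia. }
  { reflexivity. }
  { unfold nids. lia. }
  exists (/ INR (r * q))%R. split; [apply Rinv_0_lt_compat, lt_0_INR; unfold q; lia|].
  exists k', P, (IZR (kappa * CC) * (2 ^ q) ^ 3)%R.
  intros G t Wg Wb. set (n := Z.of_nat (gn G)).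
  destruct (count_ok G t q a r k c C1 P0) as (e & y & Re & Ry & Cnt & Cost); auto.
  { unfold a. lia. }
  { unfold a. vm_compute. discriminate. }
  { intros e y Re Ry B G' Wg' Gn' Gw'.
    assert (B1 : 1 <= B) by apply pow2_pos.
    destruct (HP G' t Wg') as (T & m & Ex & HT & Hm).
    { assert (Bd : Z.of_nat (gn G ^ c) <= Z.of_nat (gn G' ^ (q * c))).
      { rewrite Gn', !Nat2Z.inj_pow, Z2Nat.id by lia. rewrite Nat2Z.inj_mul, Z.pow_mul_r by lia.
        apply Z.pow_le_mono_l. split; [lia|].
        assert (B ^ Z.of_nat q <= (3 * B) ^ Z.of_nat q) by (apply Z.pow_le_mono_l; lia).
        destruct Re as [Re _]. fold B in Re. lia. }
      split.
      - intros i j Hi Hj Ha. specialize (Gw' i j Hi Hj Ha). lia.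
      - destruct Wb as [_ Wt]. lia. }
    exists T, m. split; [|split; [|exact Hm]].
    - rewrite <- Ex. f_equal. unfold word_size. rewrite Gn'. unfold B. rewrite log2_3pow. f_equal. lia.
    - destruct Ry as [Ry1 Ry2].
      (* [y = 0] would mean [B < 1]. So [Y >= 2], and the minimality of [y] yields
         [(Y / 2)^r <= B]. *)
      destruct y as [|y].
      { exfalso. change (2 ^ Z.of_nat 0) with 1 in Ry1. rewrite Z.pow_1_l in Ry1 by lia. fold B in Ry1. lia. }
      destruct Ry2 as [Ry2|Ry2]; [discriminate Ry2|]. rewrite Nat.sub_succ, Nat.sub_0_r in Ry2.
      apply (oracle_steps B (2 ^ Z.of_nat (S y)) C1 r T eps C); auto.
      + rewrite pow2_succ. pose proof (pow2_pos y). lia.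
      + apply IZR_le in Ry2. rewrite <- pow_IZR in Ry2. rewrite pow2_succ, mult_IZR.
        replace (2 * IZR (2 ^ Z.of_nat y) / 2)%R with (IZR (2 ^ Z.of_nat y)) by field. exact Ry2.
      + rewrite Gn' in HT. rewrite (INR_IZR_INZ (Z.to_nat (3 * B))), Z2Nat.id, mult_IZR in HT by lia. exact HT. }
  fold n in Re. cbv zeta in Cost. fold CC in Cost.
  set (N := (2 ^ Z.of_nat e) ^ Z.of_nat q) in *. set (Y := 2 ^ Z.of_nat y) in *.
  assert (Y1 : 1 <= Y) by apply pow2_pos.
  assert (q1 : (1 <= q)%nat) by (unfold q; lia).
  assert (n0 : 0 <= n) by (unfold n; lia).
  pose proof (rootexp_upper q n e q1 n0 Re) as NU. fold N in NU.
  assert (nN : n < N) by apply Re.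
  set (s := init (gn G) (input_mem G t)) in *.
  pose proof (cost_pos (c_count q a r k C1 P0) s) as Cp.
  set (cs := cost (c_count q a r k C1 P0) s) in *.
  assert (csN : cs <= CC * (N * N * N)) by (clear - Cost Cp Y1; nia).
  destruct (HC (gn G) (input_mem G t)) as (T & m & Ex & HT & Hm).
  { reflexivity. }
  { apply (input_loop G t 0 Wg). lia. }
  { apply (input_loop G t 1 Wg). lia. }
  { intros x. apply input_end. }
  { intros x. now apply input_bound. }
  { fold s. fold cs. set (X := width (gn G)). pose proof (width_ge2 (gn G)) as X2. pose proof (width_gt (gn G)) as Xn.
    fold X in X2, Xn. fold n in Xn.
    assert (NX : N <= X ^ Z.of_nat (q + 1)).
    { apply (Z.le_trans _ _ _ NU). rewrite Nat2Z.inj_add, Z.pow_add_r by lia.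
      change (Z.of_nat 1) with 1. rewrite Z.pow_1_r.
      apply Z.mul_le_mono_nonneg; [pose proof (pow2_pos q); lia|apply Z.pow_le_mono_l; lia|lia|lia]. }
    assert (CX : CC <= X ^ Z.of_nat (Z.to_nat CC)).
    { pose proof (pow2_gt (Z.to_nat CC)) as G1. assert (2 ^ Z.of_nat (Z.to_nat CC) <= X ^ Z.of_nat (Z.to_nat CC)) by (apply Z.pow_le_mono_l; lia). lia. }
    apply (Z.le_trans _ _ _ csN). unfold b.
    replace (Z.of_nat (Z.to_nat CC + 3 * (q + 1))) with
      (Z.of_nat (Z.to_nat CC) + (Z.of_nat (q + 1) + Z.of_nat (q + 1) + Z.of_nat (q + 1))) by lia.
    rewrite !Z.pow_add_r by lia.
    set (W := X ^ Z.of_nat (q + 1)) in *.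
    assert (N0 : 0 <= N) by lia.
    assert (N * N * N <= W * W * W).
    { now apply cube_le. }
    assert (0 <= N * N * N) by (clear - N0; nia).
    apply Z.mul_le_mono_nonneg; assumption. }
  exists T, m. split; [exact Ex|]. split; [|rewrite Hm; exact Cnt].
  fold s in HT. fold cs in HT.
  assert (TY : Z.of_nat T * Y <= kappa * CC * (N * N * N)).
  { apply (scaled_le _ cs); [lia|lia|exact HT|exact Cost]. }
  rewrite (INR_IZR_INZ T), (INR_IZR_INZ (gn G)). fold n.
  apply (final_time n N Y (Z.of_nat T) (kappa * CC) q r); auto.
  - apply Z.mul_nonneg_nonneg; assumption.
  - destruct Ry as [Ry _]. fold Y in Ry. rewrite Nat2Z.inj_mul, Z.pow_mul_r by lia.
    unfold N. apply Z.pow_le_mono_l. pose proof (pow2_pos e). lia.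
Qed.

Theorem theorem1p6 :
  ExactTri_truly_subcubic <-> CountExactTri_truly_subcubic.
Proof. split; [apply exact_to_count|apply count_to_exact]. Qed.
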